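(* There exists a unital, purely infinite, simple C*-algebra $M$ with the same $K$-theory as $\mathcal O_2$ that is not elementarily equivalent to a nuclear C*-algebra and that is not even a model of $T_N$, the theory of nuclear C*-algebras.
   Context: $\mathcal O_2$ is the Cuntz algebra ($K_0(\mathcal O_2)=K_1(\mathcal O_2)=0$). A C*-algebra is purely infinite and simple if it has dimension greater than 1 and for all nonzero positive $a,b$ there are $x_n$ with $\|x_nax_n^*-b\|\to0$. In the continuous-logic language of C*-algebras, a C*-algebra $A$ is a metric structure whose sorts are the balls $\{a:\|a\|\le n\}$, $n\in\mathbb N$, with metric $\|x-y\|$, and functions the restrictions of $+,\cdot,{}^*$, scalar multiplications, the constants $0$ and (if unital) $1$, and inclusions between balls; formulas are built from distances between *-polynomial terms by applying continuous functions $\mathbb R^n\to\mathbb R$ and $\sup_x,\inf_x$ over the sorts; a sentence $\varphi$ is a formula without free variables and has a value $\varphi^A\in\mathbb R$. $A,B$ are elementarily equivalent if $\varphi^A=\varphi^B$ for all sentences $\varphi$. A theory is a set of sentences and $A$ is a model of it if $\varphi^A=0$ for all its members. $T_N$ is the largest theory satisfied by every nuclear C*-algebra, i.e. the set of all sentences $\varphi$ with $\varphi^A=0$ for every nuclear $A$. *)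

(* Defs.v *)
From HB Require Import structures.
From mathcomp Require Import all_boot all_order all_algebra.
From mathcomp Require Import complex.
From mathcomp Require Import all_classical all_reals all_analysis.
Import Order.TTheory GRing.Theory Num.Theory.
Import numFieldNormedType.Exports.

Set Implicit Arguments.
Unset Strict Implicit.
Unset Printing Implicit Defensive.

Local Open Scope classical_set_scope.
Local Open Scope ring_scope.
Local Open Scope complex_scope.

Reserved Notation "x ** y" (at level 40, left associativity).

(* Neither commutativity nor a unit is assumed; the zero algebra is allowed.
   Recall that the norm of a normed module over R[i] takes its values in R[i]
   (in the non-negative reals). *)
HB.mixin Record CompleteNormedModule_isCstarAlgebra (R : realType) A
    of CompleteNormedModule R[i] A := {
  cmul : A -> A -> A;
  cadj : A -> A;
  cmulA : forall x y z : A, cmul x (cmul y z) = cmul (cmul x y) z;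
  cmulDl : forall x y z : A, cmul (x + y) z = cmul x z + cmul y z;
  cmulDr : forall x y z : A, cmul x (y + z) = cmul x y + cmul x z;
  cmulZl : forall (c : R[i]) (x y : A), cmul (c *: x) y = c *: cmul x y;
  cmulZr : forall (c : R[i]) (x y : A), cmul x (c *: y) = c *: cmul x y;
  cadjK : forall x : A, cadj (cadj x) = x;
  cadjD : forall x y : A, cadj (x + y) = cadj x + cadj y;
  cadjZ : forall (c : R[i]) (x : A), cadj (c *: x) = c^* *: cadj x;
  cadjM : forall x y : A, cadj (cmul x y) = cmul (cadj y) (cadj x);
  cnormM : forall x y : A, `|cmul x y| <= `|x| * `|y|;
  cnorm_cadj : forall x : A, `|cmul (cadj x) x| = `|x| ^+ 2
}.

#[short(type="cstarType")]
HB.structure Definition CstarAlgebra (R : realType) :=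
  {A of CompleteNormedModule_isCstarAlgebra R A & CompleteNormedModule R[i] A}.

HB.mixin Record CstarAlgebra_isUnital (R : realType) A of CstarAlgebra R A := {
  cone : A;
  cmul1x : forall x : A, cmul cone x = x;
  cmulx1 : forall x : A, cmul x cone = x
}.

#[short(type="unitalCstarType")]
HB.structure Definition UnitalCstarAlgebra (R : realType) :=
  {A of CstarAlgebra_isUnital R A & CstarAlgebra R A}.

Arguments cone {R} A : rename.
Notation "x ** y" := (cmul x y) : ring_scope.

Section Basics.
Context {R : realType}.

Definition rnorm (A : cstarType R) (x : A) : R := complex.Re `|x|.

Definition cpositive (A : cstarType R) (a : A) := exists b : A, a = cadj b ** b.

Lemma cmul0x (A : cstarType R) (x : A) : 0 ** x = 0.
Proof. by apply: (@addrI _ (0 ** x)); rewrite -cmulDl !addr0. Qed.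

Lemma cmulx0 (A : cstarType R) (x : A) : x ** 0 = 0.
Proof. by apply: (@addrI _ (x ** 0)); rewrite -cmulDr !addr0. Qed.

Lemma cadj0 (A : cstarType R) : cadj (0 : A) = 0.
Proof. by apply: (@addrI _ (cadj (0 : A))); rewrite -cadjD !addr0. Qed.

Definition purely_infinite_simple (A : cstarType R) :=
  (exists x y : A, forall c d : R[i], c *: x + d *: y = 0 -> c = 0 /\ d = 0) /\
  (forall a b : A, cpositive a -> a != 0 -> cpositive b -> b != 0 ->
    exists x : nat -> A,
      (fun n => rnorm (x n ** a ** cadj (x n) - b)) @ \oo --> (0 : R)).

Definition mxcmul (A : cstarType R) m n p
    (X : 'M[A]_(m, n)) (Y : 'M[A]_(n, p)) : 'M[A]_(m, p) :=
  \matrix_(i, k) \sum_j (X i j ** Y j k).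

Definition mxadj (A : cstarType R) m n (X : 'M[A]_(m, n)) : 'M[A]_(n, m) :=
  \matrix_(i, j) cadj (X j i).

Definition mxcone (A : unitalCstarType R) n : 'M[A]_n :=
  \matrix_(i, j) (if i == j then cone A else 0).

(* M_n(A) is a C*-algebra, so that its positive elements are the Y^* Y.  This
   does not involve its norm. *)
Definition mxpositive (A : cstarType R) n (X : 'M[A]_n) :=
  exists Y : 'M[A]_n, X = mxcmul (mxadj Y) Y.

Definition cpc (A B : cstarType R) (f : {linear A -> B}) :=
  (forall n (X : 'M[A]_n), mxpositive X -> mxpositive (map_mx f X)) /\
  (forall a : A, `|f a| <= `|a|).

Definition finite_dimensional (A : cstarType R) :=
  exists n (e : 'I_n -> A), forall x : A,
    exists c : 'I_n -> R[i], x = \sum_i c i *: e i.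

(* Nuclearity is taken in the form of the completely positive approximation
   property. *)
Definition nuclear (A : cstarType R) :=
  forall n (a : 'I_n -> A) (eps : R), 0 < eps ->
  exists (F : cstarType R) (phi : {linear A -> F}) (psi : {linear F -> A}),
    [/\ finite_dimensional F, cpc phi, cpc psi &
        forall i, rnorm (psi (phi (a i)) - a i) < eps].

End Basics.

Section KTheory.
Context {R : realType}.

Definition dsum (A : cstarType R) m n (X : 'M[A]_m) (Y : 'M[A]_n)
  : 'M[A]_(m + n) := block_mx X 0 0 Y.

Lemma mxcmul_dsum (A : cstarType R) m n (X X' : 'M[A]_m) (Y Y' : 'M[A]_n) :
  mxcmul (dsum X Y) (dsum X' Y') = dsum (mxcmul X X') (mxcmul Y Y').
Proof.
apply/matrixP => i k; rewrite /dsum mxE big_split_ord /=.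
case: (split_ordP i) => i' ->; case: (split_ordP k) => k' ->;
  rewrite ?(block_mxEul, block_mxEur, block_mxEdl, block_mxEdr) ?[RHS]mxE.
- rewrite [X in _ + X]big1 ?addr0 => [|j _].
    by apply: eq_bigr => j _; rewrite !block_mxEul.
  by rewrite block_mxEur block_mxEdl !mxE cmul0x.
- rewrite !big1 ?addr0 // => j _.
    by rewrite block_mxEur block_mxEdr !mxE cmul0x.
  by rewrite block_mxEul block_mxEur !mxE cmulx0.
- rewrite !big1 ?addr0 // => j _.
    by rewrite block_mxEdr block_mxEdl !mxE cmulx0.
  by rewrite block_mxEdl block_mxEul !mxE cmul0x.
- rewrite big1 ?add0r => [|j _].
    by apply: eq_bigr => j _; rewrite !block_mxEdr.
  by rewrite block_mxEdl block_mxEur !mxE cmul0x.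
Qed.

Lemma mxadj_dsum (A : cstarType R) m n (X : 'M[A]_m) (Y : 'M[A]_n) :
  mxadj (dsum X Y) = dsum (mxadj X) (mxadj Y).
Proof.
apply/matrixP => i j; rewrite mxE.
by case: (split_ordP i) => i' ->; case: (split_ordP j) => j' ->;
  rewrite ?(block_mxEul, block_mxEur, block_mxEdl, block_mxEdr) !mxE ?cadj0.
Qed.

Lemma mxcone_dsum (A : unitalCstarType R) m n :
  dsum (mxcone A m) (mxcone A n) = mxcone A (m + n).
Proof.
apply/matrixP => i j; rewrite [RHS]mxE.
by case: (split_ordP i) => i' ->; case: (split_ordP j) => j' ->;
  rewrite ?(block_mxEul, block_mxEur, block_mxEdl, block_mxEdr) !mxE
    ?(inj_eq (@lshift_inj _ _)) ?(inj_eq (@rshift_inj _ _))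
    ?eq_lrshift ?eq_rlshift.
Qed.

Definition is_projection (A : cstarType R) n (p : 'M[A]_n) :=
  mxcmul p p = p /\ mxadj p = p.

Record projection (A : cstarType R) := Projection {
  proj_size : nat;
  proj_mx :> 'M[A]_proj_size;
  proj_mxP : is_projection proj_mx }.

Lemma proj_sum_subproof (A : cstarType R) (p q : projection A) :
  is_projection (dsum p q).
Proof.
case: p q => m p [p1 p2] [n q [q1 q2]] /=.
by split; rewrite ?mxcmul_dsum ?mxadj_dsum ?p1 ?p2 ?q1 ?q2.
Qed.

Definition proj_sum (A : cstarType R) (p q : projection A) :=
  Projection (proj_sum_subproof p q).

Definition mvn_equiv (A : cstarType R) (p q : projection A) :=
  exists v : 'M[A]_(proj_size q, proj_size p),
    proj_mx p = mxcmul (mxadj v) v /\ proj_mx q = mxcmul v (mxadj v).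

(* (p, q) represents the formal difference [p] - [q] in K_0(A), the
   Grothendieck group of the semigroup of Murray-von Neumann classes of
   projections in matrix algebras over A. *)
Definition K0_rep (A : unitalCstarType R) : Type :=
  (projection A * projection A)%type.

Definition K0_eq (A : unitalCstarType R) (x y : K0_rep A) :=
  exists r : projection A,
    mvn_equiv (proj_sum (proj_sum x.1 y.2) r) (proj_sum (proj_sum y.1 x.2) r).

Definition K0_add (A : unitalCstarType R) (x y : K0_rep A) : K0_rep A :=
  (proj_sum x.1 y.1, proj_sum x.2 y.2).

Definition is_unitary (A : unitalCstarType R) n (u : 'M[A]_n) :=
  mxcmul (mxadj u) u = mxcone A n /\ mxcmul u (mxadj u) = mxcone A n.

(* The matrix topology is the entrywise one, which is the norm topology of the
   C*-algebra M_n(A). *)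
Definition unitary_homotopic (A : unitalCstarType R) n (u v : 'M[A]_n) :=
  exists gamma : R -> 'M[A]_n,
    [/\ {within `[0, 1], continuous gamma},
        forall t, t \in `[0, 1] -> is_unitary (gamma t),
        gamma 0 = u & gamma 1 = v].

Record K1_rep (A : unitalCstarType R) := K1Rep {
  unitary_size : nat;
  unitary_mx :> 'M[A]_unitary_size;
  unitary_mxP : is_unitary unitary_mx }.

(* K_1(A) is the set of classes of unitaries in matrix algebras over A, u and v
   being identified when u (+) 1_a and v (+) 1_b are homotopic in some U_k(A). *)
Definition K1_eq (A : unitalCstarType R) (u v : K1_rep A) :=
  exists (a b : nat) (e : (unitary_size u + a = unitary_size v + b)%N),
    unitary_homotopic (castmx (e, e) (dsum u (mxcone A a)))
                      (dsum v (mxcone A b)).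

Lemma K1_add_subproof (A : unitalCstarType R) (u v : K1_rep A) :
  is_unitary (dsum u v).
Proof.
case: u v => m u [u1 u2] [n v [v1 v2]] /=.
by split; rewrite mxadj_dsum mxcmul_dsum ?u1 ?u2 ?v1 ?v2 mxcone_dsum.
Qed.

Definition K1_add (A : unitalCstarType R) (u v : K1_rep A) :=
  K1Rep (K1_add_subproof u v).

End KTheory.

(* The quotients of T by eqT and of U by eqU, with the operations induced by
   addT and addU, are isomorphic. *)
Definition quotient_isomorphic (T U : Type)
    (eqT : T -> T -> Prop) (addT : T -> T -> T)
    (eqU : U -> U -> Prop) (addU : U -> U -> U) :=
  exists f : T -> U,
    [/\ forall x y, eqT x y <-> eqU (f x) (f y),
        forall z, exists x, eqU (f x) z &
        forall x y, eqU (f (addT x y)) (addU (f x) (f y))].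

Definition same_K_theory (R : realType) (A B : unitalCstarType R) :=
  quotient_isomorphic (@K0_eq R A) (@K0_add R A) (@K0_eq R B) (@K0_add R B) /\
  quotient_isomorphic (@K1_eq R A) (@K1_add R A) (@K1_eq R B) (@K1_add R B).

(* Up to isomorphism, exactly one nonzero unital C*-algebra is generated by two
   isometries whose range projections sum to 1.  The hypotheses on B say that
   it is a closed *-subalgebra containing the generators. *)
Definition is_cuntz_O2 (R : realType) (O : unitalCstarType R) :=
  cone O != 0 /\
  exists s1 s2 : O,
    [/\ cadj s1 ** s1 = cone O, cadj s2 ** s2 = cone O,
        s1 ** cadj s1 + s2 ** cadj s2 = cone O &
        forall B : set O,
          closed B -> B s1 -> B s2 ->
          (forall x y, B x -> B y -> B (x + y)) ->
          (forall (c : R[i]) x, B x -> B (c *: x)) ->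
          (forall x y, B x -> B y -> B (x ** y)) ->
          (forall x, B x -> B (cadj x)) ->
          forall x, B x].

(* The boolean [u] tells whether the language has a constant symbol for the
   unit.  Terms and formulas have their free variables among k variables,
   numbered by 'I_k.  The sorts (balls) only matter for the quantifiers: as the
   symbols of the sorted language, inclusions included, are restrictions of the
   operations of the algebra, its terms are the *-polynomials in the
   variables. *)
Section Syntax.
Variables (R : realType) (u : bool).

Inductive term (k : nat) : Type :=
  | Var of 'I_k
  | Zero
  | One of u
  | Add of term k & term k
  | Mul of term k & term k
  | Adj of term k
  | Scale of R[i] & term k.

(* In [Sup n phi] and [Inf n phi], variable 0 of phi ranges over the ball of
   radius n and variable j.+1 of phi is variable j of the context. *)
Inductive formula : nat -> Type :=
  | Dist k of term k & term k : formula k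
  | Conn k n (g : 'rV[R]_n -> R) of continuous g & ('I_n -> formula k)
    : formula k
  | Sup k (n : nat) of formula k.+1 : formula k
  | Inf k (n : nat) of formula k.+1 : formula k.

Definition sentence := formula 0.

(* The structures for the language: C*-algebras if u = false, unital
   C*-algebras if u = true. *)
Record Lstructure := LStructure {
  carrier :> cstarType R;
  one_interp : u -> carrier;
  one_interpP : forall h x, one_interp h ** x = x /\ x ** one_interp h = x }.

Variable A : Lstructure.

Fixpoint term_eval k (v : 'I_k -> A) (t : term k) : A :=
  match t with
  | Var i => v i
  | Zero => 0
  | One h => one_interp A h
  | Add t1 t2 => term_eval v t1 + term_eval v t2
  | Mul t1 t2 => term_eval v t1 ** term_eval v t2
  | Adj t1 => cadj (term_eval v t1)
  | Scale c t1 => c *: term_eval v t1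
  end.

Definition extend k (v : 'I_k -> A) (a : A) (i : 'I_k.+1) : A :=
  oapp v a (unlift ord0 i).

Definition cball (n : nat) : set A := [set a | `|a| <= n%:R].

Fixpoint formula_eval k (phi : formula k) : ('I_k -> A) -> R :=
  match phi with
  | Dist _ s t => fun v => rnorm (term_eval v s - term_eval v t)
  | Conn _ _ g _ args => fun v => g (\row_i formula_eval (args i) v)
  | Sup _ n psi => fun v =>
      sup [set formula_eval psi (extend v a) | a in cball n]
  | Inf _ n psi => fun v =>
      inf [set formula_eval psi (extend v a) | a in cball n]
  end.

Definition sentence_value (phi : sentence) : R :=
  formula_eval phi (fun i : 'I_0 => 0).

Definition theory := set sentence.

Definition models (T : theory) :=
  forall phi, T phi -> sentence_value phi = 0.

End Syntax.

Definition elementarily_equivalent (R : realType) (u : bool)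
    (A B : Lstructure R u) :=
  forall phi : sentence R u, sentence_value A phi = sentence_value B phi.

Definition nuclear_theory (R : realType) (u : bool) : theory R u :=
  [set phi | forall A : Lstructure R u, nuclear A -> sentence_value A phi = 0].

Arguments nuclear_theory : clear implicits.

Lemma unital_structure_subproof (R : realType) (u : bool)
    (A : unitalCstarType R) (h : u) (x : A) :
  cone A ** x = x /\ x ** cone A = x.
Proof. by rewrite cmul1x cmulx1. Qed.

Definition unital_structure (R : realType) (u : bool) (A : unitalCstarType R)
  : Lstructure R u :=
  LStructure (@unital_structure_subproof R u A).

(* Main.v *)
(* M is separated from the nuclear algebras by a single sentence.  It says: if
   A is unital with two orthogonal isometries, and every b in the unit ball has
   isometries s with s* b* b s close to |b|^2 1, then any four contractions x
   can be doubled, that is, there are V and W with V* x V and W* x W close to x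
   and V* x W close to 0.  In a nuclear algebra this holds by Kirchberg's
   argument: the identity nearly factors through a finite-dimensional algebra,
   and the completely positive map so obtained is approximated by compressions,
   since positive functionals are excised by isometries.

   M acts on l^2 of words in Z/2 * Z/2 * Z/2 decorated with lists; it commutes
   with right multiplications v_x and contains left multiplications u_x by the
   three generators.  If V and W double 1 and the u_x, then V delta_1 and
   W delta_1 are almost invariant under the u_x v_x, hence close to multiples of
   delta_1 because the group is not amenable, which contradicts V* W being
   small.  M is the closure of an increasing union of algebras E_i such that
   E_(i+1) contains orthogonal isometries S_n for which S_m* T S_n is scalar for
   all T in E_i.  This gives pure infiniteness; and the infinite repeat Th x of
   x in E_i along the S_n absorbs x, so that the K-theory of M vanishes.

   The K-theory of O_2 vanishes as its endomorphism x |-> s x s* + t x t* is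
   homotopic to the identity: it maps s and t to w s and w t, where w is the
   symmetry exchanging the two tensor factors, and w is connected to 1. *)
Require Import Defs.
From HB Require Import structures.
From mathcomp Require Import all_boot all_order all_algebra.
From mathcomp Require Import complex.
From mathcomp Require Import all_classical all_reals all_analysis.
From mathcomp Require Import finmap ring lra.
Import Order.TTheory GRing.Theory Num.Theory.
Import numFieldNormedType.Exports.

Set Implicit Arguments.
Unset Strict Implicit.
Unset Printing Implicit Defensive.

Local Open Scope classical_set_scope.
Local Open Scope ring_scope.
Local Open Scope complex_scope.

(** * Elementary C*-algebra *)

(** The conflict behind the construction of M: pure infiniteness needs many isometries, yet all of
    them must commute with the v_x, or the non-amenability argument loses its hold. Lists settle it.
    Each v_x multiplies one word only, the last of the list, and inserting an entry either carries
    that word along or leaves it untouched, so insertion commutes with every v_x. Defining the E_i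
    as commutants makes them closed and lets them contain strong sums. No E_i contains its own
    isometries S_n: S_0 would be S_0^* S_0 S_0, a scalar, against S_0^* S_1 = 0. This forces the
    increasing union.

    On the nuclear side a sentence sees only a fixed tolerance. High powers of b^* b amplify it to
    arbitrary precision; excision of a positive functional then comes from an iteration that
    averages compressions, in place of a separation theorem, and the positive functionals come from
    the trace of the regular representation of the finite-dimensional algebra. Inverse square roots
    of elements near 1 are the functional calculus throughout. *)

Notation "x ^†" := (cadj x) (at level 3, left associativity, format "x ^†").

(** * Linear identities in a module, decided by comparing coefficients *)

Section LmodReflection.
Variables (K : nzRingType) (V : lmodType K).

Inductive lmod_exp :=
  | LVar of nat | LZero | LAdd of lmod_exp & lmod_exp | LOpp of lmod_exp
  | LScale of K & lmod_exp.

Fixpoint lmod_eval (env : seq V) e : V :=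
  match e with
  | LVar i => env`_i
  | LZero => 0
  | LAdd a b => lmod_eval env a + lmod_eval env b
  | LOpp a => - lmod_eval env a
  | LScale c a => c *: lmod_eval env a
  end.

(** Indices are compared by [eqn], which [cbn] evaluates on numerals, so that only equations between
    scalars remain. *)
Fixpoint lmod_coef e (i : nat) : K :=
  match e with
  | LVar j => if eqn i j then 1 else 0
  | LZero => 0
  | LAdd a b => lmod_coef a i + lmod_coef b i
  | LOpp a => - lmod_coef a i
  | LScale c a => c * lmod_coef a i
  end.

Fixpoint lmod_agree (n : nat) e1 e2 : Prop :=
  if n is n'.+1 then lmod_coef e1 n' = lmod_coef e2 n' /\ lmod_agree n' e1 e2
  else True.

Lemma lmod_evalE env e :
  lmod_eval env e = \sum_(i < size env) lmod_coef e i *: env`_i.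
Proof.
elim: e => [j||a IHa b IHb|a IHa|c a IHa]; cbn [lmod_eval lmod_coef]; rewrite ?IHa ?IHb.
- have [js|js] := ltnP j (size env).
    rewrite (bigD1 (Ordinal js)) //= [eqn j j](eqxx j) scale1r big1 ?addr0 // => i ij.
    rewrite [eqn _ _](_ : _ = (val i == j)) //; case: eqP => [e|_]; rewrite ?scale0r //.
    by case/eqP: ij; apply: val_inj.
  rewrite nth_default // big1 // => i _; rewrite [eqn _ _](_ : _ = (val i == j)) //.
  case: eqP => [e|_]; last by rewrite scale0r.
  by have := ltn_ord i; rewrite e ltnNge js.
- by rewrite big1 // => i _; rewrite scale0r.
- by rewrite -big_split; apply: eq_bigr => i _; rewrite scalerDl.
- by rewrite -sumrN; apply: eq_bigr => i _; rewrite scaleNr.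
- by rewrite scaler_sumr; apply: eq_bigr => i _; rewrite scalerA.
Qed.

Lemma lmod_agreeP env e1 e2 :
  lmod_agree (size env) e1 e2 -> lmod_eval env e1 = lmod_eval env e2.
Proof.
move=> H; rewrite !lmod_evalE; apply: eq_bigr => i _; congr (_ *: _).
elim: (size env) H i => [|n IH] /=; first by move=> _ [].
move=> [H1 H2] [i i0] /=; move: (i0); rewrite ltnS leq_eqVlt => /orP[/eqP ->//|ilt].
exact: (IH H2 (Ordinal ilt)).
Qed.
End LmodReflection.

Ltac lmod_mem x l :=
  match l with
  | nil => constr:(false) | x :: _ => constr:(true) | _ :: ?t => lmod_mem x t
  end.
Ltac lmod_atoms K t l :=
  match t with
  | (?a + ?b)%R => let l1 := lmod_atoms K a l in lmod_atoms K b l1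
  | (- ?a)%R => lmod_atoms K a l
  | (?c *: ?a)%R => lmod_atoms K a l
  | GRing.zero => l
  | _ => match lmod_mem t l with
         | true => l | false => constr:(t :: l) end
  end.
Ltac lmod_index x l :=
  match l with
  | x :: _ => constr:(O) | _ :: ?t => let n := lmod_index x t in constr:(S n)
  end.
Ltac lmod_reify K t l :=
  match t with
  | (?a + ?b)%R => let x := lmod_reify K a l in let y := lmod_reify K b l in
                   constr:(@LAdd K x y)
  | (- ?a)%R => let x := lmod_reify K a l in constr:(@LOpp K x)
  | (?c *: ?a)%R => let x := lmod_reify K a l in constr:(@LScale K c x)
  | GRing.zero => constr:(@LZero K)
  | _ => let n := lmod_index t l in constr:(@LVar K n)
  end.

(* The equations between the coefficients are left to [tac]. *)
Ltac lmod_with K tac :=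
  match goal with
  | |- @eq ?V ?s ?t =>
    let l0 := constr:(@nil V) in
    let l1 := lmod_atoms K s l0 in let l := lmod_atoms K t l1 in
    let e1 := lmod_reify K s l in let e2 := lmod_reify K t l in
    refine (@lmod_agreeP K _ l e1 e2 _);
    cbn [lmod_agree lmod_coef size eqn]; repeat split; tac
  end.

(** * The real-valued norm *)

Section Rnorm.
Context {R : realType} {A : cstarType R}.
Implicit Types (x y z : A) (r : R).

Lemma rnormE x : `|x| = (rnorm x)%:C.
Proof.
have := normr_ge0 x; rewrite lecE /= => /andP[/eqP h _].
by rewrite [LHS]complexE h mulr0 addr0.
Qed.

Lemma rnorm_ge0 x : 0 <= rnorm x.
Proof. rewrite -lecR -rnormE; exact: normr_ge0. Qed.

Lemma rnorm_eq0 x : rnorm x = 0 -> x = 0.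
Proof. by move=> h; apply/eqP; rewrite -normr_eq0 rnormE h. Qed.

Lemma rnorm0 : rnorm (0 : A) = 0.
Proof. by rewrite /rnorm normr0. Qed.

Lemma rnorm_gt0 x : x != 0 -> 0 < rnorm x.
Proof.
by rewrite lt_neqAle rnorm_ge0 andbT; apply: contra => /eqP/esym/rnorm_eq0 ->.
Qed.

Lemma rnormN x : rnorm (- x) = rnorm x.
Proof. by rewrite /rnorm normrN. Qed.

Lemma rnormD x y : rnorm (x + y) <= rnorm x + rnorm y.
Proof. by rewrite -lecR rmorphD /= -!rnormE ler_normD. Qed.

Lemma rnormB x y : rnorm (x - y) <= rnorm x + rnorm y.
Proof. by rewrite -(rnormN y) rnormD. Qed.

Lemma rdistC x y : rnorm (x - y) = rnorm (y - x).
Proof. by rewrite -rnormN opprB. Qed.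

Lemma rdistD z x y : rnorm (x - y) <= rnorm (x - z) + rnorm (z - y).
Proof. by rewrite -[x - y](subrKA z) rnormD. Qed.

Definition cabs (c : R[i]) : R := complex.Re `|c|.

Lemma cabsE c : `|c| = (cabs c)%:C.
Proof.
have := normr_ge0 c; rewrite lecE /= => /andP[/eqP h _].
by rewrite [LHS]complexE h mulr0 addr0.
Qed.

Lemma rnormZ (c : R[i]) x : rnorm (c *: x) = cabs c * rnorm x.
Proof. by apply: complexI; rewrite rmorphM /= -cabsE -!rnormE normrZ. Qed.

Lemma cabsR r : cabs r%:C = `|r|.
Proof. by apply: complexI; rewrite -cabsE normc_def /= expr0n /= addr0 sqrtr_sqr. Qed.

Lemma rnormZR r x : rnorm (r%:C *: x) = `|r| * rnorm x.
Proof. by rewrite rnormZ cabsR. Qed.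

Lemma rnormM x y : rnorm (x ** y) <= rnorm x * rnorm y.
Proof. by rewrite -lecR rmorphM /= -!rnormE cnormM. Qed.

Lemma rnorm_cstar x : rnorm (x^† ** x) = rnorm x ^+ 2.
Proof. by apply: complexI; rewrite rmorphXn /= -!rnormE cnorm_cadj. Qed.

Lemma rnorm_adj x : rnorm x^† = rnorm x.
Proof.
suff le y : rnorm y <= rnorm y^† by apply/eqP; rewrite eq_le le -{2}(cadjK x) le.
have := rnormM y^† y; rewrite rnorm_cstar expr2.
have [->|y0] := eqVneq y 0; first by rewrite rnorm0 rnorm_ge0.
by rewrite ler_pM2r ?rnorm_gt0.
Qed.

Lemma cadjN x : (- x)^† = - x^†.
Proof. by rewrite -scaleN1r cadjZ rmorphN rmorph1 scaleN1r. Qed.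

Lemma cadjB x y : (x - y)^† = x^† - y^†.
Proof. by rewrite cadjD cadjN. Qed.

Lemma cadjZc (c : R[i]) x : (c *: x)^† = conjc c *: x^†.
Proof. exact: cadjZ. Qed.

Lemma cadjZR r x : (r%:C *: x)^† = r%:C *: x^†.
Proof. by rewrite cadjZ; congr (_ *: _); apply/eqP; rewrite eq_complex /= oppr0 !eqxx. Qed.

Lemma cadj_sum I (s : seq I) (P : pred I) (F : I -> A) :
  (\sum_(i <- s | P i) F i)^† = \sum_(i <- s | P i) (F i)^†.
Proof. by apply: (big_morph _ cadjD); rewrite cadj0. Qed.

Lemma cmulNl x y : (- x) ** y = - (x ** y).
Proof. by rewrite -scaleN1r cmulZl scaleN1r. Qed.

Lemma cmulNr x y : x ** (- y) = - (x ** y).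
Proof. by rewrite -scaleN1r cmulZr scaleN1r. Qed.

Lemma cmulBl x y z : (x - y) ** z = x ** z - y ** z.
Proof. by rewrite cmulDl cmulNl. Qed.

Lemma cmulBr x y z : x ** (y - z) = x ** y - x ** z.
Proof. by rewrite cmulDr cmulNr. Qed.

Lemma cmul_suml I (s : seq I) (P : pred I) (F : I -> A) x :
  (\sum_(i <- s | P i) F i) ** x = \sum_(i <- s | P i) (F i ** x).
Proof. by apply: (big_morph (fun y => y ** x) (fun y z => cmulDl y z x)); rewrite cmul0x. Qed.

Lemma cmul_sumr I (s : seq I) (P : pred I) (F : I -> A) x :
  x ** (\sum_(i <- s | P i) F i) = \sum_(i <- s | P i) (x ** F i).
Proof. by apply: (big_morph (fun y => x ** y) (cmulDr x)); rewrite cmulx0. Qed.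

Lemma rnorm_sum I (s : seq I) (P : pred I) (F : I -> A) :
  rnorm (\sum_(i <- s | P i) F i) <= \sum_(i <- s | P i) rnorm (F i).
Proof.
elim/big_ind2: _ => // [|a b c d h1 h2]; first by rewrite rnorm0.
exact: le_trans (rnormD _ _) (lerD h1 h2).
Qed.

Lemma rnorm_small x : (forall e, 0 < e -> rnorm x < e) -> x = 0.
Proof.
move=> h; apply: rnorm_eq0; apply/eqP; rewrite eq_le rnorm_ge0 andbT.
by apply/ler_addgt0Pr => e e0; rewrite add0r ltW ?h.
Qed.

Lemma gt0_complexP (e : R[i]) : 0 < e -> exists2 r, 0 < r & e = r%:C.
Proof.
by case: e => a b; rewrite ltcE /= => /andP[/eqP -> a0]; exists a.
Qed.

Lemma ball_rnorm x r y : ball x r%:C y <-> rnorm (x - y) < r.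
Proof. by rewrite -ball_normE /= rnormE ltcR. Qed.

Lemma nbhs_rnorm x (P : set A) :
  nbhs x P <-> exists2 e, 0 < e & forall y, rnorm (x - y) < e -> P y.
Proof.
split=> [/nbhs_ballP[e /= e0 h]|[e e0 h]].
  have [r r0 er] := gt0_complexP e0; exists r => // y /ball_rnorm.
  by rewrite -er; exact: h.
apply/nbhs_ballP; exists e%:C => /=; first by rewrite ltcR.
by move=> y /ball_rnorm; exact: h.
Qed.

Lemma closed_rnormP (B : set A) : closed B <->
  forall x, (forall e, 0 < e -> exists2 y, B y & rnorm (x - y) < e) -> B x.
Proof.
split=> [cB x h|h x clx].
  apply: cB => U /nbhs_rnorm[e e0 hU].
  by have [y By xy] := h e e0; exists y; split=> //; exact: hU.
apply: h => e e0; have [|y [By xy]] := clx [set y | rnorm (x - y) < e].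
  by apply/nbhs_rnorm; exists e.
by exists y.
Qed.

Lemma cvg_rnormP (T : Type) (F : set_system T) {FF : Filter F} (f : T -> A) x :
  f @ F --> x <-> forall e, 0 < e -> \forall t \near F, rnorm (x - f t) < e.
Proof.
split=> [/cvgrPdist_lt h e e0|h].
  have := h e%:C; rewrite ltcR => /(_ e0); apply: filterS => t.
  by rewrite rnormE ltcR.
apply/cvgrPdist_lt => e /gt0_complexP[r r0 ->].
by apply: filterS (h r r0) => t; rewrite rnormE ltcR.
Qed.

Lemma rnorm_complete (u : nat -> A) :
  (forall e, 0 < e -> exists N, forall m n, (N <= m)%N -> (N <= n)%N ->
     rnorm (u m - u n) < e) ->
  exists l, forall e, 0 < e ->
    exists N, forall n, (N <= n)%N -> rnorm (u n - l) < e.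
Proof.
move=> h; have : cvgn u.
  apply/cauchy_cvgP; apply/cauchy_ballP => e /gt0_complexP[r r0 ->].
  have [N hN] := h r r0; pose B := u @` [set n | (N <= n)%N].
  exists (B, B); first by split; exists N => // n Nn; exists n.
  by move=> [_ _] [[m Nm <-] [n Nn <-]]; apply/ball_rnorm; exact: hN.
move=> /cvg_ex[l /cvg_rnormP hl]; exists l => e e0.
have [N _ hN] := hl e e0; exists N => n Nn; rewrite rdistC; exact: hN.
Qed.

End Rnorm.

Lemma cmulA' {R : realType} {A : cstarType R} (x y z : A) :
  x ** (y ** z) = x ** y ** z.
Proof. exact: cmulA. Qed.

Definition cexpand := (@cmulDl, @cmulDr, @cmulNl, @cmulNr, @cmulZl, @cmulZr,
  @cmulA', @cmul0x, @cmulx0).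

(** After expansion every noncommutative monomial is an atom, so a polynomial identity becomes a
    list of scalar identities for [ring]. *)
Ltac clmod R := rewrite ?cexpand; lmod_with (R[i]) ltac:(ring).

Lemma eq_ler {d} {T : porderType d} (x y : T) : x = y -> (x <= y)%O.
Proof. by move=> ->. Qed.

(** * Fixed points, units and inverse square roots *)

Section Contraction.
Context {R : realType} {A : cstarType R}.
Implicit Types (x y z : A) (r : R).

Lemma le_rnormD x y a b : rnorm x <= a -> rnorm y <= b -> rnorm (x + y) <= a + b.
Proof. by move=> h k; apply: le_trans (rnormD _ _) _; rewrite lerD. Qed.

Lemma le_rnormB x y a b : rnorm x <= a -> rnorm y <= b -> rnorm (x - y) <= a + b.
Proof. by move=> h k; apply: le_trans (rnormB _ _) _; rewrite lerD. Qed.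

Lemma le_rnormM x y a b : rnorm x <= a -> rnorm y <= b -> rnorm (x ** y) <= a * b.
Proof. by move=> h k; apply: le_trans (rnormM _ _) _; rewrite ler_pM ?rnorm_ge0. Qed.

Lemma expr_small (q C e : R) : 0 <= q -> q < 1 -> 0 < e ->
  exists N, forall n, (N <= n)%N -> C * q ^+ n < e.
Proof.
move=> q0 q1 e0; have : `|q| < 1 by rewrite ger0_norm.
move=> /(cvg_geometric C) /cvgrPdist_lt /(_ e e0) [N _ hN].
exists N => n Nn; have := hN n Nn; rewrite /geometric /= sub0r normrN.
exact: le_lt_trans (ler_norm _).
Qed.

(** Banach's fixed point theorem on a closed set B. In [isqrt_exists] the set B carries the side
    conditions that the fixed point has to inherit. *)
Lemma contraction_fix (B : set A) (f : A -> A) (q : R) x0 :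
  0 <= q -> q < 1 -> closed B -> B x0 -> (forall x, B x -> B (f x)) ->
  (forall x y, B x -> B y -> rnorm (f x - f y) <= q * rnorm (x - y)) ->
  exists2 x, B x & f x = x.
Proof.
move=> q0 q1 cB Bx0 Bf ctr; pose u n := iter n f x0.
have Bu n : B (u n) by elim: n => //= n; exact: Bf.
pose d := rnorm (f x0 - x0); have q1' : 0 < 1 - q by rewrite subr_gt0.
have step n : rnorm (u n.+1 - u n) <= q ^+ n * d.
  elim: n => [|n IH]; first by rewrite expr0 mul1r.
  have /le_trans := ctr _ _ (Bu n.+1) (Bu n); apply.
  by rewrite exprS -mulrA ler_wpM2l.
have far n k : (1 - q) * rnorm (u (n + k)%N - u n) <= q ^+ n * d * (1 - q ^+ k).
  elim: k => [|k IH]; first by rewrite addn0 subrr rnorm0 expr0 subrr !mulr0.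
  apply: le_trans (ler_wpM2l (ltW q1') (rdistD (u (n + k)%N) _ _)) _.
  have := step (n + k)%N; rewrite addnS exprD exprS => h.
  rewrite mulrDr; apply: le_trans (lerD (ler_wpM2l (ltW q1') h) IH) _.
  by apply: eq_ler; ring.
have d0 : 0 <= d by exact: rnorm_ge0.
have [|l hl] := rnorm_complete (u := u).
  move=> e e0; have [N hN] := expr_small (2 * d / (1 - q)) q0 q1 e0.
  have near0 n : (N <= n)%N -> rnorm (u n - u N) <= q ^+ N * d / (1 - q).
    move=> Nn; have := far N (n - N)%N; rewrite subnKC // => h.
    rewrite ler_pdivlMr // mulrC; apply: le_trans h _.
    by rewrite ler_piMr ?mulr_ge0 ?exprn_ge0 // gerBl exprn_ge0.
  exists N => m n Nm Nn; apply: le_lt_trans (rdistD (u N) _ _) _.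
  apply: le_lt_trans _ (hN N (leqnn _)).
  have := lerD (near0 m Nm) (near0 n Nn); rewrite (rdistC (u n)) => h.
  by apply: le_trans h _; apply: eq_ler; field; rewrite gt_eqF.
have Bl : B l.
  apply: (closed_rnormP B).1 => // e e0; have [N hN] := hl e e0.
  by exists (u N) => //; rewrite rdistC hN.
exists l => //; apply/eqP; rewrite -subr_eq0; apply/eqP; apply: rnorm_small => e e0.
have e2 : 0 < e / 2 by rewrite divr_gt0.
have [N hN] := hl (e / 2) e2.
apply: le_lt_trans (rdistD (u N.+1) _ _) _.
rewrite [e]splitr ltrD // ?hN //; apply: le_lt_trans (ctr _ _ Bl (Bu N)) _.
apply: le_lt_trans (hN N (leqnn _)); rewrite rdistC.
by rewrite ler_piMl ?rnorm_ge0 // ltW.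
Qed.

Record star_subalgebra (B : set A) : Prop := StarSubalgebra {
  ssub_closed : closed B;
  ssub0 : B 0;
  ssubD : forall x y, B x -> B y -> B (x + y);
  ssubZ : forall c x, B x -> B (c *: x);
  ssubM : forall x y, B x -> B y -> B (x ** y);
  ssub_adj : forall x, B x -> B x^† }.

Lemma ssubN B x : star_subalgebra B -> B x -> B (- x).
Proof. by move=> sB Bx; rewrite -scaleN1r; exact: ssubZ. Qed.

Lemma ssubB B x y : star_subalgebra B -> B x -> B y -> B (x - y).
Proof. by move=> sB Bx By; apply: (ssubD sB) => //; exact: ssubN. Qed.

Definition is_unit (e : A) := forall x, e ** x = x /\ x ** e = x.

(** A fixed point y satisfies e y = e, so e kills y x - x; as multiplication by e is within d < 1 of
    the identity, y is a left unit. Its adjoint is a right unit, hence equal to it. *)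
Lemma almost_unit_unit (e : A) (d : R) : 0 <= d -> d < 1 ->
  (forall x, rnorm (e ** x - x) <= d * rnorm x) -> exists o, is_unit o.
Proof.
move=> d0 d1 he.
have [||//|x y _ _|y _ ey] := @contraction_fix setT (fun y => e + y - e ** y) d 0 d0 d1.
- exact: closedT.
- by [].
- apply: le_trans (he (x - y)); rewrite -rnormN; apply: eq_ler; congr rnorm.
  by clmod R.
have ey' : e - e ** y = 0.
  by transitivity ((e + y - e ** y) - y); [clmod R|rewrite ey subrr].
have yl x : y ** x = x.
  apply/eqP; rewrite -subr_eq0; apply/eqP; set w := _ - _.
  have ew : e ** w = 0.
    transitivity (- ((e - e ** y) ** x)); first by rewrite /w; clmod R.
    by rewrite ey' cmul0x oppr0.
  apply: rnorm_eq0; apply/eqP; rewrite eq_le rnorm_ge0 andbT.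
  have := he w; rewrite ew sub0r rnormN => h.
  have : (1 - d) * rnorm w <= 0 by rewrite mulrBl mul1r subr_le0.
  by rewrite pmulr_rle0 // subr_gt0.
have yr x : x ** y^† = x by rewrite -[x in LHS]cadjK -cadjM yl cadjK.
have yy : y = y^† by rewrite -[LHS]yr yl.
by exists y => x; split; rewrite ?yl // yy yr.
Qed.

Section Unit.
Variables (one : A) (oneP : is_unit one).

Lemma unitl x : one ** x = x. Proof. by case: (oneP x). Qed.
Lemma unitr x : x ** one = x. Proof. by case: (oneP x). Qed.

Lemma unit_adj : one^† = one.
Proof. by rewrite -[LHS]unitl -{1}(cadjK one) -cadjM unitl cadjK. Qed.

Lemma unit_norm : one != 0 -> rnorm one = 1.
Proof.
move=> o0; have := rnorm_cstar one; rewrite unitr unit_adj expr2.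
move=> /(congr1 (fun t => t / rnorm one)).
by rewrite mulfK ?divff // gt_eqF ?rnorm_gt0.
Qed.

Lemma unit_norm_le : rnorm one <= 1.
Proof. by have [->|/unit_norm ->] := eqVneq one 0; rewrite ?rnorm0. Qed.

Lemma isometry_norm x : x^† ** x = one -> rnorm x <= 1.
Proof.
move=> h; rewrite -(@ler_pXn2r _ 2) ?nnegrE ?rnorm_ge0 //.
by rewrite -rnorm_cstar h expr1n unit_norm_le.
Qed.

(* The fixed points [x] of [isqrt_map h] are the solutions of
   [(1 - h) (1 + x)^2 = 1]. *)
Let half : R[i] := (2^-1 : R)%:C.
Definition isqrt_map (h x : A) : A :=
  half *: (h + (h ** x + h ** x) + h ** x ** x - x ** x).

(** The constants are the halves of 1 + 2/4 + 1/16 and of 2/8 + 2/32 + 2/4, read off the factored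
    difference. The second is below 1, which gives the fixed point; the first gives its dependence
    on h. *)
Lemma isqrt_map_lipschitz h k x y :
  rnorm h <= 8^-1 -> rnorm k <= 8^-1 -> rnorm x <= 4^-1 -> rnorm y <= 4^-1 ->
  rnorm (isqrt_map h x - isqrt_map k y) <=
    25 / 32 * rnorm (h - k) + 13 / 32 * rnorm (x - y).
Proof.
move=> h8 k8 x4 y4; set d := rnorm (h - k); set D := rnorm (x - y).
have -> : isqrt_map h x - isqrt_map k y = half *:
    ((h - k) + ((h - k) ** x + k ** (x - y)) + ((h - k) ** x + k ** (x - y)) +
    ((h - k) ** x ** x + (k ** (x - y) ** x + k ** y ** (x - y))) -
    (x ** (x - y) + (x - y) ** y)).
  by rewrite /isqrt_map; clmod R.
rewrite rnormZR ger0_norm ?invr_ge0 //.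
have dd : rnorm (h - k) <= d by []; have DD : rnorm (x - y) <= D by [].
have h1 : rnorm ((h - k) ** x + k ** (x - y)) <= d * 4^-1 + 8^-1 * D.
  by apply: le_rnormD; apply: le_rnormM.
have h2 : rnorm ((h - k) ** x ** x + (k ** (x - y) ** x + k ** y ** (x - y))) <=
    d * 4^-1 * 4^-1 + (8^-1 * D * 4^-1 + 8^-1 * 4^-1 * D).
  by apply: le_rnormD; [|apply: le_rnormD]; repeat apply: le_rnormM.
have h3 : rnorm (x ** (x - y) + (x - y) ** y) <= 4^-1 * D + D * 4^-1.
  by apply: le_rnormD; apply: le_rnormM.
have := le_rnormB (le_rnormD (le_rnormD (le_rnormD dd h1) h1) h2) h3.
by move=> /(ler_wpM2l (x := 2^-1)) /le_trans; apply; [lra|apply: eq_ler; field].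
Qed.

Lemma isqrt_map_ball h x :
  rnorm h <= 8^-1 -> rnorm x <= 4^-1 -> rnorm (isqrt_map h x) <= 4^-1.
Proof.
move=> h8 x4; have o8 : rnorm (0 : A) <= 8^-1 by rewrite rnorm0 invr_ge0.
have o4 : rnorm (0 : A) <= 4^-1 by rewrite rnorm0 invr_ge0.
have := isqrt_map_lipschitz h8 o8 x4 o4.
have -> : isqrt_map 0 0 = 0 by rewrite /isqrt_map !cmul0x !addr0 subrr scaler0.
by rewrite !subr0; move: (rnorm_ge0 h) (rnorm_ge0 x); lra.
Qed.

Record is_isqrt (z y : A) : Prop := IsIsqrt {
  isqrt_near : rnorm (y - one) <= 4^-1;
  isqrt_adj : y^† = y;
  isqrtE : z ** y ** y = one;
  isqrt_comm : forall w, w ** z = z ** w -> w ** y = y ** w;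
  isqrt_sub : forall S, star_subalgebra S -> S one -> S z -> S y }.

Lemma half2 x : half *: (x + x) = x.
Proof.
rewrite scalerDr -scalerDl -[RHS]scale1r; congr (_ *: _).
by rewrite /half -rmorphD /= -(rmorph1 (real_complex R)); congr (_%:C); field.
Qed.

Lemma isqrt_mapP h x : isqrt_map h x = x <->
  (one - h) ** (one + x) ** (one + x) = one.
Proof.
have E : (one - h) ** (one + x) ** (one + x) = one + (x + x) -
   (isqrt_map h x + isqrt_map h x).
  rewrite -scalerDr half2 /isqrt_map.
  by rewrite ?cexpand ?(unitl, unitr); lmod_with (R[i]) ltac:(ring).
rewrite E; split=> [->|]; first by rewrite addrK.
move=> /eqP; rewrite -subr_eq0 addrC !addrA addNr add0r subr_eq0.
by move=> /eqP e; rewrite -[LHS]half2 -e half2.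
Qed.

(** The contraction runs in the set of self-adjoint x of norm at most 1/4 that commute with the
    commutant of z and lie in every closed star subalgebra containing 1 and z, so that 1 + x has
    these properties too. *)
Lemma isqrt_exists z : z^† = z -> rnorm (one - z) <= 8^-1 ->
  exists y, is_isqrt z y.
Proof.
move=> zs z8; set h := one - z.
have hs : h^† = h by rewrite cadjB unit_adj zs.
have zh : z = one - h by rewrite opprB addrC subrK.
have hz : h = one - z by [].
have h8 : rnorm h <= 8^-1 by []; clearbody h.
pose B : set A := [set x | [/\ rnorm x <= 4^-1, x^† = x,
  (forall w, w ** z = z ** w -> w ** x = x ** w) &
  (forall S, star_subalgebra S -> S one -> S z -> S x)]].
have [|||||x y|x Bx fx] := @contraction_fix B (isqrt_map h) (13/32) 0.
- lra.
- lra.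
- apply/closed_rnormP => x hx; split.
  + apply/ler_addgt0Pr => e e0; have [y [y4 _ _ _] xy] := hx e e0.
    rewrite -(subrK y x); apply: le_trans (rnormD _ _) _; lra.
  + apply/eqP; rewrite -subr_eq0; apply/eqP/rnorm_small => e e0.
    have e2 : 0 < e / 2 by rewrite divr_gt0.
    have [y [_ ys _ _] xy] := hx _ e2.
    have -> : x^† - x = (x - y)^† - (x - y) by rewrite cadjB ys; clmod R.
    by apply: le_lt_trans (rnormB _ _) _; rewrite rnorm_adj; lra.
  + move=> w wz; apply/eqP; rewrite -subr_eq0; apply/eqP/rnorm_small => e e0.
    have w0 := rnorm_ge0 w.
    have e2 : 0 < e / 2 / (1 + rnorm w) by rewrite !divr_gt0 // ltr_pwDl.
    have [y [_ _ yc _] xy] := hx _ e2.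
    have -> : w ** x - x ** w = w ** (x - y) - (x - y) ** w.
      by rewrite ?cexpand (yc w wz); lmod_with (R[i]) ltac:(ring).
    have h1 := le_rnormM (lexx (rnorm w)) (ltW xy).
    have h2 := le_rnormM (ltW xy) (lexx (rnorm w)).
    apply: le_lt_trans (le_rnormB h1 h2) _; rewrite ltr_pdivlMr in xy; last lra.
    set t := _ / (1 + _); have t0 : 0 < t by [].
    have -> : e = 2 * t * (1 + rnorm w) by rewrite /t; field; rewrite gt_eqF //; lra.
    nra.
  + move=> S sS So Sz; apply: (closed_rnormP S).1 (ssub_closed sS) _ _ => e e0.
    by have [y [_ _ _ yS] xy] := hx e e0; exists y => //; exact: yS.
- split=> [||w _|S sS _ _]; rewrite ?rnorm0 ?cadj0 ?invr_ge0 //.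
    by rewrite cmulx0 cmul0x.
  exact: ssub0.
- move=> x [x4 xs xc xS]; have hx : h ** x = x ** h.
    by apply: xc; rewrite hz ?cexpand ?(unitl, unitr).
  split.
  + exact: isqrt_map_ball.
  + rewrite /isqrt_map cadjZR !(cadjD, cadjN, cadjM) xs hs.
    by rewrite -hx cmulA' -hx.
  + move=> w wz; have wh : w ** h = h ** w.
      by rewrite hz ?cexpand ?(unitl, unitr) wz.
    have wx := xc w wz.
    have whx : w ** h ** x = h ** x ** w by rewrite wh -cmulA' wx cmulA'.
    rewrite /isqrt_map ?cexpand whx wh; congr (_ *: (_ - _)).
      by congr (_ + _); rewrite -[RHS]cmulA' -wx cmulA'.
    by rewrite wx -!cmulA' wx.
  + move=> S sS So Sz; have Sx := xS S sS So Sz.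
    have Sh : S h by rewrite hz; apply: (ssubB sS).
    have Shx : S (h ** x) by apply: (ssubM sS).
    apply: (ssubZ sS); apply: (ssubB sS); last exact: (ssubM sS).
    by repeat (apply: (ssubD sS) => //); apply: (ssubM sS).
- move=> [x4 _ _ _] [y4 _ _ _]; have := isqrt_map_lipschitz h8 h8 x4 y4.
  by rewrite subrr rnorm0 mulr0 add0r.
case: Bx => x4 xs xc xS; exists (one + x); split.
- by rewrite addrC addKr.
- by rewrite cadjD xs unit_adj.
- by rewrite zh; apply/isqrt_mapP.
- by move=> w wz; rewrite ?cexpand ?(unitl, unitr) xc.
- by move=> S sS So Sz; apply: (ssubD sS) => //; exact: xS.
Qed.

(** For fixed points the Lipschitz estimate reads D <= 25/32 d + 13/32 D, whence D <= 25/19 d. *)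
Lemma isqrt_lipschitz z z' y y' :
  rnorm (one - z) <= 8^-1 -> rnorm (one - z') <= 8^-1 ->
  is_isqrt z y -> is_isqrt z' y' -> rnorm (y - y') <= 2 * rnorm (z - z').
Proof.
move=> z8 z8' [y4 _ yE _ _] [y4' _ yE' _ _].
have fy : isqrt_map (one - z) (y - one) = y - one.
  by apply/isqrt_mapP; rewrite opprB !(addrC one) !subrK.
have fy' : isqrt_map (one - z') (y' - one) = y' - one.
  by apply/isqrt_mapP; rewrite opprB !(addrC one) !subrK.
have := isqrt_map_lipschitz z8 z8' y4 y4'; rewrite fy fy'.
have -> : y - one - (y' - one) = y - y' by clmod R.
have -> : one - z - (one - z') = z' - z by clmod R.
by rewrite (rdistC z'); move: (rnorm_ge0 (z - z')); lra.
Qed.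

End Unit.

End Contraction.

(** * Finite-dimensional algebras *)

Section MatrixSpectrum.
Context {R : realType}.
Local Notation C := R[i].

Lemma trig_mulmx_diag n (T : 'M[C]_n) i : is_trig_mx T -> (T *m T) i i = T i i ^+ 2.
Proof.
move=> /is_trig_mxP tT; rewrite mxE (bigD1 i) //= big1 ?addr0 // => j ji.
have [ij|ij|/val_inj ij] := ltngtP i j; last by rewrite ij eqxx in ji.
  by rewrite tT // mul0r.
by rewrite (tT j i) ?mulr0.
Qed.

Lemma mx_spectrum n (A : 'M[C]_n) : exists s : 'I_n -> C,
  [/\ forall i, eigenvalue A (s i), \tr A = \sum_i s i,
      \tr (A *m A) = \sum_i s i ^+ 2 &
      (forall i, s i = 0) -> forall v : 'rV_n, iter n (mulmxr A) v = 0].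
Proof.
case: n A => [|n] A.
  exists (fun=> 0); split=> [[]//|||_ v]; rewrite ?big_ord0 /mxtrace ?big_ord0 //.
  by apply/rowP => -[].
have [P Pu] := Schur A (ltn0Sn n).
have Pn : P \in unitmx by exact: unitarymx_unit.
rewrite /similar_to conjumx //; set T := P *m A *m _ => tT.
have PA : P *m A = T *m P by rewrite /T mulmxKV.
have trE B : \tr (P *m B *m invmx P) = \tr B by rewrite mxtrace_mulC mulKmx.
have TT : T *m T = P *m (A *m A) *m invmx P.
  by rewrite /T -!mulmxA; congr (_ *m (_ *m _)); rewrite mulmxA mulVmx // mul1mx.
exists (fun i => T i i); split.
- move=> i; have : eigenvalue T (T i i).
    rewrite eigenvalue_root_char char_poly_trig //.
    by rewrite rootE horner_prod (bigD1 i) //= hornerXsubC subrr mul0r.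
  move=> /eigenvalueP[v vT v0]; apply/eigenvalueP; exists (v *m P).
    by rewrite -mulmxA PA mulmxA vT scalemxAl.
  by apply: contra v0 => /eqP h; rewrite -(mulmxK Pn v) h mul0mx.
- by rewrite -(trE A).
- by rewrite -(trE (A *m A)) -TT; apply: eq_bigr => i _; rewrite trig_mulmx_diag.
- move=> s0 v; have T0 : T ^+ n.+1 = 0.
    have := Cayley_Hamilton T; rewrite char_poly_trig //.
    rewrite (eq_bigr (fun=> 'X)) => [|i _]; last by rewrite s0 subr0.
    by rewrite prodr_const card_ord rmorphXn /= horner_mx_X.
  have vE m : iter m (mulmxr A) v *m invmx P = v *m invmx P *m T ^+ m.
    elim: m => [|m IH]; first by rewrite expr0 mulmx1.
    rewrite iterS /= exprSr -[_ * T]/(_ *m T) mulmxA -IH -!mulmxA; congr (_ *m _).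
    by rewrite /T mulmxA mulmxA mulVmx // mul1mx.
  by rewrite -(mulmxKV Pn (iter _ _ _)) vE T0 mulmx0 mul0mx.
Qed.

End MatrixSpectrum.

(** * The trace of the left regular representation *)

Section FiniteDim.
Context {R : realType} {F : cstarType R}.
Local Notation C := R[i].
Implicit Types (x y z a : F).

Lemma findim_basis : finite_dimensional F -> exists n (e : 'I_n -> F),
  (forall x, exists c : 'I_n -> C, x = \sum_i c i *: e i) /\
  (forall c : 'I_n -> C, \sum_i c i *: e i = 0 -> forall i, c i = 0).
Proof.
pose P n := `[< exists e : 'I_n -> F,
  forall x, exists c : 'I_n -> C, x = \sum_i c i *: e i >].
move=> fF; have exP : exists n, P n.
  by case: fF => n [e he]; exists n; apply/asboolP; exists e.
case: (ex_minnP exP) => n /asboolP[e sp] nmin; exists n, e; split=> // c c0 k.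
apply/eqP; apply: contraT => ck; case: n => [|n] in e sp nmin c c0 k ck *.
  by case: k ck.
suff /nmin : P n by rewrite ltnn.
apply/asboolP; exists (e \o lift k) => x; have [b xb] := sp x.
exists (fun i => b (lift k i) - b k / c k * c (lift k i)).
transitivity (x - (b k / c k) *: \sum_i c i *: e i); first by rewrite c0 scaler0 subr0.
rewrite {1}xb !(bigD1_ord k) //=.
rewrite scalerDr scalerA divfK // opprD addrACA subrr add0r scaler_sumr -sumrB.
by apply: eq_bigr => i _; rewrite scalerA -scalerBl.
Qed.

(** This is x^(n+1): the algebra F comes without a unit. *)
Definition cpow x n : F := iter n (fun y => x ** y) x.

Lemma cpowS x n : cpow x n.+1 = x ** cpow x n. Proof. by []. Qed.

Lemma cpowD x m n : cpow x m ** cpow x n = cpow x (m + n).+1.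
Proof. by elim: m => // m IH; rewrite cpowS -cmulA' IH. Qed.

Lemma cpow_comm x n : x ** cpow x n = cpow x n ** x.
Proof.
by rewrite -[x in LHS]/(cpow x 0) -[x in RHS]/(cpow x 0) !cpowD addnC.
Qed.

Lemma cpow_adj x n : x^† = x -> (cpow x n)^† = cpow x n.
Proof. by move=> xs; elim: n => // n IH; rewrite cpowS cadjM IH xs cpow_comm. Qed.

Lemma cpow_norm x k : x^† = x -> rnorm (cpow x (2 ^ k).-1) = rnorm x ^+ (2 ^ k).
Proof.
move=> xs; elim: k => // k IH.
have -> : (2 ^ k.+1).-1 = ((2 ^ k).-1 + (2 ^ k).-1).+1.
  by rewrite expnS mul2n -addnn -(@prednK (2 ^ k)) ?expn_gt0 //= addnS.
by rewrite -cpowD -{1}(cpow_adj _ xs) rnorm_cstar IH -exprM expnS mulnC.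
Qed.

(** All higher powers vanish too, among them x^(2^n), whose norm is ||x||^(2^n) by the
    C*-identity. *)
Lemma cpow_eq0 x n : x^† = x -> cpow x n = 0 -> x = 0.
Proof.
move=> xs x0; apply: rnorm_eq0.
have xm m : cpow x (n + m) = 0.
  by elim: m => [|m IH]; rewrite ?addn0 // addnS cpowS IH cmulx0.
have lt : (n <= (2 ^ n).-1)%N by rewrite -ltnS prednK ?expn_gt0 // ltn_expl.
have := cpow_norm n xs; rewrite -(subnKC lt) xm rnorm0 => /esym/eqP.
by rewrite expf_eq0 => /andP[_ /eqP].
Qed.

Lemma cadj_i x : ('i *: x)^† = - ('i *: x^†).
Proof.
rewrite cadjZ -scaleNr; congr (_ *: _).
by apply/eqP; rewrite eq_complex /= oppr0 !eqxx.
Qed.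

Lemma ReIm_decomp x : exists a b, [/\ a^† = a, b^† = b & x = a + 'i *: b].
Proof.
exists (2^-1%:C *: (x + x^†)), ((- 'i * 2^-1%:C) *: (x - x^†)); split.
- by rewrite cadjZR cadjD cadjK addrC.
- rewrite cadjZ cadjB cadjK -[in RHS]opprB scalerN -scaleNr; congr (_ *: _).
  by apply/eqP; rewrite eq_complex /= !(mulr0, mul0r, mulr1, subr0, oppr0, addr0, add0r, opprK, mul1r, mulN1r) !eqxx.
- rewrite scalerA mulrA mulrN -expr2 sqr_i opprK mul1r -scalerDr addrCA addrA.
  rewrite addrA addrK -[LHS]scale1r scalerDr -scalerDl; congr (_ *: _).
  by rewrite -rmorphD /= -(rmorph1 (real_complex R)); congr (_%:C); field.
Qed.

Section Basis.
Variables (n : nat) (e : 'I_n -> F).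
Hypothesis spn : forall x, exists c : 'I_n -> C, x = \sum_i c i *: e i.
Hypothesis ind : forall c : 'I_n -> C, \sum_i c i *: e i = 0 -> forall i, c i = 0.

Definition lincomb (v : 'rV[C]_n) : F := \sum_i v 0 i *: e i.
Definition coords x : 'rV[C]_n := \row_i projT1 (cid (spn x)) i.

Lemma coordsK x : lincomb (coords x) = x.
Proof.
rewrite /coords; case: (cid _) => c /= xc; rewrite [RHS]xc.
by apply: eq_bigr => i _; rewrite mxE.
Qed.

Lemma lincombD c u v : lincomb (c *: u + v) = c *: lincomb u + lincomb v.
Proof.
rewrite /lincomb scaler_sumr -big_split; apply: eq_bigr => i _.
by rewrite !mxE scalerDl scalerA.
Qed.

Lemma lincomb_inj : injective lincomb.
Proof.
move=> u v uv; apply/rowP => i; apply/eqP; rewrite -subr_eq0; apply/eqP.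
apply: (ind (c := fun i => u 0 i - v 0 i)).
transitivity (lincomb u - lincomb v); last by rewrite uv subrr.
rewrite /lincomb -sumrB.
by apply: eq_bigr => j _; rewrite scalerBl.
Qed.

Lemma lincombK v : coords (lincomb v) = v.
Proof. by apply: lincomb_inj; rewrite coordsK. Qed.

Lemma lincomb0 : lincomb 0 = 0.
Proof. by rewrite /lincomb big1 // => i _; rewrite mxE scale0r. Qed.

Lemma coords0 : coords 0 = 0.
Proof. by apply: lincomb_inj; rewrite coordsK lincomb0. Qed.

Lemma coordsD c x y : coords (c *: x + y) = c *: coords x + coords y.
Proof. by apply: lincomb_inj; rewrite lincombD !coordsK. Qed.

(** Coordinates are row vectors, acted on from the right; hence [lmx] reverses products. *)
Definition lmx x : 'M[C]_n := \matrix_(i, j) coords (x ** e i) 0 j.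

Lemma vec_lmx v x : lincomb (v *m lmx x) = x ** lincomb v.
Proof.
rewrite /lincomb cmul_sumr.
under [RHS]eq_bigr => i _ do rewrite cmulZr -(coordsK (x ** e i)) /lincomb scaler_sumr.
rewrite exchange_big; apply: eq_bigr => j _; rewrite mxE scaler_suml.
by apply: eq_bigr => i _; rewrite mxE scalerA.
Qed.

Lemma lmxM x y : lmx (x ** y) = lmx y *m lmx x.
Proof.
apply/row_matrixP => i; rewrite !rowE mulmxA; apply: lincomb_inj.
by rewrite !vec_lmx cmulA'.
Qed.

Lemma lmxD c x y : lmx (c *: x + y) = c *: lmx x + lmx y.
Proof.
by apply/matrixP => i j; rewrite [LHS]mxE cmulDl cmulZl coordsD !mxE.
Qed.

Definition ltr x : C := \tr (lmx x).

Lemma ltrD x y : ltr (x + y) = ltr x + ltr y.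
Proof. by rewrite -{1}(scale1r x) /ltr lmxD scale1r mxtraceD. Qed.

Lemma ltrZ c x : ltr (c *: x) = c * ltr x.
Proof.
have l0 : lmx 0 = 0.
  by have := lmxD 1 0 0; rewrite !scale1r addr0 => /(canLR (addrK _)); rewrite subrr.
by rewrite -[c *: x]addr0 /ltr lmxD l0 addr0 mxtraceZ.
Qed.

Lemma ltrN x : ltr (- x) = - ltr x.
Proof. by rewrite -scaleN1r ltrZ mulN1r. Qed.

Lemma ltrC x y : ltr (x ** y) = ltr (y ** x).
Proof. by rewrite /ltr !lmxM mxtrace_mulC. Qed.

Lemma eigenvalue_lmx x l : eigenvalue (lmx x) l ->
  exists2 y, y != 0 & x ** y = l *: y.
Proof.
move=> /eigenvalueP[v vl v0]; exists (lincomb v).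
  apply: contra v0 => /eqP v0; rewrite -(lincombK v) v0.
  by rewrite coords0.
by rewrite -vec_lmx vl -[l *: v]addr0 lincombD lincomb0 addr0.
Qed.

(** If a y = l y, then l y^* y = y^* a y is self-adjoint, and y^* y is not 0. *)
Lemma eigenvalue_lmx_real a l : a^† = a -> eigenvalue (lmx a) l -> l^* = l.
Proof.
move=> sa /eigenvalue_lmx[y y0 ay].
have y2 : y^† ** y != 0.
  apply: contra y0 => /eqP h; have := rnorm_cstar y; rewrite h rnorm0.
  by move=> /esym/eqP; rewrite expf_eq0 /= => /eqP /rnorm_eq0 ->.
have h : l *: (y^† ** y) = y^† ** a ** y by rewrite -cmulA' ay cmulZr.
have := congr1 cadj h; rewrite cadjZ !cadjM cadjK sa cmulA' -h.
move=> /eqP; rewrite -subr_eq0 -scalerBl scaler_eq0 (negbTE y2) orbF subr_eq0.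
by move=> /eqP.
Qed.

Lemma eigenvalue_lmx_le x l : eigenvalue (lmx x) l -> cabs l <= rnorm x.
Proof.
move=> /eigenvalue_lmx[y y0 xy]; rewrite -(@ler_pM2r _ (rnorm y)) ?rnorm_gt0 //.
by rewrite -rnormZ -xy rnormM.
Qed.

Lemma ltr_sa a : a^† = a -> exists s : 'I_n -> R,
  [/\ ltr a = (\sum_i s i)%:C, ltr (a ** a) = (\sum_i s i ^+ 2)%:C &
      (forall i, s i = 0) -> a = 0].
Proof.
move=> sa; have [s [es tr1 tr2 s0]] := mx_spectrum (lmx a).
have sE i : s i = (complex.Re (s i))%:C.
  have := eigenvalue_lmx_real sa (es i); case: (s i) => u v /= [] h.
  by congr (_ +i* _); lra.
exists (fun i => complex.Re (s i)); split.
- by rewrite /ltr tr1 rmorph_sum; apply: eq_bigr => i _.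
- rewrite /ltr lmxM tr2 rmorph_sum; apply: eq_bigr => i _.
  by rewrite rmorphXn /= -sE.
- move=> h; apply: (cpow_eq0 (n := n)) => //.
  (* The powers of a arise from a itself by left multiplication, so nilpotency of [lmx a] applies
     without a unit. *)
  have cE m : cpow a m = lincomb (iter m (mulmxr (lmx a)) (coords a)).
    by elim: m => [|m IH] /=; rewrite ?coordsK // vec_lmx -IH.
  by rewrite cE s0 ?lincomb0 // => i; rewrite sE h.
Qed.

Lemma ltr_adj x : ltr x^† = (ltr x)^*.
Proof.
have [a [b [sa sb ->]]] := ReIm_decomp x.
rewrite cadjD cadjZ sa sb !ltrD !ltrZ rmorphD rmorphM /=.
have [s [-> _ _]] := ltr_sa sa; have [t [-> _ _]] := ltr_sa sb.
by rewrite !conjc_real.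
Qed.

(** For x = a + i b the cross terms of x^* x cancel under the trace, which leaves the squares of the
    eigenvalues of a and b. *)
Lemma ltr_pos x : exists2 r, 0 <= r & ltr (x^† ** x) = r%:C /\ (r = 0 -> x = 0).
Proof.
have [a [b [sa sb xE]]] := ReIm_decomp x.
have E : ltr (x^† ** x) = ltr (a ** a) + ltr (b ** b).
  rewrite xE cadjD cadj_i sa sb !cexpand !(ltrD, ltrN, ltrZ) (ltrC b a).
  by rewrite (mulrA 'i 'i) -expr2 sqr_i; ring.
have [s [_ s2 s0]] := ltr_sa sa; have [t [_ t2 t0]] := ltr_sa sb.
have p1 : 0 <= \sum_i s i ^+ 2 by apply: sumr_ge0 => i _; rewrite sqr_ge0.
have p2 : 0 <= \sum_i t i ^+ 2 by apply: sumr_ge0 => i _; rewrite sqr_ge0.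
exists (\sum_i s i ^+ 2 + \sum_i t i ^+ 2); first by rewrite addr_ge0.
split; first by rewrite E s2 t2 rmorphD.
move=> /eqP; rewrite paddr_eq0 // => /andP[/eqP h1 /eqP h2].
have a0 : a = 0.
  apply: s0 => i; have /(_ i isT) := psumr_eq0P (fun j _ => sqr_ge0 (s j)) h1.
  by move/eqP; rewrite sqrf_eq0 => /eqP.
have b0 : b = 0.
  apply: t0 => i; have /(_ i isT) := psumr_eq0P (fun j _ => sqr_ge0 (t j)) h2.
  by move/eqP; rewrite sqrf_eq0 => /eqP.
by rewrite xE a0 b0 scaler0 addr0.
Qed.

Lemma ltr_bounded x : cabs (ltr x) <= n%:R * rnorm x.
Proof.
have [s [es tr1 _ _]] := mx_spectrum (lmx x).
have : `|ltr x| <= (n%:R * rnorm x)%:C.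
  rewrite /ltr tr1; apply: le_trans (ler_norm_sum _ _ _) _.
  rewrite mulr_natl -[n in _ *+ n]card_ord -sumr_const rmorph_sum.
  by apply: ler_sum => i _; rewrite cabsE lecR eigenvalue_lmx_le.
by rewrite cabsE lecR.
Qed.

End Basis.

(* [tr_form] is the trace of the left regular representation and [tr_basis] an
   orthonormal basis for it; as the same functional is the trace of the right
   regular representation, [sum_i e_i^* e_i = 1]. *)
Record trace_frame : Type := TraceFrame {
  tr_form : F -> C;
  tr_dim : nat;
  tr_basis : 'I_tr_dim -> F;
  tr_bound : R;
  tr_formD : forall x y, tr_form (x + y) = tr_form x + tr_form y;
  tr_formZ : forall c x, tr_form (c *: x) = c * tr_form x;
  tr_formC : forall x y, tr_form (x ** y) = tr_form (y ** x);
  tr_form_adj : forall x, tr_form x^† = (tr_form x)^*;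
  tr_form_ge0 : forall x, 0 <= tr_form (x^† ** x);
  tr_form_eq0 : forall x, tr_form (x^† ** x) = 0 -> x = 0;
  tr_form_le : forall x, cabs (tr_form x) <= tr_bound * rnorm x;
  tr_basisE : forall x, x = \sum_i tr_form ((tr_basis i)^† ** x) *: tr_basis i;
  tr_frameE : forall x, x = \sum_i \sum_j
    tr_form (tr_basis i ** x ** (tr_basis j)^†) *: ((tr_basis i)^† ** tr_basis j) }.

Section Orthonormal.
Variables (n : nat) (e : 'I_n -> F).
Hypothesis spn : forall x, exists c : 'I_n -> C, x = \sum_i c i *: e i.
Hypothesis ind : forall c : 'I_n -> C, \sum_i c i *: e i = 0 -> forall i, c i = 0.
Local Notation tau := (ltr spn).

Let tauD := ltrD spn ind.
Let tauZ := ltrZ spn ind.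
Let tauN := ltrN spn ind.
Let tauC := ltrC spn ind.

Let tau0 : tau 0 = 0.
Proof. by rewrite -(scale0r 0) tauZ mul0r. Qed.

Let tau_sum I (s : seq I) (G : I -> F) :
  tau (\sum_(i <- s) G i) = \sum_(i <- s) tau (G i).
Proof. exact: (big_morph _ tauD tau0). Qed.

Definition orthonormal m (g : 'I_m -> F) :=
  forall i j, tau ((g j)^† ** g i) = (i == j)%:R.

Lemma orthonormal_le m (g : 'I_m -> F) : orthonormal g -> (m <= n)%N.
Proof.
move=> og; pose A := \matrix_(i < m, k < n) coords spn (g i) 0 k.
pose B := \matrix_(k < n, j < m) tau ((g j)^† ** e k).
apply: (@mulmx1_min _ m n A B); apply/matrixP => i j; rewrite !mxE -og.
rewrite -[g i in RHS](coordsK spn) /lincomb cmul_sumr tau_sum; apply: eq_bigr => k _.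
by rewrite !mxE cmulZr tauZ.
Qed.

(** An orthonormal family of maximal size spans: a nonzero remainder r, normalized, would extend
    it. *)
Lemma orthonormal_basis : exists m (g : 'I_m -> F), orthonormal g /\
  forall x, x = \sum_i tau ((g i)^† ** x) *: g i.
Proof.
pose P m := `[< exists g : 'I_m -> F, orthonormal g >].
have exP : exists m, P m.
  by exists 0%N; apply/asboolP; exists (fun=> 0) => -[].
have leP m : P m -> (m <= n)%N by move=> /asboolP[g /orthonormal_le].
case: (ex_maxnP exP leP) => m /asboolP[g og] mmax; exists m, g; split=> // x.
apply/eqP; rewrite -subr_eq0; apply: contraT; set r := x - _ => r0.
have gr j : tau ((g j)^† ** r) = 0.
  rewrite /r cmulBr tauD tauN cmul_sumr tau_sum (bigD1 j) //= big1 ?addr0.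
    by rewrite cmulZr tauZ og eqxx mulr1 subrr.
  by move=> i ij; rewrite cmulZr tauZ og (negbTE ij) mulr0.
have rg j : tau (r^† ** g j) = 0.
  by rewrite -[g j]cadjK -cadjM (ltr_adj spn ind) gr conjc0.
have [t t0 [tE tr0]] := ltr_pos spn ind r.
have tp : 0 < t by rewrite lt_neqAle t0 andbT eq_sym; apply: contra r0 => /eqP/tr0 ->.
pose s := (Num.sqrt t)^-1; have ss : s * s * t = 1.
  by rewrite /s -invfM -expr2 sqr_sqrtr // mulVf // gt_eqF.
pose h (i : 'I_m.+1) := if unlift ord_max i is Some j then g j else s%:C *: r.
suff /mmax : P m.+1 by rewrite ltnn.
apply/asboolP; exists h => i j; rewrite /h.
case: unliftP => [i' ->|->]; case: unliftP => [j' ->|->]; rewrite ?cadjZR.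
- by rewrite og (inj_eq (@lift_inj _ _)).
- by rewrite cmulZr tauZ gr mulr0 (negbTE (neq_lift _ _)).
- by rewrite cmulZl tauZ rg mulr0 eq_sym (negbTE (neq_lift _ _)).
- by rewrite cmulZl cmulZr !tauZ tE eqxx mulrA -!rmorphM ss.
Qed.

(** The trace of left multiplication by y may be computed in the basis g; A and B change coordinates
    between g and e. *)
Lemma tau_orthonormal m (g : 'I_m -> F) : orthonormal g ->
  (forall x, x = \sum_i tau ((g i)^† ** x) *: g i) ->
  forall y, \sum_i tau ((g i)^† ** y ** g i) = tau y.
Proof.
move=> og gE y; pose A := \matrix_(i < m, k < n) coords spn (g i) 0 k.
pose B := \matrix_(k < n, j < m) tau ((g j)^† ** e k).
have BA : B *m A = 1%:M.
  apply/row_matrixP => k; apply: (lincomb_inj ind); rewrite rowE row1 -rowE.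
  transitivity (e k).
    rewrite [RHS]gE /lincomb.
    have gv i : g i = \sum_l coords spn (g i) 0 l *: e l.
      by rewrite -{1}(coordsK spn (g i)).
    under [RHS]eq_bigr => i _ do rewrite [X in _ *: X]gv scaler_sumr.
    rewrite exchange_big; apply: eq_bigr => l _; rewrite !mxE scaler_suml.
    by apply: eq_bigr => i _; rewrite !mxE scalerA.
  rewrite /lincomb (bigD1 k) //= big1 ?addr0 => [|l lk].
    by rewrite mxE !eqxx scale1r.
  by rewrite mxE eqxx (negbTE lk) scale0r.
rewrite -[RHS]/(\tr _) -[lmx spn y]mulmx1 -BA mulmxA mxtrace_mulC mulmxA.
apply: eq_bigr => i _; rewrite -[X in _ ** X](coordsK spn (g i)).
have -> : (g i)^† ** y ** lincomb e (coords spn (g i)) =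
   (g i)^† ** lincomb e (coords spn (g i) *m lmx spn y) by rewrite vec_lmx // cmulA'.
rewrite /lincomb cmul_sumr tau_sum mxE; apply: eq_bigr => k _.
rewrite cmulZr tauZ [B k i]mxE; congr (_ * _).
by rewrite [in LHS]mxE [in RHS]mxE; apply: eq_bigr => l _; rewrite [A i l]mxE.
Qed.

End Orthonormal.

Lemma findim_trace_frame : finite_dimensional F -> trace_frame.
Proof.
move=> /findim_basis /cid[n /cid[e [spn ind]]].
have [m /cid[g [og gE]]] := cid (orthonormal_basis spn ind).
pose tau := ltr spn; pose h i := (g i)^†.
have og' i j : tau ((g j)^† ** g i) = (i == j)%:R := og i j.
have gE' x : x = \sum_i tau ((g i)^† ** x) *: g i := gE x.
have tauZ c x : tau (c *: x) = c * tau x := ltrZ spn ind c x.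
have tauD x y : tau (x + y) = tau x + tau y := ltrD spn ind x y.
have tauN x : tau (- x) = - tau x := ltrN spn ind x.
have tauC x y : tau (x ** y) = tau (y ** x) := ltrC spn ind x y.
have tau_adj x : tau x^† = (tau x)^* := ltr_adj spn ind x.
have tau0 : tau 0 = 0 by rewrite -(scale0r 0) tauZ mul0r.
have tau_sum (G : 'I_m -> F) : tau (\sum_i G i) = \sum_i tau (G i).
  exact: (big_morph _ tauD tau0).
(* By traciality the adjoints form an orthonormal basis as well; computing the trace in this basis
   gives [tk]. *)
have oh : orthonormal spn h.
  by move=> i j; rewrite /h cadjK [LHS]tauC og' eq_sym.
have hE x : x = \sum_i tau ((h i)^† ** x) *: h i.
  rewrite -[LHS]cadjK [x^†]gE' cadj_sum; apply: eq_bigr => i _.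
  by rewrite cadjZc -tau_adj cadjM !cadjK tauC.
pose k := \sum_i (g i)^† ** g i.
have tk y : tau (k ** y) = tau y.
  rewrite -[RHS](tau_orthonormal ind oh hE) /k cmul_suml tau_sum.
  by apply: eq_bigr => i _; rewrite /h cadjK -!cmulA' tauC -!cmulA'.
(* With w = k z - z, the trace of w^* w is that of (k z - z) w^*, which is 0 by [tk]; and the trace
   is faithful. *)
have kz z : k ** z = z.
  apply/eqP; rewrite -subr_eq0; apply/eqP; set w := _ - z.
  have [t _ [tE t0]] := ltr_pos spn ind w.
  have tE' : tau (w^† ** w) = t%:C := tE.
  apply: t0; apply: complexI; rewrite -tE' tauC {1}/w cmulBl -cmulA'.
  by rewrite tauD tauN (tk (z ** w^†)) subrr.
apply: (@TraceFrame tau m g n%:R) => //.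
- by move=> x; have [t t0 [tE _]] := ltr_pos spn ind x; rewrite [tau _]tE lecR.
- move=> x; have [t _ [tE t0]] := ltr_pos spn ind x.
  by rewrite [tau _]tE => /complexI /t0.
- exact: ltr_bounded.
- move=> x; rewrite -[LHS]kz /k cmul_suml; apply: eq_bigr => i _.
  rewrite -cmulA' [g i ** x in LHS]gE' cmul_sumr; apply: eq_bigr => j _.
  by rewrite cmulZr [tau (g i ** x ** _)]tauC.
Qed.

End FiniteDim.

(** * Functionals on nuclear algebras *)

Lemma quadratic_ge0 {R : realType} (a b c : R) : 0 <= a ->
  (forall t, 0 <= a * t ^+ 2 + 2 * b * t + c) -> b ^+ 2 <= a * c.
Proof.
move=> a0 h; have [a00|an0] := eqVneq a 0.
  rewrite a00 mul0r; have [->|b0] := eqVneq b 0; first by rewrite expr0n.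
  have := h (- (c + 1) / (2 * b)); rewrite a00 mul0r add0r.
  have -> : 2 * b * (- (c + 1) / (2 * b)) = - (c + 1) by field; rewrite b0.
  by rewrite opprD addrAC addNr add0r oppr_ge0 ler10.
have ap : 0 < a by rewrite lt_neqAle eq_sym an0.
have := h (- b / a).
have -> : a * (- b / a) ^+ 2 + 2 * b * (- b / a) + c = (a * c - b ^+ 2) / a by field.
by rewrite pmulr_lge0 ?invr_gt0 // subr_ge0.
Qed.

Section PositiveFunctional.
Context {R : realType} {A : cstarType R}.
Local Notation C := R[i].
Implicit Types (x y z a b : A).

Record positive_functional (f : A -> C) : Prop := PositiveFunctional {
  pfunD : forall x y, f (x + y) = f x + f y;
  pfunZ : forall c x, f (c *: x) = c * f x;
  pfun_ge0 : forall x, 0 <= f (x^† ** x);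
  pfun_bounded : exists K : R, forall x, cabs (f x) <= K * rnorm x }.

Variables (one : A) (oneP : is_unit one).
Let one1 := unitl oneP.
Let onex := unitr oneP.
Let ones := unit_adj oneP.

Section Fun.
Variables (f : A -> C) (fP : positive_functional f).
Local Notation fr x := (complex.Re (f x)).

Lemma pfunN x : f (- x) = - f x.
Proof. by rewrite -scaleN1r (pfunZ fP) mulN1r. Qed.

Lemma pfun_square x : f (x^† ** x) = (fr (x^† ** x))%:C /\ 0 <= fr (x^† ** x).
Proof.
have := pfun_ge0 fP x; rewrite lecE /= => /andP[/eqP h ->]; split=> //.
by rewrite [LHS]complexE h mulr0 addr0.
Qed.

(** Polarization: 2 a is (a + 1)^2 - a^2 - 1, and f is real on each of these squares. *)
Lemma pfun_real a : a^† = a -> f a = (fr a)%:C.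
Proof.
move=> sa; have [h1 _] := pfun_square (a + one); have [h2 _] := pfun_square a.
have [h3 _] := pfun_square one.
have : f ((a + one)^† ** (a + one)) = f (a^† ** a) + f (one^† ** one) + 2 * f a.
  by rewrite cadjD sa ones !cexpand !(one1, onex) !(pfunD fP); ring.
move=> h; have : 2 * f a = (fr ((a + one)^† ** (a + one)) - fr (a^† ** a) -
    fr (one^† ** one))%:C.
  by rewrite !rmorphB /= -h1 -h2 -h3 h; ring.
move=> /(congr1 (fun t => complex.Im t)); rewrite /= [f a]complexE.
by case: (f a) => u v /=; rewrite !(mul0r, mulr0, addr0, add0r, mul1r) => k; congr (_ +i* _); lra.
Qed.

Lemma frD x y : fr (x + y) = fr x + fr y.
Proof. by rewrite (pfunD fP) raddfD. Qed.

Lemma frN x : fr (- x) = - fr x.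
Proof. by rewrite pfunN raddfN. Qed.

Lemma frZ (r : R) x : fr (r%:C *: x) = r * fr x.
Proof. by rewrite (pfunZ fP); case: (f x) => u v /=; rewrite mul0r subr0. Qed.

Lemma fr_bounded : exists K : R, forall x, `|fr x| <= K * rnorm x.
Proof.
have [K hK] := pfun_bounded fP; exists K => x; apply: le_trans (hK x).
by rewrite -lecR -cabsE normc_ge_Re.
Qed.

Lemma fr_one_ge0 : 0 <= fr one.
Proof. by have [_] := pfun_square one; rewrite ones one1. Qed.

Lemma pfun_cauchy h : h^† = h -> fr h ^+ 2 <= fr one * fr (h ** h).
Proof.
move=> sh; apply: quadratic_ge0 => [|t]; first exact: fr_one_ge0.
have [_] := pfun_square (t%:C *: one + h).
rewrite cadjD cadjZR sh ones !cexpand !(one1, onex) !frD !frZ.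
by move=> /le_trans; apply; apply: eq_ler; ring.
Qed.

Definition dpow h k : A := iter k (fun y => y ** y) h.

Lemma dpow_adj h k : h^† = h -> (dpow h k)^† = dpow h k.
Proof. by move=> sh; elim: k => //= k IH; rewrite cadjM IH. Qed.

Lemma dpow_norm h k : h^† = h -> rnorm (dpow h k) = rnorm h ^+ (2 ^ k).
Proof.
move=> sh; elim: k => [|k IH] //=.
by rewrite -{1}(dpow_adj k sh) rnorm_cstar IH -exprM expnSr.
Qed.

(** Iterated Cauchy-Schwarz gives (|f h| / f 1)^(2^k) <= |f (h^(2^k))| / f 1 <= K ||h||^(2^k) / f 1.
    If |f h| exceeded f 1 ||h||, the left side would outgrow the right. *)
Lemma pfun_norm h : h^† = h -> `|fr h| <= fr one * rnorm h.
Proof.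
move=> sh; have a0 := fr_one_ge0; have h0 := rnorm_ge0 h.
have [a00|an0] := eqVneq (fr one) 0.
  have := pfun_cauchy sh; rewrite a00 !mul0r => k.
  have : fr h ^+ 2 == 0 by rewrite eq_le k sqr_ge0.
  by rewrite sqrf_eq0 => /eqP ->; rewrite normr0.
have ap : 0 < fr one by rewrite lt_neqAle eq_sym an0.
rewrite -ler_pdivrMl // leNgt; apply/negP => lt.
set q := _ * _ in lt; have q0 : 0 < q by exact: le_lt_trans lt.
have step k : q ^+ (2 ^ k) <= (fr one)^-1 * `|fr (dpow h k)|.
  elim: k => [|k IH]; first by rewrite expr1.
  have c := pfun_cauchy (dpow_adj k sh).
  rewrite expnSr exprM; have : (q ^+ (2 ^ k)) ^+ 2 <= ((fr one)^-1 * `|fr (dpow h k)|) ^+ 2.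
    by rewrite ler_pXn2r ?nnegrE ?mulr_ge0 ?invr_ge0 ?exprn_ge0 // ltW.
  move/le_trans; apply; rewrite exprMn real_normK ?num_real // expr2 -mulrA.
  rewrite ler_pM2l ?invr_gt0 // ler_pdivrMl //; apply: le_trans c _.
  by rewrite ler_pM2l // ler_norm.
have [K hK] := fr_bounded.
have s1 : rnorm h / q < 1 by rewrite ltr_pdivrMr // mul1r.
have s0 : 0 <= rnorm h / q by rewrite divr_ge0 // ltW.
have [N hN] := expr_small (K / fr one) s0 s1 ltr01.
have lt2 : (N <= 2 ^ N)%N by apply/ltnW/ltn_expl.
have := hN _ lt2; apply/negP; rewrite -leNgt.
rewrite expr_div_n mulrA ler_pdivlMr ?exprn_gt0 // mul1r.
apply: le_trans (step N) _; rewrite mulrC mulrAC ler_pM2r ?invr_gt0 //.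
by rewrite -dpow_norm.
Qed.

End Fun.

Lemma pfun_conj f w : positive_functional f ->
  positive_functional (fun x => f (w^† ** x ** w)).
Proof.
move=> fP; split=> [x y|c x|x|].
- by rewrite !cexpand (pfunD fP).
- by rewrite !cexpand (pfunZ fP).
- by have := pfun_ge0 fP (x ** w); rewrite cadjM !cmulA'.
- have [K hK] := pfun_bounded fP; exists (`|K| * (rnorm w * rnorm w)) => x.
  apply: le_trans (hK _) _; have w0 := rnorm_ge0 w; have x0 := rnorm_ge0 x.
  have k : rnorm (w^† ** x ** w) <= rnorm w * rnorm x * rnorm w.
    by repeat apply: le_rnormM => //; rewrite rnorm_adj.
  apply: le_trans (ler_wpM2r (rnorm_ge0 _) (ler_norm K)) _.
  by apply: le_trans (ler_wpM2l (normr_ge0 K) k) _; apply: eq_ler; ring.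
Qed.

(** No square root of 1 - a is at hand; positivity is tested on functionals, by the norm bound for f
    conjugated by w. *)
Lemma pfun_sub_ge0 f w a : positive_functional f -> a^† = a -> rnorm a <= 1 ->
  0 <= complex.Re (f (w^† ** (one - a) ** w)).
Proof.
move=> fP sa a1; have gP := pfun_conj w fP.
have := pfun_norm gP sa; have := frD gP one (- a); rewrite (frN gP) /= => -> h.
have := fr_one_ge0 gP => /= g0; rewrite subr_ge0.
apply: le_trans (ler_norm _) _; apply: le_trans h _.
by rewrite ler_piMr.
Qed.

Definition upow a n : A := iter n (fun y => a ** y) one.

Lemma upowD a m n : upow a m ** upow a n = upow a (m + n).
Proof. by elim: m => [|m IH] /=; rewrite ?one1 // -cmulA' IH. Qed.

Lemma upow1 a : upow a 1 = a. Proof. by rewrite /= onex. Qed.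

Lemma upowSr a n : upow a n ** a = upow a n.+1.
Proof. by rewrite -{2}(upow1 a) upowD addn1. Qed.

Lemma upow_adj a n : a^† = a -> (upow a n)^† = upow a n.
Proof.
move=> sa; elim: n => [|n IH] /=; first exact: ones.
by rewrite cadjM IH sa upowSr.
Qed.

Lemma cpow_upow a n : cpow a n = upow a n.+1.
Proof. by elim: n => [|n IH]; rewrite ?upow1 // cpowS IH. Qed.

Lemma upow_norm a k : a^† = a -> rnorm (upow a (2 ^ k)) = rnorm a ^+ (2 ^ k).
Proof. by move=> sa; rewrite -(cpow_norm k sa) cpow_upow prednK // expn_gt0. Qed.

Definition commutes x y := x ** y = y ** x.

Lemma commutes1 x : commutes one x.
Proof. by rewrite /commutes one1 onex. Qed.

Lemma commutesM x y z : commutes x z -> commutes y z -> commutes (x ** y) z.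
Proof. by move=> xz yz; rewrite /commutes -cmulA' yz cmulA' xz -cmulA'. Qed.

Lemma commutesB x y z : commutes x z -> commutes y z -> commutes (x - y) z.
Proof. by rewrite /commutes cmulBl cmulBr => -> ->. Qed.

Lemma commutes_upow a n : commutes a (upow a n).
Proof. by rewrite /commutes upowSr. Qed.

(** Writes a^j q as p r p, where p is a self-adjoint power of a and r is q or a q: the form from
    which positivity can be read off. *)
Lemma upow_half a j q : commutes q (upow a j./2) ->
  upow a j ** q = upow a j./2 ** ((if odd j then a else one) ** q) ** upow a j./2.
Proof.
move=> qp; have ap := commutes_upow a j./2.
have op : commutes (if odd j then a else one) (upow a j./2).
  by case: ifP => _ //; exact: commutes1.
rewrite -[RHS]cmulA' (commutesM op qp) [RHS]cmulA' upowD [RHS]cmulA'.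
rewrite -{1}[j]odd_double_half addnn addnC -upowD.
by case: (odd j); rewrite ?upow1.
Qed.

(* The terms decrease with [n] and telescope to a sum of at most 1. *)
Lemma pfun_moment f a b n : positive_functional f -> complex.Re (f one) <= 1 ->
  rnorm b <= 1 -> a = b^† ** b ->
  0 <= complex.Re (f (upow a n ** (one - a))) <= n.+1%:R^-1.
Proof.
move=> fP f1 b1 ab; have sa : a^† = a by rewrite ab cadjM cadjK.
have a1 : rnorm a <= 1 by rewrite ab rnorm_cstar expr_le1 ?rnorm_ge0.
have bb1 : rnorm (b ** b^†) <= 1.
  by rewrite -{1}(cadjK b) rnorm_cstar rnorm_adj expr_le1 ?rnorm_ge0.
have sbb : (b ** b^†)^† = b ** b^† by rewrite cadjM cadjK.
have s1a : (one - a)^† = one - a by rewrite cadjB ones sa.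
have com1a i : commutes (one - a) (upow a i).
  by apply: commutesB; [exact: commutes1|exact: commutes_upow].
pose D j := complex.Re (f (upow a j ** (one - a))).
have sq_ge0 w : 0 <= complex.Re (f (w^† ** w)) by case: (pfun_square fP w).
have p0 j : 0 <= complex.Re (f (upow a j)).
  rewrite -[upow a j]onex upow_half; last exact: commutes1.
  rewrite onex -{1}(upow_adj j./2 sa); case: (odd j); last by rewrite onex.
  by have := sq_ge0 (b ** upow a j./2); rewrite cadjM !cmulA' -(cmulA' _ _ b) -ab.
have D0 j : 0 <= D j.
  rewrite /D upow_half // -{1}(upow_adj j./2 sa); case: (odd j); last first.
    by rewrite one1; exact: pfun_sub_ge0.
  have := pfun_sub_ge0 (b ** upow a j./2) fP sbb bb1.
  have -> : a ** (one - a) = b^† ** (one - b ** b^†) ** b.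
    by rewrite ab !cexpand !(one1, onex).
  by rewrite cadjM !cmulA'.
have Ddec j : D j.+1 <= D j.
  rewrite -subr_ge0 /D -(frN fP) -(frD fP).
  have -> : upow a j ** (one - a) - upow a j.+1 ** (one - a) =
      upow a j ** ((one - a) ** (one - a)).
    by rewrite -upowSr !cexpand !(one1, onex); lmod_with (R[i]) ltac:(ring).
  rewrite upow_half; last exact: commutesM.
  rewrite -{1}(upow_adj j./2 sa); case: (odd j); last first.
    rewrite one1; have := sq_ge0 ((one - a) ** upow a j./2).
    by rewrite cadjM s1a !cmulA'.
  have -> : a ** ((one - a) ** (one - a)) = (one - a)^† ** b^† ** b ** (one - a).
    by rewrite s1a -(cmulA' _ b^† b) -ab !cexpand !(one1, onex); lmod_with (R[i]) ltac:(ring).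
  by have := sq_ge0 (b ** (one - a) ** upow a j./2); rewrite !cadjM !cmulA'.
have sumD m : \sum_(j < m) D j = complex.Re (f one) - complex.Re (f (upow a m)).
  elim: m => [|m IH]; first by rewrite big_ord0 subrr.
  rewrite big_ord_recr IH /= /D cmulBr onex (frD fP) (frN fP) upowSr /=.
  by ring.
have mono j k : D (j + k)%N <= D j.
  by elim: k => [|k IH]; rewrite ?addn0 // addnS (le_trans (Ddec _)).
apply/andP; split; first exact: D0.
rewrite -[leLHS]/(D n) -[leRHS]mulr1 ler_pdivlMl ?ltr0Sn //.
have : \sum_(j < n.+1) D n <= \sum_(j < n.+1) D j.
  by apply: ler_sum => j _; rewrite -{1}(subnKC (leq_ord j)).
rewrite sumr_const card_ord mulr_natl => /le_trans; apply.
by rewrite sumD; apply: le_trans f1; rewrite gerBl.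
Qed.

End PositiveFunctional.

(** * The Hilbert space structure given by the trace *)

Section TraceForm.
Context {R : realType} {F : cstarType R} (T : @trace_frame R F).
Local Notation C := R[i].
Implicit Types (x y z k : F).

Local Notation tau := (tr_form T).
Definition tdot x y : R := complex.Re (tau (y^† ** x)).
Definition tnorm x : R := tdot x x.

Lemma tauN x : tau (- x) = - tau x.
Proof. by rewrite -scaleN1r tr_formZ mulN1r. Qed.

Lemma tau0 : tau 0 = 0.
Proof. by rewrite -(scale0r 0) tr_formZ mul0r. Qed.

Lemma tau_sum I (s : seq I) (G : I -> F) :
  tau (\sum_(i <- s) G i) = \sum_(i <- s) tau (G i).
Proof. exact: (big_morph _ (@tr_formD _ _ T) tau0). Qed.

Lemma tnormE x : tau (x^† ** x) = (tnorm x)%:C.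
Proof.
have := tr_form_ge0 T x; rewrite lecE /= => /andP[/eqP h _].
by rewrite [LHS]complexE h mulr0 addr0.
Qed.

Lemma tnorm_ge0 x : 0 <= tnorm x.
Proof. by rewrite -lecR -tnormE tr_form_ge0. Qed.

Lemma tnorm_eq0 x : tnorm x = 0 -> x = 0.
Proof. by move=> h; apply: (tr_form_eq0 (t := T)); rewrite tnormE h. Qed.

Lemma tdotDl x y z : tdot (x + y) z = tdot x z + tdot y z.
Proof. by rewrite /tdot cmulDr tr_formD raddfD. Qed.

Lemma tdotC x y : tdot x y = tdot y x.
Proof.
by rewrite /tdot -{1}[x]cadjK -cadjM tr_form_adj; case: (tau _).
Qed.

Lemma tdotDr x y z : tdot x (y + z) = tdot x y + tdot x z.
Proof. by rewrite tdotC tdotDl !(tdotC x). Qed.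

Lemma tdotZl (r : R) x y : tdot (r%:C *: x) y = r * tdot x y.
Proof. by rewrite /tdot cmulZr tr_formZ; case: (tau _) => u v /=; rewrite mul0r subr0. Qed.

Lemma tdotZr (r : R) x y : tdot x (r%:C *: y) = r * tdot x y.
Proof. by rewrite tdotC tdotZl tdotC. Qed.

Lemma tdot_cauchy x y : tdot x y ^+ 2 <= tnorm x * tnorm y.
Proof.
apply: quadratic_ge0 => [|t]; first exact: tnorm_ge0.
have := tnorm_ge0 (t%:C *: x + y); rewrite /tnorm !(tdotDl, tdotDr, tdotZl, tdotZr).
by rewrite (tdotC y x) => /le_trans; apply; apply: eq_ler; ring.
Qed.

Lemma tnorm_i x : tnorm ('i *: x) = tnorm x.
Proof.
apply: complexI; rewrite -!tnormE cadj_i !cexpand tauN !tr_formZ mulrA -expr2.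
by rewrite sqr_i mulN1r opprK.
Qed.

Lemma cabs_le_ReIm (c : C) : cabs c <= `|complex.Re c| + `|complex.Im c|.
Proof.
rewrite -lecR -cabsE rmorphD /= {1}[c]complexE.
apply: le_trans (ler_normD _ _) _; rewrite normrM.
have -> : `|'i%C : C| = 1 by rewrite normc_def /= expr0n expr1n add0r sqrtr1.
rewrite mul1r.
by rewrite !cabsE !cabsR.
Qed.

(** The equivalence of norms in finite dimension, from the expansion in the orthonormal basis and
    Cauchy-Schwarz. *)
Lemma tnorm_dominates : exists K : R, forall x, rnorm x ^+ 2 <= K * tnorm x.
Proof.
pose c i := Num.sqrt (tnorm (@tr_basis _ _ T i)) * 2 * rnorm (@tr_basis _ _ T i).
exists ((\sum_i c i) ^+ 2) => x.
have le1 y z : `|tdot y z| <= Num.sqrt (tnorm y) * Num.sqrt (tnorm z).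
  rewrite -[leLHS]sqrtr_sqr -sqrtrM ?tnorm_ge0 // ler_sqrt ?tdot_cauchy //.
  by rewrite mulr_ge0 ?tnorm_ge0.
have h : rnorm x <= (\sum_i c i) * Num.sqrt (tnorm x).
  rewrite {1}[x](tr_basisE T); apply: le_trans (rnorm_sum _ _ _) _.
  rewrite mulr_suml; apply: ler_sum => i _; rewrite rnormZ /c.
  rewrite -mulrA (mulrC (rnorm _)) mulrA ler_wpM2r ?rnorm_ge0 //.
  apply: le_trans (cabs_le_ReIm _) _.
  have e1 : `|complex.Re (tau ((@tr_basis _ _ T i)^† ** x))| <=
      Num.sqrt (tnorm (@tr_basis _ _ T i)) * Num.sqrt (tnorm x).
    by have := le1 x (@tr_basis _ _ T i); rewrite mulrC.
  have e2 : `|complex.Im (tau ((@tr_basis _ _ T i)^† ** x))| <=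
      Num.sqrt (tnorm (@tr_basis _ _ T i)) * Num.sqrt (tnorm x).
    have := le1 ('i *: x) (@tr_basis _ _ T i); rewrite tnorm_i mulrC.
    rewrite /tdot cmulZr tr_formZ; case: (tau _) => u v /=.
    by rewrite mul0r mul1r sub0r normrN.
  by apply: le_trans (lerD e1 e2) _; apply: eq_ler; ring.
have := ler_pM (rnorm_ge0 x) (rnorm_ge0 x) h h.
by rewrite -expr2 => /le_trans; apply; rewrite mulrACA -!expr2 sqr_sqrtr ?tnorm_ge0.
Qed.

Lemma tr_unit : exists o : F, is_unit o.
Proof.
pose e := @tr_basis _ _ T; pose k := \sum_i (e i)^† ** e i.
have kl x : k ** x = x.
  rewrite [RHS](tr_frameE T) /k cmul_suml; apply: eq_bigr => i _.
  rewrite -cmulA' [X in _ ** X = _](tr_basisE T) cmul_sumr; apply: eq_bigr => j _.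
  by rewrite cmulZr tr_formC.
have kr x : x ** k^† = x by rewrite -[x in LHS]cadjK -cadjM kl cadjK.
have kk : k = k^† by rewrite -[LHS]kr kl.
by exists k => x; split; rewrite ?kl // kk kr.
Qed.

Lemma pfun_trace (z : F) : positive_functional (fun x => tau (z^† ** x ** z)).
Proof.
split=> [x y|c x|x|].
- by rewrite !cexpand tr_formD.
- by rewrite !cexpand tr_formZ.
- by have := tr_form_ge0 T (x ** z); rewrite cadjM !cmulA'.
- exists (`|tr_bound T| * (rnorm z * rnorm z)) => x.
  apply: le_trans (tr_form_le T _) _.
  apply: le_trans (ler_wpM2r (rnorm_ge0 _) (ler_norm _)) _.
  have k : rnorm (z^† ** x ** z) <= rnorm z * rnorm x * rnorm z.
    by repeat apply: le_rnormM => //; rewrite rnorm_adj.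
  by apply: le_trans (ler_wpM2l (normr_ge0 _) k) _; apply: eq_ler; ring.
Qed.

(** If all the values stayed below r < ||k||, polarization would bound k by r on the Hilbert space
    of the trace. Then k^m would be of order r^m in the trace norm, hence in norm, although ||k^m||
    = ||k||^m for m a power of 2. *)
Lemma trace_numerical_radius k e : k^† = k -> 0 < e ->
  exists z, tnorm z <= 1 /\ rnorm k - e <= `|tdot (k ** z) z|.
Proof.
move=> sk e0; set r := rnorm k - e.
have [r0|r0] := leP r 0.
  by exists 0; rewrite /tnorm /tdot !cmulx0 tau0 normr0.
apply: contrapT => /forallNP h.
have num z : `|tdot (k ** z) z| <= r * tnorm z.
  have [z0|z0] := eqVneq (tnorm z) 0.
    by rewrite (tnorm_eq0 z0) /tnorm /tdot !cmulx0 tau0 normr0 mulr0.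
  have zp : 0 < tnorm z by rewrite lt_neqAle eq_sym z0 tnorm_ge0.
  pose s := (Num.sqrt (tnorm z))^-1.
  have ss : s * s * tnorm z = 1.
    by rewrite /s -invfM -expr2 sqr_sqrtr ?mulVf // ltW.
  have := h (s%:C *: z); rewrite /tnorm cmulZr !(tdotZl, tdotZr) !mulrA.
  rewrite -/(tnorm z) ss => /not_andP[//|/negP]; rewrite -ltNge => /ltW.
  have ss0 : 0 < s * s by rewrite -(pmulr_lgt0 _ zp) ss.
  rewrite normrM (ger0_norm (ltW ss0)) -(ler_pM2l zp).
  rewrite mulrA (mulrC _ (s * s)) ss mul1r; move/le_trans; apply.
  by rewrite mulrC.
have sym x y : tdot (k ** x) y = tdot (k ** y) x.
  by rewrite -[RHS]tdotC /tdot cadjM sk cmulA'.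
have opn z : tnorm (k ** z) <= r ^+ 2 * tnorm z.
  (* Scaling y by t = 1/r before polarizing gives the bound r itself instead of a multiple of it. *)
  set y := k ** z; pose t := r^-1.
  have tr : t * r = 1 by rewrite mulVf // gt_eqF.
  have pol : 4 * (t * tnorm y) =
     tdot (k ** (z + t%:C *: y)) (z + t%:C *: y) -
     tdot (k ** (z - t%:C *: y)) (z - t%:C *: y).
    rewrite -!scaleNr -!rmorphN /= !cmulDr !cmulZr.
    rewrite !(tdotDl, tdotDr, tdotZl, tdotZr) -/y (sym y z) -/y /tnorm.
    by ring.
  have n1 := num (z + t%:C *: y); have n2 := num (z - t%:C *: y).
  have par : tnorm (z + t%:C *: y) + tnorm (z - t%:C *: y) =
      2 * (tnorm z + t ^+ 2 * tnorm y).
    rewrite -scaleNr -rmorphN /= /tnorm !(tdotDl, tdotDr, tdotZl, tdotZr).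
    by rewrite (tdotC y z); ring.
  have : 4 * (t * tnorm y) <= r * (2 * (tnorm z + t ^+ 2 * tnorm y)).
    rewrite pol -par mulrDr; apply: le_trans (ler_norm _) _.
    by apply: le_trans (ler_normB _ _) _; exact: lerD.
  have -> : r * (2 * (tnorm z + t ^+ 2 * tnorm y)) =
     2 * (r * tnorm z) + 2 * ((t * r) * (t * tnorm y)) by ring.
  rewrite tr mul1r => h'.
  have : t * tnorm y <= r * tnorm z by lra.
  rewrite -(ler_pM2l r0) mulrA (mulrC r) tr mul1r => /le_trans; apply.
  by rewrite mulrA expr2.
have pown m : tnorm (cpow k m) <= (r ^+ 2) ^+ m * tnorm k.
  elim: m => [|m IH]; first by rewrite expr0 mul1r.
  rewrite cpowS; apply: le_trans (opn _) _.
  by rewrite (exprS (r ^+ 2) m) -mulrA ler_wpM2l // exprn_ge0 // ltW.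
have [K hK] := tnorm_dominates.
have K0 : 0 <= K * tnorm k by apply: le_trans (hK k); rewrite exprn_ge0 // rnorm_ge0.
have rk : r < rnorm k by rewrite /r ltrBlDr ltrDl.
have k0 : 0 < rnorm k by exact: lt_trans rk.
have s0 : 0 <= (r / rnorm k) ^+ 2 by rewrite exprn_ge0 // divr_ge0 // ltW.
have s1 : (r / rnorm k) ^+ 2 < 1.
  by rewrite expr_lt1 // ?divr_ge0 ?ltr_pdivrMr ?mul1r // ltW.
have [N hN] := expr_small (`|K| * tnorm k / r ^+ 2) s0 s1 ltr01.
have lt2 : (N <= 2 ^ N)%N by apply/ltnW/ltn_expl.
have := hN _ lt2; apply/negP; rewrite -leNgt.
have := hK (cpow k (2 ^ N).-1); rewrite cpow_norm // -exprM mulnC exprM => h1.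
rewrite expr_div_n expr_div_n mulrA ler_pdivlMr ?exprn_gt0 // mul1r.
apply: le_trans h1 _; apply: le_trans (ler_wpM2r (tnorm_ge0 _) (ler_norm K)) _.
apply: le_trans (ler_wpM2l (normr_ge0 K) (pown _)) _.
have -> : (r ^+ 2) ^+ (2 ^ N) = r ^+ 2 * (r ^+ 2) ^+ (2 ^ N).-1.
  by rewrite -exprS prednK // expn_gt0.
by apply: eq_ler; field; rewrite gt_eqF.
Qed.

End TraceForm.

(** * Norms in a nuclear algebra through positive functionals *)

Section Nuclear.
Context {R : realType} {A : cstarType R}.
Variables (one : A) (oneP : is_unit one) (nA : nuclear A).
Local Notation C := R[i].
Implicit Types (x y z a b h : A).
Let one1 := unitl oneP.
Let onex := unitr oneP.
Let ones := unit_adj oneP.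

Lemma cpc_square (B : cstarType R) (phi : {linear A -> B}) x :
  cpc phi -> exists y : B, phi (x^† ** x) = y^† ** y.
Proof.
move=> [/(_ 1%N) pos _]; have := pos (const_mx (x^† ** x)).
case=> [|Y /matrixP /(_ 0 0)].
  exists (const_mx x); apply/matrixP => i j; rewrite !mxE big_ord1 /mxadj.
  by rewrite !mxE.
by rewrite !mxE big_ord1 !mxE => ->; exists (Y 0 0).
Qed.

Lemma cpc_adj (B : cstarType R) (phi : {linear A -> B}) h :
  cpc phi -> h^† = h -> (phi h)^† = phi h.
Proof.
move=> cp sh; have [y1 e1] := cpc_square (h + one) cp.
have [y2 e2] := cpc_square h cp; have [y3 e3] := cpc_square one cp.
have -> : h = 2^-1%:C *: ((h + one)^† ** (h + one) - h^† ** h - one^† ** one).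
  rewrite cadjD sh ones !cexpand !(one1, onex).
  have dbl : 2^-1%:C *: (h + h) = h.
    by rewrite scalerDr -scalerDl -rmorphD /= -[2^-1]mul1r -splitr rmorph1 scale1r.
  by rewrite -[LHS]dbl; congr (_ *: _); lmod_with (R[i]) ltac:(ring).
by rewrite linearZ !linearB /= e1 e2 e3 cadjZR !cadjB !cadjM !cadjK.
Qed.

(** The map phi to the finite-dimensional algebra loses almost no norm at h, so a vector functional
    there that nearly attains the norm of phi h pulls back to A. This takes the place of a
    Hahn-Banach extension. *)
Lemma nuclear_norm h e : h^† = h -> 0 < e ->
  exists f, [/\ positive_functional f, complex.Re (f one) <= 1 &
    rnorm h - e <= `|complex.Re (f h)|].
Proof.
move=> sh e0; have e2 : 0 < e / 2 by rewrite divr_gt0.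
have [F [phi [psi [fdF cphi cpsi hpsi]]]] := nA (fun _ : 'I_1 => h) e2.
have kh : rnorm h - e / 2 <= rnorm (phi h).
  have le : rnorm (psi (phi h)) <= rnorm (phi h).
    by have := cpsi.2 (phi h); rewrite !rnormE lecR.
  rewrite lerBlDr; apply: le_trans (lerD le (ltW (hpsi ord0))).
  by rewrite -{1}[h](subKr (psi (phi h))) rnormB.
have T := findim_trace_frame fdF.
have [z [z1 hz]] := trace_numerical_radius T (cpc_adj cphi sh) e2.
exists (fun x => tr_form T (z^† ** phi x ** z)); split.
- have fP := pfun_trace T z; split=> [x y|c x|x|].
  + by rewrite linearD (pfunD fP).
  + by rewrite linearZ (pfunZ fP).
  + by have [y ->] := cpc_square x cphi; exact: (pfun_ge0 fP).
  + have [K hK] := pfun_bounded fP; exists `|K| => x; apply: le_trans (hK _) _.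
    apply: le_trans (ler_wpM2r (rnorm_ge0 _) (ler_norm K)) _.
    by rewrite ler_wpM2l //; have := cphi.2 x; rewrite !rnormE lecR.
- have sp : (phi one)^† = phi one by exact: cpc_adj.
  have p1 : rnorm (phi one) <= 1.
    apply: le_trans (unit_norm_le oneP).
    by have := cphi.2 one; rewrite !rnormE lecR.
  have [u uP] := tr_unit T; apply: le_trans (ler_norm _) _.
  apply: le_trans (pfun_norm uP (pfun_trace T z) sp) _.
  have g0 := fr_one_ge0 uP (pfun_trace T z); apply: le_trans (ler_piMr g0 p1) _.
  by rewrite (unitr uP).
- apply: le_trans (_ : _ <= rnorm (phi h) - e / 2) _; first by clear -kh; lra.
  by apply: le_trans hz _; rewrite /tdot cmulA'.
Qed.

End Nuclear.

(** * Excision and doubling *)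

Section Excision.
Context {R : realType} {A : cstarType R}.
Local Notation C := R[i].
Implicit Types (x y z a b h r s w : A).
Variables (one : A) (oneP : is_unit one) (one0 : one != 0) (nA : nuclear A).
Let one1 := unitl oneP.
Let onex := unitr oneP.
Let ones := unit_adj oneP.

(** On [0, 1] the function t^n (1 - t) is at most 1/(n+1). [pfun_moment] proves this for the values
    of positive functionals, and these determine the norm. *)
Lemma nuclear_moment b n : rnorm b <= 1 ->
  rnorm (upow one (b^† ** b) n ** (one - b^† ** b)) <= n.+1%:R^-1.
Proof.
move=> b1; set a := b^† ** b; have sa : a^† = a by rewrite cadjM cadjK.
set x := _ ** _; have sx : x^† = x.
  by rewrite /x cadjM cadjB ones sa upow_adj // cmulBl cmulBr one1 onex upowSr.
apply/ler_addgt0Pr => e e0; have [f [fP f1 xf]] := nuclear_norm oneP nA sx e0.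
rewrite -lerBlDr; apply: le_trans xf _.
have /andP[h0 h1] := pfun_moment oneP n fP f1 b1 (erefl a).
by rewrite ger0_norm.
Qed.

Lemma iso_conj r w : r^† ** r = one -> rnorm (r^† ** w ** r) <= rnorm w.
Proof.
move=> /(isometry_norm oneP) r1; rewrite -[leRHS]mulr1 -[rnorm w]mul1r.
by repeat apply: le_rnormM => //; rewrite rnorm_adj.
Qed.

Lemma isoM r s : r^† ** r = one -> s^† ** s = one -> (r ** s)^† ** (r ** s) = one.
Proof. by move=> hr hs; rewrite cadjM -cmulA' (cmulA' r^†) hr one1. Qed.

Lemma iso_scalar r (c : C) : r^† ** r = one -> r^† ** (c *: one) ** r = c *: one.
Proof. by move=> hr; rewrite cmulZr cmulZl onex hr. Qed.

Lemma iso_conj_scalar r w (c : C) : r^† ** r = one ->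
  rnorm (r^† ** w ** r - c *: one) <= rnorm (w - c *: one).
Proof.
by move=> hr; rewrite -{1}(iso_scalar c hr) -cmulBl -cmulBr; exact: iso_conj.
Qed.

Lemma rnorm_scalar (c : C) : rnorm (c *: one) = cabs c.
Proof. by rewrite rnormZ (unit_norm oneP) // mulr1. Qed.

Hypothesis peak0 : forall b, rnorm b = 1 ->
  exists2 s, rnorm s <= 1 & rnorm (s^† ** (b^† ** b) ** s - one) <= 8^-1.

(** Improves the tolerance 1/8 to any e. Let c = a^k with k large and choose s for c: then s^*
    a^(2k) s is within 1/8 of 1, and its inverse square root y makes r = c s y an isometry. Now r^*
    (1 - a) r = y s^* a^(2k) (1 - a) s y is small by [nuclear_moment]. *)
Lemma peak1 b e : rnorm b = 1 -> 0 < e -> exists2 r, r^† ** r = one &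
  rnorm (r^† ** (b^† ** b) ** r - one) < e.
Proof.
move=> b1 e0; set a := b^† ** b.
have sa : a^† = a by rewrite cadjM cadjK.
have [N hN] : exists N : nat, 2 / e < N%:R.
  by exists (Num.bound (2 / e)); apply: archi_boundP; rewrite divr_ge0 // ltW.
(* A power of 2, for which the C*-identity gives a^k norm exactly 1; it exceeds 2 / e. *)
pose k := (2 ^ N)%N; have Nk : (N <= k)%N by apply/ltnW/ltn_expl.
set c := upow one a k; have sc : c^† = c by exact: upow_adj.
have c1 : rnorm c = 1.
  by rewrite /c /k upow_norm // /a rnorm_cstar b1 !expr1n.
have cc : c ** c = upow one a (k + k) by rewrite /c upowD.
have [s s1 hs] := peak0 c1; rewrite sc cc in hs.
set z := _ ** _ in hs; have sz : z^† = z.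
  by rewrite /z !cadjM cadjK upow_adj // !cmulA'.
have [y [y4 sy zyy yc _]] : exists y, is_isqrt one z y.
  by apply: isqrt_exists => //; rewrite rdistC.
have yz : z ** y = y ** z by exact: yc.
have y2 : rnorm y <= 5 / 4.
  rewrite -(subrK one y); apply: le_trans (rnormD _ _) _.
  by have := unit_norm_le oneP; lra.
have rr : (c ** s ** y)^† ** (c ** s ** y) = one.
  rewrite !cadjM sy sc -!cmulA' (cmulA' c c) cc (cmulA' (upow _ _ _)).
  by rewrite (cmulA' s^†) (cmulA' s^†) -/z cmulA' -yz.
exists (c ** s ** y) => //; rewrite -[X in _ - X]rr.
set r := c ** s ** y.
have -> : r^† ** a ** r - r^† ** r = - (r^† ** (one - a) ** r).
  by rewrite !cexpand onex; lmod_with (R[i]) ltac:(ring).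
rewrite rnormN.
have -> : r^† ** (one - a) ** r =
    y ** (s^† ** (upow one a (k + k) ** (one - a)) ** s) ** y.
  rewrite /r !cadjM sy sc -cc.
  have ca : c ** (one - a) = (one - a) ** c.
    by rewrite cmulBl cmulBr one1 onex /c upowSr.
  by rewrite -[c ** c ** _]cmulA' ca !cmulA'.
have h1 : rnorm (upow one a (k + k) ** (one - a)) <= (k + k).+1%:R^-1.
  by apply: nuclear_moment; rewrite b1.
have h2 : rnorm (s^† ** (upow one a (k + k) ** (one - a)) ** s) <=
    1 * (k + k).+1%:R^-1 * 1.
  by repeat apply: le_rnormM => //; rewrite rnorm_adj.
apply: le_lt_trans (le_rnormM (le_rnormM y2 h2) y2) _.
have kN : N%:R <= k%:R :> R by rewrite ler_nat.
have k1 : 0 < (k + k).+1%:R :> R by rewrite ltr0Sn.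
rewrite ltr_pdivrMr // in hN.
rewrite mul1r mulr1 mulrAC ltr_pdivrMr //.
have kE : (k + k).+1%:R = 2 * k%:R + 1 :> R by rewrite -addn1 !natrD; ring.
rewrite kE; have : N%:R * e <= k%:R * e by rewrite ler_pM2r.
by rewrite mulrC in hN; nra.
Qed.

Lemma peak b e : 0 < e -> exists2 r, r^† ** r = one &
  rnorm (r^† ** (b^† ** b) ** r - (rnorm b ^+ 2)%:C *: one) < e.
Proof.
move=> e0; have [->|b0] := eqVneq b 0.
  exists one; first by rewrite ones one1.
  by rewrite !(cmulx0, cmul0x) rnorm0 expr0n scale0r subrr rnorm0.
have bp := rnorm_gt0 b0; set B := rnorm b in bp *.
have c1 : rnorm (B^-1%:C *: b) = 1.
  by rewrite rnormZR ger0_norm ?invr_ge0 ?ltW // mulVf // gt_eqF.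
have [r rr hr] := peak1 c1 (divr_gt0 e0 (exprn_gt0 2 bp)); exists r => //.
rewrite ltr_pdivlMr ?exprn_gt0 // in hr; apply: (le_lt_trans _ hr).
have B2 : 0 <= B ^+ 2 by rewrite exprn_ge0 // ltW.
rewrite -[B ^+ 2 in leRHS](ger0_norm B2) mulrC -rnormZR.
apply: eq_ler; congr rnorm; rewrite scalerBr cadjZR !cexpand !scalerA -!rmorphM /=.
have -> : B ^+ 2 * (B^-1 / B) = 1 by field; rewrite gt_eqF.
by rewrite scale1r.
Qed.

(** [peak] is applied to 1 + n x with n small: the square of its norm is 1 + 2 n l up to order n^2,
    where l is the largest value that x takes on states, and the isometry compresses x nearly to
    l. *)
Lemma support x e : x^† = x -> 0 < e -> exists r l, [/\ r^† ** r = one,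
  rnorm (r^† ** x ** r - l%:C *: one) < e &
  forall f, positive_functional f -> complex.Re (f one) = 1 ->
    complex.Re (f x) <= l].
Proof.
move=> sx e0; set X := rnorm x; have X0 : 0 <= X by exact: rnorm_ge0.
pose n := e / (1 + X ^+ 2); have d0 : 0 < 1 + X ^+ 2 by rewrite ltr_pwDl // exprn_ge0.
have n0 : 0 < n by rewrite divr_gt0.
have n2 : 0 < 2 * n by rewrite mulr_gt0.
pose b := one + n%:C *: x.
have bb : b^† ** b = one + (2 * n)%:C *: x + (n ^+ 2)%:C *: (x ** x).
  rewrite /b cadjD cadjZR sx ones !cexpand !(one1, onex) mulr2n; lmod_with (R[i]) ltac:(ring).
have sbb : (b^† ** b)^† = b^† ** b by rewrite cadjM cadjK.
have [r rr hr] := peak b (mulr_gt0 n0 e0).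
exists r, ((rnorm b ^+ 2 - 1) / (2 * n)); split=> //.
  rewrite -(ltr_pM2l n2); have {1}-> : 2 * n = `|2 * n| by rewrite gtr0_norm.
  rewrite -rnormZR.
  have -> : (2 * n)%:C *: (r^† ** x ** r - ((rnorm b ^+ 2 - 1) / (2 * n))%:C *: one) =
     (r^† ** (b^† ** b) ** r - (rnorm b ^+ 2)%:C *: one) -
     (n ^+ 2)%:C *: (r^† ** (x ** x) ** r).
    rewrite bb scalerBr scalerA -rmorphM /= [2 * n * _]mulrC divfK ?gt_eqF //.
    rewrite !cmulDr !cmulDl onex rr !cmulZr !cmulZl rmorphB rmorph1 scalerBl scale1r.
    by lmod_with (R[i]) ltac:(ring).
  apply: le_lt_trans (rnormB _ _) _; rewrite rnormZR ger0_norm ?exprn_ge0 ?ltW //.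
  have h1 : rnorm (r^† ** (x ** x) ** r) <= X ^+ 2.
    by apply: le_trans (iso_conj _ rr) _; rewrite expr2 rnormM.
  have nX : n * X ^+ 2 <= e.
    by rewrite /n mulrAC ler_pdivrMr // ler_pM2l //; lra.
  have := ler_wpM2l (exprn_ge0 2 (ltW n0)) h1.
  by nra.
move=> f fP f1; rewrite ler_pdivlMr //.
have := pfun_norm oneP fP sbb; rewrite f1 mul1r rnorm_cstar.
rewrite [in `|_|]bb !(frD fP) !(frZ fP) f1.
have [_] := pfun_square fP x; rewrite sx => xx0.
have := ler_norm (1 + 2 * n * complex.Re (f x) + n ^+ 2 * complex.Re (f (x ** x))).
by have := mulr_ge0 (exprn_ge0 2 (ltW n0)) xx0; lra.
Qed.

(** The real and imaginary parts are treated one after the other. An element that is already near a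
    scalar stays as near to it under any further isometry. *)
Lemma scalars (Y : seq A) e : 0 < e -> exists2 r, r^† ** r = one &
  forall y, y \in Y -> exists c : C, rnorm (r^† ** y ** r - c *: one) < e.
Proof.
move=> e0; elim: Y => [|y Y [r rr hr]].
  by exists one => //; rewrite ones one1.
have [a [b [sa sb yE]]] := ReIm_decomp (r^† ** y ** r).
have e2 : 0 < e / 2 by rewrite divr_gt0.
have [p [l [pp hl _]]] := support sa e2.
have sb' : (p^† ** b ** p)^† = p^† ** b ** p by rewrite !cadjM cadjK sb cmulA'.
have [q [m [qq hm _]]] := support sb' e2.
have conjE w : (r ** p ** q)^† ** w ** (r ** p ** q) =
    q^† ** (p^† ** (r^† ** w ** r) ** p) ** q by rewrite !cadjM !cmulA'.
exists (r ** p ** q); first by rewrite isoM // isoM.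
move=> w; rewrite inE => /orP[/eqP ->|wY].
  exists (l%:C + 'i * m%:C).
  have -> : (r ** p ** q)^† ** y ** (r ** p ** q) - (l%:C + 'i * m%:C) *: one =
     (q^† ** (p^† ** a ** p) ** q - l%:C *: one) +
     'i *: (q^† ** (p^† ** b ** p) ** q - m%:C *: one).
    rewrite conjE yE !cmulDr !cmulDl !cmulDr !cmulDl !cmulZr !cmulZl !cmulZr !cmulZl.
    by lmod_with (R[i]) ltac:(ring).
  apply: le_lt_trans (rnormD _ _) _; rewrite rnormZ.
  have -> : cabs ('i : C) = 1.
    apply: complexI; rewrite -cabsE normc_def /= expr0n expr1n add0r sqrtr1.
    by [].
  rewrite mul1r; have := iso_conj_scalar (p^† ** a ** p) l%:C qq.
  by move=> h; have := le_lt_trans h hl; lra.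
have [c hc] := hr w wY; exists c; rewrite conjE; apply: le_lt_trans hc.
by apply: le_trans (iso_conj_scalar _ _ qq) _; exact: iso_conj_scalar.
Qed.

Lemma sa_Re_scalar w (c : C) : w^† = w ->
  rnorm (w - (complex.Re c)%:C *: one) <= rnorm (w - c *: one).
Proof.
move=> sw; set d := w - c *: one.
have -> : w - (complex.Re c)%:C *: one = 2^-1%:C *: (d + d^†).
  rewrite /d cadjB cadjZc ones sw -[LHS]scale1r.
  have -> : (1 : C) = (2^-1)%:C * 2 by rewrite -(rmorph_nat (real_complex R)) -rmorphM mulVf.
  rewrite -scalerA; congr (_ *: _); case: c {d} => u v /=.
  have -> : u +i* v = u%:C + v *i by apply/eqP; rewrite eq_complex /= addr0 add0r !eqxx.
  have -> : u -i* v = u%:C - v *i by apply/eqP; rewrite eq_complex /= subr0 add0r !eqxx.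
  by lmod_with (R[i]) ltac:(ring).
rewrite rnormZR ger0_norm ?invr_ge0 //; have := rnormD d d^†; rewrite rnorm_adj.
lra.
Qed.

Lemma scalar_le w (c e : R) : rnorm (w - c%:C *: one) < e -> `|c| <= rnorm w + e.
Proof.
move=> h; rewrite -(cabsR c) -rnorm_scalar.
have -> : c%:C *: one = w - (w - c%:C *: one) by lmod_with (R[i]) ltac:(ring).
by apply: le_trans (rnormB _ _) _; rewrite lerD2l ltW.
Qed.

Variables (t1 t2 : A).
Hypotheses (t1P : t1^† ** t1 = one) (t2P : t2^† ** t2 = one) (t12 : t1^† ** t2 = 0).

(** An isometry that makes every y nearly scalar is followed by t1 and by t2, and t1^* c t2 = 0 for
    a scalar c. *)
Lemma orthogonal_isometries (Y : seq A) e : 0 < e -> exists r1 r2,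
  [/\ r1^† ** r1 = one, r2^† ** r2 = one &
      forall y, y \in Y -> rnorm (r1^† ** y ** r2) < e].
Proof.
move=> e0; have [r rr hr] := scalars Y e0.
exists (r ** t1), (r ** t2); split; rewrite ?isoM // => y /hr[c hc].
have -> : (r ** t1)^† ** y ** (r ** t2) = t1^† ** (r^† ** y ** r - c *: one) ** t2.
  by rewrite cadjM !cexpand onex t12 scaler0 oppr0 addr0.
apply: le_lt_trans hc; rewrite -[leRHS]mulr1 -[rnorm (_ - _) in leRHS]mul1r.
repeat apply: le_rnormM => //; rewrite ?rnorm_adj; exact: isometry_norm oneP _ _.
Qed.

Section Excise.
Variables (f : A -> C) (fP : positive_functional f) (f1 : complex.Re (f one) = 1).
Variables (n : nat) (x : 'I_n -> A) (sx : forall i, (x i)^† = x i).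
Local Notation fr y := (complex.Re (f y)).

Lemma real_scalars I (Y : I -> A) (l : seq I) e : 0 < e ->
  (forall i, (Y i)^† = Y i) -> exists r (c : I -> R), r^† ** r = one /\
  forall i, List.In i l -> rnorm (r^† ** Y i ** r - (c i)%:C *: one) < e.
Proof.
move=> e0 sY; have [r rr hr] := scalars [seq Y i | i <- l] e0.
have /choice[c hc] : forall i, exists c : R, List.In i l ->
    rnorm (r^† ** Y i ** r - c%:C *: one) < e.
  move=> i; have [il|il] := pselect (List.In i l); last by exists 0.
  have [|c hc] := hr (Y i).
    elim: l il {hr} => //= j l IH [->|/IH h]; rewrite inE ?eqxx //.
    by rewrite h orbT.
  exists (complex.Re c) => _; apply: le_lt_trans hc; apply: sa_Re_scalar.
  by rewrite !cadjM cadjK sY cmulA'.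
by exists r, c.
Qed.

Lemma all_ord_In (i : 'I_n) : List.In i (enum 'I_n).
Proof.
have : i \in enum 'I_n by rewrite mem_enum.
by elim: (enum 'I_n) => //= j l IH; rewrite inE => /orP[/eqP ->|/IH]; [left|right].
Qed.

(** The error e of the compression can be made arbitrarily small; d measures how far the scalars
    obtained still are from the values of f. *)
Definition excised_within (d : R) := forall e, 0 < e ->
  exists s (c : 'I_n -> R),
    (forall i, rnorm (s^† ** x i ** s - (c i)%:C *: one) < e) /\
    \sum_i (c i - fr (x i)) ^+ 2 <= d.

Let bd i := 2 * rnorm (x i) + 1.
Let d0 := 1 + \sum_i bd i ^+ 2.

Lemma fr_le y : y^† = y -> `|fr y| <= rnorm y.
Proof. by move=> sy; have := pfun_norm oneP fP sy; rewrite f1 mul1r. Qed.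

Lemma bd_le i (c e : R) w : w^† ** w = one -> e <= 1 ->
  rnorm (w^† ** x i ** w - c%:C *: one) < e -> (c - fr (x i)) ^+ 2 <= bd i ^+ 2.
Proof.
move=> ww e1 h; have h1 := scalar_le h; have h2 := fr_le (sx i).
have h3 := iso_conj (x i) ww.
rewrite -[leLHS]real_normK ?num_real // ler_pXn2r ?nnegrE //.
  apply: le_trans (ler_normB _ _) _; rewrite /bd; lra.
by rewrite /bd; have := rnorm_ge0 (x i); lra.
Qed.

Lemma excised_start : excised_within d0.
Proof.
move=> e e0; pose e' := Num.min e 1.
have e'0 : 0 < e' by rewrite lt_min e0 ltr01.
have [r [c [rr hr]]] := real_scalars (enum 'I_n) e'0 sx.
have hr' i : rnorm (r^† ** x i ** r - (c i)%:C *: one) < e'.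
  by apply: hr; exact: all_ord_In.
exists r, c; split=> [i|]; first by apply: lt_le_trans (hr' i) _; rewrite ge_min lexx.
rewrite /d0; apply: le_trans (_ : _ <= \sum_i bd i ^+ 2) _; last by rewrite lerDr.
apply: ler_sum => i _; apply: bd_le rr _ (hr' i).
by rewrite ge_min lexx orbT.
Qed.

(* One Frank-Wolfe step: the current values [c] are averaged with values [c']
   that a support element in the direction [f - c] provides. *)
Lemma excised_step d e : 0 < d -> 0 < e -> excised_within d ->
  excised_within (d * d0 / (d + d0) + e).
Proof.
move=> dp ep hd e1 e10.
have d00 : 0 < d0 by rewrite /d0 ltr_pwDl // sumr_ge0 // => i _; rewrite sqr_ge0.
(* The minimizer of (1 - th)^2 d + th^2 d0, with minimum d d0 / (d + d0). *)
pose th := d / (d + d0); have ddp : 0 < d + d0 by rewrite addr_gt0.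
have th0 : 0 < th by rewrite divr_gt0.
have th1 : th < 1 by rewrite ltr_pdivrMr // mul1r ltrDl.
have e14 : 0 < e1 / 4 by rewrite divr_gt0.
have [s [c [hs hc]]] := hd _ e14.
pose u i := c i - fr (x i).
pose X := \sum_i (- u i)%:C *: x i.
have sX : X^† = X by rewrite cadj_sum; apply: eq_bigr => i _; rewrite cadjZR sx.
have e4 : 0 < e / 4 by rewrite divr_gt0.
have [q1 [l [qq1 hl suppl]]] := support sX e4.
pose U := 1 + \sum_i `|u i|.
have U1 : 1 <= U by rewrite lerDl sumr_ge0.
have Up : 0 < U by lra.
pose e3 := Num.min (Num.min 1 (e1 / 4)) (e / 4 / U).
have e3p : 0 < e3 by rewrite !lt_min ltr01 e14 divr_gt0.
have e31 : e3 <= 1 by rewrite !ge_min lexx.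
have e3e : e3 <= e1 / 4 by rewrite !ge_min lexx orbT.
have e3U : e3 * U <= e / 4.
  by rewrite -ler_pdivlMr // !ge_min lexx !orbT.
have sY i : (q1^† ** x i ** q1)^† = q1^† ** x i ** q1.
  by rewrite !cadjM cadjK sx cmulA'.
have [q2 [c' [qq2 hc']]] := real_scalars (enum 'I_n) e3p sY.
pose s' := q1 ** q2; have ss' : s'^† ** s' = one by exact: isoM.
have sE i : s'^† ** x i ** s' = q2^† ** (q1^† ** x i ** q1) ** q2.
  by rewrite /s' cadjM !cmulA'.
have hs' i : rnorm (s'^† ** x i ** s' - (c' i)%:C *: one) < e3.
  by rewrite sE; apply: hc'; exact: all_ord_In.
pose v i := c' i - fr (x i).
have vd : \sum_i v i ^+ 2 <= d0.
  rewrite /d0; apply: le_trans (_ : _ <= \sum_i bd i ^+ 2) _; last by rewrite lerDr.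
  by apply: ler_sum => i _; exact: bd_le ss' e31 (hs' i).
(* The support value l is at least f X, and X compresses to nearly l. So, up to e / 2, the new
   values c' lie on the side of f that faces away from c. *)
have uv : \sum_i u i * v i <= e / 2.
  have fX : fr X = \sum_i - u i * fr (x i).
    rewrite /X; elim/big_rec2: _ => [|i a b _ <-].
      by rewrite -(scale0r 0) (pfunZ fP) mul0r.
    by rewrite (frD fP) (frZ fP).
  have Xs : s'^† ** X ** s' = \sum_i (- u i)%:C *: (s'^† ** x i ** s').
    by rewrite /X cmul_sumr cmul_suml; apply: eq_bigr => i _; rewrite !cexpand.
  have h1 : rnorm (s'^† ** X ** s' - l%:C *: one) < e / 4.
    have -> : s'^† ** X ** s' = q2^† ** (q1^† ** X ** q1) ** q2.
      by rewrite /s' cadjM !cmulA'.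
    by apply: le_lt_trans hl; exact: iso_conj_scalar.
  have h2 : rnorm (s'^† ** X ** s' - (\sum_i - u i * c' i)%:C *: one) <= e / 4.
    rewrite Xs rmorph_sum scaler_suml -sumrB; apply: le_trans (rnorm_sum _ _ _) _.
    apply: le_trans e3U; rewrite /U mulrDr mulr1 mulr_sumr.
    apply: le_trans (_ : _ <= \sum_i e3 * `|u i|) _; last by rewrite lerDr ltW.
    apply: ler_sum => i _; rewrite rmorphM /= -scalerA -scalerBr rnormZR normrN.
    by rewrite mulrC ler_wpM2r // ltW.
  have h3 : `|l - \sum_i - u i * c' i| < e / 2.
    rewrite -cabsR -rnorm_scalar rmorphB scalerBl.
    apply: le_lt_trans (rdistD (s'^† ** X ** s') _ _) _.
    by rewrite rdistC [e / 2](_ : _ = e / 4 + e / 4); [exact: ltr_leD|field].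
  have := suppl f fP f1; rewrite fX => h4.
  have -> : \sum_i u i * v i =
      \sum_i - u i * fr (x i) - \sum_i - u i * c' i.
    by rewrite -sumrB; apply: eq_bigr => i _; rewrite /v; ring.
  by have := ler_norm (l - \sum_i - u i * c' i); lra.
(* Orthogonal isometries r1 and r2 nearly kill the cross terms, so that a s r1 + b s' r2 yields the
   convex combination of the two sets of values. *)
pose Y := [seq s^† ** x i ** s' | i <- enum 'I_n].
have [r1 [r2 [rr1 rr2 hr]]] := orthogonal_isometries Y e14.
have hr' i : rnorm (r1^† ** (s^† ** x i ** s') ** r2) < e1 / 4.
  by apply: hr; apply/mapP; exists i => //; rewrite mem_enum.
pose a := Num.sqrt (1 - th); pose b := Num.sqrt th.
have aa : a * a = 1 - th by rewrite -expr2 sqr_sqrtr // subr_ge0 ltW.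
have bb : b * b = th by rewrite -expr2 sqr_sqrtr // ltW.
have a0 : 0 <= a by exact: sqrtr_ge0.
have b0 : 0 <= b by exact: sqrtr_ge0.
have ab : a * b <= 1 by nra.
exists (a%:C *: (s ** r1) + b%:C *: (s' ** r2)), (fun i => (1 - th) * c i + th * c' i).
split=> [i|].
  pose p := r1^† ** (s^† ** x i ** s) ** r1 - (c i)%:C *: one.
  pose p' := r2^† ** (s'^† ** x i ** s') ** r2 - (c' i)%:C *: one.
  pose w := r1^† ** (s^† ** x i ** s') ** r2.
  have hp : rnorm p < e1 / 4 by apply: le_lt_trans (hs i); exact: iso_conj_scalar.
  have hp' : rnorm p' < e1 / 4.
    by apply: lt_le_trans e3e; apply: le_lt_trans (hs' i); exact: iso_conj_scalar.
  have hw : rnorm w < e1 / 4 by exact: hr'.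
  rewrite cadjD !cadjZR.
  rewrite [X in rnorm X](_ : _ = (1 - th)%:C *: p + th%:C *: p' +
      (a * b)%:C *: (w + w^†)); last first.
    rewrite -aa -bb /p /p' /w !cadjM !cadjK sx !cexpand !rmorphD !rmorphM /=.
    by lmod_with (R[i]) ltac:(ring).
  have abp : 0 <= a * b by rewrite mulr_ge0.
  have h1 : 0 <= 1 - th by lra.
  have hww := rnormD w w^†; rewrite rnorm_adj in hww.
  have w0 := rnorm_ge0 (w + w^†).
  apply: le_lt_trans (le_rnormD (rnormD _ _) (lexx _)) _.
  rewrite !rnormZR !ger0_norm // ?(ltW th0) //.
  by have := rnorm_ge0 p; have := rnorm_ge0 p'; nra.
have -> : \sum_i ((1 - th) * c i + th * c' i - fr (x i)) ^+ 2 =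
   (1 - th) ^+ 2 * \sum_i u i ^+ 2 + 2 * th * (1 - th) * \sum_i u i * v i +
   th ^+ 2 * \sum_i v i ^+ 2.
  rewrite !mulr_sumr -!big_split; apply: eq_bigr => i _; rewrite /u /v /=; ring.
have -> : d * d0 / (d + d0) = (1 - th) ^+ 2 * d + th ^+ 2 * d0.
  by rewrite /th; field; rewrite gt_eqF.
have g1 : (1 - th) ^+ 2 * \sum_i u i ^+ 2 <= (1 - th) ^+ 2 * d.
  by rewrite ler_wpM2l // sqr_ge0.
have g3 : th ^+ 2 * \sum_i v i ^+ 2 <= th ^+ 2 * d0.
  by rewrite ler_wpM2l // sqr_ge0.
have th' : 0 <= 2 * th * (1 - th) <= 1.
  by apply/andP; split; nra.
have [/andP[th'0 th'1]] := conj th' isT.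
have g2 : 2 * th * (1 - th) * \sum_i u i * v i <= e.
  apply: le_trans (ler_wpM2l th'0 uv) _; nra.
lra.
Qed.

(** The step adds 1 / d0 to 1 / d, taking 2 d0 / k to 2 d0 / (k + 2). Only 2 d0 / (k + 1) is
    claimed; the difference pays for the error e. *)
Lemma excised_within_harmonic m : excised_within (2 * d0 / m.+1%:R).
Proof.
have d00 : 0 < d0 by rewrite /d0 ltr_pwDl // sumr_ge0 // => i _; rewrite sqr_ge0.
elim: m => [|m IH].
  move=> e e0; have [s [c [hs hc]]] := excised_start e0; exists s, c; split=> //.
  by rewrite divr1; lra.
have m1 : 0 < m.+1%:R :> R by rewrite ltr0Sn.
have mE : m.+2%:R = m.+1%:R + 1 :> R by rewrite -addn1 natrD.
have dm : 0 < 2 * d0 / m.+1%:R by rewrite divr_gt0 // mulr_gt0.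
set k := m.+1%:R in m1 mE IH dm.
pose e := 2 * d0 / (k + 1) - 2 * d0 / (k + 2).
have k1 : 0 < k + 1 by lra.
have k2 : 0 < k + 2 by lra.
have ep : 0 < e.
  have -> : e = 2 * d0 / ((k + 1) * (k + 2)) by rewrite /e; field; rewrite !gt_eqF.
  by rewrite divr_gt0 ?mulr_gt0.
have := excised_step dm ep IH; rewrite mE.
have -> : 2 * d0 / k * d0 / (2 * d0 / k + d0) + e = 2 * d0 / (k + 1).
  by rewrite /e; field; rewrite !gt_eqF //= addr_gt0 ?mulr_gt0.
by [].
Qed.

Lemma excise e : 0 < e -> exists s,
  forall i, rnorm (s^† ** x i ** s - (fr (x i))%:C *: one) < e.
Proof.
move=> e0; have e2 : 0 < e / 2 by rewrite divr_gt0.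
have d00 : 0 < d0 by rewrite /d0 ltr_pwDl // sumr_ge0 // => i _; rewrite sqr_ge0.
pose M := Num.bound (2 * d0 / (e / 2) ^+ 2).
have hM : 2 * d0 / (e / 2) ^+ 2 < M%:R.
  by apply: archi_boundP; rewrite divr_ge0 ?exprn_ge0 ?mulr_ge0 // ltW.
have [s [c [hs hc]]] := excised_within_harmonic M e2; exists s => i.
apply: le_lt_trans (rdistD ((c i)%:C *: one) _ _) _.
rewrite [e]splitr ltr_leD //.
rewrite -scalerBl -rmorphB rnorm_scalar cabsR.
rewrite -(@ler_pXn2r _ 2) ?nnegrE ?normr_ge0 ?(ltW e2) // real_normK ?num_real //.
apply: le_trans (_ : _ <= 2 * d0 / M.+1%:R) _; last first.
  rewrite ltr_pdivrMr ?exprn_gt0 // in hM; rewrite ler_pdivrMr ?ltr0Sn //.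
  by apply: le_trans (ltW hM) _; rewrite mulrC ler_wpM2l ?sqr_ge0 // ler_nat.
apply: le_trans hc; rewrite (bigD1 i) //= lerDl.
by apply: sumr_ge0 => j _; rewrite sqr_ge0.
Qed.

End Excise.

End Excision.

Lemma cpc_gram {R : realType} {A B : cstarType R} (phi : {linear A -> B}) d (w : 'I_d -> A) :
  cpc phi -> exists y : 'I_d -> 'I_d -> B, forall i j,
    phi ((w i)^† ** w j) = \sum_l (y l i)^† ** y l j.
Proof.
move=> [cp _]; have [|Y /matrixP YE] := cp d (\matrix_(i, j) ((w i)^† ** w j)).
  case: d w => [|d] w; first by exists 0; apply/matrixP => -[].
  (* The row w padded by zero rows, so that the Gram matrix comes from a square matrix. *)
  exists (\matrix_(l, j) if l == ord0 then w j else 0); apply/matrixP => i j.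
  rewrite !mxE big_ord_recl big1 ?addr0 => [|l _]; first by rewrite !mxE eqxx.
  by rewrite !mxE /= cmulx0.
by exists Y => i j; have := YE i j; rewrite !mxE => ->; apply: eq_bigr => l _; rewrite mxE.
Qed.

(** * Kirchberg's doubling argument *)

Section Doubling.
Context {R : realType} {A : cstarType R}.
Local Notation C := R[i].
Implicit Types (x y z a b h r s w : A).
Variables (one : A) (oneP : is_unit one) (one0 : one != 0) (nA : nuclear A).
Let one1 := unitl oneP.
Let onex := unitr oneP.
Let ones := unit_adj oneP.
Hypothesis peak0 : forall b, rnorm b = 1 ->
  exists2 s, rnorm s <= 1 & rnorm (s^† ** (b^† ** b) ** s - one) <= 8^-1.
Variables (t1 t2 : A).
Hypotheses (t1P : t1^† ** t1 = one) (t2P : t2^† ** t2 = one) (t12 : t1^† ** t2 = 0).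

Lemma cabs_i : cabs ('i : C) = 1.
Proof. by apply: complexI; rewrite -cabsE normc_def /= expr0n expr1n add0r sqrtr1. Qed.

(** The self-adjoint parts are excised together for the state f / f 1, and the result is rescaled by
    the square root of f 1. *)
Lemma excise_fin (f : A -> C) (I : finType) (y : I -> A) e :
  positive_functional f -> 0 < e -> exists s,
  forall i, rnorm (s^† ** y i ** s - f (y i) *: one) < e.
Proof.
move=> fP e0; have f0 x : x^† = x -> f x = (complex.Re (f x))%:C by move=> sx; exact: (pfun_real oneP fP sx).
set m := complex.Re (f one); have m0 : 0 <= m by exact: (fr_one_ge0 oneP fP).
have [mz|mn] := eqVneq m 0.
  exists 0 => i; have [a [b [sa sb ->]]] := ReIm_decomp (y i).
  have z w : w^† = w -> f w = 0.
    move=> sw; have := pfun_norm oneP fP sw; rewrite -/m mz mul0r.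
    by rewrite normr_le0 => /eqP h; rewrite f0 // h.
  by rewrite cmulx0 (pfunD fP) (pfunZ fP) !z // mulr0 addr0 scale0r subrr rnorm0.
have mp : 0 < m by rewrite lt_neqAle eq_sym mn.
pose g x := m^-1%:C * f x; have gP : positive_functional g.
  split=> [u v|c u|u|].
  - by rewrite /g (pfunD fP) mulrDr.
  - by rewrite /g (pfunZ fP) mulrCA.
  - by rewrite mulr_ge0 ?(pfun_ge0 fP) // lecR invr_ge0 ltW.
  - have [K hK] := pfun_bounded fP; exists (m^-1 * K) => u.
    have -> : cabs (g u) = m^-1 * cabs (f u).
      apply: complexI; rewrite -cabsE normrM rmorphM /= -!cabsE; congr (_ * _).
      by rewrite ger0_norm // lecR invr_ge0 ltW.
    by rewrite -mulrA ler_wpM2l // invr_ge0 ltW.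
have gf u : complex.Re (g u) = m^-1 * complex.Re (f u).
  by rewrite /g; case: (f u) => p q /=; rewrite mul0r subr0.
have g1 : complex.Re (g one) = 1 by rewrite gf mulVf.
have /choice[a0 /choice[b0 ab]] : forall i, exists a b,
    [/\ a^† = a, b^† = b & y i = a + 'i *: b] by move=> i; exact: ReIm_decomp.
pose N := #|{: I + I}|.
pose x (k : 'I_N) := match enum_val k with inl i => a0 i | inr i => b0 i end.
have sx k : (x k)^† = x k by rewrite /x; case: (enum_val k) => i; case: (ab i).
have d0 : 0 < e / (2 * m) by rewrite divr_gt0 // mulr_gt0.
have [s hs] := excise oneP one0 nA peak0 t1P t2P t12 gP g1 sx d0.
exists ((Num.sqrt m)%:C *: s) => i; have [sa sb yE] := ab i.
have mm : Num.sqrt m * Num.sqrt m = m by rewrite -expr2 sqr_sqrtr.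
have step w : w^† = w -> rnorm (s^† ** w ** s - (complex.Re (g w))%:C *: one) < e / (2 * m) ->
    rnorm (m%:C *: (s^† ** w ** s) - f w *: one) < e / 2.
  move=> sw hw; rewrite f0 //.
  have -> : complex.Re (f w) = m * complex.Re (g w) by rewrite gf mulVKf.
  rewrite rmorphM /= -scalerA -scalerBr rnormZR ger0_norm //.
  by move: hw; rewrite ltr_pdivlMr ?mulr_gt0 //; lra.
have ha : rnorm (m%:C *: (s^† ** a0 i ** s) - f (a0 i) *: one) < e / 2.
  apply: step => //; have := hs (enum_rank (inl i)); rewrite /x enum_rankK //.
have hb : rnorm (m%:C *: (s^† ** b0 i ** s) - f (b0 i) *: one) < e / 2.
  apply: step => //; have := hs (enum_rank (inr i)); rewrite /x enum_rankK //.
rewrite yE (pfunD fP) (pfunZ fP).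
rewrite [X in rnorm X](_ : _ = (m%:C *: (s^† ** a0 i ** s) - f (a0 i) *: one) +
   'i *: (m%:C *: (s^† ** b0 i ** s) - f (b0 i) *: one)); last first.
  rewrite cadjZR !cexpand; set r := (Num.sqrt m)%:C.
  have -> : m%:C = r * r by rewrite /r -rmorphM /= mm.
  by lmod_with (R[i]) ltac:(ring).
apply: le_lt_trans (rnormD _ _) _; rewrite rnormZ cabs_i mul1r; lra.
Qed.

Definition tpow k : A := iter k (fun y => t2 ** y) t1.

Lemma tpow_orth k l : (tpow k)^† ** tpow l = if k == l then one else 0.
Proof.
have t21 : t2^† ** t1 = 0 by rewrite -[LHS]cadjK cadjM cadjK t12 cadj0.
elim: k l => [|k IH] [|l] //=.
- by rewrite cmulA' t12 cmul0x.
- by rewrite cadjM -cmulA' t21 cmulx0.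
- by rewrite cadjM -cmulA' (cmulA' t2^†) t2P one1 IH eqSS.
Qed.

(** Let t_i be [tpow i]. In the finite-dimensional algebra phi x is the sum of the c_ij(x) g_i^*
    g_j, and psi takes g_i^* g_j to the sum of the b_li^* b_lj. With V the sum of the t_i^* s q_l
    b_li, the terms of V^* x V are b_li^* q_l^* (s^* t_i x t_j^* s) q_l' b_l'j. Excision turns the
    bracket into c_ij(x), and orthogonality of the q_l leaves psi (phi x). *)
Lemma nuclear_doubling n (x : 'I_n -> A) e : 0 < e -> exists V W, forall i,
  [/\ rnorm (V^† ** x i ** V - x i) < e, rnorm (W^† ** x i ** W - x i) < e &
      rnorm (V^† ** x i ** W) < e].
Proof.
move=> e0; have e2 : 0 < e / 2 by rewrite divr_gt0.
have [F [phi [psi [fdF cphi cpsi happ]]]] := nA x e2.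
have T := findim_trace_frame fdF; pose tau := tr_form T; pose d := tr_dim T.
pose g : 'I_d -> F := @tr_basis _ _ T.
pose c (i j : 'I_d) z : C := tau (g i ** phi z ** (g j)^†).
have cD i j : {morph c i j : u v / u + v}.
  by move=> u v; rewrite /c linearD !cexpand /tau tr_formD.
have cZ i j k u : c i j (k *: u) = k * c i j u.
  by rewrite /c linearZ !cexpand /tau tr_formZ.
have c0 i j : c i j 0 = 0 by rewrite -(scale0r 0) cZ mul0r.
(* One functional encodes all the coefficients: at t_i x t_j^* its value is c_ij(x). *)
pose f z := \sum_i \sum_j c i j ((tpow i)^† ** z ** tpow j).
have fP : positive_functional f.
  split=> [u v|k u|w|].
  - rewrite /f -big_split; apply: eq_bigr => i _; rewrite -big_split.
    by apply: eq_bigr => j _; rewrite !cexpand cD.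
  - rewrite /f mulr_sumr; apply: eq_bigr => i _; rewrite mulr_sumr.
    by apply: eq_bigr => j _; rewrite !cexpand cZ.
  - have [Y YE] := cpc_gram (fun i : 'I_d => w ** tpow i) cphi.
    have -> : f (w^† ** w) = \sum_l tau
        ((\sum_j Y l j ** (g j)^†)^† ** (\sum_j Y l j ** (g j)^†)).
      rewrite /f /c.
      under [LHS]eq_bigr => i _ do under eq_bigr => j _ do
        rewrite (_ : _ ** tpow j = (w ** tpow i)^† ** (w ** tpow j)) ?YE ?cadjM ?cmulA' //.
      under [LHS]eq_bigr => i _ do under eq_bigr => j _ do
        rewrite cmul_sumr cmul_suml /tau tau_sum.
      under [RHS]eq_bigr => l _ do rewrite cadj_sum cmul_suml /tau tau_sum.
      rewrite [RHS]exchange_big; apply: eq_bigr => i _.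
      rewrite [LHS]exchange_big; apply: eq_bigr => l _.
      rewrite cmul_sumr tau_sum; apply: eq_bigr => j _.
      by rewrite cadjM cadjK !cmulA'.
    by apply: sumr_ge0 => l _; exact: tr_form_ge0.
  - pose K := \sum_(i < d) \sum_(j < d) `|tr_bound T| *
      (rnorm (g i) * (rnorm (tpow i) * rnorm (tpow j)) * rnorm (g j)).
    exists K => u; rewrite -lecR -cabsE; apply: le_trans (ler_norm_sum _ _ _) _.
    rewrite mulr_suml rmorph_sum; apply: ler_sum => i _.
    apply: le_trans (ler_norm_sum _ _ _) _.
    rewrite mulr_suml rmorph_sum; apply: ler_sum => j _.
    rewrite cabsE lecR /c; apply: le_trans (tr_form_le T _) _.
    apply: le_trans (ler_wpM2r (rnorm_ge0 _) (ler_norm _)) _.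
    rewrite -[leRHS]mulrA ler_wpM2l //.
    have le v : rnorm (phi v) <= rnorm v by have := cphi.2 v; rewrite !rnormE lecR.
    have h : rnorm (g i ** phi ((tpow i)^† ** u ** tpow j) ** (g j)^†) <=
       rnorm (g i) * (rnorm (tpow i) * rnorm u * rnorm (tpow j)) * rnorm (g j).
      apply: le_rnormM; last by rewrite rnorm_adj.
      apply: le_rnormM => //; apply: le_trans (le _) _.
      by repeat apply: le_rnormM => //; rewrite rnorm_adj.
    by apply: le_trans h _; apply: eq_ler; ring.
have [b bE] := cpc_gram g cpsi.
pose B := \sum_(l < d) \sum_(i < d) \sum_(l' < d) \sum_(j < d)
  rnorm (b l i) * rnorm (b l' j).
have B0 : 0 <= B.
  by do 4!(apply: sumr_ge0 => ? _); rewrite mulr_ge0 ?rnorm_ge0.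
have dl0 : 0 < e / 2 / (1 + B) by rewrite !divr_gt0 // ltr_pwDl.
set dl := e / 2 / (1 + B) in dl0.
pose y (q : 'I_n * ('I_d * 'I_d)) := tpow q.2.1 ** x q.1 ** (tpow q.2.2)^†.
have [s hs] := excise_fin y fP dl0.
have fy k i j : f (y (k, (i, j))) = c i j (x k).
  rewrite /f /y (bigD1 i) //= [X in _ + X]big1 ?addr0 => [|i' ii'].
    rewrite (bigD1 j) //= [X in _ + X]big1 ?addr0 => [|j' jj'].
      by rewrite !cmulA' tpow_orth eqxx one1 -cmulA' tpow_orth eqxx onex.
    by rewrite !cmulA' -cmulA' (tpow_orth j j') [(j : nat) == j']eq_sym [j' == j :> nat](negbTE jj') cmulx0 c0.
  by apply: big1 => j' _; rewrite !cmulA' tpow_orth [i' == i :> nat](negbTE ii') !cmul0x c0.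
(* Isometries of odd index serve V and those of even index serve W; their orthogonality makes V^* x
   W small. *)
pose q (k : bool) l := tpow (k + l.*2).
have qE k l k' l' : (q k l)^† ** q k' l' = if (k == k') && (l == l') then one else 0.
  rewrite /q tpow_orth; congr (if _ then _ else _); apply/eqP/andP => [E|[/eqP -> /eqP ->]//].
  by have := congr1 odd E; have := congr1 half E; rewrite !half_bit_double !oddD !odd_double !addbF => -> ; case: k {E}; case: k'.
pose V k := \sum_(l < d) \sum_(i < d) (tpow i)^† ** s ** q k l ** b l i.
pose rho m i j := s^† ** y (m, (i, j)) ** s - c i j (x m) *: one.
have rhole m i j : rnorm (rho m i j) <= dl.
  by have := hs (m, (i, j)); rewrite fy => /ltW.
have VE k k' m : (V k)^† ** x m ** V k' = \sum_(l < d) \sum_(i < d)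
    \sum_(l' < d) \sum_(j < d) (b l i)^† ** (q k l)^† **
      (s^† ** y (m, (i, j)) ** s) ** q k' l' ** b l' j.
  rewrite /V cadj_sum !cmul_suml; apply: eq_bigr => l _.
  rewrite cadj_sum !cmul_suml; apply: eq_bigr => i _.
  rewrite cmul_sumr; apply: eq_bigr => l' _.
  rewrite cmul_sumr; apply: eq_bigr => j _.
  by rewrite !cadjM !cadjK /y !cmulA'.
pose target (k k' : bool) m := \sum_(l < d) \sum_(i < d)
  \sum_(l' < d) \sum_(j < d) c i j (x m) *:
     ((b l i)^† ** ((q k l)^† ** q k' l') ** b l' j).
have targetE k k' m : target k k' m = if k == k' then psi (phi (x m)) else 0.
  rewrite /target; case: eqP => [<-|/eqP kk']; last first.
    do 4!(apply: big1 => ? _).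
    by rewrite qE (negbTE kk') cmulx0 cmul0x scaler0.
  have psiE i j : psi (c i j (x m) *: ((g i)^† ** g j)) =
      \sum_l c i j (x m) *: ((b l i)^† ** b l j).
    by rewrite linearZ /= bE scaler_sumr.
  rewrite [phi (x m)](tr_frameE T) linear_sum.
  under [RHS]eq_bigr => i _ do rewrite linear_sum.
  under [RHS]eq_bigr => i _ do under eq_bigr => j _ do rewrite psiE.
  under [RHS]eq_bigr => i _ do rewrite exchange_big.
  rewrite [RHS]exchange_big; apply: eq_bigr => l _; apply: eq_bigr => i _.
  rewrite (bigD1 l) //= [X in _ + X]big1 ?addr0 => [|l' ll'].
    by apply: eq_bigr => j _; rewrite qE !eqxx onex.
  by apply: big1 => j _; rewrite qE eqxx eq_sym [l' == l :> nat](negbTE ll') cmulx0 cmul0x scaler0.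
have near k k' m : rnorm ((V k)^† ** x m ** V k' - target k k' m) <= e / 2.
  rewrite VE /target -sumrB.
  have dlB : dl * B <= e / 2.
    have B1 : 0 < 1 + B by lra.
    by rewrite /dl mulrAC ler_pdivrMr // ler_wpM2l ?(ltW e2) //; lra.
  apply: le_trans dlB; apply: le_trans (rnorm_sum _ _ _) _.
  rewrite mulr_sumr; apply: ler_sum => l _; rewrite -sumrB.
  apply: le_trans (rnorm_sum _ _ _) _; rewrite mulr_sumr.
  apply: ler_sum => i _; rewrite -sumrB.
  apply: le_trans (rnorm_sum _ _ _) _; rewrite mulr_sumr.
  apply: ler_sum => l' _; rewrite -sumrB.
  apply: le_trans (rnorm_sum _ _ _) _; rewrite mulr_sumr.
  apply: ler_sum => j _.
  have -> : (b l i)^† ** (q k l)^† ** (s^† ** y (m, (i, j)) ** s) ** q k' l' ** b l' j -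
     c i j (x m) *: ((b l i)^† ** ((q k l)^† ** q k' l') ** b l' j) =
     (b l i)^† ** ((q k l)^† ** rho m i j ** q k' l') ** b l' j.
    by rewrite /rho !cexpand onex.
  have q1 k0 l0 : rnorm (q k0 l0) <= 1.
    by apply: (isometry_norm oneP); rewrite qE !eqxx.
  have h1 : rnorm ((q k l)^† ** rho m i j ** q k' l') <= 1 * dl * 1.
    by apply: le_rnormM => //; apply: le_rnormM => //; rewrite rnorm_adj.
  have h2 : rnorm ((b l i)^†) <= rnorm (b l i) by rewrite rnorm_adj.
  have := le_rnormM (le_rnormM h2 h1) (lexx (rnorm (b l' j))).
  by move=> /le_trans; apply; apply: eq_ler; ring.
have main k m : rnorm ((V k)^† ** x m ** V k - x m) < e.
  apply: le_lt_trans (rdistD (psi (phi (x m))) _ _) _.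
  have := near k k m; rewrite targetE eqxx => h.
  by have := ler_ltD h (happ m); rewrite -splitr.
exists (V true), (V false) => m; split; [exact: main..|].
have := near true false m; rewrite targetE subr0 => /le_lt_trans; apply.
by rewrite ltr_pdivrMr // ltr_pMr // ltr1n.
Qed.

End Doubling.

(** * The sentence *)

Section Formulas.
Context {R : realType} {u : bool}.
Local Notation fml := (formula R u).
Local Notation trm := (term R u).

Definition vnext k (i : 'I_k) : 'I_k.+1 := lift ord0 i.

Definition fconn2 (op : R -> R -> R)
    (c : continuous (fun v : 'rV[R]_2 => op (v ord0 ord0) (v ord0 ord_max)))
    k (f g : fml k) : fml k :=
  Conn c (fun i => if i == ord0 then f else g).

Lemma coord_continuous2 (j : 'I_2) : continuous (fun v : 'rV[R]_2 => v ord0 j).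
Proof. exact: coord_continuous. Qed.
Lemma add_continuous2 : continuous (fun v : 'rV[R]_2 => v ord0 ord0 + v ord0 ord_max).
Proof. by move=> v;
exact: (@cvgD R R _ _ _ (fun v : 'rV[R]_2 => v ord0 ord0) (fun v => v ord0 ord_max) _ _
  (@coord_continuous2 ord0 v) (@coord_continuous2 ord_max v)). Qed.
Lemma sub_continuous2 : continuous (fun v : 'rV[R]_2 => v ord0 ord0 - v ord0 ord_max).
Proof. by move=> v;
exact: (@cvgB R R _ _ _ (fun v : 'rV[R]_2 => v ord0 ord0) (fun v => v ord0 ord_max) _ _
  (@coord_continuous2 ord0 v) (@coord_continuous2 ord_max v)). Qed.
Lemma max_continuous2 :
  continuous (fun v : 'rV[R]_2 => Num.max (v ord0 ord0) (v ord0 ord_max)).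
Proof. by move=> v; apply: continuous_max; apply: coord_continuous2. Qed.
Lemma min_continuous2 :
  continuous (fun v : 'rV[R]_2 => Num.min (v ord0 ord0) (v ord0 ord_max)).
Proof. by move=> v; apply: continuous_min; apply: coord_continuous2. Qed.
Lemma cst_continuous0 (c : R) : continuous (fun v : 'rV[R]_0 => c).
Proof. by exact: (@cst_continuous _ _ c). Qed.

Definition fadd := @fconn2 (fun x y => x + y) add_continuous2.
Definition fmax := @fconn2 Num.max max_continuous2.
Definition fmin := @fconn2 Num.min min_continuous2.
Definition fsub := @fconn2 (fun x y => x - y) sub_continuous2.

Definition fconst (c : R) k : fml k :=
  Conn (@cst_continuous0 c) (fun _ => Dist (Zero _ _ k) (Zero _ _ k)).

Definition clamp (x : R) := Num.max 0 (Num.min 1 x).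
Definition fclamp k (f : fml k) := fmax (fconst 0 k) (fmin (fconst 1 k) f).

(* Clamping the matrix of every quantifier to [0, 1] makes the suprema and
   infima range over bounded sets. *)
Definition fsup k n (f : fml k.+1) : fml k := Sup n (fclamp f).
Definition finf k n (f : fml k.+1) : fml k := Inf n (fclamp f).

Lemma clamp_ge0 x : 0 <= clamp x.
Proof. by rewrite /clamp le_max lexx. Qed.
Lemma clamp_le1 x : clamp x <= 1.
Proof. by rewrite /clamp ge_max ler01 ge_min lexx. Qed.
Lemma clamp_le x c : 0 <= c -> x <= c -> clamp x <= c.
Proof. by move=> c0 xc; rewrite /clamp ge_max c0 ge_min xc orbT. Qed.
Lemma clamp_lt x c : c <= 1 -> clamp x < c -> x < c.
Proof. by move=> c1; rewrite /clamp gt_max gt_min => /andP[_ /orP[|//]]; rewrite ltNge c1. Qed.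

Section Eval.
Variable A : Lstructure R u.
Local Notation ev := (@formula_eval R u A _).
Implicit Types a : A.

Lemma extend0 k (v : 'I_k -> A) a : extend v a ord0 = a.
Proof. by rewrite /extend unlift_none. Qed.
Lemma extend_next k (v : 'I_k -> A) a i : extend v a (vnext i) = v i.
Proof. by rewrite /extend /vnext liftK. Qed.

Lemma fconn2E op c k (f g : fml k) (v : 'I_k -> A) : ev (@fconn2 op c k f g) v = op (ev f v) (ev g v).
Proof. by rewrite /= !mxE. Qed.
Lemma faddE k (f g : fml k) (v : 'I_k -> A) : ev (fadd f g) v = ev f v + ev g v.
Proof. exact: fconn2E. Qed.
Lemma fmaxE k (f g : fml k) (v : 'I_k -> A) : ev (fmax f g) v = Num.max (ev f v) (ev g v).
Proof. exact: fconn2E. Qed.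
Lemma fminE k (f g : fml k) (v : 'I_k -> A) : ev (fmin f g) v = Num.min (ev f v) (ev g v).
Proof. exact: fconn2E. Qed.
Lemma fsubE k (f g : fml k) (v : 'I_k -> A) : ev (fsub f g) v = ev f v - ev g v.
Proof. exact: fconn2E. Qed.
Lemma fconstE c k (v : 'I_k -> A) : ev (fconst c k) v = c.
Proof. by []. Qed.
Lemma fclampE k (f : fml k) (v : 'I_k -> A) : ev (fclamp f) v = clamp (ev f v).
Proof. by rewrite fmaxE fminE. Qed.
Definition fE := (faddE, fmaxE, fminE, fsubE, fconstE).

Lemma cballP n a : @cball R u A n a <-> rnorm a <= n%:R.
Proof.
rewrite /cball /= rnormE; have -> : (n%:R : R[i]) = (n%:R)%:C by rewrite rmorph_nat.
by rewrite lecR.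
Qed.

Let bnd k (f : fml k.+1) (v : 'I_k -> A) n :=
  [set ev (fclamp f) (extend v a) | a in @cball R u A n].

Let bnd0 k (f : fml k.+1) (v : 'I_k -> A) n : @bnd k f v n !=set0.
Proof.
by exists (ev (fclamp f) (extend v 0)), 0 => //; apply/cballP; rewrite rnorm0.
Qed.

Lemma fsup_ge k n (f : fml k.+1) (v : 'I_k -> A) a :
  rnorm a <= n%:R -> clamp (ev f (extend v a)) <= ev (fsup n f) v.
Proof.
move=> /cballP an; rewrite -fclampE; apply: (@ub_le_sup _ (bnd f v n)); last by exists a.
by exists 1 => _ [b _ <-]; rewrite fclampE clamp_le1.
Qed.

Lemma fsup_le k n (f : fml k.+1) (v : 'I_k -> A) c :
  (forall a, rnorm a <= n%:R -> clamp (ev f (extend v a)) <= c) -> ev (fsup n f) v <= c.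
Proof.
move=> h; apply: (@ge_sup _ (bnd f v n)); first exact: bnd0.
by move=> _ [a /cballP an <-]; rewrite fclampE h.
Qed.

Lemma fsup_lt k n (f : fml k.+1) (v : 'I_k -> A) c : c <= 1 -> ev (fsup n f) v < c ->
  forall a, rnorm a <= n%:R -> ev f (extend v a) < c.
Proof. by move=> c1 h a an; apply: clamp_lt => //; apply: le_lt_trans h; exact: fsup_ge. Qed.

Lemma finf_le k n (f : fml k.+1) (v : 'I_k -> A) a c : rnorm a <= n%:R -> 0 <= c ->
  ev f (extend v a) <= c -> ev (finf n f) v <= c.
Proof.
move=> /cballP an c0 fc; apply: (@le_trans _ _ (ev (fclamp f) (extend v a))).
  apply: (@ge_inf _ (bnd f v n)); last by exists a.
  by exists 0 => _ [b _ <-]; rewrite fclampE clamp_ge0.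
by rewrite fclampE clamp_le.
Qed.

Lemma finf_lt k n (f : fml k.+1) (v : 'I_k -> A) c : c <= 1 -> ev (finf n f) v < c ->
  exists2 a, rnorm a <= n%:R & ev f (extend v a) < c.
Proof.
move=> c1 h; have [|_ [a /cballP an <-]] := @inf_lt _ (bnd f v n) _ _ h.
  exact: bnd0.
by rewrite fclampE => /(clamp_lt c1) ?; exists a.
Qed.

End Eval.

Local Notation "s ⋆ t" := (Mul s t) (at level 40, left associativity).
Local Notation "s ^⋆" := (Adj s) (at level 3).
Local Notation x0 := (Var R u ord0).
Local Notation x1 := (Var R u (vnext ord0)).
Local Notation x2 := (Var R u (vnext (vnext ord0))).
Local Notation x3 := (Var R u (vnext (vnext (vnext ord0)))).
Local Notation x4 := (Var R u (vnext (vnext (vnext (vnext ord0))))).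
Local Notation x5 := (Var R u (vnext (vnext (vnext (vnext (vnext ord0)))))).
Local Notation "'O_'" := (Zero R u _).

(** The unit is a quantified variable instead of the constant, so that one sentence serves both
    languages. Variable 0 is the innermost bound one; the variable of the unit moves up with every
    quantifier. *)
Definition unit_defect : fml 1 :=
  fsup 1 (fadd (Dist (x1 ⋆ x0) x0) (Dist (x0 ⋆ x1) x0)).

Definition isometry_defect : fml 1 :=
  finf 1 (finf 1 (fmax (Dist (x1^⋆ ⋆ x1) x2)
    (fmax (Dist (x0^⋆ ⋆ x0) x2) (Dist (x1^⋆ ⋆ x0) O_)))).

(** When s^* b^* b s is m times the unit, with m = ||b||^2, the distance 1 - m cancels against m -
    1. So all contractions b are treated alike, and for ||b|| = 1 the expression is the distance to
    the unit. *)
Definition peak_defect : fml 1 :=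
  fsup 1 (finf 1 (fsub (fadd (Dist (x0^⋆ ⋆ (x1^⋆ ⋆ x1) ⋆ x0) x2)
     (Dist (x1^⋆ ⋆ x1) O_)) (fconst 1 _))).

Definition doubling_matrix k (V W : trm k) (x : trm k) : fml k :=
  fmax (Dist (V^⋆ ⋆ x ⋆ V) x) (fmax (Dist (W^⋆ ⋆ x ⋆ W) x) (Dist (V^⋆ ⋆ x ⋆ W) O_)).

Definition doubling_defect : fml 1 :=
  fsup 1 (fsup 1 (fsup 1 (fsup 1 (finf 2 (finf 2
    (fmax (fmax (doubling_matrix x1 x0 x2) (doubling_matrix x1 x0 x3))
          (fmax (doubling_matrix x1 x0 x4) (doubling_matrix x1 x0 x5)))))))).

(** The minimum expresses an implication: it is positive only if the three defects are below 1/64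
    and some four contractions fail to double. The clamping in [fsup] then makes 0 the value of
    truth. *)
Definition doubling_sentence : sentence R u :=
  fsup 1 (fmin (fsub (fconst 64^-1 _) unit_defect)
    (fmin (fsub (fconst 64^-1 _) isometry_defect)
    (fmin (fsub (fconst 64^-1 _) peak_defect) doubling_defect))).

Definition doubling (A : cstarType R) (V W x : A) (e : R) :=
  [/\ rnorm (V^† ** x ** V - x) < e, rnorm (W^† ** x ** W - x) < e & rnorm (V^† ** x ** W) < e].

Lemma doubling_matrix_lt (A : Lstructure R u) k (V W x : trm k) (v : 'I_k -> A) e :
  formula_eval (doubling_matrix V W x) v < e <->
  doubling (term_eval v V) (term_eval v W) (term_eval v x) e.
Proof.
rewrite /doubling_matrix !fE !gt_max /= subr0.
by split=> [/andP[h /andP[h1 h2]]|[-> -> ->]].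
Qed.

Lemma rnorm_le1_scale (A : cstarType R) (f : A -> A) (d : R) :
  (forall c x, f (c *: x) = c *: f x) -> 0 <= d ->
  (forall x, rnorm x <= 1 -> rnorm (f x) <= d) -> forall x, rnorm (f x) <= d * rnorm x.
Proof.
move=> fZ d0 h x; have [->|xn] := eqVneq x 0.
  by rewrite -(scale0r 0) fZ !scale0r rnorm0 mulr0.
have x0 := rnorm_gt0 xn; have ix0 : 0 <= (rnorm x)^-1 by rewrite invr_ge0 ltW.
have := h ((rnorm x)^-1%:C *: x); rewrite fZ !rnormZR !ger0_norm // mulVf ?gt_eqF // => /(_ (lexx _)).
by rewrite mulrC ler_pdivrMr.
Qed.

Section NuclearStructure.
Variables (A : Lstructure R u) (nA : nuclear A).

(** Gram-Schmidt with polar decompositions: s is normalized to t1, the component of t along t1 is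
    removed, and the rest is normalized. *)
Lemma exact_isometries (one : A) : is_unit one -> one != 0 -> forall (s t : A) d,
  rnorm (s^† ** s - one) <= d -> rnorm (t^† ** t - one) <= d -> rnorm (s^† ** t) <= d ->
  d <= 32^-1 -> exists t1 t2 : A, [/\ t1^† ** t1 = one, t2^† ** t2 = one & t1^† ** t2 = 0].
Proof.
move=> oneP one0 s t d hs ht hst hd.
have one1 := unitl oneP; have onex := unitr oneP.
have sa (w : A) : (w^† ** w)^† = w^† ** w by rewrite cadjM cadjK.
have d0 : 0 <= d by apply: le_trans hst; exact: rnorm_ge0.
have mk (w : A) : rnorm (w^† ** w - one) <= 8^-1 -> exists y, [/\ rnorm y <= 5 / 4, y^† = y &
    (w ** y)^† ** (w ** y) = one].
  move=> hw; have [||y yP] := isqrt_exists oneP (z := w^† ** w).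
  - exact: sa.
  - by rewrite rdistC.
  exists y; split; [|exact: isqrt_adj yP|].
    have := le_rnormD (isqrt_near yP) (lexx (rnorm one)); rewrite subrK (unit_norm oneP one0) => h.
    by apply: le_trans h _; lra.
  have ys := isqrt_adj yP; have E := isqrtE yP; have K := isqrt_comm yP.
  have wy : w^† ** w ** y = y ** (w^† ** w) by rewrite K.
  by rewrite cadjM ys !cmulA' -(cmulA' y) -wy E.
have h8 : d <= 8^-1 by lra.
have [y [y54 ys yP]] := mk s (le_trans hs h8); set t1 := s ** y in yP.
pose r := t1^† ** t; pose w := t - t1 ** r.
have rle : rnorm r <= 5 / 4 * d.
  by rewrite /r cadjM -cmulA'; apply: le_rnormM => //; rewrite rnorm_adj.
have t1w : t1^† ** w = 0 by rewrite /w cmulBr cmulA' yP one1 subrr.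
have ww : w^† ** w = t^† ** t - r^† ** r.
  rewrite {1}/w cadjB cmulBl [in (t1 ** r)^†]cadjM -(cmulA' r^†) t1w cmulx0 subr0.
  by rewrite /w cmulBr cmulA' /r !cadjM !cadjK !cmulA'.
have [|z [_ zs zP]] := mk w.
  rewrite ww (_ : _ - one = (t^† ** t - one) - r^† ** r); last by clmod R.
  have rs : rnorm r^† <= 5 / 4 * d by rewrite rnorm_adj.
  apply: le_trans (le_rnormB ht (le_rnormM rs rle)) _; nra.
by exists t1, (w ** z); split=> //; rewrite cmulA' t1w cmul0x.
Qed.

Lemma nuclear_doubling_sentence : sentence_value A doubling_sentence = 0.
Proof.
apply/eqP; rewrite eq_le; apply/andP; split; last first.
  by apply: le_trans (clamp_ge0 _) (fsup_ge (a := 0) _ _ _); rewrite rnorm0.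
apply: fsup_le => e e1; apply: clamp_le => //; rewrite !fE !ge_min !subr_le0.
have h64 : 64^-1 <= 1 :> R by lra.
set v := extend _ e; have vE : v ord0 = e by exact: extend0.
have [//|hD] := leP 64^-1 (formula_eval unit_defect v).
have [//|hC] := leP 64^-1 (formula_eval isometry_defect v).
have [//|hH] := leP 64^-1 (formula_eval peak_defect v).
have eD x : rnorm x <= 1 -> rnorm (e ** x - x) + rnorm (x ** e - x) < 64^-1.
  by move=> x1'; have := fsup_lt h64 hD x1'; rewrite faddE /= !extend_next !extend0 vE.
have [un oP] : exists o : A, is_unit o.
  apply: (@almost_unit_unit _ _ e 64^-1); [lra|lra|].
  apply: (@rnorm_le1_scale _ (fun x => e ** x - x)) => [c x||x x1']; [|lra|].
    by rewrite cmulZr scalerBr.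
  by have := eD x x1'; have := rnorm_ge0 (x ** e - x); lra.
have one1 := unitl oP; have onex := unitr oP.
apply/ler_addgt0Pr => d d0; rewrite add0r.
(* The zero algebra is a structure as well; all its distances vanish. *)
have [oz|o0] := eqVneq un 0.
  have z (x : A) : x = 0 by rewrite -(one1 x) oz cmul0x.
  do 4!(apply: fsup_le => ? _; apply: clamp_le; first exact: ltW).
  do 2!(apply: (finf_le (a := 0)); [by rewrite rnorm0|exact: ltW|]).
  have zd (x y : A) : rnorm (x - y) = 0 by rewrite (z (x - y)) rnorm0.
  by rewrite !fE /= !zd !maxxx ltW.
have n1 : rnorm un = 1 by exact: (unit_norm oP).
have eo : rnorm (e - un) <= 64^-1.
  have := eD un; rewrite n1 onex => /(_ (lexx _)); have := rnorm_ge0 (un ** e - un); lra.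
have [t1 [t2 [t1P t2P t12]]] : exists t1 t2 : A,
    [/\ t1^† ** t1 = un, t2^† ** t2 = un & t1^† ** t2 = 0].
  have [s s1 hs] := finf_lt h64 hC; have [t t1' ht] := finf_lt h64 hs.
  move: ht; rewrite !fE !gt_max /= !extend_next !extend0 vE subr0 => /andP[a1 /andP[a2 a3]].
  (* The error 1/32 is 1/64 from the defect plus 1/64 from exchanging e for the unit. *)
  apply: (exact_isometries oP o0 (s := s) (t := t) (d := 32^-1)) => //.
  - by apply: le_trans (rdistD e _ _) _; lra.
  - by apply: le_trans (rdistD e _ _) _; lra.
  - by lra.
have peak0 (b : A) : rnorm b = 1 ->
    exists2 s, rnorm s <= 1 & rnorm (s^† ** (b^† ** b) ** s - un) <= 8^-1.
  move=> b1; have /(fsup_lt h64 hH)/(finf_lt h64)[s s1] : rnorm b <= 1%:R by rewrite b1.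
  rewrite !fE /= !extend_next !extend0 vE subr0 rnorm_cstar b1 expr1n => hs.
  by exists s => //; apply: le_trans (rdistD e _ _) _; lra.
apply: fsup_le => x3' _; apply: clamp_le; first exact: ltW.
apply: fsup_le => x2' _; apply: clamp_le; first exact: ltW.
apply: fsup_le => x1' _; apply: clamp_le; first exact: ltW.
apply: fsup_le => x0' _; apply: clamp_le; first exact: ltW.
pose d' := Num.min d 1; have d'0 : 0 < d' by rewrite lt_min d0 ltr01.
have d'd : d' <= d by rewrite ge_min lexx.
have d'1 : d' <= 1 by rewrite ge_min lexx orbT.
(* The unit joins the four contractions: as it is doubled within 1, V and W have norm at most 2 and
   lie in the ball they are quantified over. *)
pose x := tnth [tuple x0'; x1'; x2'; x3'; un].
have [V [W h]] := nuclear_doubling oP o0 nA peak0 t1P t2P t12 x d'0.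
have [hV hW _] := h (inord 4).
have le2 (U : A) : rnorm (U^† ** un ** U - un) < d' -> rnorm U <= 2.
  rewrite onex => hU; have := rnormD (U^† ** U - un) un; rewrite subrK rnorm_cstar n1 => hh.
  by have := rnorm_ge0 U; nra.
rewrite /x (tnth_nth 0) /= inordK // in hV hW.
apply: (finf_le (a := V)); [exact: le2|exact: ltW|].
apply: (finf_le (a := W)); [exact: le2|exact: ltW|].
have hj (j : nat) : (j < 5)%N -> doubling V W (nth 0 [:: x0'; x1'; x2'; x3'; un] j) d.
  move=> j5; have := h (inord j); rewrite /x (tnth_nth 0) /= inordK // => -[p q r].
  by split; apply: lt_le_trans d'd.
apply: ltW; rewrite fmaxE gt_max; apply/andP.
split; rewrite fmaxE gt_max; apply/andP; split; apply/doubling_matrix_lt;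
  rewrite /= !extend_next !extend0 ?extend_next ?extend0.
- exact: (hj 0).
- exact: (hj 1).
- exact: (hj 2).
- exact: (hj 3).
Qed.

End NuclearStructure.

Lemma unital_doubling_sentence (A : unitalCstarType R) (d : R) (y0 y1 y2 y3 : A) :
  cone A != 0 -> 0 < d -> d <= 1 ->
  (exists t1 t2 : A, [/\ t1^† ** t1 = cone A, t2^† ** t2 = cone A & t1^† ** t2 = 0]) ->
  (forall (b : A) e, 0 < e -> exists2 s : A, s^† ** s = cone A &
     rnorm (s^† ** (b^† ** b) ** s - (rnorm b ^+ 2)%:C *: cone A) < e) ->
  rnorm y0 <= 1 -> rnorm y1 <= 1 -> rnorm y2 <= 1 -> rnorm y3 <= 1 ->
  (forall V W, ~ [/\ doubling V W y0 d, doubling V W y1 d, doubling V W y2 d & doubling V W y3 d]) ->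
  sentence_value (unital_structure u A) doubling_sentence != 0.
Proof.
move=> o0 d0 d1 [t1 [t2 [t1P t2P t12]]] peak h0 h1 h2 h3 gap.
have oP : is_unit (cone A) by move=> x; rewrite cmul1x cmulx1.
have n1 : rnorm (cone A) = 1 by exact: (unit_norm oP).
pose B := unital_structure u A; pose v := extend (fun i : 'I_0 => 0 : B) (cone A).
have vE : v ord0 = cone A by exact: extend0.
have hD : formula_eval unit_defect v <= 0.
  apply: fsup_le => x _; apply: clamp_le => //; rewrite faddE /= !extend_next !extend0 vE.
  by rewrite cmul1x cmulx1 subrr rnorm0 addr0.
have iso (s : A) : s^† ** s = cone A -> rnorm s <= 1 by exact: (isometry_norm oP).
have hC : formula_eval isometry_defect v <= 0.
  apply: (finf_le (A := B) (a := t1)) => //; first exact: iso.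
  apply: (finf_le (A := B) (a := t2)) => //; first exact: iso.
  by rewrite !fE /= !extend_next !extend0 vE t1P t2P t12 !subrr rnorm0 !maxxx.
have hH : formula_eval peak_defect v <= 0.
  apply: fsup_le => b b1; apply: clamp_le => //; apply/ler_addgt0Pr => e e0.
  have [s sP sb] := peak b e e0.
  apply: (finf_le (A := B) (a := s)); [exact: iso|by rewrite add0r ltW|].
  rewrite !fE /= !extend_next !extend0 vE subr0 rnorm_cstar.
  set m := rnorm b ^+ 2; have m1 : m <= 1 by rewrite exprn_ile1 ?rnorm_ge0.
  have := rdistD (m%:C *: cone A) (s^† ** (b^† ** b) ** s) (cone A).
  have -> : m%:C *: cone A - cone A = (m - 1)%:C *: cone A.
    by rewrite rmorphB rmorph1 scalerBl scale1r.
  rewrite rnormZR n1 mulr1.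
  by rewrite ler0_norm ?subr_le0 //; lra.
have hX : d <= formula_eval doubling_defect v.
  rewrite leNgt; apply/negP => hX.
  have := fsup_lt d1 (fsup_lt d1 (fsup_lt d1 (fsup_lt d1 hX h3) h2) h1) h0.
  move=> /(finf_lt d1)[V V2] /(finf_lt d1)[W W2].
  rewrite fmaxE gt_max => /andP[].
  rewrite fmaxE gt_max => /andP[/doubling_matrix_lt a1 /doubling_matrix_lt a2].
  rewrite fmaxE gt_max => /andP[/doubling_matrix_lt a3 /doubling_matrix_lt a4].
  apply: (gap V W); move: a1 a2 a3 a4; rewrite /= !extend_next !extend0 => *; by split.
apply: lt0r_neq0; apply: lt_le_trans (fsup_ge (a := cone A : B) _ _ _); last by rewrite n1.
rewrite /clamp lt_max lt_min ltr01 !fE !lt_min !subr_gt0; apply/orP; right.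
have p64 : 0 < 64^-1 :> R by rewrite invr_gt0.
rewrite !(le_lt_trans _ p64) //=; exact: lt_le_trans hX.
Qed.

End Formulas.

(** * Operators on l^2 *)

Section Sums.
Context {R : realType} {X : choiceType}.
Local Notation C := R[i].
Implicit Types (h k : X -> C) (a : X -> R) (l m : C) (F G : {fset X}).

Lemma cabs_ge0 (c : C) : 0 <= cabs c.
Proof. by rewrite -lecR -cabsE normr_ge0. Qed.
Lemma cabs0 : cabs (0 : C) = 0.
Proof. by rewrite /cabs normr0. Qed.
Lemma cabs_eq0 (c : C) : cabs c = 0 -> c = 0.
Proof. by move=> h; apply/eqP; rewrite -normr_eq0 cabsE h. Qed.
Lemma cabsD (c d : C) : cabs (c + d) <= cabs c + cabs d.
Proof. by rewrite -lecR rmorphD /= -!cabsE ler_normD. Qed.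
Lemma cabsM (c d : C) : cabs (c * d) = cabs c * cabs d.
Proof. by apply: complexI; rewrite rmorphM /= -!cabsE normrM. Qed.
Lemma cabsN (c : C) : cabs (- c) = cabs c.
Proof. by rewrite /cabs normrN. Qed.
Lemma cabs_conj (c : C) : cabs (conjc c) = cabs c.
Proof. by case: c => u v; rewrite /cabs !normc_def /= sqrrN. Qed.
Lemma cabs_Re (c : C) : `|complex.Re c| <= cabs c.
Proof. by rewrite -lecR -cabsE normc_ge_Re. Qed.
Lemma cabs_Im (c : C) : `|complex.Im c| <= cabs c.
Proof.
have := cabs_Re ('i * c); rewrite cabsM cabs_i mul1r; apply: le_trans; apply: eq_ler.
by case: c => u v /=; rewrite !(mul0r, mul1r) sub0r normrN.
Qed.
Lemma cabs_sqr (c : C) : ((cabs c ^+ 2)%:C : C) = conjc c * c.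
Proof. by rewrite rmorphXn /= -cabsE sqr_normc mulrC. Qed.

Definition has_sum h l := forall e : R, 0 < e ->
  exists F, forall G, (F `<=` G)%fset -> cabs (\sum_(x <- G) h x - l) < e.

Lemma has_sum_uniq h l m : has_sum h l -> has_sum h m -> l = m.
Proof.
move=> hl hm; apply/eqP; rewrite -subr_eq0; apply/eqP/cabs_eq0/eqP.
rewrite eq_le cabs_ge0 andbT; apply/ler_addgt0Pr => e e0.
have e2 : 0 < e / 2 by rewrite divr_gt0.
have [F hF] := hl _ e2; have [G hG] := hm _ e2.
have h1 := hF (F `|` G)%fset (fsubsetUl _ _).
have h2 := hG (F `|` G)%fset (fsubsetUr _ _).
have := cabsD (\sum_(x <- (F `|` G)%fset) h x - m) (- (\sum_(x <- (F `|` G)%fset) h x - l)).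
rewrite cabsN opprB addrC addrA subrK; lra.
Qed.

Lemma has_sumD h k l m : has_sum h l -> has_sum k m -> has_sum (fun x => h x + k x) (l + m).
Proof.
move=> hl hm e e0; have e2 : 0 < e / 2 by rewrite divr_gt0.
have [F hF] := hl _ e2; have [G hG] := hm _ e2; exists (F `|` G)%fset => H.
rewrite fsubUset => /andP[/hF h1 /hG h2]; rewrite big_split /= opprD addrACA.
by have := cabsD (\sum_(x <- H) h x - l) (\sum_(x <- H) k x - m); lra.
Qed.

Lemma has_sumZ c h l : has_sum h l -> has_sum (fun x => c * h x) (c * l).
Proof.
move=> hl e e0; have c0 := cabs_ge0 c.
have e2 : 0 < e / (1 + cabs c) by rewrite divr_gt0 // ltr_pwDl.
have [F hF] := hl _ e2; exists F => G /hF; rewrite -mulr_sumr -mulrBr cabsM.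
rewrite ltr_pdivlMr ?ltr_pwDl //; have := cabs_ge0 (\sum_(x <- G) h x - l); nra.
Qed.

Lemma has_sum_conj h l : has_sum h l -> has_sum (fun x => conjc (h x)) (conjc l).
Proof.
move=> hl e /hl[F hF]; exists F => G /hF.
by rewrite -(cabs_conj (_ - _)) rmorphB rmorph_sum.
Qed.

Lemma has_sum_fin F h : (forall x, x \notin F -> h x = 0) -> has_sum h (\sum_(x <- F) h x).
Proof.
move=> h0 e e0; exists F => G FG; rewrite -(big_fset_incl _ FG) ?subrr ?cabs0 //.
by move=> x _ /h0.
Qed.

Lemma sum_fsub F G a : (forall x, 0 <= a x) -> (F `<=` G)%fset ->
  \sum_(x <- F) a x <= \sum_(x <- G) a x.
Proof.
move=> a0 FG; rewrite [leRHS](big_fsetID _ (fun x => x \in F)) /=.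
have -> : [fset x in G | x \in F]%fset = F.
  by apply/fsetP => x; rewrite !inE /= andb_idl // => /(fsubsetP FG).
by rewrite lerDl; apply: sumr_ge0.
Qed.

Lemma has_sum_nonneg a K : (forall x, 0 <= a x) -> (forall F, \sum_(x <- F) a x <= K) ->
  exists r : R, has_sum (fun x => (a x)%:C) r%:C.
Proof.
move=> a0 aK; pose S := [set \sum_(x <- F) a x | F in [set: {fset X}]].
have hS : has_sup S.
  by split; [exists (\sum_(x <- fset0) a x), fset0|exists K => _ [F _ <-]; exact: aK].
exists (sup S) => e e0; have [_ [F _ <-] hF] := sup_adherent e0 hS; exists F => G FG.
rewrite -rmorph_sum -rmorphB cabsR ler0_norm ?subr_le0.
  by have := sum_fsub a0 FG; lra.
by apply: ub_le_sup; [exact: hS.2|exists G].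
Qed.

Lemma has_sum_ge a (l : R) F : (forall x, 0 <= a x) -> has_sum (fun x => (a x)%:C) l%:C ->
  \sum_(x <- F) a x <= l.
Proof.
move=> a0 hl; apply/ler_addgt0Pr => e /hl[G hG].
have := hG (F `|` G)%fset (fsubsetUr _ _); rewrite -rmorph_sum -rmorphB cabsR.
have := sum_fsub a0 (fsubsetUl F G); rewrite ltr_norml => h /andP[_]; lra.
Qed.

Lemma has_sum_le h l K : has_sum h l -> (forall F, cabs (\sum_(x <- F) h x) <= K) -> cabs l <= K.
Proof.
move=> hl hK; apply/ler_addgt0Pr => e /hl[F /(_ F (fsubset_refl _))].
have := cabsD (\sum_(x <- F) h x) (- (\sum_(x <- F) h x - l)).
rewrite cabsN opprB addrC subrK; have := hK F; lra.
Qed.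

(** The real and the imaginary part p of h are differences (p + |h|) - |h| of nonnegative summable
    families. *)
Lemma has_sum_abs h K : (forall F, \sum_(x <- F) cabs (h x) <= K) -> exists l, has_sum h l.
Proof.
move=> hK.
have part (p : X -> R) : (forall x, `|p x| <= cabs (h x)) -> exists l, has_sum (fun x => (p x)%:C) l.
  move=> hp; have h0 x : 0 <= cabs (h x) by exact: cabs_ge0.
  have [|F|l hl] := @has_sum_nonneg (fun x => p x + cabs (h x)) (K + K).
  - by move=> x; have := hp x; rewrite ler_norml => /andP[]; lra.
  - rewrite big_split lerD //; apply: le_trans (hK F); apply: ler_sum => x _.
    exact: le_trans (ler_norm _) (hp x).
  have [m hm] := @has_sum_nonneg (fun x => cabs (h x)) K h0 hK.
  exists (l%:C + -1 * m%:C); have := has_sumD hl (has_sumZ (-1) hm).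
  by congr has_sum; apply/funext => x; rewrite mulN1r rmorphD /= addrK.
have [l hl] := part (fun x => complex.Re (h x)) (fun x => cabs_Re _).
have [m hm] := part (fun x => complex.Im (h x)) (fun x => cabs_Im _).
exists (l + 'i * m); have := has_sumD hl (has_sumZ 'i hm).
by congr has_sum; apply/funext => x; rewrite -complexE.
Qed.

Definition l2fun : {pred X -> C} :=
  fun f => `[< exists K : R, forall F, \sum_(x <- F) cabs (f x) ^+ 2 <= K >].

Lemma l2fun_submod : submod_closed l2fun.
Proof.
split=> [|c f g /asboolP[K hK] /asboolP[L hL]].
  by apply/asboolP; exists 0 => F; rewrite big1 // => x _; rewrite cabs0 expr0n.
apply/asboolP; exists (2 * cabs c ^+ 2 * K + 2 * L) => F.
apply: (@le_trans _ _ (\sum_(x <- F) (2 * cabs c ^+ 2 * cabs (f x) ^+ 2 + 2 * cabs (g x) ^+ 2))).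
  apply: ler_sum => x _; have : cabs (c * f x + g x) <= cabs c * cabs (f x) + cabs (g x).
    by rewrite -cabsM; exact: cabsD.
  rewrite -[(c *: f + g) x]/(c * f x + g x).
  have := cabs_ge0 (c * f x + g x); set u := cabs (_ + _); rewrite -mulrA -exprMn.
  move: (cabs c * _) (cabs (g x)) => p q u0 h; have : u ^+ 2 <= (p + q) ^+ 2 by rewrite ler_sqr ?nnegrE; lra.
  by have := sqr_ge0 (p - q); nra.
rewrite big_split /= -!mulr_sumr; have := hK F; have := hL F; have := sqr_ge0 (cabs c); nra.
Qed.

End Sums.

(** * The Hilbert space l^2(X) *)

Section Vectors.
Variables (R : realType) (X : choiceType).
Local Notation C := R[i].

Record vec := Vec { vec_val :> X -> C; vecP : vec_val \in @l2fun R X }.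
HB.instance Definition _ := [isSub for vec_val].
HB.instance Definition _ := [Choice of vec by <:].
HB.instance Definition _ := GRing.isSubmodClosed.Build _ _ (@l2fun R X) (@l2fun_submod R X).
HB.instance Definition _ := [SubChoice_isSubLmodule of vec by <:].

Implicit Types (f g h : vec) (c d : C) (x y : X).

Lemma vecD f g x : (f + g) x = f x + g x. Proof. by []. Qed.
Lemma vecZ c f x : (c *: f) x = c * f x. Proof. by []. Qed.
Lemma vecB f g x : (f - g) x = f x - g x. Proof. by []. Qed.
Lemma vec0 x : (0 : vec) x = 0. Proof. by []. Qed.
Lemma vec_ext f g : f =1 g -> f = g.
Proof. by move=> h; apply: val_inj; apply/funext. Qed.
Lemma vec_sum I (s : seq I) (F : I -> vec) x : (\sum_(i <- s) F i) x = \sum_(i <- s) F i x.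
Proof. by elim/big_ind2: _ => // u v w z <- <-. Qed.

Definition dot f g : C := xget 0 [set l | has_sum (fun x => conjc (f x) * g x) l].

Lemma dotP f g : has_sum (fun x => conjc (f x) * g x) (dot f g).
Proof.
apply: (@xgetPex _ 0 [set l | has_sum _ l]).
have /asboolP[K hK] := vecP f; have /asboolP[L hL] := vecP g.
apply: (@has_sum_abs _ _ _ (K + L)) => F; apply: le_trans (lerD (hK F) (hL F)).
rewrite -big_split /=; apply: ler_sum => x _; rewrite cabsM cabs_conj.
have := cabs_ge0 (f x); have := cabs_ge0 (g x); have := sqr_ge0 (cabs (f x) - cabs (g x)).
by move: (cabs _) (cabs _) => p q; nra.
Qed.

Lemma dotE f g l : has_sum (fun x => conjc (f x) * g x) l -> dot f g = l.
Proof. exact: has_sum_uniq (dotP f g). Qed.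

Lemma dotC f g : dot g f = conjc (dot f g).
Proof.
apply: dotE; have := has_sum_conj (dotP f g); congr has_sum; apply/funext => x.
by rewrite rmorphM /= conjcK mulrC.
Qed.

Lemma dotDr f g h : dot f (g + h) = dot f g + dot f h.
Proof.
apply: dotE; have := has_sumD (dotP f g) (dotP f h); congr has_sum.
by apply/funext => x; rewrite vecD mulrDr.
Qed.

Lemma dotZr c f g : dot f (c *: g) = c * dot f g.
Proof.
apply: dotE; have := has_sumZ c (dotP f g); congr has_sum.
by apply/funext => x; rewrite vecZ mulrCA.
Qed.

Lemma dotDl f g h : dot (f + g) h = dot f h + dot g h.
Proof. by rewrite dotC dotDr rmorphD /= -!dotC. Qed.
Lemma dotZl c f g : dot (c *: f) g = conjc c * dot f g.
Proof. by rewrite dotC dotZr rmorphM /= -dotC. Qed.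
Lemma dotNr f g : dot f (- g) = - dot f g.
Proof. by rewrite -scaleN1r dotZr mulN1r. Qed.
Lemma dotNl f g : dot (- f) g = - dot f g.
Proof. by rewrite dotC dotNr rmorphN /= -dotC. Qed.
Lemma dot0r f : dot f 0 = 0.
Proof. by rewrite -(scale0r 0) dotZr mul0r. Qed.
Lemma dot0l f : dot 0 f = 0.
Proof. by rewrite dotC dot0r conjc0. Qed.
Definition dot_expand := (dotDr, dotDl, dotNr, dotNl, dotZr, dotZl).

Definition nsq f : R := complex.Re (dot f f).

Lemma nsq_sum f : has_sum (fun x => (cabs (f x) ^+ 2)%:C) (nsq f)%:C.
Proof.
have /asboolP[K hK] := vecP f.
have [r hr] := has_sum_nonneg (fun x => sqr_ge0 (cabs (f x))) hK.
have E : dot f f = r%:C.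
  by apply: dotE; move: hr; congr has_sum; apply/funext => x; rewrite cabs_sqr.
by rewrite /nsq E.
Qed.

Lemma dotff f : dot f f = (nsq f)%:C.
Proof.
apply: dotE; have := nsq_sum f; congr has_sum; apply/funext => x.
by rewrite cabs_sqr.
Qed.

Lemma nsq_ge f (F : {fset X}) : \sum_(x <- F) cabs (f x) ^+ 2 <= nsq f.
Proof. by apply: has_sum_ge (nsq_sum f) => x; exact: sqr_ge0. Qed.

Lemma nsq_ge0 f : 0 <= nsq f.
Proof. by have := nsq_ge f fset0; rewrite big_seq_fset0. Qed.

Lemma nsq_le f K : (forall F : {fset X}, \sum_(x <- F) cabs (f x) ^+ 2 <= K) -> nsq f <= K.
Proof.
move=> hK; rewrite -(ger0_norm (nsq_ge0 f)) -cabsR; apply: has_sum_le (nsq_sum f) _ => F.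
by rewrite -rmorph_sum cabsR ger0_norm ?sumr_ge0 // => x _; exact: sqr_ge0.
Qed.

Definition vnorm f : R := Num.sqrt (nsq f).

Lemma vnorm_ge0 f : 0 <= vnorm f.
Proof. exact: sqrtr_ge0. Qed.
Lemma sqr_vnorm f : vnorm f ^+ 2 = nsq f.
Proof. by rewrite sqr_sqrtr ?nsq_ge0. Qed.
Lemma dot_vnorm f : dot f f = (vnorm f ^+ 2)%:C.
Proof. by rewrite sqr_vnorm dotff. Qed.
Lemma vnorm_le f K : 0 <= K -> (vnorm f <= K) = (nsq f <= K ^+ 2).
Proof. by move=> K0; rewrite -sqr_vnorm ler_sqr ?nnegrE ?vnorm_ge0. Qed.
Lemma vnorm_coef f x : cabs (f x) <= vnorm f.
Proof.
rewrite -(ler_pXn2r (n := 2)) ?nnegrE ?cabs_ge0 ?vnorm_ge0 // sqr_vnorm.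
by have := nsq_ge f [fset x]%fset; rewrite big_seq_fset1.
Qed.
Lemma vnorm_eq0 f : vnorm f = 0 -> f = 0.
Proof.
move=> h; apply: vec_ext => x; apply: cabs_eq0; apply/eqP.
by rewrite eq_le cabs_ge0 -h vnorm_coef.
Qed.

Lemma nsqD f g c : nsq (f + c *: g) =
  nsq f + 2 * complex.Re (c * dot f g) + cabs c ^+ 2 * nsq g.
Proof.
have := dotff (f + c *: g); rewrite !dot_expand (dotC f g) !dotff => /esym.
have -> : (nsq f)%:C + conjc c * conjc (dot f g) + (c * dot f g + c * (conjc c * (nsq g)%:C)) =
  (nsq f)%:C + (c * dot f g + conjc (c * dot f g)) + (cabs c ^+ 2)%:C * (nsq g)%:C.
  by rewrite cabs_sqr rmorphM /=; ring.
rewrite -rmorphM; case: (c * _) => u v /(congr1 (fun z => complex.Re z)) /=; lra.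
Qed.

Lemma dot_le f g : cabs (dot f g) <= vnorm f * vnorm g.
Proof.
set d := dot f g; have [/eqP d0|d0] := boolP (cabs d == 0).
  by rewrite d0 mulr_ge0 ?vnorm_ge0.
have dp : 0 < cabs d by rewrite lt_neqAle eq_sym d0 cabs_ge0.
have : (cabs d ^+ 2) ^+ 2 <= cabs d ^+ 2 * nsq g * nsq f.
  (* Adding to f the multiple t conj(d) of g makes the cross term 2 t |d|^2 real. The price is a
     factor |d|^2 on both sides, cancelled below. *)
  apply: quadratic_ge0 => [|t]; first by rewrite mulr_ge0 ?sqr_ge0 ?nsq_ge0.
  have := nsq_ge0 (f + (t%:C * conjc d) *: g).
  rewrite nsqD cabsM cabsR cabs_conj exprMn -/d -mulrA -cabs_sqr -rmorphM /= real_normK ?num_real //; lra.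
rewrite expr2 -mulrA ler_pM2l ?exprn_gt0 // -!sqr_vnorm -exprMn => h.
by rewrite mulrC -(ler_pXn2r (n := 2)) ?nnegrE ?(ltW dp) ?mulr_ge0 ?vnorm_ge0.
Qed.

Lemma vnormD f g : vnorm (f + g) <= vnorm f + vnorm g.
Proof.
rewrite vnorm_le ?addr_ge0 ?vnorm_ge0 //; have := nsqD f g 1.
rewrite scale1r mul1r (cabsR 1) normr1 expr1n mul1r => ->.
have := cabs_Re (dot f g); have := dot_le f g; rewrite ler_norml -!sqr_vnorm => h /andP[_ h']; nra.
Qed.

Lemma vnormZ c f : vnorm (c *: f) = cabs c * vnorm f.
Proof.
apply/eqP; rewrite -(eqrXn2 (n := 2)) ?mulr_ge0 ?vnorm_ge0 ?cabs_ge0 // exprMn !sqr_vnorm.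
apply/eqP/complexI; rewrite -dotff dotZr dotZl mulrCA mulrA rmorphM /= cabs_sqr dotff; ring.
Qed.

Lemma vnormN f : vnorm (- f) = vnorm f.
Proof. by rewrite -scaleN1r vnormZ cabsN (cabsR 1) normr1 mul1r. Qed.
Lemma vnorm0 : vnorm 0 = 0.
Proof. by rewrite -(scale0r 0) vnormZ cabs0 mul0r. Qed.
Lemma vdistC f g : vnorm (f - g) = vnorm (g - f).
Proof. by rewrite -vnormN opprB. Qed.

Lemma dot_ext f g : (forall h, dot h f = dot h g) -> f = g.
Proof.
move=> e; apply/eqP; rewrite -subr_eq0; apply/eqP; apply: vnorm_eq0.
by apply/eqP; rewrite sqrtr_eq0 /nsq dotDr dotNr e subrr.
Qed.

Lemma delta_subproof x : (fun y => (y == x)%:R : C) \in @l2fun R X.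
Proof.
apply/asboolP; exists 1 => F.
apply: (@le_trans _ _ (\sum_(y <- (F `|` [fset x])%fset) cabs ((y == x)%:R : C) ^+ 2)).
  by apply: sum_fsub (fsubsetUl _ _) => y; exact: sqr_ge0.
rewrite (big_fsetD1 x) ?inE ?eqxx ?orbT //= (cabsR 1) normr1 expr1n big_seq big1 ?addr0 //.
by move=> y; rewrite !inE => /andP[/negPf -> _]; rewrite cabs0 expr0n.
Qed.

Definition delta x : vec := Vec (delta_subproof x).

Lemma deltaE x y : delta x y = (y == x)%:R. Proof. by []. Qed.

Lemma dot_delta x f : dot (delta x) f = f x.
Proof.
apply: dotE; have := @has_sum_fin R X [fset x]%fset (fun y => conjc (delta x y) * f y).
rewrite big_seq_fset1 deltaE eqxx conjc1 mul1r; apply=> y; rewrite inE deltaE => /negPf ->.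
by rewrite conjc0 mul0r.
Qed.

Lemma dot_delta2 x y : dot (delta x) (delta y) = (x == y)%:R.
Proof. by rewrite dot_delta deltaE. Qed.

Lemma delta_norm x : vnorm (delta x) = 1.
Proof. by rewrite /vnorm /nsq dot_delta2 eqxx sqrtr1. Qed.

Lemma delta_dense f e : 0 < e -> exists F : {fset X},
  vnorm (f - \sum_(x <- F) f x *: delta x) < e.
Proof.
move=> e0; have e2 : 0 < e ^+ 2 / 2 by rewrite divr_gt0 ?exprn_gt0.
have [F hF] := nsq_sum f e2; exists F.
have gE y : (\sum_(x <- F) f x *: delta x) y = if y \in F then f y else 0.
  rewrite vec_sum; case: ifPn => yF.
    rewrite (big_fsetD1 y) // vecZ deltaE eqxx mulr1 big_seq big1 => [|z]; first by rewrite /= addr0.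
    by rewrite !inE vecZ deltaE eq_sym => /andP[/negPf -> _]; rewrite mulr0.
  rewrite big_seq big1 // => z zF; rewrite vecZ deltaE; case: eqP => [yz|]; rewrite ?mulr0 //.
  by rewrite yz zF in yF.
have [g gdef gE'] : exists2 g, g = f - \sum_(x <- F) f x *: delta x &
    forall y, g y = if y \in F then 0 else f y.
  by eexists=> [|y]; [reflexivity|]; rewrite vecB gE; case: ifP; rewrite ?subrr ?subr0.
rewrite -gdef; suff : vnorm g ^+ 2 <= e ^+ 2 / 2 by have := vnorm_ge0 g; nra.
rewrite sqr_vnorm; apply: nsq_le => G.
apply: (@le_trans _ _ (\sum_(x <- (G `\` F)%fset) cabs (f x) ^+ 2)).
  rewrite (big_fsetID _ (fun x => x \in F)) /= [X in X + _]big_seq big1 ?add0r; last first.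
    by move=> x; rewrite !inE => /andP[_ xF]; rewrite gE' xF cabs0 expr0n.
  rewrite le_eqVlt; apply/orP; left; apply/eqP.
  rewrite [LHS](_ : _ = \sum_(x <- (G `\` F)%fset) cabs (g x) ^+ 2).
    rewrite !big_seq; apply: eq_bigr => x; rewrite inE => /andP[/negPf xF _].
    by rewrite gE' xF.
  have -> // : [fset x in G | x \notin F]%fset = (G `\` F)%fset.
  by apply/fsetP => x; rewrite !inE /= andbC.
have := nsq_ge f (F `|` G)%fset; have := hF F (fsubset_refl _).
rewrite -rmorph_sum -rmorphB cabsR (big_fsetID _ (fun x => x \in F) (F `|` G)%fset) /=.
have -> : [fset x in (F `|` G)%fset | x \in F]%fset = F.
  by apply/fsetP => x; rewrite !inE /=; case: (x \in F); rewrite ?andbF.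
have -> : [fset x in (F `|` G)%fset | x \notin F]%fset = (G `\` F)%fset.
  by apply/fsetP => x; rewrite !inE /=; case: (x \in F); rewrite ?orbT ?andbF ?andbT.
rewrite ltr_norml => /andP[]; lra.
Qed.

Lemma vec_complete (u : nat -> vec) :
  (forall e, 0 < e -> exists N, forall m n, (N <= m)%N -> (N <= n)%N -> vnorm (u m - u n) < e) ->
  exists f, forall e, 0 < e -> exists N, forall n, (N <= n)%N -> vnorm (u n - f) < e.
Proof.
move=> h.
have rlim (a : nat -> R) : (forall e, 0 < e -> exists N, forall m n, (N <= m)%N -> (N <= n)%N ->
    `|a m - a n| < e) -> exists l, forall e, 0 < e -> exists N, forall n, (N <= n)%N -> `|a n - l| < e.
  move=> ha; have : cvgn (a : nat -> R^o).
    apply/cauchy_cvgP; apply/cauchy_ballP => e e0; have [N hN] := ha e e0.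
    pose B := a @` [set n | (N <= n)%N].
    exists (B, B); first by split; exists N => // n Nn; exists n.
    by move=> [_ _] [[m Nm <-] [n Nn <-]]; exact: hN.
  move=> /cvg_ex[l hl]; exists l => e e0.
  have /cvgrPdist_lt/(_ e e0)[N _ hN] := hl.
  by exists N => n Nn; rewrite distrC; exact: hN.
have clim x : exists l : C, forall e, 0 < e -> exists N, forall n, (N <= n)%N -> cabs (u n x - l) < e.
  have part (p : C -> R) : (forall z, `|p z| <= cabs z) -> {morph p : z w / z - w} ->
     exists l, forall e, 0 < e -> exists N, forall n, (N <= n)%N -> `|p (u n x) - l| < e.
    move=> p1 pB; apply: rlim => e /h[N hN]; exists N => m n Nm Nn; rewrite -pB.
    apply: le_lt_trans (p1 _) _; rewrite -vecB; apply: le_lt_trans (vnorm_coef _ _) (hN _ _ Nm Nn).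
  have [a ha] := part _ cabs_Re (raddfB _); have [b hb] := part _ cabs_Im (raddfB _).
  exists (a +i* b) => e e0; have e2 : 0 < e / 2 by rewrite divr_gt0.
  have [N hN] := ha _ e2; have [M hM] := hb _ e2; exists (N + M)%N => n Nn.
  have := hN n (leq_trans (leq_addr _ _) Nn); have := hM n (leq_trans (leq_addl _ _) Nn).
  have := cabs_le_ReIm (u n x - (a +i* b)); case: (u n x) => p q /=; lra.
have [f hf] := choice clim.
(* The bound on u n - u M passes to the pointwise limit f on each finite F; M is taken beyond N and
   so large that u M is close to f on F. *)
have tail e : 0 < e -> exists N, forall n, (N <= n)%N -> forall F : {fset X},
    \sum_(x <- F) cabs (u n x - f x) ^+ 2 <= e ^+ 2.
  move=> e0; have [N hN] := h e e0; exists N => n Nn F.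
  apply/ler_addgt0Pr => d d0; pose B := \sum_(x <- F) (2 * e + 2); pose t := Num.min 1 (d / (1 + B)).
  have B0 : 0 <= B by apply: sumr_ge0 => x _; lra.
  have t0 : 0 < t by rewrite lt_min ltr01 divr_gt0 // ltr_pwDl.
  have [M hM] : exists M, (N <= M)%N /\ forall x, x \in F -> cabs (u M x - f x) < t.
    pose g x := xget 0%N [set M | forall n, (M <= n)%N -> cabs (u n x - f x) < t].
    have hg x n' : (g x <= n')%N -> cabs (u n' x - f x) < t.
      have [M hM] := hf x t t0; exact: (@xgetPex _ 0%N [set M | forall n, (M <= n)%N -> _] (ex_intro _ M hM)).
    exists (N + \sum_(x <- F) g x)%N; split; first exact: leq_addr.
    by move=> x xF; apply: hg; rewrite (big_fsetD1 x) //= addnCA leq_addr.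
  case: hM => NM hM.
  apply: (@le_trans _ _ (\sum_(x <- F) (cabs (u n x - u M x) ^+ 2 + t * (2 * e + 2)))).
    rewrite !big_seq; apply: ler_sum => x xF.
    have := cabsD (u n x - u M x) (u M x - f x); rewrite addrA subrK.
    have : cabs (u n x - u M x) <= e.
      by rewrite -vecB; apply: le_trans (vnorm_coef _ _) (ltW (hN _ _ Nn NM)).
    have t1 : t <= 1 by rewrite ge_min lexx.
    move: (hM x xF) (cabs_ge0 (u n x - u M x)) (cabs_ge0 (u n x - f x)) (cabs_ge0 (u M x - f x)).
    move: (cabs _) (cabs _) (cabs _) => p q r; nra.
  rewrite big_split /= -mulr_sumr -/B; apply: lerD.
    apply: le_trans (nsq_ge (u n - u M) F) _; rewrite -sqr_vnorm.
    by rewrite ler_sqr ?nnegrE ?vnorm_ge0 ?(ltW e0) // ltW // hN.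
  have : t <= d / (1 + B) by rewrite ge_min lexx orbT.
  rewrite ler_pdivlMr ?ltr_pwDl //; nra.
have fP : f \in @l2fun R X.
  have [N hN] := tail 1 ltr01; have := hN N (leqnn _) => hF.
  have gP : (fun x => u N x - f x) \in @l2fun R X by apply/asboolP; exists (1 ^+ 2).
  have -> : f = vec_val (u N) - (fun x => u N x - f x).
    by apply/funext => x; rewrite -[RHS]/(u N x - (u N x - f x)) opprB addrC subrK.
  exact: rpredB (vecP (u N)) gP.
exists (Vec fP) => e e0; have [N hN] := tail (e / 2) (divr_gt0 e0 (ltr0Sn _ _)).
exists N => n Nn; apply: le_lt_trans (_ : vnorm _ <= e / 2) _; last by rewrite ltr_pdivrMr // ltr_pMr // ltr1n.
by rewrite vnorm_le ?divr_ge0 ?(ltW e0) //; apply: nsq_le => F; exact: hN.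
Qed.

End Vectors.

(** Collects the axioms with a real-valued norm and sequential completeness; [cstar_of] derives the
    uniform structure from them once, for operator algebras and for their subalgebras. *)
Record cstar_data (R : realType) := CstarData {
  cd_car : lmodType R[i];
  cd_norm : cd_car -> R;
  cd_mul : cd_car -> cd_car -> cd_car;
  cd_adj : cd_car -> cd_car;
  cd_one : cd_car;
  cd_normD : forall x y, cd_norm (x + y) <= cd_norm x + cd_norm y;
  cd_normZ : forall (c : R[i]) x, cd_norm (c *: x) = cabs c * cd_norm x;
  cd_norm_eq0 : forall x, cd_norm x = 0 -> x = 0;
  cd_complete : forall u : nat -> cd_car,
    (forall e, 0 < e -> exists N, forall m n, (N <= m)%N -> (N <= n)%N ->
       cd_norm (u m - u n) < e) ->
    exists l, forall e, 0 < e -> exists N, forall n, (N <= n)%N -> cd_norm (u n - l) < e;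
  cd_mulA : forall x y z, cd_mul x (cd_mul y z) = cd_mul (cd_mul x y) z;
  cd_mulDl : forall x y z, cd_mul (x + y) z = cd_mul x z + cd_mul y z;
  cd_mulDr : forall x y z, cd_mul x (y + z) = cd_mul x y + cd_mul x z;
  cd_mulZl : forall (c : R[i]) x y, cd_mul (c *: x) y = c *: cd_mul x y;
  cd_mulZr : forall (c : R[i]) x y, cd_mul x (c *: y) = c *: cd_mul x y;
  cd_adjK : forall x, cd_adj (cd_adj x) = x;
  cd_adjD : forall x y, cd_adj (x + y) = cd_adj x + cd_adj y;
  cd_adjZ : forall (c : R[i]) x, cd_adj (c *: x) = conjc c *: cd_adj x;
  cd_adjM : forall x y, cd_adj (cd_mul x y) = cd_mul (cd_adj y) (cd_adj x);
  cd_normM : forall x y, cd_norm (cd_mul x y) <= cd_norm x * cd_norm y;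
  cd_cstar : forall x, cd_norm (cd_mul (cd_adj x) x) = cd_norm x ^+ 2;
  cd_mul1x : forall x, cd_mul cd_one x = x;
  cd_mulx1 : forall x, cd_mul x cd_one = x }.

Definition cstar_of (R : realType) (D : cstar_data R) : Type := cd_car D.

Section CstarOf.
Variables (R : realType) (D : cstar_data R).
Local Notation T := (cstar_of D).

HB.instance Definition _ := GRing.Lmodule.on T.

Let norm (x : T) : R[i] := (cd_norm x)%:C.
Let norm_D (x y : T) : norm (x + y) <= norm x + norm y.
Proof. by rewrite -rmorphD lecR cd_normD. Qed.
Let norm_Z (c : R[i]) (x : T) : norm (c *: x) = `|c| * norm x.
Proof. by rewrite /norm cd_normZ rmorphM /= -cabsE. Qed.
Let norm_eq0 (x : T) : norm x = 0 -> x = 0.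
Proof. by move=> h; apply: cd_norm_eq0; exact: complexI h. Qed.

Let norm_C (x y : T) : cd_norm (x - y) = cd_norm (y - x).
Proof.
by rewrite -[x - y]opprB -scaleN1r cd_normZ cabsN (cabsR 1) normr1 mul1r.
Qed.

HB.instance Definition _ := Lmodule_isNormed.Build R[i] T norm_D norm_Z norm_eq0.

Lemma cstar_of_ball (x y : T) (r : R) : ball x r%:C y <-> cd_norm (x - y : T) < r.
Proof. by rewrite -ball_normE /= ltcR. Qed.

Let cauchy_cvg (F : set_system T) : ProperFilter F -> cauchy F -> cvg F.
Proof.
move=> FF /cauchyP h.
(* The centers of balls of radius 1/(n+1) that belong to the Cauchy filter form a Cauchy sequence;
   its limit is the limit of the filter. *)
have /choice[a ha] : forall n : nat, exists x : T, F (ball x (n.+1%:R^-1 : R)%:C).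
  by move=> n; apply: h; rewrite ltcR invr_gt0 ltr0Sn.
have sm e : 0 < e -> exists N, forall n, (N <= n)%N -> (n.+1%:R^-1 : R) < e.
  move=> e0; exists (Num.truncn e^-1) => n Nn; rewrite invf_plt ?posrE ?ltr0Sn //.
  by apply: lt_le_trans (truncnS_gt _) _; rewrite ler_nat.
have [e e0|l hl] := @cd_complete R D a.
  have e2 : 0 < e / 2 by rewrite divr_gt0.
  have [N hN] := sm _ e2; exists N => m n Nm Nn.
  have [z [/cstar_of_ball zm /cstar_of_ball zn]] := filter_ex (filterI (ha m) (ha n)).
  have := cd_normD (a m - z : T) (z - a n : T); rewrite addrA subrK.
  rewrite (norm_C z).
  move=> /le_lt_trans; apply; rewrite [ltRHS]splitr.
  by apply: Num.Theory.ltrD; [exact: lt_trans zm (hN m Nm)|exact: lt_trans zn (hN n Nn)].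
apply/cvg_ex; exists l; apply/cvgrPdist_lt => e /gt0_complexP[r r0 ->].
have r2 : 0 < r / 2 by rewrite divr_gt0.
have [N hN] := hl _ r2; have [M hM] := sm _ r2; pose n := (N + M)%N.
apply: filterS (ha n) => z /cstar_of_ball zn; rewrite ltcR.
have := cd_normD (l - a n : T) (a n - z : T); rewrite addrA subrK.
rewrite (norm_C l (a n)).
move=> /le_lt_trans; apply; rewrite [ltRHS]splitr.
by apply: Num.Theory.ltrD; [exact: hN (leq_addr _ _)|exact: lt_trans zn (hM n (leq_addl _ _))].
Qed.

HB.instance Definition _ := Uniform_isComplete.Build T cauchy_cvg.

Let adj_cstar (x : T) : `|cd_mul (cd_adj x) x : T| = `|x| ^+ 2.
Proof. by rewrite -[LHS]/(norm _) -[X in X ^+ 2]/(norm _) /norm cd_cstar rmorphXn. Qed.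
Let normM (x y : T) : `|cd_mul x y : T| <= `|x| * `|y|.
Proof.
by rewrite -[leLHS]/(norm _) -[X in X * _]/(norm _) -[X in _ * X]/(norm _) /norm -rmorphM lecR cd_normM.
Qed.

HB.instance Definition _ := CompleteNormedModule_isCstarAlgebra.Build R T
  (@cd_mulA R D) (@cd_mulDl R D) (@cd_mulDr R D) (@cd_mulZl R D) (@cd_mulZr R D)
  (@cd_adjK R D) (@cd_adjD R D) (@cd_adjZ R D) (@cd_adjM R D) normM adj_cstar.
HB.instance Definition _ := CstarAlgebra_isUnital.Build R T (@cd_mul1x R D) (@cd_mulx1 R D).

End CstarOf.

(** * Uniformly bounded families of operators on l^2(X) *)

Section Operators.
Variables (R : realType) (I : Type) (X : choiceType).
Local Notation C := R[i].
Local Notation V := (vec R X).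

(** For I = [unit] these are the bounded operators; O_2 uses a product over a large I. Linearity
    follows from the existence of an adjoint, see [opD] and [opZ]. *)
Definition opfam : {pred I -> V -> V} := fun T => `[< exists (T' : I -> V -> V) (K : R),
  forall i f g, dot (T i f) g = dot f (T' i g) /\ vnorm (T i f) <= K * vnorm f >].

Lemma opfam_submod : submod_closed opfam.
Proof.
split=> [|c T S /asboolP[T' [K hK]] /asboolP[S' [L hL]]].
  apply/asboolP; exists (fun _ _ => 0), 0 => i f g.
  by rewrite -[(0 : I -> V -> V) i f]/(0 : V) dot0l dot0r vnorm0 mul0r.
apply/asboolP; exists (fun i g => conjc c *: T' i g + S' i g), (cabs c * K + L) => i f g.
rewrite -[(c *: T + S) i f]/(c *: T i f + S i f) !dot_expand.
have [-> hT] := hK i f g; have [-> hS] := hL i f g; split=> //.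
apply: le_trans (vnormD _ _) _; rewrite vnormZ mulrDl -mulrA lerD //.
by rewrite ler_wpM2l ?cabs_ge0.
Qed.

Record ops := Ops { op_val :> I -> V -> V; opP : op_val \in opfam }.
HB.instance Definition _ := [isSub for op_val].
HB.instance Definition _ := [Choice of ops by <:].
HB.instance Definition _ := GRing.isSubmodClosed.Build _ _ opfam opfam_submod.
HB.instance Definition _ := [SubChoice_isSubLmodule of ops by <:].

Implicit Types (T S U : ops) (i : I) (f g : V) (c : C).

Definition opadj T : I -> V -> V := projT1 (cid (asboolW (opP T))).
Lemma opadjP T i f g : dot (T i f) g = dot f (opadj T i g).
Proof. by rewrite /opadj; case: cid => T' /= [K /(_ i f g)[]]. Qed.
Lemma op_bounded T : exists2 K, 0 <= K & forall i f, vnorm (T i f) <= K * vnorm f.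
Proof.
have [T' [K hK]] := asboolW (opP T); exists `|K| => // i f.
by have [_ /le_trans] := hK i f f; apply; rewrite ler_wpM2r ?vnorm_ge0 ?ler_norm.
Qed.

Lemma op_eq T S : (forall i f, T i f = S i f) -> T = S.
Proof. by move=> h; apply: val_inj; apply/funext => i; apply/funext => f; exact: h. Qed.

Lemma opD T i f g : T i (f + g) = T i f + T i g.
Proof. by apply: dot_ext => h; rewrite dotDr !(dotC _ h) !opadjP dotDl rmorphD. Qed.
Lemma opZ T i c f : T i (c *: f) = c *: T i f.
Proof. by apply: dot_ext => h; rewrite dotZr !(dotC _ h) !opadjP dotZl rmorphM /= conjcK. Qed.
Lemma op0 T i : T i 0 = 0.
Proof. by have := opZ T i 0 0; rewrite !scale0r. Qed.
Lemma opDE T S i f : (T + S) i f = T i f + S i f. Proof. by []. Qed.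
Lemma opBE T S i f : (T - S) i f = T i f - S i f. Proof. by []. Qed.
Lemma opZE c T i f : (c *: T) i f = c *: T i f. Proof. by []. Qed.

Lemma opadj_le T K : (forall i f, vnorm (T i f) <= K * vnorm f) ->
  forall i f, vnorm (opadj T i f) <= K * vnorm f.
Proof.
move=> hK i f; set g := opadj T i f.
have [g0|g0] := eqVneq (vnorm g) 0.
  have K0 : 0 <= K * vnorm f by apply: le_trans (hK i f); exact: vnorm_ge0.
  by rewrite g0.
have gp : 0 < vnorm g by rewrite lt_neqAle eq_sym g0 vnorm_ge0.
have := dot_le (T i g) f; rewrite opadjP dot_vnorm cabsR ger0_norm ?sqr_ge0 // => h.
have := le_trans h (ler_wpM2r (vnorm_ge0 f) (hK i g)).
by rewrite expr2 mulrAC ler_pM2r.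
Qed.

(** The value 0 keeps the set inhabited when I is empty. *)
Definition op_norm T : R := sup [set r | r = 0 \/ exists i f, vnorm f <= 1 /\ r = vnorm (T i f)].

Let norm_set_has_sup T :
  has_sup [set r | r = 0 \/ exists i f, vnorm f <= 1 /\ r = vnorm (T i f)].
Proof.
split; first by exists 0; left.
have [K K0 hK] := op_bounded T; exists K => r [->//|[i [f [f1 ->]]]].
by apply: le_trans (hK i f) _; rewrite -[leRHS]mulr1 ler_wpM2l.
Qed.

Lemma op_norm_ge0 T : 0 <= op_norm T.
Proof. by apply: ub_le_sup; [exact: (norm_set_has_sup T).2|left]. Qed.

Lemma op_norm_le T K : 0 <= K -> (forall i f, vnorm (T i f) <= K * vnorm f) -> op_norm T <= K.
Proof.
move=> K0 hK; apply: ge_sup; first exact: (norm_set_has_sup T).1.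
by move=> r [->//|[i [f [f1 ->]]]]; apply: le_trans (hK i f) _; rewrite -[leRHS]mulr1 ler_wpM2l.
Qed.

Lemma op_le T i f : vnorm (T i f) <= op_norm T * vnorm f.
Proof.
have [->|fn] := eqVneq f 0; first by rewrite op0 vnorm0 mulr0.
have f0 : 0 < vnorm f.
  by rewrite lt_neqAle vnorm_ge0 andbT eq_sym; apply: contraNneq fn => /vnorm_eq0 ->.
rewrite -ler_pdivrMr // mulrC.
have -> : (vnorm f)^-1 * vnorm (T i f) = vnorm (T i ((vnorm f)^-1%:C *: f)).
  by rewrite opZ vnormZ cabsR ger0_norm // invr_ge0 ltW.
apply: ub_le_sup; first exact: (norm_set_has_sup T).2.
right; exists i, ((vnorm f)^-1%:C *: f); split=> //.
by rewrite vnormZ cabsR ger0_norm ?invr_ge0 ?(ltW f0) // mulVf ?gt_eqF.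
Qed.

Lemma op_norm_attained T e : 0 < e -> e < op_norm T ->
  exists i f, vnorm f <= 1 /\ op_norm T - e < vnorm (T i f).
Proof.
move=> e0 eT; have [r [->|[i [f [f1 ->]]]] h] := sup_adherent e0 (norm_set_has_sup T).
  by move: h; rewrite -/(op_norm T) subr_lt0 ltNge (ltW eT).
by exists i, f.
Qed.

Lemma adj_subproof T : opadj T \in opfam.
Proof.
apply/asboolP; have [K _ hK] := op_bounded T; exists T, K => i f g; split.
  by rewrite dotC -opadjP -dotC.
exact: opadj_le.
Qed.
Definition op_adj T := Ops (adj_subproof T).

Lemma op_adjP T i f g : dot (T i f) g = dot f (op_adj T i g).
Proof. exact: opadjP. Qed.

Lemma op_adj_uniq T S : (forall i f g, dot (T i f) g = dot f (S i g)) -> op_adj T = S.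
Proof. by move=> h; apply: op_eq => i f; apply: dot_ext => g; rewrite -op_adjP. Qed.

Lemma mul_subproof T S : (fun i f => T i (S i f)) \in opfam.
Proof.
apply/asboolP; have [K K0 hK] := op_bounded T; have [L L0 hL] := op_bounded S.
exists (fun i f => op_adj S i (op_adj T i f)), (K * L) => i f g; split.
  by rewrite !op_adjP.
by apply: le_trans (hK _ _) _; rewrite -mulrA ler_wpM2l.
Qed.
Definition op_mul T S := Ops (mul_subproof T S).

Lemma one_subproof : (fun (i : I) f => f) \in opfam.
Proof. by apply/asboolP; exists (fun _ f => f), 1 => i f g; rewrite mul1r. Qed.
Definition op_one := Ops one_subproof.

Lemma op_adjK T : op_adj (op_adj T) = T.
Proof. by apply: op_adj_uniq => i f g; rewrite dotC -op_adjP -dotC. Qed.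

(** The adjoints have to converge too: their limit is the adjoint that [opfam] asks for. *)
Lemma strong_limit (u : nat -> ops) (K : R) :
  (forall n i f, vnorm (u n i f) <= K * vnorm f) ->
  (forall i f e, 0 < e -> exists N, forall m n, (N <= m)%N -> (N <= n)%N ->
     vnorm (u m i f - u n i f) < e) ->
  (forall i f e, 0 < e -> exists N, forall m n, (N <= m)%N -> (N <= n)%N ->
     vnorm (op_adj (u m) i f - op_adj (u n) i f) < e) ->
  exists T, forall i f e, 0 < e -> exists N, forall n, (N <= n)%N ->
     vnorm (u n i f - T i f) < e /\ vnorm (op_adj (u n) i f - op_adj T i f) < e.
Proof.
move=> hK cu cu'.
have lim (v : nat -> ops) : (forall i f e, 0 < e -> exists N, forall m n, (N <= m)%N -> (N <= n)%N ->
     vnorm (v m i f - v n i f) < e) -> exists L : I * V -> V, forall p e, 0 < e ->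
     exists N, forall n, (N <= n)%N -> vnorm (v n p.1 p.2 - L p) < e.
  move=> cv; have /choice[L hL] : forall p : I * V, exists l : V, forall e, 0 < e ->
      exists N, forall n, (N <= n)%N -> vnorm (v n p.1 p.2 - l) < e.
    by move=> [i f]; apply: (vec_complete (u := fun n => v n i f)) => e; exact: cv.
  by exists L.
have [L hL] := lim u cu; have [L' hL'] := lim (fun n => op_adj (u n)) cu'.
have LP : (fun i f => L (i, f)) \in opfam.
  apply/asboolP; exists (fun i f => L' (i, f)), K => i f g; split; last first.
    apply/ler_addgt0Pr => e /(hL (i, f))[N /(_ N (leqnn _)) /= h].
    have := vnormD (L (i, f) - u N i f) (u N i f); rewrite subrK vdistC.
    by have := hK N i f; lra.
  apply/eqP; rewrite -subr_eq0; apply/eqP/cabs_eq0/eqP.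
  rewrite eq_le cabs_ge0 andbT; apply/ler_addgt0Pr => e e0; rewrite add0r.
  pose d := e / (1 + vnorm f + vnorm g).
  have s0 : 0 < 1 + vnorm f + vnorm g by have := vnorm_ge0 f; have := vnorm_ge0 g; lra.
  have d0 : 0 < d by rewrite divr_gt0.
  have [N hN] := hL (i, f) d d0; have [M hM] := hL' (i, g) d d0.
  have h1 := hN (N + M)%N (leq_addr _ _); have h2 := hM (N + M)%N (leq_addl _ _).
  move: h1 h2; move: (N + M)%N => n /= h1 h2.
  have -> : dot (L (i, f)) g - dot f (L' (i, g)) =
    - dot (u n i f - L (i, f)) g + dot f (op_adj (u n) i g - L' (i, g)).
    by rewrite !dot_expand op_adjP; ring.
  have := cabsD (- dot (u n i f - L (i, f)) g) (dot f (op_adj (u n) i g - L' (i, g))).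
  rewrite cabsN; have := dot_le (u n i f - L (i, f)) g.
  have := dot_le f (op_adj (u n) i g - L' (i, g)).
  have ed : e = d * (1 + vnorm f + vnorm g) by rewrite /d divfK // gt_eqF.
  move: (vnorm_ge0 f) (vnorm_ge0 g) h1 h2; rewrite ed.
  move: (vnorm (_ - _)) (vnorm (_ - _)) (vnorm f) (vnorm g) => p q r s; nra.
exists (Ops LP) => i f e e0; have [N hN] := hL (i, f) e e0; have [M hM] := hL' (i, f) e e0.
have E : op_adj (Ops LP) i f = L' (i, f).
  apply: dot_ext => g; rewrite -op_adjP /=.
  apply/eqP; rewrite -subr_eq0; apply/eqP/cabs_eq0/eqP.
  rewrite eq_le cabs_ge0 andbT; apply/ler_addgt0Pr => d d0; rewrite add0r.
  pose t := d / (1 + vnorm f + vnorm g).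
  have s0 : 0 < 1 + vnorm f + vnorm g by have := vnorm_ge0 f; have := vnorm_ge0 g; lra.
  have t0 : 0 < t by rewrite divr_gt0.
  have [P hP] := hL (i, g) t t0; have [Q hQ] := hL' (i, f) t t0.
  have h1 := hP (P + Q)%N (leq_addr _ _); have h2 := hQ (P + Q)%N (leq_addl _ _).
  move: h1 h2; move: (P + Q)%N => n /= h1 h2.
  have -> : dot (L (i, g)) f - dot g (L' (i, f)) =
    - dot (u n i g - L (i, g)) f + dot g (op_adj (u n) i f - L' (i, f)).
    by rewrite !dot_expand op_adjP; ring.
  have := cabsD (- dot (u n i g - L (i, g)) f) (dot g (op_adj (u n) i f - L' (i, f))).
  rewrite cabsN; have := dot_le (u n i g - L (i, g)) f.
  have := dot_le g (op_adj (u n) i f - L' (i, f)).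
  have ed : d = t * (1 + vnorm f + vnorm g) by rewrite /t divfK // gt_eqF.
  move: (vnorm_ge0 f) (vnorm_ge0 g) h1 h2; rewrite ed.
  move: (vnorm (_ - _)) (vnorm (_ - _)) (vnorm f) (vnorm g) => p q r s; nra.
exists (N + M)%N => n Nn; rewrite E; split; first exact: hN (leq_trans (leq_addr _ _) Nn).
exact: hM (leq_trans (leq_addl _ _) Nn).
Qed.

Lemma op_adjD T S : op_adj (T + S) = op_adj T + op_adj S.
Proof. by apply: op_adj_uniq => i f g; rewrite !opDE dotDl dotDr !op_adjP. Qed.
Lemma op_adjZ c T : op_adj (c *: T) = conjc c *: op_adj T.
Proof. by apply: op_adj_uniq => i f g; rewrite !opZE dotZl dotZr !op_adjP. Qed.
Lemma op_adjM T S : op_adj (op_mul T S) = op_mul (op_adj S) (op_adj T).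
Proof. by apply: op_adj_uniq => i f g; rewrite /= !op_adjP. Qed.

Lemma op_normD T S : op_norm (T + S) <= op_norm T + op_norm S.
Proof.
apply: op_norm_le => [|i f]; first by rewrite addr_ge0 ?op_norm_ge0.
by rewrite opDE mulrDl; apply: le_trans (vnormD _ _) _; rewrite lerD ?op_le.
Qed.

Lemma op_normZ c T : op_norm (c *: T) = cabs c * op_norm T.
Proof.
have le d S : op_norm (d *: S) <= cabs d * op_norm S.
  apply: op_norm_le => [|i f]; first by rewrite mulr_ge0 ?op_norm_ge0 ?cabs_ge0.
  by rewrite opZE vnormZ -mulrA ler_wpM2l ?cabs_ge0 ?op_le.
apply/eqP; rewrite eq_le le; have [->|c0] := eqVneq c 0.
  by rewrite cabs0 mul0r op_norm_ge0.
have := le c^-1 (c *: T); rewrite scalerA mulVf // scale1r => h.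
have cc : cabs c * cabs c^-1 = 1 by rewrite -cabsM mulfV // (cabsR 1) normr1.
by apply: le_trans (ler_wpM2l (cabs_ge0 c) h) _; rewrite mulrA cc mul1r.
Qed.

Lemma op_norm_eq0 T : op_norm T = 0 -> T = 0.
Proof.
move=> h; apply: op_eq => i f; apply: vnorm_eq0; apply/eqP.
by rewrite eq_le vnorm_ge0 andbT; have := op_le T i f; rewrite h mul0r.
Qed.

Lemma op_normM T S : op_norm (op_mul T S) <= op_norm T * op_norm S.
Proof.
apply: op_norm_le => [|i f]; first by rewrite mulr_ge0 ?op_norm_ge0.
by apply: le_trans (op_le T i (S i f)) _; rewrite -mulrA ler_wpM2l ?op_norm_ge0 ?op_le.
Qed.

Lemma op_norm_adj T : op_norm (op_adj T) <= op_norm T.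
Proof. by apply: op_norm_le => [|i f]; [exact: op_norm_ge0|apply: opadj_le => ? ?; exact: op_le]. Qed.

Lemma op_cstar T : op_norm (op_mul (op_adj T) T) = op_norm T ^+ 2.
Proof.
apply/eqP; rewrite eq_le; apply/andP; split.
  by apply: le_trans (op_normM _ _) _; rewrite expr2 ler_wpM2r ?op_norm_ge0 ?op_norm_adj.
set m := op_norm (op_mul _ _); have m0 : 0 <= m by exact: op_norm_ge0.
have : op_norm T <= Num.sqrt m.
  apply: op_norm_le => [|i f]; first exact: sqrtr_ge0.
  have := dot_le f (op_mul (op_adj T) T i f); rewrite /= -op_adjP dot_vnorm cabsR.
  rewrite ger0_norm ?sqr_ge0 // => h.
  have h' := le_trans h (ler_wpM2l (vnorm_ge0 f) (op_le (op_mul (op_adj T) T) i f)).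
  rewrite -(ler_pXn2r (n := 2)) ?nnegrE ?mulr_ge0 ?sqrtr_ge0 ?vnorm_ge0 //.
  by apply: le_trans h' _; rewrite exprMn sqr_sqrtr // -/m; apply: eq_ler; ring.
by move=> h; rewrite -(sqr_sqrtr m0) ler_sqr ?nnegrE ?sqrtr_ge0 ?op_norm_ge0.
Qed.

Lemma op_complete (u : nat -> ops) :
  (forall e, 0 < e -> exists N, forall m n, (N <= m)%N -> (N <= n)%N -> op_norm (u m - u n) < e) ->
  exists T, forall e, 0 < e -> exists N, forall n, (N <= n)%N -> op_norm (u n - T) < e.
Proof.
move=> cu.
have cauchy (v : nat -> ops) : (forall m n, op_norm (v m - v n) <= op_norm (u m - u n)) ->
    forall i f e, 0 < e -> exists N, forall m n, (N <= m)%N -> (N <= n)%N -> vnorm (v m i f - v n i f) < e.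
  move=> vu i f e e0; have s0 : 0 < 1 + vnorm f by have := vnorm_ge0 f; lra.
  have [N hN] := cu (e / (1 + vnorm f)) (divr_gt0 e0 s0).
  exists N => m n Nm Nn; rewrite -opBE; apply: le_lt_trans (op_le _ _ _) _.
  have := hN m n Nm Nn; rewrite ltr_pdivlMr //; have := vu m n.
  move: (vnorm_ge0 f) (op_norm_ge0 (v m - v n)) (op_norm_ge0 (u m - u n)).
  move: (op_norm _) (op_norm _) (vnorm f) => p q r; nra.
have [N0 hN0] := cu 1 ltr01.
pose w n := u (N0 + n)%N.
have [|||T hT] := @strong_limit w (op_norm (u N0) + 1).
- move=> n i f; apply: le_trans (op_le _ _ _) _; rewrite ler_wpM2r ?vnorm_ge0 //.
  have := op_normD (u N0) (w n - u N0); rewrite addrC subrK.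
  by have := hN0 (N0 + n)%N N0 (leq_addr _ _) (leqnn _); rewrite -/(w n); lra.
- move=> i f e /(cauchy u (fun _ _ => lexx _) i f)[N hN]; exists N => m n Nm Nn.
  by apply: hN; apply: leq_trans (leq_addl _ _).
- have hv m n : op_norm (op_adj (u m) - op_adj (u n)) <= op_norm (u m - u n).
    have -> : op_adj (u m) - op_adj (u n) = op_adj (u m - u n).
      by rewrite -[- u n]scaleN1r op_adjD op_adjZ rmorphN rmorph1 scaleN1r.
    exact: op_norm_adj.
  move=> i f e /(cauchy (fun n => op_adj (u n)) hv i f)[N hN]; exists N => m n Nm Nn.
  by apply: hN; apply: leq_trans (leq_addl _ _).
exists T => e e0; have e2 : 0 < e / 2 by rewrite divr_gt0.
have [N hN] := cu _ e2; exists N => n Nn.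
apply: le_lt_trans (_ : e / 2 < e); last by rewrite ltr_pdivrMr // ltr_pMr // ltr1n.
apply: op_norm_le => [|i f]; first exact: ltW.
apply/ler_addgt0Pr => d d0; have [M hM] := hT i f d d0.
have [h _] := hM (N + M)%N (leq_addl _ _).
rewrite opBE; have := vnormD (u n i f - w (N + M)%N i f) (w (N + M)%N i f - T i f).
rewrite addrA subrK; have := op_le (u n - w (N + M)%N) i f; rewrite opBE.
have := hN n (N0 + (N + M))%N Nn _; rewrite addnCA leq_addr => /(_ isT).
rewrite addnCA -/(w _) => h1 h2 h3; apply: le_trans h3 _; rewrite lerD ?(ltW h) //.
by apply: le_trans h2 _; rewrite ler_wpM2r ?vnorm_ge0 ?(ltW h1).
Qed.

Definition ops_data : cstar_data R.
Proof.
refine (@CstarData R ops op_norm op_mul op_adj op_one op_normD op_normZ op_norm_eq0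
  op_complete _ _ _ _ _ op_adjK op_adjD op_adjZ op_adjM op_normM op_cstar _ _).
- by move=> x y z; exact: op_eq.
- by move=> x y z; exact: op_eq.
- by move=> x y z; apply: op_eq => i f /=; rewrite opD.
- by move=> c x y; exact: op_eq.
- by move=> c x y; apply: op_eq => i f /=; rewrite opZ.
- by move=> x; exact: op_eq.
- by move=> x; exact: op_eq.
Defined.

Record operator_algebra (B : unitalCstarType R) := OperatorAlgebra {
  oa_op : B -> I -> V -> V;
  oa_mul : forall (T S : B) i f, oa_op (T ** S) i f = oa_op T i (oa_op S i f);
  oa_adj : forall (T : B) i f g, dot (oa_op T i f) g = dot f (oa_op T^† i g);
  oa_one : forall i f, oa_op (cone B) i f = f;
  oa_add : forall (T S : B) i f, oa_op (T + S) i f = oa_op T i f + oa_op S i f;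
  oa_scale : forall c (T : B) i f, oa_op (c *: T) i f = c *: oa_op T i f;
  oa_eq : forall T S : B, (forall i f, oa_op T i f = oa_op S i f) -> T = S;
  oa_le : forall (T : B) i f, vnorm (oa_op T i f) <= rnorm T * vnorm f;
  oa_norm_le : forall (T : B) K, 0 <= K -> (forall i f, vnorm (oa_op T i f) <= K * vnorm f) ->
    rnorm T <= K;
  oa_attained : forall (T : B) e, 0 < e -> e < rnorm T ->
    exists i f, vnorm f <= 1 /\ rnorm T - e < vnorm (oa_op T i f);
  oa_mk : forall F, F \in opfam -> B;
  oa_mkE : forall F (FP : F \in opfam), oa_op (oa_mk FP) = F }.

(* Sealing the construction keeps conversion from unfolding it. *)
Lemma operator_algebra_exists : {B : unitalCstarType R & operator_algebra B}.
Proof.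
exists (cstar_of ops_data : unitalCstarType R).
refine (@OperatorAlgebra (cstar_of ops_data) (fun T => op_val (T : ops)) _ _ _ _ _ _ _ _ _
  (fun F FP => Ops FP) _) => //.
- by move=> T i f g; exact: op_adjP.
- exact: op_eq.
- exact: op_le.
- exact: op_norm_le.
- exact: op_norm_attained.
Qed.

Definition bops : unitalCstarType R := projT1 operator_algebra_exists.
Definition bops_oa : operator_algebra bops := projT2 operator_algebra_exists.

Definition bop (T : bops) : I -> V -> V := oa_op bops_oa T.
Definition mkbop F (FP : F \in opfam) : bops := oa_mk bops_oa FP.

Lemma mkbopE F (FP : F \in opfam) : bop (mkbop FP) = F.
Proof. exact: oa_mkE. Qed.
Lemma bop_mul (T S : bops) i f : bop (T ** S) i f = bop T i (bop S i f).
Proof. exact: oa_mul. Qed.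
Lemma bop_adj (T : bops) i f g : dot (bop T i f) g = dot f (bop T^† i g).
Proof. exact: oa_adj. Qed.
Lemma bop_one i f : bop (cone bops) i f = f.
Proof. exact: oa_one. Qed.
Lemma bopDE (T S : bops) i f : bop (T + S) i f = bop T i f + bop S i f.
Proof. exact: oa_add. Qed.
Lemma bopZE c (T : bops) i f : bop (c *: T) i f = c *: bop T i f.
Proof. exact: oa_scale. Qed.
Lemma bopNE (T : bops) i f : bop (- T) i f = - bop T i f.
Proof. by rewrite -scaleN1r bopZE scaleN1r. Qed.
Lemma bop0E i f : bop 0 i f = 0.
Proof. by rewrite -(scale0r 0) bopZE scale0r. Qed.
Lemma bopD (T : bops) i f g : bop T i (f + g) = bop T i f + bop T i g.
Proof. by apply: dot_ext => h; rewrite dotDr !(dotC _ h) !bop_adj dotDl rmorphD. Qed.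
Lemma bopZ (T : bops) i c f : bop T i (c *: f) = c *: bop T i f.
Proof. by apply: dot_ext => h; rewrite dotZr !(dotC _ h) !bop_adj dotZl rmorphM /= conjcK. Qed.
Lemma bopN (T : bops) i f : bop T i (- f) = - bop T i f.
Proof. by rewrite -scaleN1r bopZ scaleN1r. Qed.
Lemma bop0 (T : bops) i : bop T i 0 = 0.
Proof. by have := bopZ T i 0 0; rewrite !scale0r. Qed.
Lemma bop_sum (T : bops) i J (s : seq J) (F : J -> V) :
  bop T i (\sum_(j <- s) F j) = \sum_(j <- s) bop T i (F j).
Proof. by apply: (big_morph (bop T i) (bopD T i)); exact: bop0. Qed.
Lemma bop_sumE J (s : seq J) (F : J -> bops) i f :
  bop (\sum_(j <- s) F j) i f = \sum_(j <- s) bop (F j) i f.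
Proof.
by elim: s => [|j s IH]; rewrite ?big_nil ?bop0E // !big_cons bopDE IH.
Qed.
Lemma bop_le (T : bops) i f : vnorm (bop T i f) <= rnorm T * vnorm f.
Proof. exact: oa_le. Qed.
Lemma rnorm_bop_le (T : bops) K : 0 <= K -> (forall i f, vnorm (bop T i f) <= K * vnorm f) ->
  rnorm T <= K.
Proof. exact: oa_norm_le. Qed.
Lemma rnorm_bop_attained (T : bops) e : 0 < e -> e < rnorm T ->
  exists i f, vnorm f <= 1 /\ rnorm T - e < vnorm (bop T i f).
Proof. exact: oa_attained. Qed.
Lemma bop_eq (T S : bops) : (forall i f, bop T i f = bop S i f) -> T = S.
Proof. exact: oa_eq. Qed.

Lemma bop_adj_uniq (T S : bops) : (forall i f g, dot (bop T i f) g = dot f (bop S i g)) -> T^† = S.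
Proof. by move=> h; apply: bop_eq => i f; apply: dot_ext => g; rewrite -bop_adj. Qed.

Lemma bop_opfam (T : bops) : bop T \in opfam.
Proof.
apply/asboolP; exists (bop T^†), (rnorm T) => i f g; split; first exact: bop_adj.
exact: bop_le.
Qed.

Lemma bop_strong_limit (u : nat -> bops) (K : R) :
  (forall n i f, vnorm (bop (u n) i f) <= K * vnorm f) ->
  (forall i f e, 0 < e -> exists N, forall m n, (N <= m)%N -> (N <= n)%N ->
     vnorm (bop (u m) i f - bop (u n) i f) < e) ->
  (forall i f e, 0 < e -> exists N, forall m n, (N <= m)%N -> (N <= n)%N ->
     vnorm (bop (u m)^† i f - bop (u n)^† i f) < e) ->
  exists T : bops, forall i f e, 0 < e -> exists N, forall n, (N <= n)%N ->
     vnorm (bop (u n) i f - bop T i f) < e.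
Proof.
move=> h1 h2 h3; pose v n := Ops (bop_opfam (u n)).
have vadj n i f : op_adj (v n) i f = bop (u n)^† i f.
  by apply: dot_ext => g; rewrite -op_adjP -bop_adj.
have [|||T hT] := @strong_limit v K; [exact: h1|exact: h2| |].
  by move=> i f e /(h3 i f)[N hN]; exists N => m n Nm Nn; rewrite !vadj hN.
exists (mkbop (opP T)) => i f e /(hT i f)[N hN]; exists N => n /hN[].
by rewrite mkbopE.
Qed.

Lemma bop_delta_ext (T S : bops) : (forall i x, bop T i (delta R x) = bop S i (delta R x)) -> T = S.
Proof.
move=> h; apply: bop_eq => i f; apply: dot_ext => g; rewrite dotC [RHS]dotC !bop_adj.
congr (conjc (dot f _)); apply: vec_ext => x.
by rewrite -!dot_delta -!bop_adj h.
Qed.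

End Operators.

(** * Closed unital subalgebras as C*-algebras *)

Section Subalgebras.
Variables (R : realType) (A : unitalCstarType R).

Record unital_subalgebra := UnitalSubalgebra {
  us_set :> A -> Prop;
  us_star : star_subalgebra us_set;
  us_one : us_set (cone A) }.

Variable S : unital_subalgebra.

Definition sub_pred : {pred A} := fun x => `[< S x >].

Lemma sub_submod : submod_closed sub_pred.
Proof.
have sS := us_star S; split=> [|c x y /asboolP Sx /asboolP Sy]; apply/asboolP.
  exact: ssub0 sS.
by apply: (ssubD sS) => //; exact: (ssubZ sS).
Qed.

Record subC := SubC { sub_val :> A; sub_valP : sub_val \in sub_pred }.
HB.instance Definition _ := [isSub for sub_val].
HB.instance Definition _ := [Choice of subC by <:].
HB.instance Definition _ := GRing.isSubmodClosed.Build _ _ sub_pred sub_submod.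
HB.instance Definition _ := [SubChoice_isSubLmodule of subC by <:].

Lemma subP (x : subC) : S x. Proof. exact/asboolP/sub_valP. Qed.
Definition mksub x (Sx : S x) : subC := SubC (asboolT Sx).

Definition sub_data : cstar_data R.
Proof.
pose M (x y : subC) := mksub (ssubM (us_star S) (subP x) (subP y)).
pose J (x : subC) := mksub (ssub_adj (us_star S) (subP x)).
refine (@CstarData R subC (fun x => rnorm (sub_val x)) M J (mksub (us_one S))
  (fun x y => rnormD _ _) (fun c x => rnormZ _ _) _ _ _ _ _ _ _ _ _ _ _
  (fun x y => rnormM _ _) (fun x => rnorm_cstar _) _ _).
- by move=> x /rnorm_eq0 h; exact: val_inj.
- move=> u cu; have [l hl] := rnorm_complete (u := fun n => sub_val (u n)) cu.
  have Sl : S l.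
    apply: (closed_rnormP S).1 => [|e /hl[N hN]]; first exact: ssub_closed (us_star S).
    by exists (sub_val (u N)); [exact: subP|rewrite rdistC hN].
  by exists (mksub Sl).
- by move=> x y z; apply: val_inj; exact: cmulA.
- by move=> x y z; apply: val_inj; exact: cmulDl.
- by move=> x y z; apply: val_inj; exact: cmulDr.
- by move=> c x y; apply: val_inj; exact: cmulZl.
- by move=> c x y; apply: val_inj; exact: cmulZr.
- by move=> x; apply: val_inj; exact: cadjK.
- by move=> x y; apply: val_inj; exact: cadjD.
- by move=> c x; apply: val_inj; exact: cadjZ.
- by move=> x y; apply: val_inj; exact: cadjM.
- by move=> x; apply: val_inj; exact: cmul1x.
- by move=> x; apply: val_inj; exact: cmulx1.
Defined.

Record subalgebra_model (M : unitalCstarType R) := SubalgebraModel {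
  sm_val : M -> A;
  sm_in : forall x : M, S (sm_val x);
  sm_lift : forall x, S x -> M;
  sm_liftE : forall x (Sx : S x), sm_val (sm_lift Sx) = x;
  sm_inj : injective sm_val;
  sm_D : forall x y : M, sm_val (x + y) = sm_val x + sm_val y;
  sm_Z : forall c (x : M), sm_val (c *: x) = c *: sm_val x;
  sm_M : forall x y : M, sm_val (x ** y) = sm_val x ** sm_val y;
  sm_adj : forall x : M, sm_val x^† = (sm_val x)^†;
  sm_1 : sm_val (cone M) = cone A;
  sm_norm : forall x : M, rnorm (sm_val x) = rnorm x }.

Lemma subalgebra_exists : {M : unitalCstarType R & subalgebra_model M}.
Proof.
exists (cstar_of sub_data : unitalCstarType R).
refine (@SubalgebraModel (cstar_of sub_data) (fun x => sub_val (x : subC)) _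
  (fun x Sx => mksub Sx) _ _ _ _ _ _ _ _) => //.
- exact: subP.
- by move=> x y h; exact: val_inj.
Qed.

Definition subalg : unitalCstarType R := projT1 subalgebra_exists.
Let sm : subalgebra_model subalg := projT2 subalgebra_exists.

Definition emb (x : subalg) : A := sm_val sm x.
Definition slift x (Sx : S x) : subalg := sm_lift sm Sx.

Lemma sliftE x (Sx : S x) : emb (slift Sx) = x. Proof. exact: sm_liftE. Qed.
Lemma emb_mem (x : subalg) : S (emb x). Proof. exact: sm_in. Qed.
Lemma emb_inj : injective emb. Proof. exact: sm_inj. Qed.
Lemma embD x y : emb (x + y) = emb x + emb y. Proof. exact: sm_D. Qed.
Lemma embZ c x : emb (c *: x) = c *: emb x. Proof. exact: sm_Z. Qed.
Lemma embN x : emb (- x) = - emb x. Proof. by rewrite -scaleN1r embZ scaleN1r. Qed.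
Lemma embB x y : emb (x - y) = emb x - emb y. Proof. by rewrite embD embN. Qed.
Lemma emb0 : emb 0 = 0. Proof. by rewrite -(scale0r 0) embZ scale0r. Qed.
Lemma embM x y : emb (x ** y) = emb x ** emb y. Proof. exact: sm_M. Qed.
Lemma emb_adj x : emb x^† = (emb x)^†. Proof. exact: sm_adj. Qed.
Lemma emb1 : emb (cone subalg) = cone A. Proof. exact: sm_1. Qed.
Lemma emb_norm x : rnorm (emb x) = rnorm x. Proof. exact: sm_norm. Qed.

End Subalgebras.

(** * Partial bijections of the basis and strong sums *)

Section UnitOperators.
Variables (R : realType) (X : choiceType).
Local Notation C := R[i].
Local Notation V := (vec R X).
Local Notation B := (bops R unit X).
Local Notation "T · f" := (bop T tt f) (at level 40, f at next level).
Implicit Types (f g : V) (T U Z : B).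

Lemma vec_small f : (forall e, 0 < e -> vnorm f < e) -> f = 0.
Proof.
move=> h; apply: vnorm_eq0; apply/eqP; rewrite eq_le vnorm_ge0 andbT.
by apply/ler_addgt0Pr => e /h/ltW; rewrite add0r.
Qed.

Lemma adjoint_from_delta (S T : V -> V) (K L : R) : 0 <= K -> 0 <= L ->
  (forall f g, S (f + g) = S f + S g) -> (forall c f, S (c *: f) = c *: S f) ->
  (forall f, vnorm (S f) <= K * vnorm f) -> (forall f, vnorm (T f) <= L * vnorm f) ->
  (forall x g, dot (S (delta R x)) g = dot (delta R x) (T g)) ->
  forall f g, dot (S f) g = dot f (T g).
Proof.
move=> K0 L0 SD SZ SK TL h f g; apply/eqP; rewrite -subr_eq0; apply/eqP/cabs_eq0/eqP.
rewrite eq_le cabs_ge0 andbT; apply/ler_addgt0Pr => e e0; rewrite add0r.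
have k0 : 0 < 1 + (K + L) * vnorm g by have := vnorm_ge0 g; nra.
have d0 : 0 < e / (1 + (K + L) * vnorm g) by rewrite divr_gt0.
have [F] := delta_dense f d0; set r := f - _ => hr.
have S0 : S 0 = 0 by rewrite -(scale0r 0) SZ !scale0r.
have Ssum : S (f - r) = \sum_(x <- F) f x *: S (delta R x).
  rewrite /r subKr (big_morph S SD S0); apply: eq_bigr => x _; exact: SZ.
have E : dot (S (f - r)) g = dot (f - r) (T g).
  have dl0 : dot 0 g = 0 by rewrite dot0l.
  rewrite Ssum (big_morph (fun v => dot v g) (fun u v => dotDl u v g) (dot0l g)).
  rewrite /r subKr (big_morph (fun v => dot v (T g)) (fun u v => dotDl u v (T g)) (dot0l _)).
  by apply: eq_bigr => x _; rewrite !dotZl h.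
have Sf : S f = S (f - r) + S r by rewrite -SD subrK.
have -> : dot (S f) g - dot f (T g) = dot (S r) g - dot r (T g).
  have fE : dot f (T g) = dot (f - r) (T g) + dot r (T g) by rewrite -dotDl subrK.
  by rewrite Sf dotDl E fE; ring.
have h1 := dot_le (S r) g; have h2 := dot_le r (T g).
have := cabsD (dot (S r) g) (- dot r (T g)); rewrite cabsN.
move: hr; rewrite ltr_pdivlMr //.
have := ler_wpM2r (vnorm_ge0 g) (SK r); have := ler_wpM2l (vnorm_ge0 r) (TL g).
move: (vnorm_ge0 g) (vnorm_ge0 r) h1 h2; move: (vnorm g) (vnorm r) (vnorm (S r)) (vnorm (T g)).
move=> p q a b p0 q0 h1 h2 h3 h4 h5 h6; apply: le_trans h6 _.
have : (K + L) * p * q <= e by nra.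
have -> : (K + L) * p * q = K * q * p + q * (L * p) by ring.
lra.
Qed.

Lemma nsq_ge_seq f (s : seq X) : uniq s -> \sum_(x <- s) cabs (f x) ^+ 2 <= nsq f.
Proof.
move=> us; rewrite (perm_big (enum_fset [fset x in s]%fset)); first exact: nsq_ge.
by apply: uniq_perm => // x; rewrite !inE.
Qed.

Record pbij := Pbij {
  pb_fun :> X -> option X;
  pb_inv : X -> option X;
  pbP : forall x y, pb_fun x = Some y <-> pb_inv y = Some x }.

Definition pb_sym (b : pbij) : pbij := Pbij (fun x y => iff_sym (pbP b y x)).

Section PermOp.
Variable b : pbij.

Lemma pb_vec_subproof (b' : pbij) f : (fun y => oapp (vec_val f) 0 (pb_inv b' y)) \in @l2fun R X.
Proof.
apply/asboolP; exists (nsq f) => F.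
have inj x y z : pb_inv b' x = Some z -> pb_inv b' y = Some z -> x = y.
  by move=> /pbP h /pbP; rewrite h => -[].
apply: le_trans (nsq_ge_seq f (s := pmap (pb_inv b') (enum_fset F)) _).
  elim: (enum_fset F) => [|y s IH]; rewrite ?big_nil //= big_cons.
  case: (pb_inv b' y) => [x|] /=; first by rewrite big_cons lerD2l.
  by rewrite cabs0 expr0n add0r.
have := fset_uniq F; elim: (enum_fset F) => //= y s IH /andP[ys /IH us].
case E: (pb_inv b' y) => [x|] //=; rewrite us andbT.
apply: contra ys; rewrite mem_pmap => /mapP[y' y's] E'.
by rewrite (inj y y' x).
Qed.

Definition pb_vec (b' : pbij) f : V := Vec (pb_vec_subproof b' f).

Lemma pb_vecE (b' : pbij) f y : pb_vec b' f y = oapp (vec_val f) 0 (pb_inv b' y).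
Proof. by []. Qed.

Lemma pb_vec_delta (b' : pbij) x : pb_vec b' (delta R x) = oapp (@delta R X) 0 (b' x).
Proof.
apply: vec_ext => y; rewrite pb_vecE.
case E: (b' x) => [z|]; case E': (pb_inv b' y) => [x'|]; rewrite [LHS]/= [RHS]/= ?vec0 //.
- congr (_%:R); congr (nat_of_bool _); move/pbP: (E') => E''.
  apply/eqP/eqP => [xx|yz]; first by move: E''; rewrite xx E => -[].
  by move/pbP: E; rewrite -yz E' => -[].
- by case: eqP => // yz; move/pbP: E; rewrite -yz E'.
- by case: eqP => // xx; move/pbP: E'; rewrite xx E.
Qed.

Lemma pb_vec_le (b' : pbij) f : vnorm (pb_vec b' f) <= 1 * vnorm f.
Proof.
rewrite mul1r vnorm_le ?vnorm_ge0 // sqr_vnorm; apply: nsq_le => F.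
have /asboolP := pb_vec_subproof b' f; have inj x y z : pb_inv b' x = Some z -> pb_inv b' y = Some z -> x = y.
  by move=> /pbP h /pbP; rewrite h => -[].
move=> _; apply: le_trans (nsq_ge_seq f (s := pmap (pb_inv b') (enum_fset F)) _).
  elim: (enum_fset F) => [|y s IH]; rewrite ?big_nil //= big_cons.
  case: (pb_inv b' y) => [x|] /=; first by rewrite big_cons lerD2l.
  by rewrite cabs0 expr0n add0r.
have := fset_uniq F; elim: (enum_fset F) => //= y s IH /andP[ys /IH us].
case E: (pb_inv b' y) => [x|] //=; rewrite us andbT.
apply: contra ys; rewrite mem_pmap => /mapP[y' y's] E'.
by rewrite (inj y y' x).
Qed.

Lemma pb_vec_adj f g : dot (pb_vec b f) g = dot f (pb_vec (pb_sym b) g).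
Proof.
apply: (@adjoint_from_delta (pb_vec b) (pb_vec (pb_sym b)) 1 1) => //.
- by move=> f' g'; apply: vec_ext => y; rewrite vecD !pb_vecE; case: (pb_inv b y) => [x|] /=; rewrite ?vecD ?addr0.
- by move=> c f'; apply: vec_ext => y; rewrite vecZ !pb_vecE; case: (pb_inv b y) => [x|] /=; rewrite ?vecZ ?mulr0.
- exact: pb_vec_le.
- exact: pb_vec_le.
- move=> x h; rewrite pb_vec_delta dot_delta /=.
  by case: (b x) => [y|] /=; rewrite ?dot_delta ?dot0l.
Qed.

Lemma pb_op_subproof : (fun _ : unit => pb_vec b) \in @opfam R unit X.
Proof.
apply/asboolP; exists (fun _ => pb_vec (pb_sym b)), 1 => i f g.
by split; [exact: pb_vec_adj|exact: pb_vec_le].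
Qed.
Definition pb_op : B := mkbop pb_op_subproof.

Lemma pb_opE f : pb_op · f = pb_vec b f.
Proof. by rewrite /pb_op mkbopE. Qed.
Lemma pb_op_delta x : pb_op · delta R x = oapp (@delta R X) 0 (b x).
Proof. by rewrite pb_opE pb_vec_delta. Qed.
End PermOp.

Lemma pb_op_adj b : (pb_op b)^† = pb_op (pb_sym b).
Proof. by apply: bop_adj_uniq => -[] f g; rewrite !pb_opE; exact: pb_vec_adj. Qed.

Lemma pb_op_inv_delta b x : (pb_op b)^† · delta R x = oapp (@delta R X) 0 (pb_inv b x).
Proof. by rewrite pb_op_adj pb_op_delta. Qed.

Section Amplification.
Variables (A D : nat -> B).
Hypothesis AP : forall m n, (A m)^† ** A n = if m == n then cone B else 0.
Hypothesis DP : forall m n, (D m)^† ** D n = if m == n then cone B else 0.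

Lemma orth_sum_nsq (A' : nat -> B) (s : seq nat) (g : nat -> V) :
  (forall m n, (A' m)^† ** A' n = if m == n then cone B else 0) -> uniq s ->
  nsq (\sum_(n <- s) A' n · g n) = \sum_(n <- s) nsq (g n).
Proof.
move=> AP'; elim: s => [|m s IH] /=; first by rewrite !big_nil /nsq dot0l.
move=> /andP[ms us]; rewrite !big_cons -IH //.
have := nsqD (A' m · g m) (\sum_(n <- s) A' n · g n) 1; rewrite scale1r => ->.
have -> : dot (A' m · g m) (\sum_(n <- s) A' n · g n) = 0.
  rewrite bop_adj bop_sum big_seq big1 ?dot0r // => n ns.
  rewrite -bop_mul AP'; case: eqP => [mn|]; last by rewrite bop0E.
  by rewrite mn ns in ms.
rewrite mulr0 mulr0 addr0 (cabsR 1) normr1 expr1n mul1r; congr (_ + _).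
by apply: complexI; rewrite -!dotff bop_adj -bop_mul AP' eqxx bop_one.
Qed.

Lemma bessel (A' : nat -> B) (s : seq nat) f :
  (forall m n, (A' m)^† ** A' n = if m == n then cone B else 0) -> uniq s ->
  \sum_(n <- s) nsq ((A' n)^† · f) <= nsq f.
Proof.
move=> AP' us; pose g := \sum_(n <- s) A' n · ((A' n)^† · f).
have h1 := orth_sum_nsq (fun n => (A' n)^† · f) AP' us.
have h2 : dot f g = (\sum_(n <- s) nsq ((A' n)^† · f))%:C.
  rewrite /g (big_morph _ (dotDr f) (dot0r f)) rmorph_sum; apply: eq_bigr => n _.
  by have := bop_adj (A' n)^† tt f ((A' n)^† · f); rewrite cadjK dotff => <-.
have := nsq_ge0 (f + -1 *: g); rewrite nsqD h2 cabsN (cabsR 1) normr1 expr1n mul1r mulN1r /=.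
rewrite /g h1; lra.
Qed.

Lemma bounded_sum_cauchy (a : nat -> R) (K : R) : (forall n, 0 <= a n) ->
  (forall n, \sum_(0 <= j < n) a j <= K) -> forall e, 0 < e ->
  exists N, forall m n, (N <= m)%N -> (m <= n)%N -> \sum_(m <= j < n) a j < e.
Proof.
move=> a0 aK e e0; pose S := [set \sum_(0 <= j < n) a j | n in [set: nat]].
have hS : has_sup S.
  by split; [exists (\sum_(0 <= j < 0) a j), 0%N|exists K => _ [n _ <-]; exact: aK].
have [_ [N _ <-] hN] := sup_adherent e0 hS; exists N => m n Nm mn.
have : \sum_(0 <= j < n) a j <= sup S by apply: ub_le_sup; [exact: hS.2|exists n].
rewrite (big_cat_nat (n := m)) //= (big_cat_nat (n := N)) //=.
have : 0 <= \sum_(N <= j < m) a j by apply: sumr_ge0.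
lra.
Qed.

Definition psum (A' D' : nat -> B) T N : B := \sum_(0 <= n < N) A' n ** T ** (D' n)^†.

Lemma psum_le A' D' T m n f :
  (forall m n, (A' m)^† ** A' n = if m == n then cone B else 0) ->
  nsq (\sum_(m <= j < n) (A' j ** T ** (D' j)^†) · f) <=
    rnorm T ^+ 2 * \sum_(m <= j < n) nsq ((D' j)^† · f).
Proof.
move=> AP'; under eq_bigr do rewrite bop_mul bop_mul.
rewrite orth_sum_nsq ?iota_uniq // mulr_sumr; apply: ler_sum => j _.
rewrite -!sqr_vnorm -exprMn ler_sqr ?nnegrE ?mulr_ge0 ?vnorm_ge0 ?rnorm_ge0 //.
exact: bop_le.
Qed.

Lemma psum_cauchy A' D' T f e :
  (forall m n, (A' m)^† ** A' n = if m == n then cone B else 0) ->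
  (forall m n, (D' m)^† ** D' n = if m == n then cone B else 0) -> 0 < e ->
  exists N, forall m n, (N <= m)%N -> (N <= n)%N ->
    vnorm (psum A' D' T m · f - psum A' D' T n · f) < e.
Proof.
move=> AP' DP' e0.
have k0 : 0 < 1 + rnorm T ^+ 2 by have := sqr_ge0 (rnorm T); lra.
have d0 : 0 < e ^+ 2 / (1 + rnorm T ^+ 2) by rewrite divr_gt0 ?exprn_gt0.
have [||N hN] := bounded_sum_cauchy (a := fun n => nsq ((D' n)^† · f)) (K := nsq f) _ _ d0.
- by move=> n; exact: nsq_ge0.
- by move=> n; apply: bessel => //; exact: iota_uniq.
exists N; suff h m n : (N <= m)%N -> (m <= n)%N -> vnorm (psum A' D' T n · f - psum A' D' T m · f) < e.
  move=> m n Nm Nn; have [mn|nm] := leqP m n; first by rewrite vdistC h.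
  by apply: h => //; exact: ltnW.
move=> Nm mn; rewrite /psum (big_cat_nat (n := m)) // bopDE addrC addKr bop_sumE.
rewrite -(ltr_pXn2r (n := 2)) ?nnegrE ?vnorm_ge0 ?(ltW e0) // sqr_vnorm.
apply: le_lt_trans (psum_le _ _ _ _ _ AP') _.
have := hN m n Nm mn; rewrite ltr_pdivlMr //.
have : 0 <= \sum_(m <= j < n) nsq ((D' j)^† · f) by apply: sumr_ge0 => j _; exact: nsq_ge0.
by have := sqr_ge0 (rnorm T); nra.
Qed.

Lemma psum_bounded A' D' T N f :
  (forall m n, (A' m)^† ** A' n = if m == n then cone B else 0) ->
  (forall m n, (D' m)^† ** D' n = if m == n then cone B else 0) ->
  vnorm (psum A' D' T N · f) <= rnorm T * vnorm f.
Proof.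
move=> AP' DP'; rewrite vnorm_le ?mulr_ge0 ?rnorm_ge0 ?vnorm_ge0 // /psum bop_sumE.
apply: le_trans (psum_le _ _ _ _ _ AP') _; rewrite exprMn ler_wpM2l ?sqr_ge0 // sqr_vnorm.
by apply: bessel => //; exact: iota_uniq.
Qed.

Definition strong_lim (u : nat -> B) W := forall f e, 0 < e -> exists N, forall n, (N <= n)%N ->
  vnorm (u n · f - W · f) < e.

Lemma strong_lim_mul u W (Z1 Z2 : B) : strong_lim u W ->
  strong_lim (fun n => Z1 ** u n ** Z2) (Z1 ** W ** Z2).
Proof.
move=> hU f e e0; have k0 : 0 < 1 + rnorm Z1 by have := rnorm_ge0 Z1; lra.
have [M hM] := hU (Z2 · f) _ (divr_gt0 e0 k0); exists M => n /hM.
rewrite !bop_mul; move: (u n · _) (W · _) => p q; rewrite ltr_pdivlMr // => h.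
have -> : Z1 · p - Z1 · q = Z1 · (p - q) by rewrite bopD bopN.
apply: le_lt_trans (bop_le _ _ _) _.
by move: h (rnorm_ge0 Z1) (vnorm_ge0 (p - q)); nra.
Qed.

Lemma strong_lim_uniq u v W Z : strong_lim u W -> strong_lim v Z ->
  (exists N, forall n, (N <= n)%N -> u n = v n) -> W = Z.
Proof.
move=> hu hv [K hK]; apply: bop_eq => -[] f; apply/eqP; rewrite -subr_eq0; apply/eqP/vec_small => e e0.
have e2 : 0 < e / 2 by rewrite divr_gt0.
have [N hN] := hu f _ e2; have [M hM] := hv f _ e2; pose n := (K + (N + M))%N.
have h1 : vnorm (u n · f - W · f) < e / 2 by apply: hN; rewrite /n addnCA leq_addr.
have h2 : vnorm (v n · f - Z · f) < e / 2 by apply: hM; rewrite /n addnCA addnA leq_addl.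
have uv : u n = v n by apply: hK; rewrite leq_addr.
rewrite -uv in h2; have := vnormD (W · f - u n · f) (u n · f - Z · f).
rewrite addrA subrK (vdistC (W · f)) => /le_lt_trans; apply.
by rewrite [ltRHS]splitr; exact: Num.Theory.ltrD.
Qed.

Lemma strong_lim_eq u W (Y Z1 Z2 : B) : strong_lim u W ->
  (exists N, forall n, (N <= n)%N -> Z1 ** u n ** Z2 = Y) -> Z1 ** W ** Z2 = Y.
Proof.
move=> hu h; apply: (strong_lim_uniq (strong_lim_mul Z1 Z2 hu) _ h) => f e e0.
by exists 0%N => n _; rewrite subrr vnorm0.
Qed.

Lemma psum_adj A' D' T N : (psum A' D' T N)^† = psum D' A' T^† N.
Proof. by rewrite /psum cadj_sum; apply: eq_bigr => n _; rewrite !cadjM cadjK cmulA. Qed.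

Lemma psum_mulr A' D' T N n :
  (forall m n, (D' m)^† ** D' n = if m == n then cone B else 0) -> (n < N)%N ->
  psum A' D' T N ** D' n = A' n ** T.
Proof.
move=> DP' nN; rewrite /psum cmul_suml (bigD1_seq n) ?iota_uniq ?mem_index_iota //=.
rewrite -cmulA DP' eqxx cmulx1 big1 ?addr0 // => j jn.
by rewrite -cmulA DP' (negPf jn) cmulx0.
Qed.

Lemma psum_mull A' D' T N n :
  (forall m n, (A' m)^† ** A' n = if m == n then cone B else 0) -> (n < N)%N ->
  (A' n)^† ** psum A' D' T N = T ** (D' n)^†.
Proof. by move=> AP' nN; rewrite -[LHS]cadjK cadjM cadjK psum_adj psum_mulr // cadjM cadjK. Qed.

Lemma psum_lim T : exists U, strong_lim (psum A D T) U.
Proof.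
have [|||W hW] := @bop_strong_limit R unit X (psum A D T) (rnorm T).
- by move=> n [] f; exact: psum_bounded.
- by move=> [] f e e0; exact: psum_cauchy.
- move=> [] f e e0; have [N hN] := psum_cauchy T^† f DP AP e0.
  by exists N => m n Nm Nn; rewrite !psum_adj; exact: hN.
by exists W => f e /(hW tt f).
Qed.

(** U is the strong sum of the A_n T D_n^*. The middle clauses say that it lives between the spans
    of the two families of ranges; the last puts it into every commutant that contains T, the A_n
    and the D_n^*, which is how the repeats of elements of E_i land in E_(i+1). *)
Lemma amplification T : exists U,
  [/\ forall n, U ** D n = A n ** T, forall n, (A n)^† ** U = T ** (D n)^†,
      forall Z, (forall n, Z ** A n = 0) -> Z ** U = 0,
      forall Z, (forall n, (D n)^† ** Z = 0) -> U ** Z = 0 &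
      forall Z, (forall n, Z ** A n = A n ** Z) -> (forall n, Z ** (D n)^† = (D n)^† ** Z) ->
        Z ** T = T ** Z -> Z ** U = U ** Z].
Proof.
have [U hU] := psum_lim T; exists U; split.
- move=> n; rewrite -[U]cmul1x; apply: (strong_lim_eq hU); exists n.+1 => N nN.
  by rewrite cmul1x psum_mulr.
- move=> n; rewrite -[LHS]cmulx1; apply: (strong_lim_eq hU); exists n.+1 => N nN.
  by rewrite cmulx1 psum_mull.
- move=> Z ZA; rewrite -[LHS]cmulx1; apply: (strong_lim_eq hU); exists 0%N => N _.
  rewrite cmulx1 /psum cmul_sumr big1 // => j _.
  by rewrite !cmulA' ZA !cmul0x.
- move=> Z ZD; rewrite -[U]cmul1x; apply: (strong_lim_eq hU); exists 0%N => N _.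
  rewrite cmul1x /psum cmul_suml big1 // => j _.
  by rewrite -cmulA ZD cmulx0.
move=> Z ZA ZD ZT; rewrite -[LHS]cmulx1 -[RHS]cmul1x cmulA'.
apply: (strong_lim_uniq (strong_lim_mul _ _ hU) (strong_lim_mul _ _ hU)).
exists 0%N => N _; rewrite cmulx1 cmul1x /psum cmul_sumr cmul_suml; apply: eq_bigr => j _.
by rewrite !cmulA' ZA -!cmulA' -ZD !cmulA'; congr (_ ** _); rewrite -!cmulA' ZT.
Qed.

End Amplification.
End UnitOperators.

(** * K-theory of algebras with Cuntz pairs *)

Section Criteria.
Context {R : realType} {A : unitalCstarType R}.
Implicit Types (x y z p q r u v w a b s t : A).
Local Notation one := (cone A).

Definition isproj p := p ** p = p /\ p^† = p.
Definition mvn1 p q := exists v, v^† ** v = p /\ v ** v^† = q.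
Definition unit1 u := u^† ** u = one /\ u ** u^† = one.
Definition cuntz_pair s t :=
  [/\ s^† ** s = one, t^† ** t = one & s ** s^† + t ** t^† = one].

Lemma coneP : is_unit one.
Proof. by move=> x; rewrite cmul1x cmulx1. Qed.
Lemma cone_adj : one^† = one.
Proof. exact: unit_adj coneP. Qed.

Lemma isometry_le1 s : s^† ** s = one -> rnorm s <= 1.
Proof. by move=> h; exact: (isometry_norm coneP h). Qed.

(** Inserting s s^* + t t^* = 1 between s^* and t gives 2 s^* t = s^* t. *)
Lemma cuntz_orth s t : cuntz_pair s t -> s^† ** t = 0 /\ t^† ** s = 0.
Proof.
move=> [ss tt st]; have : s^† ** (s ** s^† + t ** t^†) ** t = s^† ** t.
  by rewrite st cmulx1.
rewrite !cexpand ss cmul1x -!cmulA tt cmulx1 => h.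
have h0 : s^† ** t = 0.
  by apply: (@addrI _ (s^† ** t)); rewrite addr0.
by split=> //; rewrite -[LHS]cadjK cadjM cadjK h0 cadj0.
Qed.

(** The diagonal matrix with entries x and y, carried to A by the isomorphism with M_2(A) that a
    Cuntz pair provides. *)
Definition diag s t x y := s ** x ** s^† + t ** y ** t^†.

Lemma diagM s t x y x' y' : cuntz_pair s t ->
  diag s t x y ** diag s t x' y' = diag s t (x ** x') (y ** y').
Proof.
move=> st; have [st0 ts0] := cuntz_orth st; case: st => ss tt _.
rewrite /diag !cexpand -(cmulA _ s^† s) -(cmulA _ s^† t) -(cmulA _ t^† t) -(cmulA _ t^† s).
by rewrite st0 ts0 ss tt !cmulx1 !cmulx0 !cmul0x addr0 add0r.
Qed.

Lemma diag_adj s t x y : (diag s t x y)^† = diag s t x^† y^†.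
Proof. by rewrite /diag cadjD !cadjM !cadjK !cmulA'. Qed.

Lemma diag1 s t : cuntz_pair s t -> diag s t one one = one.
Proof. by case=> _ _ h; rewrite /diag !cmulx1. Qed.

Lemma diag_proj s t p q : cuntz_pair s t -> isproj p -> isproj q -> isproj (diag s t p q).
Proof. by move=> st [p1 p2] [q1 q2]; rewrite /isproj diagM // diag_adj p1 p2 q1 q2. Qed.

Lemma diag_unit s t u v : cuntz_pair s t -> unit1 u -> unit1 v -> unit1 (diag s t u v).
Proof. by move=> st [u1 u2] [v1 v2]; rewrite /unit1 diag_adj !diagM // u1 u2 v1 v2 diag1. Qed.

Lemma proj_small p : isproj p -> rnorm p < 1 -> p = 0.
Proof.
move=> [p1 p2] pl; apply: rnorm_eq0; have := rnorm_cstar p; rewrite p2 p1 => h.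
by have := rnorm_ge0 p; nra.
Qed.

Lemma proj_norm p : isproj p -> rnorm p <= 1.
Proof.
by move=> [p1 p2]; have := rnorm_cstar p; rewrite p2 p1 => h; have := rnorm_ge0 p; nra.
Qed.

Lemma mvn1_refl p : isproj p -> mvn1 p p.
Proof. by move=> [p1 p2]; exists p; rewrite p2. Qed.

Lemma mvn1_sym p q : mvn1 p q -> mvn1 q p.
Proof. by move=> [v [h1 h2]]; exists v^†; rewrite cadjK. Qed.

Lemma mvn1_trans q p r : isproj p -> isproj r -> mvn1 p q -> mvn1 q r -> mvn1 p r.
Proof.
move=> [p1 _] [r1 _] [v [vp vq]] [w [wq wr]]; exists (w ** v).
rewrite cadjM; split.
  by rewrite -cmulA (cmulA w^†) wq -vq cmulA' cmulA' vp -cmulA vp p1.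
by rewrite -cmulA (cmulA v) vq -wq cmulA' cmulA' wr -cmulA wr r1.
Qed.

Lemma mvn1_diag s t p q p' q' : cuntz_pair s t -> mvn1 p p' -> mvn1 q q' ->
  mvn1 (diag s t p q) (diag s t p' q').
Proof.
move=> st [v [<- <-]] [w [<- <-]]; exists (diag s t v w).
by rewrite diag_adj !diagM.
Qed.

Lemma mvn1_rebase s t s' t' p q : cuntz_pair s t -> cuntz_pair s' t' ->
  isproj p -> isproj q -> mvn1 (diag s t p q) (diag s' t' p q).
Proof.
move=> st st' [p1 p2] [q1 q2].
have [st0 ts0] := cuntz_orth st; have [st0' ts0'] := cuntz_orth st'.
have [ss tt _] := st; have [ss' tt' _] := st'.
exists (s' ** p ** s^† + t' ** q ** t^†); rewrite cadjD !cadjM !cadjK p2 q2 /diag.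
rewrite !cexpand -!(cmulA _ s'^† s') -!(cmulA _ s'^† t') -!(cmulA _ t'^† t') -!(cmulA _ t'^† s').
rewrite -!(cmulA _ s^† s) -!(cmulA _ s^† t) -!(cmulA _ t^† t) -!(cmulA _ t^† s).
rewrite st0 ts0 st0' ts0' ss tt ss' tt' !cmulx1 !cmulx0 !cmul0x !addr0 !add0r.
by rewrite -!(cmulA _ p p) -!(cmulA _ q q) p1 q1.
Qed.

(** With y the inverse square root of z = p q p + 1 - p, the element v = q p y has v^* v = p, and q
    - v v^* is a projection of norm below 1, hence 0. *)
Lemma close_projections p q : isproj p -> isproj q -> rnorm (p - q) <= 8^-1 -> mvn1 p q.
Proof.
move=> [p1 p2] [q1 q2] pq; pose z := p ** q ** p + (one - p).
have pn := proj_norm (conj p1 p2); have qn := proj_norm (conj q1 q2).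
have zs : z^† = z.
  by rewrite /z cadjD cadjB !cadjM p2 q2 cone_adj cmulA.
have z8 : rnorm (one - z) <= 8^-1.
  have -> : one - z = p ** (p - q) ** p.
    rewrite /z !cexpand p1 p1; lmod_with (R[i]) ltac:(ring).
  have := le_rnormM (le_rnormM pn pq) pn; by rewrite mul1r mulr1.
have [y yP] := isqrt_exists coneP zs z8.
have pz : p ** z = p ** q ** p.
  by rewrite /z cmulDr cmulBr cmulx1 p1 subrr addr0 !cmulA' p1.
have zp : z ** p = p ** q ** p.
  by rewrite /z cmulDl cmulBl cmul1x p1 subrr addr0 -!cmulA p1.
have yp : p ** y = y ** p by apply: (isqrt_comm yP); rewrite pz zp.
have ys := isqrt_adj yP; have zy := isqrtE yP.
have yz : z ** y = y ** z by rewrite (isqrt_comm yP).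
have [v vE] : exists v, v = q ** p ** y by exists (q ** p ** y).
have vv : v^† ** v = p.
  rewrite vE !cadjM ys p2 q2 !cmulA' -(cmulA _ q q) q1 -(cmulA _ p q) -(cmulA _ (p ** q) p).
  by rewrite -zp cmulA' -yz -(cmulA _ p) yp cmulA' zy cmul1x.
have vp : v ** p = v by rewrite vE -cmulA -yp cmulA' -(cmulA _ p p) p1.
have qv : q ** v = v by rewrite vE !cmulA' q1.
set e := v ** v^†.
have ee : e ** e = e by rewrite /e !cmulA' -(cmulA v v^†) vv vp.
have es : e^† = e by rewrite /e cadjM cadjK.
have qe : q ** e = e by rewrite /e cmulA' qv.
have eq : e ** q = e by rewrite -[LHS]cadjK cadjM es q2 qe es.
exists v; split=> //; rewrite -/e; apply/eqP; rewrite eq_sym -subr_eq0; apply/eqP.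
apply: proj_small.
  by split; rewrite ?cadjB ?q2 ?es // cmulBr !cmulBl q1 qe eq ee subrr subr0.
have yn := isqrt_near yP.
have yn1 : rnorm y <= 5 / 4.
  have on : rnorm one <= 1 by apply: isometry_le1; rewrite cone_adj cmul1x.
  by have := rnormD (y - one) one; rewrite subrK; lra.
have -> : q - e = q ** (q - p) ** q - q ** (p ** ((y - one) ** y + (y - one)) ** p) ** q.
  rewrite /e vE !cadjM ys p2 q2.
  have h : q ** p ** y ** y ** p ** q = q ** p ** (y ** y) ** p ** q by rewrite !cmulA'.
  rewrite !cexpand ?cmulx1 ?cmul1x !q1 -!(cmulA _ p p) !p1.
  by lmod_with (R[i]) ltac:(ring).
have h1 := le_rnormM (le_rnormM qn (_ : rnorm (q - p) <= 8^-1)) qn.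
have h2 : rnorm ((y - one) ** y + (y - one)) <= 4^-1 * (5 / 4) + 4^-1.
  by apply: le_rnormD => //; apply: le_rnormM.
have h3 := le_rnormM (le_rnormM qn (le_rnormM (le_rnormM pn h2) pn)) qn.
by apply: le_lt_trans (le_rnormB (h1 _) h3) _; [rewrite rdistC|lra].
Qed.

(** * Rounding to unitaries and projections of a subalgebra *)

Section Rounding.
Variables (S : set A) (sS : star_subalgebra S) (S1 : S one).

Lemma isqrt_one : is_isqrt one one one.
Proof.
split; rewrite ?subrr ?rnorm0 ?invr_ge0 ?cone_adj ?cmul1x //.
Qed.

Lemma isqrt_near_one z y : rnorm (one - z) <= 8^-1 -> is_isqrt one z y ->
  rnorm (y - one) <= 2 * rnorm (z - one).
Proof.
move=> z8 yP; have o8 : rnorm (one - one) <= 8^-1 by rewrite subrr rnorm0 invr_ge0.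
exact: (isqrt_lipschitz coneP z8 o8 yP isqrt_one).
Qed.

Lemma isometry_polar w y : is_isqrt one (w^† ** w) y -> (w ** y)^† ** (w ** y) = one.
Proof.
move=> yP; have ys := isqrt_adj yP; have E := isqrtE yP.
have wy : w^† ** w ** y = y ** (w^† ** w) by rewrite (isqrt_comm yP).
by rewrite cadjM ys !cmulA' -(cmulA y) -wy E.
Qed.

(** 1 - g g^* is a projection, and it has norm below 1 since u u^* = 1. *)
Lemma isometry_near_unitary g u : unit1 u -> g^† ** g = one -> 2 * rnorm (g - u) < 1 -> unit1 g.
Proof.
move=> [u1 u2] gg gu; split=> //.
have gn := isometry_le1 gg; have un : rnorm u^† <= 1 by rewrite rnorm_adj; exact: isometry_le1.
apply/eqP; rewrite eq_sym -subr_eq0; apply/eqP; apply: proj_small.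
  split; last by rewrite cadjB cone_adj cadjM cadjK.
  rewrite cmulBr cmulx1 !cmulBl cmul1x !cmulA' -(cmulA g) gg cmulx1 subrr subr0 //.
have -> : one - g ** g^† = - ((g - u) ** u^† + g ** (g - u)^†).
  by rewrite cadjB !cexpand u2; lmod_with (R[i]) ltac:(ring).
rewrite rnormN; apply: le_lt_trans gu.
have h1 := le_rnormM (lexx (rnorm (g - u))) un.
have h2 : rnorm (g ** (g - u)^†) <= 1 * rnorm (g - u).
  by apply: le_rnormM => //; rewrite rnorm_adj.
by apply: le_trans (le_rnormD h1 h2) _; lra.
Qed.

Lemma norm_one_le1 : rnorm one <= 1.
Proof. by apply: isometry_le1; rewrite cone_adj cmul1x. Qed.

Lemma near_unitary_gram u x d : unit1 u -> rnorm (x - u) <= d -> d <= 1 ->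
  rnorm (x^† ** x - one) <= 3 * d.
Proof.
move=> [u1 u2] xu d1; have un := isometry_le1 u1; have d0 := le_trans (rnorm_ge0 _) xu.
have xn : rnorm x <= 2 by have := rnormD (x - u) u; rewrite subrK; lra.
have -> : x^† ** x - one = (x - u)^† ** x + u^† ** (x - u).
  by rewrite cadjB !cexpand u1; lmod_with (R[i]) ltac:(ring).
have h1 : rnorm ((x - u)^† ** x) <= d * 2 by apply: le_rnormM => //; rewrite rnorm_adj.
have h2 : rnorm (u^† ** (x - u)) <= 1 * d by apply: le_rnormM => //; rewrite rnorm_adj.
by apply: le_trans (le_rnormD h1 h2) _; lra.
Qed.

(** The unitary part of x: the inverse square root of x^* x lies in S together with x. *)
Lemma round_unitary u x d : unit1 u -> S x -> rnorm (x - u) <= d -> d <= 100^-1 ->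
  exists2 g, S g & unit1 g /\ rnorm (g - u) <= 16 * d.
Proof.
move=> uP Sx xu d1; have [u1 u2] := uP; have d0 := le_trans (rnorm_ge0 _) xu.
have un := isometry_le1 u1.
have zn := near_unitary_gram uP xu (_ : d <= 1).
have {}zn : rnorm (x^† ** x - one) <= 3 * d by apply: zn; lra.
have [||y yP] := isqrt_exists coneP (z := x^† ** x).
- by rewrite cadjM cadjK.
- by rewrite rdistC; lra.
have yn := isqrt_near_one (_ : rnorm (one - x^† ** x) <= 8^-1) yP.
have {}yn : rnorm (y - one) <= 6 * d by have : rnorm (one - x^† ** x) <= 8^-1; [rewrite rdistC; lra|move=> /yn; lra].
have xn : rnorm x <= 2 by have := rnormD (x - u) u; rewrite subrK; lra.
have gu : rnorm (x ** y - u) <= 16 * d.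
  have -> : x ** y - u = x ** (y - one) + (x - u).
    by rewrite cmulBr cmulx1; lmod_with (R[i]) ltac:(ring).
  by apply: le_trans (le_rnormD (le_rnormM xn yn) xu) _; lra.
exists (x ** y); last first.
  split=> //; apply: (isometry_near_unitary uP); first exact: isometry_polar.
  by apply: le_lt_trans (ler_wpM2l _ gu) _; lra.
apply: (ssubM sS) => //; apply: (isqrt_sub yP) => //.
by apply: (ssubM sS) => //; exact: (ssub_adj sS).
Qed.

(** The symmetry 2 p - 1 is easier to correct than p: h = x + x^* - 1 is near it, g = h (h^2)^(-1/2)
    is a self-adjoint unitary of S, and (1 + g) / 2 is the projection. *)
Lemma round_projection p x d : isproj p -> S x -> rnorm (x - p) <= d -> d <= 200^-1 ->
  exists2 q, S q & isproj q /\ rnorm (q - p) <= 16 * d.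
Proof.
move=> pP Sx xp d1; have [p1 p2] := pP; have d0 := le_trans (rnorm_ge0 _) xp.
pose two : R[i] := (2 : R)%:C; pose half : R[i] := (2^-1 : R)%:C.
have th : two * half = 1 by rewrite /two /half -rmorphM /= mulfV ?rmorph1.
have halfR c : c = half *: (two *: c).
  by rewrite scalerA mulrC th scale1r.
pose u := two *: p - one; pose h := (x + x^†) - one.
have sc (y z : A) : two *: (y : A) = y + y by rewrite /two rmorphD /= scalerDl scale1r.
have uu : u ** u = one.
  by rewrite /u sc // !cexpand cmul1x !cmulx1 !p1; lmod_with (R[i]) ltac:(ring).
have us : u^† = u by rewrite /u sc // cadjB cadjD p2 cone_adj.
have uP : unit1 u by split; rewrite us.
have hs : h^† = h by rewrite /h cadjB cadjD cadjK cone_adj addrC [x + _]addrC addrC.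
have Sh : S h by apply: (ssubB sS) => //; apply: (ssubD sS) => //; exact: (ssub_adj sS).
have hu : rnorm (h - u) <= 2 * d.
  have -> : h - u = (x - p) + (x - p)^†.
    by rewrite /h /u sc // cadjB p2; lmod_with (R[i]) ltac:(ring).
  have xa : rnorm (x - p)^† <= d by rewrite rnorm_adj.
  by apply: le_trans (le_rnormD xp xa) _; lra.
have zn := near_unitary_gram uP hu (_ : 2 * d <= 1).
have {}zn : rnorm (h ** h - one) <= 6 * d by move: zn; rewrite hs => zn; have := zn _; lra.
have z8 : rnorm (one - h ** h) <= 8^-1 by rewrite rdistC; lra.
have [|y yP] := isqrt_exists coneP _ z8; first by rewrite cadjM hs.
have yn : rnorm (y - one) <= 12 * d by have := isqrt_near_one z8 yP; lra.
have un := isometry_le1 uP.1.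
have hn : rnorm h <= 2 by have := rnormD (h - u) u; rewrite subrK; lra.
have hy : h ** y = y ** h by apply: (isqrt_comm yP); rewrite cmulA.
pose g := h ** y.
have gs : g^† = g by rewrite /g cadjM hs (isqrt_adj yP) hy.
have gg : g ** g = one.
  have zy : h ** h ** y = y ** (h ** h) by rewrite (isqrt_comm yP).
  by rewrite /g {1}hy !cmulA' -(cmulA y) -zy (isqrtE yP).
have gu : rnorm (g - u) <= 26 * d.
  have -> : g - u = h ** (y - one) + (h - u).
    by rewrite /g cmulBr cmulx1; lmod_with (R[i]) ltac:(ring).
  by apply: le_trans (le_rnormD (le_rnormM hn yn) hu) _; lra.
have Sg : S g by apply: (ssubM sS) => //; apply: (isqrt_sub yP) => //; exact: (ssubM sS).
clearbody g; exists (half *: (one + g)).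
  by apply: (ssubZ sS); apply: (ssubD sS).
have half4 : half * half * two = half by rewrite -mulrA (mulrC half two) th mulr1.
split; first split.
- rewrite cmulZl cmulZr scalerA !cexpand cmul1x !cmulx1 cmul1x gg.
  have -> : one + g + (g + one) = two *: (one + g) by rewrite sc //; lmod_with (R[i]) ltac:(ring).
  by rewrite scalerA half4.
- by rewrite cadjZR cadjD cone_adj gs.
have -> : half *: (one + g) - p = half *: (g - u).
  rewrite {1}[p]halfR -scalerBr; congr (_ *: _).
  by rewrite /u; lmod_with (R[i]) ltac:(ring).
by rewrite rnormZR ger0_norm ?invr_ge0 //; lra.
Qed.

End Rounding.

End Criteria.

(** * Paths of unitaries *)

Section Paths.
Context {R : realType} {A : unitalCstarType R}.
Implicit Types (x y p q u v w : A) (f g : R -> A).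
Local Notation one := (cone A).

Definition cpath (f : R -> A) := forall t e : R, 0 < e -> exists2 d : R, 0 < d &
  forall s : R, `|s - t| < d -> rnorm (f s - f t) < e.

Lemma cpath_cst x : cpath (fun _ => x).
Proof. by move=> t e e0; exists 1 => // s _; rewrite subrr rnorm0. Qed.

Lemma cpathD f g : cpath f -> cpath g -> cpath (fun t => f t + g t).
Proof.
move=> cf cg t e e0; have e2 : 0 < e / 2 by rewrite divr_gt0.
have [d d0 hd] := cf t _ e2; have [c c0 hc] := cg t _ e2.
exists (Num.min c d); first by rewrite lt_min c0.
move=> s; rewrite lt_min => /andP[/hc h1 /hd h2]; rewrite opprD addrACA.
by apply: le_lt_trans (rnormD _ _) _; rewrite [ltRHS]splitr; exact: Num.Theory.ltrD.
Qed.

Lemma cpathM f g : cpath f -> cpath g -> cpath (fun t => f t ** g t).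
Proof.
move=> cf cg t e e0; pose K := 1 + rnorm (f t) + rnorm (g t).
have f0 := rnorm_ge0 (f t); have g0 := rnorm_ge0 (g t).
have K0 : 0 < K by rewrite /K; lra.
have e2 : 0 < Num.min 1 (e / (2 * K)) by rewrite lt_min ltr01 divr_gt0 // mulr_gt0.
have [d d0 hd] := cf t _ e2; have [c c0 hc] := cg t _ e2.
exists (Num.min c d); first by rewrite lt_min c0.
move=> s; rewrite lt_min => /andP[/hc h1 /hd h2].
have -> : f s ** g s - f t ** g t =
    (f s - f t) ** (g s - g t) + (f s - f t) ** g t + f t ** (g s - g t).
  by rewrite !cexpand; lmod_with (R[i]) ltac:(ring).
move: h1 h2; rewrite !lt_min => /andP[h1 h3] /andP[h2 h4].
have := le_rnormD (le_rnormD (rnormM (f s - f t) (g s - g t)) (rnormM (f s - f t) (g t)))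
  (rnormM (f t) (g s - g t)); move=> /le_lt_trans; apply.
move: h3 h4; rewrite !ltr_pdivlMr ?mulr_gt0 // /K.
move: (rnorm_ge0 (f s - f t)) (rnorm_ge0 (g s - g t)) h1 h2 f0 g0.
move: (rnorm (f s - f t)) (rnorm (g s - g t)) (rnorm (f t)) (rnorm (g t)) => a b p q.
by move=> a0 b0 b1 a1 p0 q0 h h'; nra.
Qed.

Lemma cpath_adj f : cpath f -> cpath (fun t => (f t)^†).
Proof. by move=> cf t e /(cf t)[d d0 hd]; exists d => // s /hd; rewrite -cadjB rnorm_adj. Qed.

Lemma cpathZ (c : R -> R) x : continuous c -> cpath (fun t => (c t)%:C *: x).
Proof.
move=> cc t e e0; have k0 : 0 < 1 + rnorm x by have := rnorm_ge0 x; lra.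
have /cvgrPdist_lt/(_ _ (divr_gt0 e0 k0))/nbhs_ballP[d /= d0 hd] := cc t.
exists d => // s st; rewrite -scalerBl -rmorphB rnormZR distrC.
have := hd s; rewrite /ball /= (distrC t) => /(_ st); rewrite ltr_pdivlMr //.
by have := normr_ge0 (c t - c s); have := rnorm_ge0 x; nra.
Qed.

Lemma cpath_sum I (r : seq I) (F : I -> R -> A) : (forall i, cpath (F i)) ->
  cpath (fun t => \sum_(i <- r) F i t).
Proof.
move=> h; elim: r => [|i r IH].
  have -> : (fun t => \sum_(i <- [::]) F i t) = (fun _ => 0).
    by apply/funext => t; rewrite big_nil.
  exact: cpath_cst.
have -> : (fun t => \sum_(j <- i :: r) F j t) = (fun t => F i t + \sum_(j <- r) F j t).
  by apply/funext => t; rewrite big_cons.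
exact: cpathD.
Qed.

Lemma cpath_rev f : cpath f -> cpath (fun t => f (1 - t)).
Proof.
move=> cf t e /(cf (1 - t))[d d0 hd]; exists d => // s st; apply: hd.
by rewrite opprB addrC addrA subrK -normrN opprB.
Qed.

(** Paths are defined and unitary on the whole line, which spares restrictions to [0, 1];
    trigonometric parametrizations provide this. *)
Definition hom1 u v := exists f : R -> A,
  [/\ cpath f, forall t, unit1 (f t), f 0 = u & f 1 = v].

Lemma unit1M u v : unit1 u -> unit1 v -> unit1 (u ** v).
Proof.
move=> [u1 u2] [v1 v2]; rewrite /unit1 cadjM !cmulA' -(cmulA v^†) u1 cmulx1 v1.
by rewrite -(cmulA u v) v2 cmulx1 u2.
Qed.
Lemma unit1_adj u : unit1 u -> unit1 u^†.
Proof. by move=> [h1 h2]; rewrite /unit1 cadjK. Qed.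

Lemma hom1_refl u : unit1 u -> hom1 u u.
Proof. by move=> uP; exists (fun _ => u); split=> //; exact: cpath_cst. Qed.
Lemma hom1_sym u v : hom1 u v -> hom1 v u.
Proof.
move=> [f [cf uf f0 f1]]; exists (fun t => f (1 - t)); split=> //.
- exact: cpath_rev.
- by rewrite subr0.
- by rewrite subrr.
Qed.
Lemma hom1M u v u' v' : hom1 u v -> hom1 u' v' -> hom1 (u ** u') (v ** v').
Proof.
move=> [f [cf uf <- <-]] [g [cg ug <- <-]]; exists (fun t => f t ** g t); split=> //.
  exact: cpathM.
by move=> t; exact: unit1M.
Qed.
Lemma hom1_unit u v : hom1 u v -> unit1 u.
Proof. by move=> [f [_ uf <- _]]. Qed.
Lemma hom1_trans v u w : hom1 u v -> hom1 v w -> hom1 u w.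
Proof.
move=> uv vw; have vP := hom1_unit vw.
have := hom1M (hom1M uv (hom1_refl (unit1_adj vP))) vw.
by case: (vP) => v1 v2; rewrite v2 cmul1x -cmulA v1 cmulx1.
Qed.

(** u transported to the range of the isometry V and completed by 1 on the orthogonal complement. *)
Definition ampl V u := V ** u ** V^† + (one - V ** V^†).

Lemma amplM V u v : V^† ** V = one -> ampl V u ** ampl V v = ampl V (u ** v).
Proof.
move=> VV; rewrite /ampl !cexpand !cmulx1 !cmul1x.
rewrite -!(cmulA _ V^† V) VV !cmulx1.
by lmod_with (R[i]) ltac:(ring).
Qed.
Lemma ampl_adj V u : (ampl V u)^† = ampl V u^†.
Proof. by rewrite /ampl cadjD cadjB !cadjM !cadjK cone_adj cmulA. Qed.
Lemma ampl1 V : ampl V one = one.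
Proof. by rewrite /ampl cmulx1 addrC subrK. Qed.
Lemma ampl_unit V u : V^† ** V = one -> unit1 u -> unit1 (ampl V u).
Proof. by move=> VV [u1 u2]; rewrite /unit1 ampl_adj !amplM // u1 u2 ampl1. Qed.
Lemma ampl_ampl V W u : ampl V (ampl W u) = ampl (V ** W) u.
Proof.
rewrite /ampl !cexpand cadjM !cmulA' cmulx1.
by lmod_with (R[i]) ltac:(ring).
Qed.

Lemma ampl_hom V u v : V^† ** V = one -> hom1 u v -> hom1 (ampl V u) (ampl V v).
Proof.
move=> VV [f [cf uf <- <-]]; exists (fun t => ampl V (f t)); split=> //.
  apply: cpathD; last exact: cpath_cst.
  by apply: cpathM; [apply: cpathM => //; exact: cpath_cst|exact: cpath_cst].
by move=> t; exact: ampl_unit.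
Qed.

Definition quarter (t : R) := t * (pi / 2).

Lemma quarter_cos : continuous (fun t => cos (quarter t)).
Proof. by move=> t; apply: continuous_comp; [apply: cvgMl|exact: continuous_cos]. Qed.
Lemma quarter_sin : continuous (fun t => sin (quarter t)).
Proof. by move=> t; apply: continuous_comp; [apply: cvgMl|exact: continuous_sin]. Qed.

(** Since V and W have orthogonal ranges, cos V + sin W is an isometry at every angle. *)
Lemma ampl_rotate V W u : V^† ** V = one -> W^† ** W = one -> V^† ** W = 0 -> unit1 u ->
  hom1 (ampl V u) (ampl W u).
Proof.
move=> VV WW VW uP; have WV : W^† ** V = 0 by rewrite -[LHS]cadjK cadjM cadjK VW cadj0.
pose X t := (cos (quarter t))%:C *: V + (sin (quarter t))%:C *: W.
have XX t : (X t)^† ** X t = one.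
  rewrite /X cadjD !cadjZR !cexpand VV WW VW WV !scaler0 addr0 add0r !scalerA -scalerDl.
  by rewrite -!rmorphM -rmorphD -!expr2 cos2Dsin2 rmorph1 scale1r.
have cX : cpath X by apply: cpathD; apply: cpathZ; [exact: quarter_cos|exact: quarter_sin].
exists (fun t => ampl (X t) u); split.
- apply: cpathD; first by apply: cpathM; [apply: cpathM => //; exact: cpath_cst|exact: cpath_adj].
  have -> : (fun t => one - X t ** (X t)^†) = (fun t => one + (-1 *: X t) ** (X t)^†).
    by apply/funext => t; rewrite scaleN1r cmulNl.
  apply: cpathD; first exact: cpath_cst.
  apply: cpathM; last exact: cpath_adj.
  have -> : (fun t => -1 *: X t) = (fun t => (- one) ** X t).
    by apply/funext => t; rewrite cmulNl cmul1x scaleN1r.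
  by apply: cpathM => //; exact: cpath_cst.
- by move=> t; exact: ampl_unit.
- by rewrite /X /quarter mul0r cos0 sin0 rmorph1 rmorph0 scale1r scale0r addr0.
- by rewrite /X /quarter mul1r cos_pihalf sin_pihalf rmorph1 rmorph0 scale1r scale0r add0r.
Qed.

(** Conjugation by the unitary s' s^* + t' t^* takes one amplification to the other and fixes 1. *)
Lemma ampl_rebase (s t s' t' : A) u : cuntz_pair s t -> cuntz_pair s' t' -> unit1 u ->
  hom1 (ampl s u) one -> hom1 (ampl s' u) one.
Proof.
move=> st st' uP h; have [st0 ts0] := cuntz_orth st; have [st0' ts0'] := cuntz_orth st'.
have [ss tt e] := st; have [ss' tt' e'] := st'.
pose Z := s' ** s^† + t' ** t^†.
have Zs : Z^† = s ** s'^† + t ** t'^† by rewrite /Z cadjD !cadjM !cadjK.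
have Z1 : Z^† ** Z = one.
  rewrite Zs /Z !cexpand -!(cmulA _ s'^†) -!(cmulA _ t'^†) ss' tt' st0' ts0'.
  by rewrite !cmulx0 !cmul0x !cmulx1 addr0 add0r.
have Z2 : Z ** Z^† = one.
  rewrite Zs /Z !cexpand -!(cmulA _ s^† s) -!(cmulA _ s^† t) -!(cmulA _ t^† s) -!(cmulA _ t^† t) ss tt st0 ts0.
  by rewrite !cmulx0 !cmul0x !cmulx1 addr0 add0r.
have ZP : unit1 Z by split.
have Zss : Z ** s = s' by rewrite /Z cmulDl -!cmulA ss ts0 cmulx0 cmulx1 addr0.
have := hom1M (hom1M (hom1_refl ZP) h) (hom1_refl (unit1_adj ZP)).
rewrite cmulx1 Z2; have -> // : Z ** ampl s u ** Z^† = ampl s' u.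
rewrite /ampl cmulDr cmulDl cmulBr cmulBl cmulx1 Z2 !cmulA' Zss.
by rewrite -!(cmulA _ s^† Z^†) -cadjM Zss.
Qed.

(** A swindle. Amplified by s, the hypothesis connects [ampl s w] to the product of
    [ampl (s ** s) u] and [ampl (s ** t) w]. The last factor is rotated back to [ampl s w] and
    cancelled, so that [ampl (s ** s) u] is connected to 1. Ranges that are not orthogonal are
    joined through that of t. *)
Lemma ampl_trivial (s t : A) u w : cuntz_pair s t -> unit1 u -> hom1 w (diag s t u w) ->
  hom1 (ampl s u) one.
Proof.
move=> st uP h; have wP := hom1_unit h; have [st0 ts0] := cuntz_orth st.
have [ss tt e] := st.
have iso a b : a^† ** a = one -> b^† ** b = one -> (a ** b)^† ** (a ** b) = one.
  by move=> aa bb; rewrite cadjM !cmulA' -(cmulA b^†) aa cmulx1.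
have E : diag s t u w = ampl s u ** ampl t w.
  rewrite /diag /ampl !cexpand !cmulx1 !cmul1x.
  rewrite -!(cmulA _ s^† t) st0 ?cmulx0 ?cmul0x.
  rewrite -e.
  by lmod_with (R[i]) ltac:(ring).
have h1 : hom1 (ampl s w) (ampl (s ** s) u ** ampl (s ** t) w).
  have := ampl_hom ss h; rewrite E -amplM // !ampl_ampl //.
have h2 : hom1 (ampl (s ** t) w) (ampl s w).
  apply: (@hom1_trans (ampl t w)); apply: ampl_rotate => //; try exact: iso.
  by rewrite cadjM -cmulA st0 cmulx0.
have h3 : hom1 (ampl s w) (ampl (s ** s) u ** ampl s w).
  by apply: hom1_trans h1 _; apply: hom1M h2; apply: hom1_refl; apply: ampl_unit => //; exact: iso.
have swP : unit1 (ampl s w) by exact: ampl_unit.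
have h4 := hom1M h3 (hom1_refl (unit1_adj swP)).
rewrite -cmulA swP.2 cmulx1 in h4.
apply: hom1_trans (hom1_sym h4).
apply: (@hom1_trans (ampl t u)); apply: ampl_rotate => //; try exact: iso.
by rewrite cmulA' ts0 cmul0x.
Qed.

(** The unitary parts of the points of the segment from u to v; the parameter sin^2 stays in [0, 1]
    for all real t. *)
Lemma near_unitary_hom u v : unit1 u -> unit1 v -> rnorm (u - v) <= 24^-1 -> hom1 u v.
Proof.
move=> uP vP uv; have un := isometry_le1 uP.1.
pose c t : R := sin (quarter t) ^+ 2.
have c01 t : 0 <= c t <= 1.
  by rewrite sqr_ge0 /=; have := cos2Dsin2 (quarter t); have := sqr_ge0 (cos (quarter t)); rewrite /c; lra.
have cc : continuous c.
  by move=> t; rewrite /c; apply: cvgM; exact: quarter_sin.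
pose w t := u + (c t)%:C *: (v - u).
have wu t : rnorm (w t - u) <= 24^-1.
  rewrite /w addrAC subrr add0r rnormZR ger0_norm; last by case/andP: (c01 t).
  have := c01 t; have := rnorm_ge0 (v - u); rewrite rdistC => h /andP[h1 h2]; nra.
have w2 t := near_unitary_gram uP (wu t) (_ : 24^-1 <= 1).
have {}w2 t : rnorm (one - (w t)^† ** w t) <= 8^-1.
  by rewrite rdistC; have h24 : 24^-1 <= 1 :> R; [lra|have := w2 h24 t; lra].
have /choice[y yP] : forall t, exists y, is_isqrt one ((w t)^† ** w t) y.
  by move=> t; apply: isqrt_exists (w2 t); [exact: coneP|rewrite cadjM cadjK].
have cw : cpath w.
  by apply: cpathD; [exact: cpath_cst|exact: cpathZ].
have cy : cpath y.
  move=> t e e0; have e2 : 0 < e / 2 by rewrite divr_gt0.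
  have [d d0 hd] := cpathM (cpath_adj cw) cw t e2; exists d => // s /hd h.
  by apply: le_lt_trans (isqrt_lipschitz coneP (w2 s) (w2 t) (yP s) (yP t)) _; lra.
have y1 t : unit1 (w t) -> y t = one.
  move=> [w1 _]; apply/eqP; rewrite -subr_eq0; apply/eqP/rnorm_eq0/eqP.
  rewrite eq_le rnorm_ge0 andbT.
  by have := isqrt_near_one (w2 t) (yP t); rewrite w1 subrr rnorm0 mulr0.
have w0 : w 0 = u by rewrite /w /c /quarter mul0r sin0 expr0n rmorph0 scale0r addr0.
have w1 : w 1 = v by rewrite /w /c /quarter mul1r sin_pihalf expr1n rmorph1 scale1r addrC subrK.
exists (fun t => w t ** y t); split.
- exact: cpathM.
- move=> t; apply: (isometry_near_unitary uP); first exact: isometry_polar.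
  have -> : w t ** y t - u = w t ** (y t - one) + (w t - u).
    by rewrite cmulBr cmulx1; lmod_with (R[i]) ltac:(ring).
  have wn : rnorm (w t) <= 1 + 24^-1 by have := rnormD (w t - u) u; rewrite subrK; have := wu t; lra.
  have := le_rnormD (le_rnormM wn (isqrt_near (yP t))) (wu t); lra.
- by rewrite y1 ?w0 ?cmulx1.
- by rewrite y1 ?w1 ?cmulx1.
Qed.

(** * Reducing matrices over A to A *)

Section MatrixAlgebra.
Implicit Types (m n k l : nat).

Lemma mxcmulA m n k l (X : 'M[A]_(m, n)) (Y : 'M[A]_(n, k)) (Z : 'M[A]_(k, l)) :
  mxcmul X (mxcmul Y Z) = mxcmul (mxcmul X Y) Z.
Proof.
apply/matrixP => i j; rewrite !mxE.
under eq_bigr do rewrite mxE cmul_sumr.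
under [RHS]eq_bigr do rewrite mxE cmul_suml.
rewrite exchange_big; apply: eq_bigr => a _; apply: eq_bigr => b _; exact: cmulA.
Qed.

Lemma mxadjM m n k (X : 'M[A]_(m, n)) (Y : 'M[A]_(n, k)) :
  mxadj (mxcmul X Y) = mxcmul (mxadj Y) (mxadj X).
Proof.
apply/matrixP => i j; rewrite !mxE cadj_sum; apply: eq_bigr => a _.
by rewrite cadjM !mxE.
Qed.

Lemma mxadjK m n (X : 'M[A]_(m, n)) : mxadj (mxadj X) = X.
Proof. by apply/matrixP => i j; rewrite !mxE cadjK. Qed.

Lemma mxcmul1x m n (X : 'M[A]_(m, n)) : mxcmul (mxcone A m) X = X.
Proof.
apply/matrixP => i j; rewrite !mxE (bigD1 i) //= !mxE eqxx cmul1x big1 ?addr0 // => k ki.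
by rewrite !mxE eq_sym (negPf ki) cmul0x.
Qed.

Lemma mxcmulx1 m n (X : 'M[A]_(m, n)) : mxcmul X (mxcone A n) = X.
Proof.
apply/matrixP => i j; rewrite !mxE (bigD1 j) //= !mxE eqxx cmulx1 big1 ?addr0 // => k ki.
by rewrite !mxE (negPf ki) cmulx0.
Qed.

Lemma mxadj_one n : mxadj (mxcone A n) = mxcone A n.
Proof. by apply/matrixP => i j; rewrite !mxE eq_sym; case: ifP; rewrite ?cone_adj ?cadj0. Qed.

Definition mx1 x : 'M[A]_1 := \matrix_(i, j) x.

Lemma mx1M x y : mxcmul (mx1 x) (mx1 y) = mx1 (x ** y).
Proof. by apply/matrixP => i j; rewrite !mxE big_ord1 !mxE. Qed.
Lemma mx1_adj x : mxadj (mx1 x) = mx1 x^†.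
Proof. by apply/matrixP => i j; rewrite !mxE. Qed.
Lemma mx1E (X : 'M[A]_1) : X = mx1 (X ord0 ord0).
Proof. by apply/matrixP => i j; rewrite !ord1 mxE. Qed.
Lemma mx1_inj x y : mx1 x = mx1 y -> x = y.
Proof. by move=> /matrixP/(_ ord0 ord0); rewrite !mxE. Qed.

Definition cuntz_row n (t : 'I_n -> A) :=
  (forall i j, (t i)^† ** t j = if i == j then one else 0).

Variables (s t : A) (st : cuntz_pair s t).

Lemma cuntz_row_exists n : exists2 r : 'I_n.+1 -> A, cuntz_row r &
  \sum_i r i ** (r i)^† = one.
Proof.
have [st0 ts0] := cuntz_orth st; have [ss tt e] := st.
elim: n => [|n [r rP rs]].
  exists (fun _ => one) => [i j|]; first by rewrite !ord1 eqxx cone_adj cmul1x.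
  by rewrite big_ord1 cone_adj cmul1x.
exists (fun i => if unlift ord0 i is Some j then t ** r j else s).
  move=> i j; case: (unliftP ord0 i) => [i'|] ->; case: (unliftP ord0 j) => [j'|] ->.
  - rewrite cadjM !cmulA' -(cmulA _ t^†) tt cmulx1 rP.
    by rewrite (inj_eq (@lift_inj _ _)).
  - by rewrite cadjM -cmulA ts0 cmulx0 eq_sym (negPf (neq_lift _ _)).
  - by rewrite cmulA' st0 cmul0x (negPf (neq_lift _ _)).
  - by rewrite eqxx ss.
rewrite big_ord_recl unlift_none -e; congr (_ + _).
under eq_bigr do rewrite liftK cadjM cmulA' -(cmulA t).
by rewrite -cmul_suml -cmul_sumr rs cmulx1.
Qed.

Lemma mvn1_proj_row n (P : 'M[A]_n) : is_projection P ->
  exists (v : 'rV[A]_n) p, [/\ isproj p, mxcmul (mxadj v) v = P & mxcmul v (mxadj v) = mx1 p].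
Proof.
move=> [PP Ps]; have [r rP _] := cuntz_row_exists n.
(* [cuntz_row_exists] provides n + 1 isometries, which covers n = 0; the last one is dropped. *)
pose v : 'rV[A]_n := mxcmul (\row_j r (widen_ord (leqnSn n) j)) P.
have rr : mxcmul (mxadj (\row_j r (widen_ord (leqnSn n) j))) (\row_j r (widen_ord (leqnSn n) j)) = mxcone A n.
  by apply/matrixP => i j; rewrite !mxE big_ord1 !mxE rP.
have vv : mxcmul (mxadj v) v = P.
  by rewrite /v mxadjM Ps mxcmulA -(mxcmulA P) rr mxcmulx1 PP.
have vP : mxcmul v P = v by rewrite /v -mxcmulA PP.
pose X := mxcmul v (mxadj v); exists v, (X ord0 ord0); rewrite -mx1E; split=> //.
split; apply: mx1_inj; rewrite -?mx1M -?mx1_adj -!mx1E /X.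
  by rewrite mxcmulA -(mxcmulA v (mxadj v) v) vv vP.
by rewrite mxadjM mxadjK.
Qed.

Lemma partial_isometry (z c : A) : isproj c -> z^† ** z = c -> z ** c = z.
Proof.
move=> [c1 c2] zc; apply/eqP; rewrite -subr_eq0; apply/eqP/rnorm_eq0/eqP.
rewrite -sqrf_eq0 -rnorm_cstar cadjB cadjM c2.
have -> : (c ** z^† - z^†) ** (z ** c - z) = 0; last by rewrite rnorm0.
rewrite cmulBl !cmulBr !cmulA' -(cmulA c z^† z) zc !c1.
by rewrite !subrr.
Qed.

(** Equality of x and y means stable equivalence of x.1 + y.2 and y.1 + x.2. These are brought to
    projections p and q of A; if a absorbs p and b absorbs q, then r = a + b absorbs both, so p + r
    and q + r are equivalent to r. *)
Lemma K0_trivial :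
  (forall p, isproj p -> exists a b r, [/\ cuntz_pair a b, isproj r & mvn1 r (diag a b p r)]) ->
  forall x y : K0_rep A, K0_eq x y.
Proof.
move=> H x y.
have Hst p : isproj p -> exists2 r, isproj r & mvn1 r (diag s t p r).
  move=> pP; have [a [b [r [ab rP h]]]] := H p pP; exists r => //.
  by apply: (mvn1_trans rP _ h (mvn1_rebase ab st pP rP)); exact: diag_proj.
have [v [p [pP vp vv]]] := mvn1_proj_row (proj_mxP (proj_sum x.1 y.2)).
have [w [q [qP wq ww]]] := mvn1_proj_row (proj_mxP (proj_sum y.1 x.2)).
have [a aP ha] := Hst p pP; have [b bP hb] := Hst q qP.
pose r := diag s t a b; have rP : isproj r by exact: diag_proj.
have [st0 ts0] := cuntz_orth st; have [ss tt e] := st.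
have D0P x' y' : isproj x' -> isproj y' -> isproj (diag s t x' y') by exact: diag_proj.
have h1 : mvn1 (diag s t p r) r.
  apply: (@mvn1_trans _ _ (diag s t (diag s t p a) b)); rewrite /r; try by repeat apply: D0P.
    have [pp ps] := pP; have [aa as'] := aP; have [bb bs] := bP.
    (* Sums formed with [diag] are associative only up to equivalence; this is the partial
       isometry. *)
    exists (s ** s ** p ** s^† + s ** t ** a ** s^† ** t^† + t ** b ** t^† ** t^†).
    rewrite /diag !(cadjD, cadjM, cadjK) ps as' bs !cexpand.
    rewrite -!(cmulA _ s^† s) -!(cmulA _ s^† t) -!(cmulA _ t^† s) -!(cmulA _ t^† t) ss tt st0 ts0.
    rewrite !(cmulx1, cmulx0, cmul0x, addr0, add0r).
    rewrite -!(cmulA _ s^† s) -!(cmulA _ s^† t) -!(cmulA _ t^† s) -!(cmulA _ t^† t) ss tt st0 ts0.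
    rewrite !(cmulx1, cmulx0, cmul0x, addr0, add0r).
    rewrite -!(cmulA _ p p) -!(cmulA _ a a) -!(cmulA _ b b) pp aa bb.
    by split; lmod_with (R[i]) ltac:(ring).
  by apply: mvn1_diag => //; [exact: mvn1_sym|exact: mvn1_refl].
have h2 : mvn1 (diag s t q r) r.
  apply: (@mvn1_trans _ _ (diag s t a (diag s t q b))); rewrite /r; try by repeat apply: D0P.
    have [qq qs] := qP; have [aa as'] := aP; have [bb bs] := bP.
    exists (t ** s ** q ** s^† + s ** a ** s^† ** t^† + t ** t ** b ** t^† ** t^†).
    rewrite /diag !(cadjD, cadjM, cadjK) qs as' bs !cexpand.
    rewrite -!(cmulA _ s^† s) -!(cmulA _ s^† t) -!(cmulA _ t^† s) -!(cmulA _ t^† t) ss tt st0 ts0.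
    rewrite !(cmulx1, cmulx0, cmul0x, addr0, add0r).
    rewrite -!(cmulA _ s^† s) -!(cmulA _ s^† t) -!(cmulA _ t^† s) -!(cmulA _ t^† t) ss tt st0 ts0.
    rewrite !(cmulx1, cmulx0, cmul0x, addr0, add0r).
    rewrite -!(cmulA _ q q) -!(cmulA _ a a) -!(cmulA _ b b) qq aa bb.
    by split; lmod_with (R[i]) ltac:(ring).
  by apply: mvn1_diag => //; [exact: mvn1_refl|exact: mvn1_sym].
have mr : is_projection (mx1 r).
  by case: rP => r1 r2; rewrite /is_projection mx1M mx1_adj r1 r2.
have row n (V : 'rV[A]_n) P p' : isproj p' -> mxcmul (mxadj V) V = P -> mxcmul V (mxadj V) = mx1 p' ->
    exists V' : 'rV[A]_(n + 1), mxcmul (mxadj V') V' = dsum P (mx1 r) /\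
      mxcmul V' (mxadj V') = mx1 (diag s t p' r).
  move=> [p1 p2] VV Vp; case: (rP) => r1 r2.
  exists (row_mx (mxcmul (mx1 s) V) (mx1 (t ** r))).
  have adjE : mxadj (row_mx (mxcmul (mx1 s) V) (mx1 (t ** r))) =
      col_mx (mxcmul (mxadj V) (mx1 s^†)) (mx1 (r ** t^†)).
    rewrite -mx1_adj -mxadjM; apply/matrixP => i j; rewrite [LHS]mxE.
    by case: (split_ordP i) => i' ->; rewrite ?(row_mxEl, row_mxEr, col_mxEu, col_mxEd) !mxE ?cadjM ?r2.
  rewrite adjE; split; apply/matrixP => i j; rewrite [LHS]mxE.
    rewrite big_ord1.
    have E1 i' : (mxcmul (mxadj V) (mx1 s^†)) i' ord0 = (V ord0 i')^† ** s^†.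
      by rewrite mxE big_ord1 !mxE.
    have E2 i' : (mxcmul (mx1 s) V) ord0 i' = s ** V ord0 i'.
      by rewrite mxE big_ord1 !mxE.
    case: (split_ordP i) => i' ->; case: (split_ordP j) => j' ->;
      rewrite ?(row_mxEl, row_mxEr, col_mxEu, col_mxEd) /dsum
        ?(block_mxEul, block_mxEur, block_mxEdl, block_mxEdr) ?E2 ?E1 //.
    - by rewrite !cmulA' -(cmulA _ s^†) ss cmulx1 -VV !mxE big_ord1 !mxE.
    - by rewrite !mxE !cmulA' -(cmulA _ s^†) st0 cmulx0 cmul0x.
    - by rewrite !mxE !cmulA' -(cmulA _ t^†) ts0 cmulx0 cmul0x.
    - by rewrite !mxE !cmulA' -(cmulA _ t^†) tt cmulx1 r1.
  rewrite big_split_ord /= big_ord1 row_mxEr col_mxEd !mxE /diag; congr (_ + _).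
    under eq_bigr do rewrite row_mxEl col_mxEu.
    have <- : mxcmul (mxcmul (mx1 s) V) (mxcmul (mxadj V) (mx1 s^†)) i j = s ** p' ** s^†.
      by rewrite mxcmulA -(mxcmulA _ V) Vp !mx1M mxE.
    by rewrite [RHS]mxE.
  by rewrite !cmulA' -(cmulA t) r1.
have [V [V1 V2]] := row _ _ _ _ pP vp vv; have [W [W1 W2]] := row _ _ _ _ qP wq ww.
have DpP : isproj (diag s t p r) by exact: diag_proj.
have DqP : isproj (diag s t q r) by exact: diag_proj.
have [z [z1 z2]] := mvn1_trans DpP DqP h1 (mvn1_sym h2).
exists (Projection mr); exists (mxcmul (mxadj W) (mxcmul (mx1 z) V)) => /=.
rewrite mxadjM mxadjK mxadjM mx1_adj.
have [PP _] := proj_mxP (proj_sum (proj_sum x.1 y.2) (Projection mr)).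
have [QQ _] := proj_mxP (proj_sum (proj_sum y.1 x.2) (Projection mr)).
have zc := partial_isometry DpP z1.
have cz : diag s t q r ** z = z by rewrite -z2 -cmulA z1.
move: PP QQ; rewrite /= -V1 -W1 => PP QQ; split.
  transitivity (mxcmul (mxadj V) (mxcmul (mx1 (z^† ** (diag s t q r ** z))) V)).
    rewrite cz z1 -V2 -[in RHS]mxcmulA [RHS]mxcmulA; exact: esym.
  by rewrite -!mx1M -W2 !mxcmulA.
transitivity (mxcmul (mxadj W) (mxcmul (mx1 (z ** diag s t p r ** z^†)) W)).
  rewrite zc z2 -W2 -[in RHS]mxcmulA [RHS]mxcmulA; exact: esym.
by rewrite -!mx1M -V2 !mxcmulA.
Qed.

Definition mpath n (f : R -> 'M[A]_n) := forall i j, cpath (fun r => f r i j).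

Lemma mpath_continuous n (f : R -> 'M[A]_n) : mpath f -> continuous f.
Proof.
move=> cf r P [Q hQ QP].
have : \forall r' \near r, forall i j, Q i j (f r' i j).
  apply: (@filter_forall R 'I_n (fun i r' => forall j, Q i j (f r' i j)) (nbhs r) _) => i.
  apply: (@filter_forall R 'I_n (fun j r' => Q i j (f r' i j)) (nbhs r) _) => j.
  have /nbhs_rnorm[e e0 he] := hQ i j; have [d d0 hd] := cf i j r e e0.
  apply/nbhs_ballP; exists d => // r'; rewrite /ball /= distrC => /hd h.
  by apply: he; rewrite rdistC.
by apply: filterS => r' h; apply: QP => i j; exact: h.
Qed.

Lemma mpathM n (f g : R -> 'M[A]_n) : mpath f -> mpath g -> mpath (fun r => mxcmul (f r) (g r)).
Proof.
move=> cf cg i j.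
have -> : (fun r => mxcmul (f r) (g r) i j) = (fun r => \sum_k f r i k ** g r k j).
  by apply/funext => r; rewrite mxE.
by apply: cpath_sum => k; apply: cpathM.
Qed.

Definition mhom n (u v : 'M[A]_n) := exists f : R -> 'M[A]_n,
  [/\ mpath f, forall r, Defs.is_unitary (f r), f 0 = u & f 1 = v].

Lemma mhom_unitary n (u v : 'M[A]_n) : mhom u v -> unitary_homotopic u v.
Proof.
move=> [f [cf uf f0 f1]]; exists f; split=> //.
exact/continuous_subspaceT/mpath_continuous.
Qed.

Lemma is_unitaryM n (u v : 'M[A]_n) : Defs.is_unitary u -> Defs.is_unitary v -> Defs.is_unitary (mxcmul u v).
Proof.
move=> [u1 u2] [v1 v2]; rewrite /Defs.is_unitary mxadjM; split.
  by rewrite mxcmulA -(mxcmulA (mxadj v)) u1 mxcmulx1.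
by rewrite mxcmulA -(mxcmulA u) v2 mxcmulx1.
Qed.

Lemma mhom_join n (u v : 'M[A]_n) : mhom u (mxcone A n) -> mhom v (mxcone A n) -> mhom u v.
Proof.
move=> [f [cf uf f0 f1]] [g [cg ug g0 g1]].
exists (fun r => mxcmul (f r) (g (1 - r))); split.
- by apply: mpathM => // i j; apply: (cpath_rev (f := fun r => g r i j)); exact: cg.
- by move=> r; exact: is_unitaryM.
- by rewrite f0 subr0 g1 mxcmulx1.
- by rewrite f1 subrr g0 mxcmul1x.
Qed.

Lemma mhom_castmx m n (e : m = n) (u : 'M[A]_m) :
  mhom u (mxcone A m) -> mhom (castmx (e, e) u) (mxcone A n).
Proof. by case: n / e; rewrite castmx_id. Qed.

(** x is sent to the matrix of the r_i^* x r_j, a unital homomorphism from A to M_n(A) that takes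
    the given sum back to U. *)
Lemma mhom_row n (r : 'I_n -> A) (U : 'M[A]_n) : cuntz_row r -> \sum_i r i ** (r i)^† = one ->
  hom1 (\sum_i \sum_j r i ** U i j ** (r j)^†) one -> mhom U (mxcone A n).
Proof.
move=> rP rs [f [cf uf f0 f1]].
pose F x : 'M[A]_n := \matrix_(i, j) ((r i)^† ** x ** r j).
have FM x y : mxcmul (F x) (F y) = F (x ** y).
  apply/matrixP => i j; rewrite !mxE; under eq_bigr do rewrite !mxE !cmulA' -(cmulA ((r i)^† ** x)).
  by rewrite -!cmul_suml -cmul_sumr rs cmulx1 !cmulA'.
have FJ x : mxadj (F x) = F x^†.
  by apply/matrixP => i j; rewrite !mxE !cadjM cadjK cmulA.
have F1 : F one = mxcone A n.
  by apply/matrixP => i j; rewrite !mxE cmulx1 rP.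
exists (fun d : R => F (f d)); split.
- move=> i j; have -> : (fun d : R => F (f d) i j) = (fun d : R => (r i)^† ** f d ** r j).
    by apply/funext => y; rewrite mxE.
  by apply: cpathM; [apply: cpathM => //; exact: cpath_cst|exact: cpath_cst].
- by move=> y; have [h1 h2] := uf y; rewrite /Defs.is_unitary FJ !FM h1 h2 F1.
- rewrite f0; apply/matrixP => i j; rewrite mxE cmul_sumr cmul_suml (bigD1 i) //= [X in _ + X]big1 ?addr0.
    rewrite cmul_sumr cmul_suml (bigD1 j) //= [X in _ + X]big1 ?addr0.
      by rewrite !cmulA' rP eqxx cmul1x -cmulA rP eqxx cmulx1.
    by move=> k kj; rewrite -!cmulA rP (negPf kj) !cmulx0.
  move=> k ki; rewrite cmul_sumr cmul_suml big1 // => l _.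
  by rewrite !cmulA' rP eq_sym (negPf ki) !cmul0x.
- by rewrite f1 F1.
Qed.

(** Under the row g made of the s r_i and the t q_j, the sum of U and an identity becomes
    [ampl s u]. The complement of the range of s has to be filled, hence an identity of size at
    least 1. *)
Lemma unitary_stably_trivial : (forall u, unit1 u -> hom1 (ampl s u) one) ->
  forall n (U : 'M[A]_n) a, Defs.is_unitary U -> mhom (dsum U (mxcone A a.+1)) (mxcone A (n + a.+1)).
Proof.
move=> H n U a [U1 U2]; have [st0 ts0] := cuntz_orth st; have [ss tt e] := st.
case: n U U1 U2 => [|n] U U1 U2.
  have -> : dsum U (mxcone A a.+1) = mxcone A (0 + a.+1).
    rewrite [RHS](esym (mxcone_dsum A 0 a.+1)); congr dsum; by apply/matrixP => i; have := ltn_ord i; rewrite ltn0.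
  exists (fun _ => mxcone A (0 + a.+1)); split=> //; first by move=> i j; exact: cpath_cst.
  by move=> _; rewrite /Defs.is_unitary mxadj_one mxcmul1x.
have [r rP rs] := cuntz_row_exists n; have [q qP qs] := cuntz_row_exists a.
pose g (i : 'I_(n.+1 + a.+1)) := match fintype.split i with inl i => s ** r i | inr i => t ** q i end.
have gl i : g (lshift a.+1 i) = s ** r i by rewrite /g (unsplitK (inl i)).
have gr i : g (rshift n.+1 i) = t ** q i by rewrite /g (unsplitK (inr i)).
apply: (@mhom_row _ g).
- move=> i j; case: (split_ordP i) => i' ->; case: (split_ordP j) => j' ->; rewrite !(gl, gr) cadjM !cmulA'.
  + by rewrite -(cmulA _ s^†) ss cmulx1 rP (inj_eq (@lshift_inj _ _)).
  + by rewrite -(cmulA _ s^†) st0 cmulx0 cmul0x eq_lrshift.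
  + by rewrite -(cmulA _ t^†) ts0 cmulx0 cmul0x eq_rlshift.
  + by rewrite -(cmulA _ t^†) tt cmulx1 qP (inj_eq (@rshift_inj _ _)).
- rewrite big_split_ord /= -e; congr (_ + _).
    under eq_bigr do rewrite gl cadjM cmulA' -(cmulA s).
    by rewrite -cmul_suml -cmul_sumr rs cmulx1.
  under eq_bigr do rewrite gr cadjM cmulA' -(cmulA t).
  by rewrite -cmul_suml -cmul_sumr qs cmulx1.
pose u := \sum_i \sum_j r i ** U i j ** (r j)^†.
have uM (X Y : 'M[A]_n.+1) : (\sum_i \sum_j r i ** X i j ** (r j)^†) ** (\sum_i \sum_j r i ** Y i j ** (r j)^†) =
    \sum_i \sum_j r i ** mxcmul X Y i j ** (r j)^†.
  rewrite cmul_suml; apply: eq_bigr => i _; rewrite cmul_suml.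
  under eq_bigr => k _ do rewrite cmul_sumr.
  rewrite (_ : \sum_k _ = \sum_k \sum_j r i ** (X i k ** Y k j) ** (r j)^†).
    rewrite exchange_big; apply: eq_bigr => j _.
    by rewrite mxE cmul_sumr cmul_suml.
  apply: eq_bigr => k _; rewrite (bigD1 k) //= [X in _ + X]big1 ?addr0.
    rewrite cmul_sumr; apply: eq_bigr => j _.
    by rewrite !cmulA' -(cmulA _ (r k)^†) rP eqxx cmulx1.
  move=> l lk; rewrite cmul_sumr big1 // => j _.
  by rewrite !cmulA' -(cmulA _ (r k)^†) rP eq_sym (negPf lk) cmulx0 !cmul0x.
have u1 : \sum_i \sum_j r i ** mxcone A n.+1 i j ** (r j)^† = one.
  rewrite -rs; apply: eq_bigr => i _; rewrite (bigD1 i) //= big1 ?addr0.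
    by rewrite mxE eqxx cmulx1.
  by move=> j ji; rewrite mxE eq_sym (negPf ji) cmulx0 cmul0x.
have uJ : u^† = \sum_i \sum_j r i ** mxadj U i j ** (r j)^†.
  rewrite /u cadj_sum; under eq_bigr do rewrite cadj_sum.
  rewrite exchange_big; apply: eq_bigr => i _; apply: eq_bigr => j _.
  by rewrite !cadjM cadjK mxE cmulA.
have uP : unit1 u by rewrite /unit1 uJ !uM U1 U2 u1.
have := H u uP; congr (hom1 _ _).
rewrite /ampl [RHS]big_split_ord /=; congr (_ + _).
  rewrite cmul_sumr cmul_suml; apply: eq_bigr => i _; rewrite big_split_ord /= [X in _ = _ + X]big1 ?addr0.
    rewrite cmul_sumr cmul_suml; apply: eq_bigr => j _.
    by rewrite !gl /dsum block_mxEul cadjM !cmulA'.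
  by move=> j _; rewrite /dsum block_mxEur mxE cmulx0 cmul0x.
have -> : one - s ** s^† = t ** t^† by rewrite -e addrC addKr.
rewrite -{1}(cmulx1 t) -qs cmul_sumr cmul_suml; apply: eq_bigr => i _.
rewrite big_split_ord /= big1 ?add0r => [|j _]; last by rewrite /dsum block_mxEdl mxE cmulx0 cmul0x.
rewrite (bigD1 i) //= big1 ?addr0.
  by rewrite /dsum block_mxEdr mxE eqxx cmulx1 gr cadjM !cmulA'.
by move=> j ji; rewrite /dsum block_mxEdr mxE eq_sym (negPf ji) cmulx0 cmul0x.
Qed.

Lemma K1_trivial :
  (forall u, unit1 u -> exists a b w, cuntz_pair a b /\ hom1 w (diag a b u w)) ->
  forall x y : K1_rep A, K1_eq x y.
Proof.
move=> H x y.
have Hs u : unit1 u -> hom1 (ampl s u) one.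
  move=> uP; have [a [b [w [ab h]]]] := H u uP.
  exact: (ampl_rebase ab st uP (ampl_trivial ab uP h)).
(* Each unitary is enlarged by one more than the size of the other: the sizes agree, and the added
   identities are not empty. *)
exists (unitary_size y).+1, (unitary_size x).+1.
have e : (unitary_size x + (unitary_size y).+1 = unitary_size y + (unitary_size x).+1)%N.
  by rewrite !addnS addnC.
exists e; apply: mhom_unitary; apply: mhom_join.
  by apply: mhom_castmx; apply: unitary_stably_trivial => //; exact: unitary_mxP.
by apply: unitary_stably_trivial => //; exact: unitary_mxP.
Qed.

End MatrixAlgebra.
End Paths.

(** * The algebra M *)

Section Words.
Implicit Types (x y : 'I_3) (s : seq 'I_3).

Definition reduced s := sorted (fun a b : 'I_3 => a != b) s.
(** The head of the list is the last letter of the word, so [push] multiplies on the right and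
    [push_end] on the left, with cancellation. *)
Definition push x s := if s is y :: s' then if y == x then s' else x :: s else [:: x].
Definition push_end x s := rev (push x (rev s)).

Lemma push_reduced x s : reduced s -> reduced (push x s).
Proof.
case: s => [//|y s] /= h; case: eqP => [_|/eqP yx]; last by rewrite /= eq_sym yx.
by move: h; rewrite /reduced /=; exact: path_sorted.
Qed.

Lemma reduced_rev s : reduced (rev s) = reduced s.
Proof. by rewrite /reduced rev_sorted; case: s => //= a s; apply: eq_path => u v; rewrite eq_sym. Qed.

Lemma push_end_reduced x s : reduced s -> reduced (push_end x s).
Proof. by move=> h; rewrite /push_end reduced_rev push_reduced // reduced_rev. Qed.

Lemma pushK x s : reduced s -> push x (push x s) = s.
Proof.
case: s => [|y s] /=; first by rewrite eqxx.
case: eqP => [<-|_] //=; last by rewrite eqxx.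
by case: s => [|z s] //=; rewrite /reduced /= eq_sym => /andP[/negPf -> _].
Qed.

Lemma push_endK x s : reduced s -> push_end x (push_end x s) = s.
Proof. by move=> h; rewrite /push_end revK pushK ?revK // reduced_rev. Qed.

Lemma push_commute x y s : push_end x (push y s) = push y (push_end x s).
Proof.
case: s => [|z s].
  by rewrite /push_end /= /rev /= [y == x]eq_sym; case: (x == y).
case/lastP: s => [|m w].
  rewrite /push_end /rev /=; case zy: (z == y); case zx: (z == x);
    rewrite /= ?zx ?zy //= ?zx ?zy //.
  by rewrite -(eqP zy) (eqP zx).
have E s' : push_end x (rcons s' w) = if w == x then s' else rcons (rcons s' w) x.
  rewrite /push_end rev_rcons /=; case: ifP => _; rewrite ?revK //.
  by rewrite !rev_cons revK.
rewrite -rcons_cons E /=; case zy: (z == y).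
  by rewrite E; case: ifP => _ /=; rewrite zy.
by rewrite -!rcons_cons E; case: ifP => _ /=; rewrite zy.
Qed.

Definition word := {s : seq 'I_3 | reduced s}.
HB.instance Definition _ := Countable.on word.

Definition word1 : word := exist (fun s => reduced s) [::] isT.
Definition rmul x (g : word) : word := exist (fun s => reduced s) _ (push_reduced x (valP g)).
Definition lmul x (g : word) : word := exist (fun s => reduced s) _ (push_end_reduced x (valP g)).

Lemma rmulK x : involutive (rmul x).
Proof. by move=> g; apply: val_inj; rewrite /= pushK // (valP g). Qed.
Lemma lmulK x : involutive (lmul x).
Proof. by move=> g; apply: val_inj; rewrite /= push_endK // (valP g). Qed.
Lemma lrmul x y g : lmul x (rmul y g) = rmul y (lmul x g).
Proof. by apply: val_inj; rewrite /= push_commute. Qed.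

Definition ends x (g : word) := ohead (val g) == Some x.

Lemma ends_rmul x g : ~~ ends x g -> ends x (rmul x g).
Proof.
rewrite /ends /=; case: (val g) => [|y s] /=; first by rewrite eqxx.
by case: ifP => [/eqP ->|_ _] /=; rewrite eqxx.
Qed.

(** For a nontrivial word the letter that [lmul] adds or cancels is at the other end from the x that
    [rmul] has just added. *)
Lemma ends_lrmul x g : g != word1 -> ~~ ends x g -> ends x (lmul x (rmul x g)).
Proof.
move=> g1; rewrite /ends /=; case E: (val g) => [|y s] /=.
  by case/eqP: g1; apply: val_inj.
case: ifP => [/eqP ->|yx _] /=; first by rewrite eqxx.
rewrite /push_end; case/lastP: s {E} => [|s w].
  by rewrite /rev /= yx /= eqxx.
rewrite -!rcons_cons rev_rcons /=; case: ifP => _; first by rewrite revK /= eqxx.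
by rewrite rev_cons rev_cons revK /= eqxx.
Qed.

Lemma lrmul1 x : lmul x (rmul x word1) = word1.
Proof. by apply: val_inj; rewrite /= /push_end /rev /= eqxx. Qed.
Lemma lmul1_neq x : lmul x word1 != word1.
Proof. by apply/eqP => /(congr1 val). Qed.
End Words.

(* An entry of the list of a point is its level, a code and a word. *)
Definition entry := (nat * nat * word)%type.
Definition point := (word * seq entry)%type.
HB.instance Definition _ := Countable.on entry.
HB.instance Definition _ := Countable.on point.

(** * Points: words decorated with lists *)

Section Points.
Implicit Types (e : entry) (h t l : seq entry) (z y k : point) (g : word) (i : nat) (x : 'I_3).

Definition lev e := e.1.1.
Definition eset e g : entry := (e.1, g).
Definition lset l g := if l is e :: l' then rcons (belast e l') (eset (last e l') g) else [::].
Definition lact l := if l is e :: l' then (last e l').2 else word1.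
Arguments lset : simpl never.
Arguments lact : simpl never.

Lemma lset_rcons l e g : lset (rcons l e) g = rcons l (eset e g).
Proof. by case: l => //= a l; rewrite /lset /= belast_rcons last_rcons. Qed.
Lemma lact_rcons l e : lact (rcons l e) = e.2.
Proof. by case: l => //= a l; rewrite /lact /= last_rcons. Qed.

(** The acting word, in the last entry or, for an empty list, the base word, is the one that v_x
    multiplies; u_x always multiplies the base word. *)
Definition act z := if nilp z.2 then z.1 else lact z.2.
Definition sact z g : point := if nilp z.2 then (g, [::]) else (z.1, lset z.2 g).

Lemma nilp_rcons l e : nilp (rcons l e) = false.
Proof. by case: l. Qed.

Lemma lset_cat h t g : t != [::] -> lset (h ++ t) g = h ++ lset t g.
Proof. by case/lastP: t => // t e _; rewrite -rcons_cat !lset_rcons rcons_cat. Qed.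
Lemma lact_cat h t : t != [::] -> lact (h ++ t) = lact t.
Proof. by case/lastP: t => // t e _; rewrite -rcons_cat !lact_rcons. Qed.
Lemma lev_lset l g : map lev (lset l g) = map lev l.
Proof. by case/lastP: l => // l e; rewrite lset_rcons !map_rcons. Qed.

Lemma act_sact z g : act (sact z g) = g.
Proof.
case: z => w l; rewrite /act /sact /=; case/lastP: l => [|l e] //=.
by rewrite nilp_rcons /= lset_rcons nilp_rcons lact_rcons.
Qed.
Lemma sact_sact z g g' : sact (sact z g) g' = sact z g'.
Proof.
case: z => w l; rewrite /sact /=; case/lastP: l => [|l e] //=.
by rewrite nilp_rcons /= !lset_rcons nilp_rcons ?lset_rcons.
Qed.
Lemma sact_act z : sact z (act z) = z.
Proof.
case: z => w l; rewrite /sact /act /=; case/lastP: l => [|l e] //=.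
by rewrite nilp_rcons lset_rcons lact_rcons /eset; case: e.
Qed.

Definition vmap x z := sact z (rmul x (act z)).
Definition umap x z : point := (lmul x z.1, z.2).

Lemma vmapK x : involutive (vmap x).
Proof. by move=> z; rewrite /vmap act_sact rmulK sact_sact sact_act. Qed.
Lemma umapK x : involutive (umap x).
Proof. by move=> [w l]; rewrite /umap /= lmulK. Qed.
Lemma uvmap x x' z : umap x (vmap x' z) = vmap x' (umap x z).
Proof.
case: z => w l; rewrite /umap /vmap /sact /act /=.
by case: (nilp l); rewrite //= lrmul.
Qed.

Definition lows i l := all (fun e => lev e < i)%N l.
Definition itail i t := if t is e :: _ then (i <= lev e)%N else true.
(** The cut is at the first entry of level at least i. Elements of E_i change the base word and the
    part before the cut and keep the part after it. *)
Definition cut i l := find (fun e => i <= lev e)%N l.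
Definition hd i l := take (cut i l) l.
Definition tl i l := drop (cut i l) l.

Lemma cat_hd_tl i l : hd i l ++ tl i l = l.
Proof. exact: cat_take_drop. Qed.

Lemma cut_cat i h t : lows i h -> itail i t -> cut i (h ++ t) = size h.
Proof.
move=> hl ti; rewrite /cut find_cat; have -> : has (fun e => i <= lev e)%N h = false.
  apply/negbTE; rewrite -all_predC; apply: sub_all hl => e /=; by rewrite -ltnNge.
by case: t ti => [|e t] /=; [rewrite addn0|move=> ->; rewrite addn0].
Qed.
Lemma hd_cat i h t : lows i h -> itail i t -> hd i (h ++ t) = h.
Proof. by move=> hl ti; rewrite /hd cut_cat // take_size_cat. Qed.
Lemma tl_cat i h t : lows i h -> itail i t -> tl i (h ++ t) = t.
Proof. by move=> hl ti; rewrite /tl cut_cat // drop_size_cat. Qed.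
Lemma lows_hd i l : lows i (hd i l).
Proof.
rewrite /hd /cut; elim: l => //= e l IH; case: leqP => //= ei.
by rewrite ei.
Qed.
Lemma itail_tl i l : itail i (tl i l).
Proof. by rewrite /tl /cut; elim: l => //= e l IH; case: leqP. Qed.

Lemma lows_cat i h t : lows i (h ++ t) = lows i h && lows i t.
Proof. exact: all_cat. Qed.
Lemma lows_S i l : lows i l -> lows i.+1 l.
Proof. by apply: sub_all => e; exact: ltnW. Qed.
Lemma lows_le i j l : (i <= j)%N -> lows i l -> lows j l.
Proof. by move=> ij; apply: sub_all => e h; exact: leq_trans h ij. Qed.
Lemma itail_le i j t : (i <= j)%N -> itail j t -> itail i t.
Proof. by case: t => //= e t ij; exact: leq_trans. Qed.
Lemma lows_lset i l g : lows i (lset l g) = lows i l.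
Proof.
have E l' : lows i l' = all (fun n => n < i)%N (map lev l') by rewrite all_map.
by rewrite !E lev_lset.
Qed.
Lemma itail_lset i l g : itail i (lset l g) = itail i l.
Proof.
have E l' : itail i l' = if map lev l' is n :: _ then (i <= n)%N else true by case: l'.
by rewrite !E lev_lset.
Qed.

Lemma lows_hd2 i l l' : lows i.+1 (hd i l ++ hd i.+1 l').
Proof. by rewrite lows_cat lows_S ?lows_hd. Qed.
Lemma tl_tl i l : tl i.+1 (tl i l) = tl i.+1 l.
Proof.
rewrite -[in RHS](cat_hd_tl i l) -[in RHS](cat_hd_tl i.+1 (tl i l)) catA tl_cat ?itail_tl //.
exact: lows_hd2.
Qed.
Lemma tl_split i l : tl i l = hd i.+1 (tl i l) ++ tl i.+1 l.
Proof. by rewrite -tl_tl cat_hd_tl. Qed.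
Lemma hd_split i l : hd i.+1 l = hd i l ++ hd i.+1 (tl i l).
Proof.
by rewrite -[in LHS](cat_hd_tl i l) [in LHS]tl_split catA hd_cat ?itail_tl ?lows_hd2.
Qed.

(* The isometry with parameters i, k, n reads the part of the list of level
   at most i, moves its acting word to a new entry of level i and stores the
   rest, together with the label n, in the code of that entry. *)
Definition tag i (n : nat) z : entry :=
  let y := (z.1, hd i.+1 z.2) in (i, choice.pickle (n, sact y word1), act y).
Definition ins i (k : point) n z : point := (k.1, k.2 ++ tag i n z :: tl i.+1 z.2).

Lemma tag_inj i n m z y : tag i n z :: tl i.+1 z.2 = tag i m y :: tl i.+1 y.2 -> n = m /\ z = y.
Proof.
case=> /(pcan_inj choice.pickleK)[nm E] A T; split=> //.
have : (z.1, hd i.+1 z.2) = (y.1, hd i.+1 y.2).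
  by rewrite -[LHS]sact_act -(sact_sact _ word1) E sact_sact A sact_act.
case: z y {nm E A} T => w l [w' l'] /= T [-> H].
by rewrite -(cat_hd_tl i.+1 l) H T cat_hd_tl.
Qed.

Lemma hd_ins i k n z : lows i k.2 -> hd i (ins i k n z).2 = k.2.
Proof. by move=> kl; rewrite hd_cat //= leqnn. Qed.
Lemma tl_ins i k n z : lows i k.2 -> tl i (ins i k n z).2 = tag i n z :: tl i.+1 z.2.
Proof. by move=> kl; rewrite tl_cat //= leqnn. Qed.
Lemma ins_cat i k n z : (ins i k n z).2 = rcons k.2 (tag i n z) ++ tl i.+1 z.2.
Proof. by rewrite cat_rcons. Qed.
Lemma lows_ins i k n z : lows i k.2 -> lows i.+1 (rcons k.2 (tag i n z)).
Proof. by move=> kl; rewrite /lows all_rcons /= ltnSn; exact: lows_S. Qed.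
Lemma hdS_ins i k n z : lows i k.2 -> hd i.+1 (ins i k n z).2 = rcons k.2 (tag i n z).
Proof. by move=> kl; rewrite ins_cat hd_cat ?lows_ins ?itail_tl. Qed.
Lemma tlS_ins i k n z : lows i k.2 -> tl i.+1 (ins i k n z).2 = tl i.+1 z.2.
Proof. by move=> kl; rewrite ins_cat tl_cat ?lows_ins ?itail_tl. Qed.

Lemma ins_inj i k n m z y : ins i k n z = ins i k m y -> n = m /\ z = y.
Proof. by case=> /eqP; rewrite eqseq_cat // eqxx /= => /eqP /tag_inj. Qed.

Lemma vmap_rcons x (w : word) l e : vmap x (w, rcons l e) = (w, rcons l (eset e (rmul x e.2))).
Proof. by rewrite /vmap /sact /act /= nilp_rcons lset_rcons lact_rcons. Qed.

Lemma ins_low i k n z : lows i.+1 z.2 ->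
  ins i k n z = (k.1, rcons k.2 (i, choice.pickle (n, sact z word1), act z)).
Proof.
case: z => w l /= ll; have [h t] : hd i.+1 l = l /\ tl i.+1 l = [::].
  by split; rewrite -[in LHS](cats0 l) ?hd_cat ?tl_cat.
by rewrite /ins /tag /= h t cats1.
Qed.

(** If nothing follows the new entry, that entry has taken over the acting word; otherwise the
    acting word is in the part that is kept. Both times the multiplication by v_x acts on the same
    word before and after. *)
Lemma ins_vmap i k n x z : lows i k.2 -> vmap x (ins i k n z) = ins i k n (vmap x z).
Proof.
move=> kl; case: z => w l; have e := cat_hd_tl i.+1 l.
have [t0|t0] := eqVneq (tl i.+1 l) [::].
  have lh : hd i.+1 l = l by rewrite -[RHS]e t0 cats0.
  have ll : lows i.+1 l by rewrite -lh lows_hd.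
  have vl : lows i.+1 (vmap x (w, l)).2.
    by rewrite /vmap /sact; case: nilP => //= _; rewrite lows_lset.
  by rewrite !ins_low // vmap_rcons /eset /= /vmap sact_sact act_sact.
rewrite /ins /tag /=.
have nl : nilp l = false.
  by apply/negbTE/nilP => l0; case/eqP: t0; rewrite l0.
have vE : vmap x (w, l) = (w, hd i.+1 l ++ lset (tl i.+1 l) (rmul x (lact l))).
  by rewrite /vmap /sact /act /= nl -{1}e lset_cat.
have tt : itail i.+1 (lset (tl i.+1 l) (rmul x (lact l))) by rewrite itail_lset itail_tl.
rewrite vE /= hd_cat ?tl_cat ?lows_hd // /vmap /sact /act /=.
have -> : nilp (k.2 ++ (i, choice.pickle (n, sact (w, hd i.+1 l) word1), act (w, hd i.+1 l)) :: tl i.+1 l) = false.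
  by case: (k.2).
rewrite -cat_rcons lset_cat // lact_cat // cat_rcons.
have la : lact l = lact (tl i.+1 l) by rewrite -{1}e lact_cat.
by rewrite la.
Qed.

End Points.

(** * Commutants and closures of increasing unions *)

Section Commutants.
Context {R : realType} {A : unitalCstarType R}.
Implicit Types (x y s T : A) (S : A -> Prop).

Definition commutant S : set A := fun T => forall s, S s -> T ** s = s ** T.

Lemma commutant_one S : commutant S (cone A).
Proof. by move=> s _; rewrite cmul1x cmulx1. Qed.

Lemma commutant_star S : (forall s, S s -> S s^†) -> star_subalgebra (commutant S).
Proof.
move=> Sa; split.
- apply/closed_rnormP => x hx s Ss; apply/eqP; rewrite -subr_eq0; apply/eqP/rnorm_small => e e0.
  have k0 : 0 < 1 + 2 * rnorm s by have := rnorm_ge0 s; lra.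
  have [y Ey xy] := hx _ (divr_gt0 e0 k0).
  have -> : x ** s - s ** x = (x - y) ** s - s ** (x - y).
    by rewrite cmulBl cmulBr (Ey s Ss); lmod_with (R[i]) ltac:(ring).
  have h1 := rnormM (x - y) s; have h2 := rnormM s (x - y).
  apply: le_lt_trans (le_rnormB h1 h2) _; move: xy; rewrite ltr_pdivlMr //.
  by have := rnorm_ge0 (x - y); have := rnorm_ge0 s; nra.
- by move=> s _; rewrite cmul0x cmulx0.
- by move=> x y hx hy s Ss; rewrite cmulDl cmulDr hx // hy.
- by move=> c x hx s Ss; rewrite cmulZl cmulZr hx.
- by move=> x y hx hy s Ss; rewrite -cmulA hy // cmulA hx // cmulA.
- by move=> x hx s Ss; rewrite -[s]cadjK -!cadjM hx // ; exact: Sa.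
Qed.

Variable E : nat -> set A.
Hypothesis EP : forall i, star_subalgebra (E i).
Hypothesis ES : forall i, E i `<=` E i.+1.

Definition union_closure : set A :=
  fun T => forall e, 0 < e -> exists i T', E i T' /\ rnorm (T - T') < e.

Lemma union_le i j : (i <= j)%N -> E i `<=` E j.
Proof.
move=> /subnK <-; elim: (j - i)%N => [|n IH] T //= ET; rewrite addSn; exact/ES/IH.
Qed.

Lemma union_sub i T : E i T -> union_closure T.
Proof. by move=> ET e e0; exists i, T; rewrite subrr rnorm0. Qed.

Lemma union_closure_star : star_subalgebra union_closure.
Proof.
split.
- apply/closed_rnormP => x hx e e0; have e2 : 0 < e / 2 by rewrite divr_gt0.
  have [y hy xy] := hx _ e2; have [i [T' [ET' yT]]] := hy _ e2; exists i, T'; split=> //.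
  by apply: le_lt_trans (rdistD y _ _) _; rewrite [ltRHS]splitr; exact: Num.Theory.ltrD.
- exact: union_sub (ssub0 (EP 0)).
- move=> x y hx hy e e0; have e2 : 0 < e / 2 by rewrite divr_gt0.
  have [i [x' [Ex' xx]]] := hx _ e2; have [j [y' [Ey' yy]]] := hy _ e2.
  exists (i + j)%N, (x' + y'); split.
    by apply: (ssubD (EP _)); [apply: (union_le (leq_addr _ _))|apply: (union_le (leq_addl _ _))].
  rewrite opprD addrACA; apply: le_lt_trans (rnormD _ _) _.
  by rewrite [ltRHS]splitr; exact: Num.Theory.ltrD.
- move=> c x hx e e0; have k0 : 0 < 1 + cabs c by have := cabs_ge0 c; lra.
  have [i [x' [Ex' xx]]] := hx _ (divr_gt0 e0 k0); exists i, (c *: x'); split.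
    exact: (ssubZ (EP _)).
  rewrite -scalerBr rnormZ; move: xx; rewrite ltr_pdivlMr //.
  by have := rnorm_ge0 (x - x'); have := cabs_ge0 c; nra.
- move=> x y hx hy e e0; pose K := 2 + rnorm x + rnorm y.
  have x0 := rnorm_ge0 x; have y0 := rnorm_ge0 y; have K0 : 0 < K by rewrite /K; lra.
  have e2 : 0 < Num.min 1 (e / K) by rewrite lt_min ltr01 divr_gt0.
  have [i [x' [Ex' xx]]] := hx _ e2; have [j [y' [Ey' yy]]] := hy _ e2.
  exists (i + j)%N, (x' ** y'); split.
    by apply: (ssubM (EP _)); [apply: (union_le (leq_addr _ _))|apply: (union_le (leq_addl _ _))].
  have -> : x ** y - x' ** y' = (x - x') ** y + x ** (y - y') - (x - x') ** (y - y').
    by rewrite !cexpand; lmod_with (R[i]) ltac:(ring).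
  move: xx yy; rewrite !lt_min => /andP[a1 a2] /andP[b1 b2].
  apply: le_lt_trans (le_rnormB (le_rnormD (rnormM _ _) (rnormM _ _)) (rnormM _ _)) _.
  move: a2 b2; rewrite !ltr_pdivlMr // /K.
  move: (rnorm_ge0 (x - x')) (rnorm_ge0 (y - y')) a1 b1 x0 y0.
  by move: (rnorm _) (rnorm _) (rnorm _) (rnorm _) => a b p q; nra.
- move=> x hx e /hx[i [x' [Ex' xx]]]; exists i, x'^†; split; first exact: (ssub_adj (EP _)).
  by rewrite -cadjB rnorm_adj.
Qed.

End Commutants.

(** * The algebras E_i and their isometries *)

Section Model.
Variable R : realType.
Local Notation C := R[i].
Local Notation X := point.
Local Notation V := (vec R X).
Local Notation B := (bops R unit X).
Local Notation "T · f" := (bop T tt f) (at level 40, f at next level).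
Local Notation "'δ' z" := (delta R (z : X)) (at level 8, z at level 8).
Implicit Types (T S U : B) (f g : V) (z y k : X) (i n m : nat) (t : seq entry) (x : 'I_3).

Lemma invol_pbP (h : X -> X) : involutive h -> forall z y, Some (h z) = Some y <-> Some (h y) = Some z.
Proof. by move=> hK z y; split=> -[<-]; rewrite hK. Qed.
Definition invol_op (h : X -> X) (hK : involutive h) : B := pb_op R (Pbij (invol_pbP hK)).

Lemma invol_op_delta h hK z : @invol_op h hK · δ z = δ (h z).
Proof. by rewrite /invol_op pb_op_delta. Qed.
Lemma invol_op_adj h hK : (@invol_op h hK)^† = @invol_op h hK.
Proof. by apply: bop_delta_ext => -[] z; rewrite /invol_op pb_op_inv_delta pb_op_delta. Qed.
Lemma invol_op_sqr h hK : @invol_op h hK ** @invol_op h hK = cone B.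
Proof. by apply: bop_delta_ext => -[] z; rewrite bop_mul !invol_op_delta hK bop_one. Qed.

Definition vop x : B := invol_op (vmapK x).
Definition uop x : B := invol_op (umapK x).

Definition thetaf i t t' z : option X :=
  if tl i z.2 == t' then Some (z.1, hd i z.2 ++ t) else None.

Lemma thetaf_pbP i t t' : itail i t -> itail i t' ->
  forall z y, thetaf i t t' z = Some y <-> thetaf i t' t y = Some z.
Proof.
move=> it it'; suff h t1 t2 z y : itail i t1 -> thetaf i t1 t2 z = Some y -> thetaf i t2 t1 y = Some z.
  by move=> z y; split; exact: h.
move=> i1; rewrite /thetaf; case: eqP => // <- [<-] /=.
by rewrite tl_cat ?hd_cat ?lows_hd // eqxx cat_hd_tl; case: z.
Qed.

Definition theta i t t' (it : itail i t) (it' : itail i t') : B :=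
  pb_op R (Pbij (thetaf_pbP it it')).

Lemma theta_delta i t t' (it : itail i t) (it' : itail i t') z :
  theta it it' · δ z = oapp (fun y => δ y) 0 (thetaf i t t' z).
Proof. by rewrite /theta pb_op_delta. Qed.
Lemma theta_adj i t t' (it : itail i t) (it' : itail i t') : (theta it it')^† = theta it' it.
Proof. by apply: bop_delta_ext => -[] z; rewrite /theta pb_op_inv_delta pb_op_delta. Qed.

(** Commuting with the v_x is what the final contradiction requires of M. Commuting with [theta],
    which exchanges one tail for another, means acting on the head alone and in the same way in
    front of every tail. *)
Definition gens i : B -> Prop := fun s => (exists x, s = vop x) \/
  (exists t t' (it : itail i t) (it' : itail i t'), s = theta it it').

Definition E i : set B := commutant (gens i).

Lemma E_star i : star_subalgebra (E i).
Proof.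
apply: commutant_star => s [[x ->]|[t [t' [it [it' ->]]]]].
  by left; exists x; rewrite /vop invol_op_adj.
by right; exists t', t, it', it; rewrite theta_adj.
Qed.

Lemma E_one i : E i (cone B). Proof. exact: commutant_one. Qed.

Lemma E_theta i T t t' (it : itail i t) (it' : itail i t') :
  E i T -> T ** theta it it' = theta it it' ** T.
Proof. by move=> ET; apply: ET; right; exists t, t', it, it'. Qed.
Lemma E_vop i T x : E i T -> T ** vop x = vop x ** T.
Proof. by move=> ET; apply: ET; left; exists x. Qed.

(** On vectors with a given segment m between the two cuts, exchanging the tails t' and t at level i
    + 1 is exchanging m t' and m t at level i. *)
Lemma E_mono i : E i `<=` E i.+1.
Proof.
move=> T ET s [[x ->]|[t [t' [it [it' ->]]]]]; first exact: E_vop ET.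
apply: bop_delta_ext => -[] z; rewrite !bop_mul theta_delta.
have fz : tl i z.2 = tl i z.2 by [].
have zt : itail i (tl i z.2) by exact: itail_tl.
have zz : theta zt zt · δ z = δ z.
  by rewrite theta_delta /thetaf eqxx /= cat_hd_tl; case: z {fz zt}.
pose m := hd i.+1 (tl i z.2).
have hm : tl i z.2 = m ++ tl i.+1 z.2 by exact: tl_split.
have hz : hd i.+1 z.2 = hd i z.2 ++ m by exact: hd_split.
have mi t1 : itail i.+1 t1 -> itail i (m ++ t1).
  move=> h; have : itail i (tl i z.2) by [].
  rewrite hm; case: (m) => [_|] //=; exact: itail_le h.
have mit := mi _ it; have mit' := mi _ it'.
have Tz : T · δ z = theta zt zt · (T · δ z).
  by rewrite -{1}zz -bop_mul (E_theta _ _ ET) bop_mul.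
have zd y : theta zt zt · δ y = if tl i y.2 == tl i z.2 then δ y else 0.
  by rewrite theta_delta /thetaf; case: eqP => //= <-; rewrite cat_hd_tl; case: y.
rewrite -theta_delta; have [tz|tz] := eqVneq (tl i.+1 z.2) t'.
  have <- : theta mit mit' · δ z = theta it it' · δ z.
    by rewrite !theta_delta /thetaf hm tz !eqxx /= hz catA.
  rewrite -(bop_mul T) (E_theta mit mit' ET) bop_mul Tz -!bop_mul; congr (bop (_ ** _) _ _).
  apply: bop_delta_ext => -[] y; rewrite !bop_mul zd; case: eqP => [yz|_]; last by rewrite !bop0.
  rewrite !theta_delta /thetaf -(tl_tl i y.2) yz tl_tl tz hm tz !eqxx /=.
  by rewrite (hd_split i y.2) yz catA.
rewrite Tz -(bop_mul (theta it it')) (_ : theta it it' ** theta zt zt = 0).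
  by rewrite bop0E theta_delta /thetaf (negPf tz) /= bop0.
apply: bop_delta_ext => -[] y; rewrite !bop_mul zd bop0E; case: eqP => [yz|_]; last by rewrite !bop0.
by rewrite theta_delta /thetaf -(tl_tl i y.2) yz tl_tl (negPf tz).
Qed.

Lemma uop_E x : E 0 (uop x).
Proof.
move=> s [[x' ->]|[t [t' [it [it' ->]]]]]; apply: bop_delta_ext => -[] z; rewrite !bop_mul.
  by rewrite /uop /vop !invol_op_delta uvmap.
rewrite /uop invol_op_delta !theta_delta /thetaf /=.
by case: eqP => _ /=; rewrite ?bop0 ?invol_op_delta.
Qed.

Lemma ins_pbP i k n : forall z y, Some (ins i k n z) = Some y <->
  (if pselect (exists z, ins i k n z = y) is left h then Some (projT1 (cid h)) else None) = Some z.
Proof.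
move=> z y; split=> [[<-]|].
  case: pselect => [h|]; last by case; exists z.
  by congr Some; case: cid => z' /= /ins_inj[].
by case: pselect => // h [<-]; case: cid => z' /= ->.
Qed.

Definition sop i k n : B := pb_op R (Pbij (@ins_pbP i k n)).

Lemma sop_delta i k n z : sop i k n · δ z = δ (ins i k n z).
Proof. by rewrite /sop pb_op_delta. Qed.

Lemma sop_E i k n : lows i k.2 -> E i.+1 (sop i k n).
Proof.
move=> kl s [[x ->]|[t [t' [it [it' ->]]]]]; apply: bop_delta_ext => -[] z; rewrite !bop_mul.
  by rewrite /vop invol_op_delta !sop_delta invol_op_delta ins_vmap.
rewrite sop_delta !theta_delta /thetaf tlS_ins // hdS_ins //.
case: eqP => [zt|_] /=; last by rewrite bop0.
rewrite sop_delta; congr (delta R _).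
by rewrite /ins /tag /= hd_cat ?tl_cat ?lows_hd // cat_rcons.
Qed.

Definition coef T k k' : C := dot (δ k) (T · δ k').

(** [ins i k' m z] is k' with its empty tail exchanged for one that encodes m and z. T commutes with
    this exchange, so only its coefficient between k and k' remains, and by [tag_inj] different
    pairs (m, z) have different tails. *)
Lemma sop_gram i T k k' n m : E i T -> lows i k.2 -> lows i k'.2 ->
  (sop i k n)^† ** T ** sop i k' m = (if n == m then coef T k k' else 0) *: cone B.
Proof.
move=> ET kl kl'; apply: bop_delta_ext => -[] z; apply: vec_ext => y.
rewrite bopZE bop_one vecZ deltaE -[LHS]dot_delta !bop_mul.
rewrite -[X in dot _ X]/(bop (sop i k n)^† tt _) -[δ y in LHS]/(δ y).
have := bop_adj (sop i k n) tt (δ y) (T · (sop i k' m · δ z)) => <-.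
rewrite !sop_delta.
have nt : itail i [::] by [].
have kt : itail i (tag i m z :: tl i.+1 z.2) by rewrite /= leqnn.
have k'E : hd i k'.2 = k'.2 /\ tl i k'.2 = [::].
  by split; rewrite -[in LHS](cats0 k'.2) ?hd_cat ?tl_cat.
have -> : δ (ins i k' m z) = theta kt nt · δ k'.
  by rewrite theta_delta /thetaf k'E.2 eqxx k'E.1.
rewrite -bop_mul (E_theta _ _ ET) bop_mul -[theta kt nt]cadjK -bop_adj theta_adj theta_delta.
rewrite /thetaf tl_ins // hd_ins // cats0; case: eqP => [/tag_inj[-> ->]|ne] /=.
  by rewrite !eqxx mulr1; case: k {kl}.
rewrite dot0l; case: eqP => [nm|_]; last by rewrite mul0r.
by case: eqP => [yz|_]; rewrite ?mulr0 //; case: ne; rewrite nm yz.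
Qed.

End Model.

Section Repeat.
Variables (R : realType) (X : choiceType).
Local Notation B := (bops R unit X).
Local Notation one := (cone B).
Implicit Types (x y Z : B).
Variable S : nat -> B.
Hypothesis SP : forall m n, (S m)^† ** S n = if m == n then one else 0.

(* x |-> Th x is the infinite repeat of x along the orthogonal isometries S n,
   and W shifts them. *)
Lemma infinite_repeat : exists (Th : B -> B) (W : B),
  [/\ cuntz_pair (S 0) W,
      forall x y, Th x ** Th y = Th (x ** y),
      forall x, (Th x)^† = Th x^†,
      forall x, Th x = diag (S 0) W x (Th x) &
      W ** (one - Th one) = one - Th one /\
      forall Z, (forall n, Z ** S n = S n ** Z) -> (forall n, Z ** (S n)^† = (S n)^† ** Z) ->
        Z ** W = W ** Z /\ forall x, Z ** x = x ** Z -> Z ** Th x = Th x ** Z].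
Proof.
have /choice[Th hT] : forall T, exists U, [/\ forall n, U ** S n = S n ** T,
    forall n, (S n)^† ** U = T ** (S n)^†, forall Z, (forall n, Z ** S n = 0) -> Z ** U = 0,
    forall Z, (forall n, (S n)^† ** Z = 0) -> U ** Z = 0 &
    forall Z, (forall n, Z ** S n = S n ** Z) -> (forall n, Z ** (S n)^† = (S n)^† ** Z) ->
      Z ** T = T ** Z -> Z ** U = U ** Z].
  by move=> T; exact: amplification SP SP T.
have S1P m n : (S m.+1)^† ** S n.+1 = if m == n then one else 0 by rewrite SP eqSS.
have [W0 [W1 W2 W3 W4 W5]] := amplification S1P SP one.
pose Q := Th one.
have TS x n : Th x ** S n = S n ** x by case: (hT x).
have ST x n : (S n)^† ** Th x = x ** (S n)^† by case: (hT x).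
have QS n : Q ** S n = S n by rewrite TS cmulx1.
have SQ n : (S n)^† ** Q = (S n)^† by rewrite ST cmul1x.
have Q1S n : (Q - one) ** S n = 0 by rewrite cmulBl QS cmul1x subrr.
have SQ1 n : (S n)^† ** (Q - one) = 0 by rewrite cmulBr SQ cmulx1 subrr.
have sub0 (a b : B) : a - b = 0 -> a = b by move=> /eqP; rewrite subr_eq0 => /eqP.
have ThQ x : Th x ** Q = Th x.
  case: (hT x) => _ _ _ h _; apply: sub0; rewrite -{2}[Th x]cmulx1 -cmulBr; exact: h.
have QTh x : Q ** Th x = Th x.
  case: (hT x) => _ _ h _ _; apply: sub0; rewrite -{2}[Th x]cmul1x -cmulBl; exact: h.
have ext x y : x ** Q = x -> y ** Q = y -> (forall n, x ** S n = y ** S n) -> x = y.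
  move=> xQ yQ xy; apply: sub0; rewrite -xQ -yQ -cmulBl.
  by case: (hT one) => _ _ h _ _; apply: h => n; rewrite cmulBl xy subrr.
have Qs : Q^† = Q.
  have h1 : Q ** Q^† = Q.
    apply: sub0; rewrite -{3}[Q]cmulx1 -cmulBr; case: (hT one) => _ _ _ h _; apply: h => n.
    by rewrite cmulBr -cadjM QS cmulx1 subrr.
  by rewrite -{1}h1 cadjM cadjK.
have W0Q : W0 ** Q = W0 by apply: sub0; rewrite -{2}[W0]cmulx1 -cmulBr; exact: W4.
have QW0 : Q ** W0 = W0 by apply: sub0; rewrite -{2}[W0]cmul1x -cmulBl; apply: W3 => n; exact: Q1S.
have W0S n : W0 ** S n = S n.+1 by rewrite W1 cmulx1.
have W0aS n : W0^† ** S n.+1 = S n by rewrite -[LHS]cadjK cadjM cadjK W2 cmul1x cadjK.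
have W0aS0 : W0^† ** S 0 = 0.
  rewrite -[LHS]cadjK cadjM cadjK (W3 (S 0)^†) ?cadj0 // => n; by rewrite SP.
have QW0a : Q ** W0^† = W0^† by rewrite -Qs -cadjM W0Q.
have W0aQ : W0^† ** Q = W0^† by rewrite -Qs -cadjM QW0.
have QQ : Q ** Q = Q by exact: ThQ.
have WW0 : W0^† ** W0 = Q.
  by apply: ext => //; [rewrite -cmulA W0Q|move=> n; rewrite -cmulA W0S W0aS QS].
have S0Q : S 0 ** (S 0)^† ** Q = S 0 ** (S 0)^† by rewrite -cmulA SQ.
have SS0 n : S 0 ** (S 0)^† ** S n = if n == 0%N then S 0 else 0.
  by rewrite -cmulA SP eq_sym; case: eqP; rewrite ?cmulx1 ?cmulx0.
have W0W : W0 ** W0^† = Q - S 0 ** (S 0)^†.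
  apply: ext; rewrite ?cmulBl ?QQ ?S0Q // -?cmulA ?W0aQ // => -[|n].
    by rewrite -cmulA W0aS0 cmulx0 cmulBl QS SS0 eqxx subrr.
  by rewrite -cmulA W0aS W0S cmulBl QS SS0 subr0.
have [P PE] : exists P, P = one - Q by exists (one - Q).
(* The shift W0 lives under Q = Th 1; adding 1 - Q makes it an isometry whose range is the
   complement of that of S 0. *)
pose W := W0 + P.
have W0P : W0 ** P = 0 by rewrite PE cmulBr cmulx1 W0Q subrr.
have PW0 : P ** W0 = 0 by rewrite PE cmulBl cmul1x QW0 subrr.
have W0aP : W0^† ** P = 0 by rewrite PE cmulBr cmulx1 W0aQ subrr.
have PW0a : P ** W0^† = 0 by rewrite PE cmulBl cmul1x QW0a subrr.
have PP : P ** P = P by rewrite PE cmulBr cmulx1 cmulBl cmul1x QQ subrr subr0.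
have Ps : P^† = P by rewrite PE cadjB cone_adj Qs.
have Wa : W^† = W0^† + P by rewrite /W cadjD Ps.
have PTh x : P ** Th x = 0 by rewrite PE cmulBl cmul1x QTh subrr.
have ThP x : Th x ** P = 0 by rewrite PE cmulBr cmulx1 ThQ subrr.
exists Th, W; split.
- split; first by rewrite SP.
    by rewrite Wa /W cmulDl !cmulDr WW0 W0aP PW0 PP addr0 add0r PE addrC subrK.
  rewrite Wa /W cmulDl !cmulDr W0W W0P PW0a PP addr0 add0r.
  by rewrite addrA [S 0 ** _ + _]addrC subrK PE addrC subrK.
- move=> x y; apply: ext => [||n]; rewrite ?ThQ // -?cmulA ?ThQ //.
  by rewrite !TS cmulA' TS -cmulA.
- move=> x; apply: ext => [||n]; rewrite ?ThQ //.
    by rewrite -Qs -cadjM QTh.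
  by rewrite TS -[LHS]cadjK cadjM cadjK ST cadjM cadjK.
- move=> x; rewrite /diag Wa /W.
  have -> : (W0 + P) ** Th x ** (W0^† + P) = W0 ** Th x ** W0^†.
    by rewrite cmulDl PTh addr0 cmulDr -(cmulA W0 (Th x) P) ThP cmulx0 addr0.
  apply: ext => [||n].
  + exact: ThQ.
  + by rewrite cmulDl -!cmulA SQ W0aQ.
  rewrite TS cmulDl -!cmulA SP; case: n => [|n].
    by rewrite eqxx W0aS0 !cmulx0 addr0 cmulx1.
  by rewrite /= !cmulx0 add0r W0aS TS cmulA' W0S.
- split; first by rewrite -/Q -PE /W cmulDl W0P PP add0r.
  move=> Z ZS ZSa; split=> [|x Zx]; last by case: (hT x) => _ _ _ _ h; exact: h.
  have ZQ : Z ** Q = Q ** Z.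
    by case: (hT one) => _ _ _ _ h; apply: h => //; rewrite cmulx1 cmul1x.
  have ZW0 : Z ** W0 = W0 ** Z by apply: W5 => //; rewrite cmulx1 cmul1x.
  have ZP : Z ** P = P ** Z by rewrite PE cmulBr cmulBl ZQ cmul1x cmulx1.
  by rewrite /W cmulDr cmulDl ZW0 ZP.
Qed.

End Repeat.

(** * Pure infiniteness from peak isometries *)

Section Peak.
Context {R : realType} {A : unitalCstarType R}.
Implicit Types (b s w : A).
Local Notation one := (cone A).

Definition peaking b := forall e, 0 < e -> exists2 s, s^† ** s = one &
  rnorm (s^† ** (b^† ** b) ** s - (rnorm b ^+ 2)%:C *: one) < e.

Lemma peaking_purely_infinite : (forall b, peaking b) ->
  (exists x y : A, forall c d : R[i], c *: x + d *: y = 0 -> c = 0 /\ d = 0) ->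
  purely_infinite_simple A.
Proof.
move=> pk li; split=> // _ _ [b ->] b0 [e ->] _.
have bn : b != 0 by apply: contraNneq b0 => ->; rewrite cmulx0.
have nb := rnorm_gt0 bn; pose K := (1 + rnorm e ^+ 2) / rnorm b ^+ 2.
have K0 : 0 < K by rewrite divr_gt0 ?exprn_gt0 //; have := sqr_ge0 (rnorm e); lra.
have /choice[s hs] : forall n : nat, exists s, s^† ** s = one /\
    rnorm (s^† ** (b^† ** b) ** s - (rnorm b ^+ 2)%:C *: one) < n.+1%:R^-1 / K.
  by move=> n; have [|s s1 s2] := pk b (n.+1%:R^-1 / K); [rewrite divr_gt0 ?invr_gt0 ?ltr0Sn|exists s].
exists (fun n => (rnorm b)^-1%:C *: (e^† ** (s n)^†)).
have bound n : rnorm ((rnorm b)^-1%:C *: (e^† ** (s n)^†) ** (b^† ** b) **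
    cadj ((rnorm b)^-1%:C *: (e^† ** (s n)^†)) - e^† ** e) <= n.+1%:R^-1.
  have [_ h] := hs n; set d := _ - _ in h.
  have -> : (rnorm b)^-1%:C *: (e^† ** (s n)^†) ** (b^† ** b) **
      cadj ((rnorm b)^-1%:C *: (e^† ** (s n)^†)) - e^† ** e =
      ((rnorm b ^+ 2)^-1)%:C *: (e^† ** d ** e).
    rewrite cadjZR cadjM !cadjK /d !cexpand cmulx1 scalerBr !scalerA -!rmorphM.
    rewrite mulVf ?expf_neq0 ?gt_eqF // rmorph1 scale1r -expr2 exprVn.
    by [].
  rewrite rnormZR ger0_norm ?invr_ge0 ?sqr_ge0 //.
  have ea : rnorm e^† <= rnorm e by rewrite rnorm_adj.
  have h1 := le_rnormM (le_rnormM ea (ltW h)) (lexx (rnorm e)).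
  apply: le_trans (ler_wpM2l _ h1) _; first by rewrite invr_ge0 sqr_ge0.
  have n0 : 0 < n.+1%:R^-1 :> R by rewrite invr_gt0 ltr0Sn.
  have -> : (rnorm b ^+ 2)^-1 * (rnorm e * (n.+1%:R^-1 / K) * rnorm e) =
      n.+1%:R^-1 * (rnorm e ^+ 2 / (1 + rnorm e ^+ 2)).
    rewrite /K; field; rewrite ?gt_eqF ?ltr0Sn //.
    by have := sqr_ge0 (rnorm e); lra.
  rewrite ler_piMr ?(ltW n0) // ler_pdivrMr ?mul1r; have := sqr_ge0 (rnorm e); lra.
apply/cvgrPdist_lt => d d0; exists (Num.truncn d^-1) => // n /= Nn.
rewrite sub0r normrN ger0_norm ?rnorm_ge0 //; apply: le_lt_trans (bound n) _.
rewrite invf_plt ?posrE ?ltr0Sn //; apply: lt_le_trans (truncnS_gt _) _.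
by rewrite ler_nat.
Qed.

Lemma peaking_closure b : (forall e, 0 < e -> exists2 b', peaking b' & rnorm (b - b') < e) -> peaking b.
Proof.
move=> h e e0; pose K := 3 + 4 * rnorm b.
have b0 := rnorm_ge0 b; have K0 : 0 < K by rewrite /K; lra.
have e2 : 0 < Num.min 1 (e / (2 * K)) by rewrite lt_min ltr01 divr_gt0 // mulr_gt0.
have [b' pk bb] := h _ e2; have [|s ss hs] := pk (e / 2); first by rewrite divr_gt0.
exists s => //; move: bb; rewrite lt_min => /andP[d1 d2]; set d := rnorm (b - b') in d1 d2.
have d0 : 0 <= d by exact: rnorm_ge0.
have sn := isometry_le1 ss; have sa : rnorm s^† <= 1 by rewrite rnorm_adj.
have b'n : rnorm b' <= rnorm b + d by have := rnormB b (b - b'); rewrite subKr.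
have bn : rnorm b <= rnorm b' + d by have := rnormD (b - b') b'; rewrite subrK addrC.
have E1 : rnorm (b^† ** b - b'^† ** b') <= d * (2 * rnorm b + 1).
  have -> : b^† ** b - b'^† ** b' = (b - b')^† ** b + b'^† ** (b - b').
    by rewrite cadjB !cexpand; lmod_with (R[i]) ltac:(ring).
  have h1 : rnorm ((b - b')^† ** b) <= d * rnorm b by apply: le_rnormM => //; rewrite rnorm_adj.
  have h2 : rnorm (b'^† ** (b - b')) <= (rnorm b + d) * d by apply: le_rnormM => //; rewrite rnorm_adj.
  by apply: le_trans (le_rnormD h1 h2) _; nra.
have -> : s^† ** (b^† ** b) ** s - (rnorm b ^+ 2)%:C *: one =
    (s^† ** (b^† ** b - b'^† ** b') ** s) + (s^† ** (b'^† ** b') ** s - (rnorm b' ^+ 2)%:C *: one) +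
    (rnorm b' ^+ 2 - rnorm b ^+ 2)%:C *: one.
  by rewrite rmorphB !cexpand; lmod_with (R[i]) ltac:(ring).
have h1 := le_rnormM (le_rnormM sa E1) sn.
have h3 : rnorm ((rnorm b' ^+ 2 - rnorm b ^+ 2)%:C *: one) <= d * (2 * rnorm b + 1).
  rewrite rnormZR; apply: le_trans (ler_wpM2l (normr_ge0 _) norm_one_le1) _; rewrite mulr1.
  by rewrite ler_norml; apply/andP; split; have := rnorm_ge0 b'; nra.
apply: le_lt_trans (le_rnormD (le_rnormD h1 (ltW hs)) h3) _.
by move: d2; rewrite ltr_pdivlMr ?mulr_gt0 // /K; nra.
Qed.

End Peak.

Section ModelPeak.
Variable R : realType.
Local Notation C := R[i].
Local Notation V := (vec R point).
Local Notation B := (bops R unit point).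
Local Notation "T · f" := (bop T tt f) (at level 40, f at next level).
Local Notation "'δ' z" := (delta R (z : point)) (at level 8, z at level 8).
Implicit Types (T S U b : B) (f g : V) (i n m : nat).
Local Notation E := (@E R).

(** b nearly attains its norm at a finitely supported unit vector g = sum of c_x delta_x. The
    combination w of the isometries belonging to the points x, with coefficients c_x, satisfies w^*
    T w = <g, T g> 1 for T in E_j by [sop_gram]; T = b^* b gives ||b g||^2. *)
Lemma model_peaking i b : E i b -> forall e, 0 < e -> exists j s, [/\ E j s, s^† ** s = cone B &
  rnorm (s^† ** (b^† ** b) ** s - (rnorm b ^+ 2)%:C *: cone B) < e].
Proof.
move=> Eb e e0; set N := rnorm b; have N0 : 0 <= N by exact: rnorm_ge0.
have k0 : lows i ((word1, [::]) : point).2 by [].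
have [bz|bn] := eqVneq b 0.
  exists i.+1, (sop R i (word1, [::]) 0); split; first exact: sop_E.
    have := sop_gram 0 0 (@E_one R i) k0 k0; rewrite eqxx cmulx1 => ->.
    by rewrite /coef bop_one dot_delta2 eqxx scale1r.
  by rewrite /N bz cadj0 !cmul0x cmulx0 cmul0x rnorm0 expr0n scale0r subrr rnorm0.
have Np : 0 < N by exact: rnorm_gt0.
pose d := Num.min (N / (2 * (1 + N))) (e / (2 * N * (1 + 2 * N) + 1)).
have q0 : 0 < 2 * N * (1 + 2 * N) + 1 by nra.
have d0 : 0 < d by rewrite lt_min !divr_gt0 // mulr_gt0 //; lra.
have dN : d * (2 * (1 + N)) <= N by rewrite -ler_pdivlMr ?ge_min ?lexx //; nra.
have de : d * (2 * N * (1 + 2 * N) + 1) <= e by rewrite -ler_pdivlMr ?ge_min ?lexx ?orbT.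
have [|[] [f [f1 hf]]] := @rnorm_bop_attained R unit point b d d0.
  by rewrite -/N; nra.
have [F hF] := delta_dense f d0; set f' := \sum_(x <- F) _ in hF.
have bf' : N - d * (1 + N) < vnorm (b · f').
  have := vnormD (b · (f - f')) (b · f'); rewrite -bopD subrK.
  have := bop_le b tt (f - f'); rewrite -/N in hf *; move: hF hf.
  by move: (vnorm_ge0 (f - f')); nra.
have f'1 : vnorm f' <= 1 + d.
  have := vnormD f (f' - f); rewrite addrC subrK (vdistC f'); lra.
have f'0 : 0 < vnorm f'.
  have h := bop_le b tt f'; rewrite -/N in h.
  have : 0 < vnorm (b · f') by apply: le_lt_trans bf'; lra.
  by move=> h'; rewrite lt_neqAle vnorm_ge0 andbT; apply/eqP => f0; move: h; rewrite -f0 mulr0; lra.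
pose c x : C := (vnorm f')^-1%:C * f x.
have gE : (vnorm f')^-1%:C *: f' = \sum_(x <- F) c x *: δ x.
  by rewrite scaler_sumr; apply: eq_bigr => x _; rewrite scalerA.
set g := _ *: f' in gE.
have g1 : vnorm g = 1.
  by rewrite vnormZ cabsR ger0_norm ?invr_ge0 ?(ltW f'0) // mulVf ?gt_eqF.
have bg : vnorm (b · g) = (vnorm f')^-1 * vnorm (b · f').
  by rewrite bopZ vnormZ cabsR ger0_norm ?invr_ge0 ?(ltW f'0).
have bgN : vnorm (b · g) <= N by have := bop_le b tt g; rewrite g1 mulr1.
have bgl : N - d * (1 + 2 * N) < vnorm (b · g).
  have e1 : vnorm (b · f') = vnorm f' * vnorm (b · g) by rewrite bg mulVKf // gt_eqF.
  have := vnorm_ge0 (b · g); rewrite e1 in bf'; nra.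
pose lv (x : point) := (\max_(a <- x.2) lev a).+1.
have lvP x : lows (lv x) x.2.
  by apply/allP => a ax; rewrite /lv ltnS; apply: leq_bigmax_seq.
(* At least i and beyond all levels in the lists of F, so that b lies in E_j and [sop_gram] applies
   to the points of F. *)
pose j := maxn i (\max_(x <- F) lv x).
have lF x : x \in F -> lows j x.2.
  move=> xF; apply: lows_le (lvP x); apply: leq_trans (leq_maxr _ _).
  by apply: leq_bigmax_seq.
have Ebj : E j b by apply: (@union_le _ _ E (@E_mono R) _ _ (leq_maxl i _)).
pose w := \sum_(x <- F) c x *: sop R j x 0.
have gram T : E j T -> w^† ** T ** w = dot g (T · g) *: cone B.
  move=> ET; rewrite /w cadj_sum cmul_suml cmul_suml gE bop_sum.
  rewrite (big_morph (fun v => dot v _) (fun u v => dotDl u v _) (dot0l _)) scaler_suml.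
  rewrite !big_seq; apply: eq_bigr => x xF.
  rewrite cmul_sumr (big_morph _ (dotDr _) (dot0r _)) scaler_suml.
  apply: eq_bigr => y yF; rewrite bopZ dotZl dotZr cadjZ !cmulZl cmulZr !scalerA.
  by rewrite (sop_gram _ _ ET (lF x xF) (lF y yF)) eqxx scalerA mulrA.
exists j.+1, w; split.
- rewrite /w big_seq; elim/big_ind: _ => [|u v|x xF].
  + exact: ssub0 (E_star _ _).
  + exact: (ssubD (E_star _ _)).
  + by apply: (ssubZ (E_star _ _)); apply: sop_E; exact: lF.
- by have := gram _ (@E_one R j); rewrite cmulx1 bop_one dot_vnorm g1 expr1n rmorph1 scale1r.
rewrite gram; last by apply: (ssubM (E_star _ _)) => //; exact: (ssub_adj (E_star _ _)).
rewrite bop_mul -bop_adj dot_vnorm -scalerBl -rmorphB rnormZR.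
apply: le_lt_trans (ler_wpM2l (normr_ge0 _) norm_one_le1) _; rewrite mulr1.
by rewrite ltr_norml; apply/andP; split; have := vnorm_ge0 (b · g); nra.
Qed.

Lemma model_pairs i : exists S : nat -> B,
  [/\ forall n, E i.+1 (S n), forall m n, (S m)^† ** S n = if m == n then cone B else 0 &
      forall m n T, E i T -> (S m)^† ** T ** S n = (if m == n then coef T (word1, [::]) (word1, [::]) else 0) *: cone B].
Proof.
have k0 : lows i ((word1, [::]) : point).2 by [].
exists (fun n => sop R i (word1, [::]) n); split.
- by move=> n; exact: sop_E.
- move=> m n; have := sop_gram m n (@E_one R i) k0 k0; rewrite cmulx1 => ->.
  by case: eqP => _; rewrite ?scale0r // /coef bop_one dot_delta2 eqxx scale1r.
by move=> m n T ET; exact: sop_gram.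
Qed.

Definition restrictf (P : pred point) (z : point) := if P z then Some z else None.
Lemma restrict_pbP P : forall z y, restrictf P z = Some y <-> restrictf P y = Some z.
Proof. by rewrite /restrictf => z y; split; case: ifP => // Pz [<-]; rewrite Pz. Qed.
Definition restrict (P : pred point) : B := pb_op R (Pbij (restrict_pbP P)).

Lemma restrictE P f z : (restrict P · f) z = if P z then f z else 0.
Proof. by rewrite /restrict pb_opE /= /restrictf; case: ifP. Qed.

Lemma restrict_norm P f : nsq f = nsq (restrict P · f) + nsq (restrict (predC P) · f).
Proof.
have {1}-> : f = restrict P · f + 1 *: (restrict (predC P) · f).
  by apply: vec_ext => z; rewrite scale1r vecD !restrictE /=; case: (P z); rewrite ?addr0 ?add0r.
rewrite nsqD (cabsR 1) normr1 expr1n !mul1r.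
rewrite (_ : dot _ _ = 0) ?mulr0 ?addr0 //.
apply: dotE; have := @has_sum_fin R point fset0 (fun _ => 0); rewrite big_seq_fset0 => /(_ (fun _ _ => erefl)).
congr has_sum; apply/funext => z; rewrite !restrictE /=.
by case: (P z); rewrite ?mulr0 // conjc0 mul0r.
Qed.

Lemma restrict_union (P Q : pred point) f : (forall z, ~~ (P z && Q z)) ->
  nsq (restrict (predU P Q) · f) = nsq (restrict P · f) + nsq (restrict Q · f).
Proof.
move=> PQ; rewrite (restrict_norm P (restrict (predU P Q) · f)).
congr (_ + _); congr nsq; apply: vec_ext => z; rewrite !restrictE /=.
  by case: (P z).
by have := PQ z; case: (P z) => //=; case: (Q z).
Qed.

Lemma restrict_mono (P Q : pred point) f : (forall z, P z -> Q z) ->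
  nsq (restrict P · f) <= nsq (restrict Q · f).
Proof.
move=> PQ; rewrite (restrict_norm P (restrict Q · f)).
rewrite (_ : restrict P · (restrict Q · f) = restrict P · f); first by rewrite lerDl nsq_ge0.
by apply: vec_ext => z; rewrite !restrictE; case Pz: (P z) => //; rewrite PQ.
Qed.

Lemma restrict_le P f : nsq (restrict P · f) <= nsq f.
Proof. by rewrite [leRHS](restrict_norm P) lerDl nsq_ge0. Qed.
End ModelPeak.

(** * Non-amenability against doubling *)

Section ModelGap.
Variable R : realType.
Local Notation C := R[i].
Local Notation V := (vec R point).
Local Notation B := (bops R unit point).
Local Notation "T · f" := (bop T tt f) (at level 40, f at next level).
Local Notation "'δ' z" := (delta R (z : point)) (at level 8, z at level 8).
Implicit Types (T S U : B) (f g : V) (x : 'I_3) (z : point).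

Lemma invol_opE h hK f z : (@invol_op R h hK · f) z = f (h z).
Proof. by rewrite /invol_op pb_opE pb_vecE. Qed.

Lemma invol_op_norm h hK f : nsq (@invol_op R h hK · f) = nsq f.
Proof. by rewrite /nsq bop_adj -bop_mul invol_op_adj invol_op_sqr bop_one. Qed.

Definition basepoint : point := (word1, [::]).
Local Notation Ω := basepoint.
Local Notation away := (restrict R (predC1 Ω)).
Definition ends_at x : pred point := fun z => ends x (act z).

Lemma ends_at_basepoint x : ends_at x Ω = false. Proof. by []. Qed.

Lemma move_to_ends x z : z != Ω -> ~~ ends_at x z -> ends_at x (umap x (vmap x z)).
Proof.
case: z => w l; rewrite /ends_at; case/lastP: l => [|l e] z1 ze.
  by apply: (ends_lrmul _ ze); apply: contraNneq z1 => w1; have <- : word1 = w by [].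
rewrite vmap_rcons /umap /act /= nilp_rcons lact_rcons /=; apply: ends_rmul.
by move: ze; rewrite /act /= nilp_rcons lact_rcons.
Qed.

Lemma uvmapK x z : umap x (vmap x (umap x (vmap x z))) = z.
Proof. by rewrite -uvmap umapK vmapK. Qed.

(* The free product of three copies of Z/2 is not amenable: the pairs
   (umap x) (vmap x) move everything but the base point and ends_at x into
   ends_at x, and some ends_at x carries at most a third of the mass. *)
Lemma almost_invariant f (t : R) : 0 <= t ->
  (forall x, vnorm (uop R x · (vop R x · f) - f) <= t) -> nsq (away · f) <= 19 * t ^+ 2.
Proof.
move=> t0 ft; pose m x := nsq (restrict R (ends_at x) · f).
have disj x y z : x != y -> ~~ (ends_at x z && ends_at y z).
  rewrite /ends_at /ends => /eqP xy; apply/negP => /andP[/eqP -> /eqP[yx]].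
  by apply: xy.
have sum3 : m ord0 + m (inord 1) + m ord_max <= nsq (away · f).
  rewrite /m -restrict_union; last by move=> z; apply: disj; rewrite -val_eqE /= inordK.
  rewrite -restrict_union.
    apply: restrict_mono => z /= h; apply/eqP => z1; move: h; rewrite z1.
    by rewrite !ends_at_basepoint.
  move=> z /=; rewrite andb_orl negb_or !disj // -val_eqE /= ?inordK //.
have [x mx] : exists x, 3 * m x <= nsq (away · f).
  have [h0|h0] := lerP (3 * m ord0) (nsq (away · f)); first by exists ord0.
  have [h1|h1] := lerP (3 * m (inord 1)) (nsq (away · f)); first by exists (inord 1).
  by exists ord_max; lra.
pose P : pred point := fun z => (z != Ω) && ~~ ends_at x z.
have PE : nsq (away · f) = m x + nsq (restrict R P · f).
  rewrite /m -restrict_union; last by move=> z; rewrite /P; case: ends_at; rewrite ?andbF.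
  congr nsq; apply: vec_ext => z; rewrite !restrictE /= /P.
  by case: eqP => [->|_] //=; case: ends_at.
have Pm : nsq (restrict R P · (uop R x · (vop R x · f))) <= m x.
  have -> : restrict R P · (uop R x · (vop R x · f)) =
      uop R x · (vop R x · (restrict R (fun z => P (umap x (vmap x z))) · f)).
    apply: vec_ext => z; rewrite restrictE /uop /vop !invol_opE restrictE.
    by rewrite vmapK umapK.
  rewrite /uop /vop !invol_op_norm; apply: restrict_mono => z /andP[h1 h2].
  by rewrite -[z](uvmapK x); exact: move_to_ends.
have h : vnorm (restrict R P · f) <= vnorm (restrict R (ends_at x) · f) + t.
  have -> : restrict R P · f = restrict R P · (uop R x · (vop R x · f)) -
      restrict R P · (uop R x · (vop R x · f) - f).
    by rewrite bopD bopN opprD addrA subrr add0r opprK.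
  apply: le_trans (vnormD _ _) _; rewrite vnormN; apply: lerD.
    by rewrite vnorm_le ?vnorm_ge0 // sqr_vnorm.
  apply: le_trans (ft x); rewrite vnorm_le ?vnorm_ge0 // sqr_vnorm; exact: restrict_le.
move: mx; rewrite PE /m -!sqr_vnorm; move: h (vnorm_ge0 (restrict R P · f)).
move: (vnorm_ge0 (restrict R (ends_at x) · f)); move: (vnorm _) (vnorm _) => b a a0 h b0 ab.
(* a^2 is at most a third of a^2 + b^2, so b^2 >= 2 a^2, and 7/5 is below the square root of 2. With
   b <= a + t this gives b <= 7/2 t and a <= 5/2 t, so a^2 + b^2 <= 18.5 t^2. *)
have ab' : 7 / 5 * a <= b by nra.
have : b <= 7 / 2 * t by nra.
have : a <= 5 / 2 * t by nra.
nra.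
Qed.

(** The square of the commutator expands into four terms, each within d of 1 or of -1 with total 0:
    a quantitative form of the multiplicative domain. *)
Lemma displacement T u d : u^† = u -> u ** u = cone B -> 0 <= d ->
  rnorm (T^† ** T - cone B) <= d -> rnorm (T^† ** u ** T - u) <= d ->
  rnorm (u ** T - T ** u) ^+ 2 <= 4 * d.
Proof.
move=> us uu d0 h0 h1; have un : rnorm u <= 1 by apply: isometry_le1; rewrite us.
rewrite -rnorm_cstar.
have -> : (u ** T - T ** u)^† ** (u ** T - T ** u) =
    (T^† ** T - cone B) - (T^† ** u ** T - u) ** u - u ** (T^† ** u ** T - u) +
    u ** (T^† ** T - cone B) ** u.
  rewrite cadjB !cadjM us !cexpand cmulx1 uu.
  have -> : T^† ** u ** u ** T = T^† ** T by rewrite -(cmulA (T^†)) uu cmulx1.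
  lmod_with (R[i]) ltac:(ring).
apply: le_trans (le_rnormD (le_rnormB (le_rnormB h0 (le_rnormM h1 un)) (le_rnormM un h1))
  (le_rnormM (le_rnormM un h0) un)) _; nra.
Qed.

(** T commutes with the v_x and nearly with the u_x, while u_x v_x fixes delta_1; so T delta_1 is
    invariant up to the square root of 4 d, and 76 is 19 times 4. *)
Lemma near_basepoint T d : (forall x, T ** vop R x = vop R x ** T) -> 0 <= d ->
  rnorm (T^† ** T - cone B) <= d -> (forall x, rnorm (T^† ** uop R x ** T - uop R x) <= d) ->
  nsq (away · (T · δ Ω)) <= 76 * d.
Proof.
move=> Tv d0 h0 h1; have d4 : 0 <= 4 * d by lra.
have -> : 76 * d = 19 * Num.sqrt (4 * d) ^+ 2 by rewrite sqr_sqrtr //; lra.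
apply: almost_invariant => [|x]; first exact: sqrtr_ge0.
have us : (uop R x)^† = uop R x by rewrite /uop invol_op_adj.
have uu : uop R x ** uop R x = cone B by rewrite /uop invol_op_sqr.
have fixΩ : uop R x · (vop R x · δ Ω) = δ Ω.
  rewrite /uop /vop !invol_op_delta; congr (delta R _).
  by rewrite /vmap /umap /sact /act /= lrmul1.
have -> : uop R x · (vop R x · (T · δ Ω)) - T · δ Ω =
    (uop R x ** T - T ** uop R x) · (vop R x · δ Ω).
  by rewrite -{2}fixΩ -(bop_mul (vop R x)) -Tv bopDE bopNE !bop_mul.
apply: le_trans (bop_le _ _ _) _.
have -> : vnorm (vop R x · δ Ω) = 1 by rewrite /vop invol_op_delta delta_norm.
rewrite mulr1 -(@ler_pXn2r _ 2) ?nnegrE ?rnorm_ge0 ?sqrtr_ge0 // sqr_sqrtr //.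
exact: displacement.
Qed.

Lemma away_dot f g : dot f g = conjc (f Ω) * g Ω + dot (away · f) (away · g).
Proof.
have E (h : V) : h = h Ω *: δ Ω + away · h.
  apply: vec_ext => z; rewrite vecD vecZ deltaE restrictE /=.
  by case: eqP => [->|_]; rewrite ?mulr1 ?mulr0 ?addr0 ?add0r.
have O1 (h : V) : dot (δ Ω) (away · h) = 0 by rewrite dot_delta restrictE.
have O2 (h : V) : dot (away · h) (δ Ω) = 0 by rewrite dotC O1 conjc0.
rewrite {1}(E f) {1}(E g) !dot_expand O1 O2 dot_delta2 eqxx.
by rewrite !mulr0 mulr1 addr0 add0r mulrC.
Qed.

Lemma model_no_doubling (v w : B) :
  (forall x, v ** vop R x = vop R x ** v) -> (forall x, w ** vop R x = vop R x ** w) ->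
  ~ [/\ doubling v w (cone B) 200^-1, doubling v w (uop R ord0) 200^-1,
        doubling v w (uop R (inord 1)) 200^-1 & doubling v w (uop R ord_max) 200^-1].
Proof.
move=> vv wv; have [d dE] : exists d : R, d = 200^-1 by exists 200^-1.
rewrite -dE => -[[]]; rewrite !cmulx1 => v1 w1 vw [a1 a2 _] [b1 b2 _] [c1 c2 _].
have I3 (x : 'I_3) : [\/ x = ord0, x = inord 1 | x = ord_max].
  case: x => [[|[|[|//]]] h]; [constructor 1|constructor 2|constructor 3]; apply: val_inj => //=.
  by rewrite inordK.
have d0 : 0 <= d by lra.
have vP : nsq (away · (v · δ Ω)) <= 76 * d.
  by apply: near_basepoint => //; [exact: ltW|move=> x; case: (I3 x) => ->; exact: ltW].
have wP : nsq (away · (w · δ Ω)) <= 76 * d.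
  by apply: near_basepoint => //; [exact: ltW|move=> x; case: (I3 x) => ->; exact: ltW].
have near1 (T : B) : rnorm (T^† ** T - cone B) < d -> nsq (away · (T · δ Ω)) <= 76 * d ->
    1 - 77 * d <= cabs ((T · δ Ω) Ω) ^+ 2.
  move=> h1 h2; set f := T · δ Ω in h2 *.
  have e1 : dot f f = 1 + dot (δ Ω) ((T^† ** T - cone B) · δ Ω).
    by rewrite /f bop_adj bopDE bopNE bop_one bop_mul !dot_expand dot_delta2 eqxx addrC subrK.
  have e2 : cabs (dot (δ Ω) ((T^† ** T - cone B) · δ Ω)) <= d.
    apply: le_trans (dot_le _ _) _; rewrite delta_norm mul1r.
    by apply: le_trans (bop_le _ _ _) _; rewrite delta_norm mulr1 ltW.
  have := away_dot f f; rewrite e1 [dot (away · f) _]dotff -cabs_sqr -rmorphD.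
  move=> /(congr1 (@complex.Re R)) /=; move: (le_trans (cabs_Re _) e2).
  rewrite ler_norml; set q := dot _ _; case: q => p r /= /andP[p1 p2].
  by move=> ?; lra.
have v2 := near1 v v1 vP; have w2 := near1 w w1 wP.
have e1 : dot (v · δ Ω) (w · δ Ω) = dot (δ Ω) ((v^† ** w) · δ Ω) by rewrite bop_adj bop_mul.
have e2 : cabs (dot (v · δ Ω) (w · δ Ω)) <= d.
  rewrite e1; apply: le_trans (dot_le _ _) _; rewrite delta_norm mul1r.
  by apply: le_trans (bop_le _ _ _) _; rewrite delta_norm mulr1 ltW.
have e3 : cabs (dot (away · (v · δ Ω)) (away · (w · δ Ω))) <= 76 * d.
  apply: le_trans (dot_le _ _) _; rewrite -!sqr_vnorm in vP wP.
  move: vP wP (vnorm_ge0 (away · (v · δ Ω))) (vnorm_ge0 (away · (w · δ Ω))).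
  by move: (vnorm _) (vnorm _) => a b; nra.
have e4 : conjc ((v · δ Ω) Ω) * (w · δ Ω) Ω =
    dot (v · δ Ω) (w · δ Ω) - dot (away · (v · δ Ω)) (away · (w · δ Ω)).
  by rewrite (away_dot (v · δ Ω)) addrK.
have := cabsD (dot (v · δ Ω) (w · δ Ω)) (- dot (away · (v · δ Ω)) (away · (w · δ Ω))).
rewrite -e4 cabsM cabs_conj cabsN.
move: v2 w2 e2 e3 (cabs_ge0 ((v · δ Ω) Ω)) (cabs_ge0 ((w · δ Ω) Ω)).
move: (cabs ((v · δ Ω) Ω)) (cabs ((w · δ Ω) Ω)) => p q; move: (cabs _) (cabs _) => a b.
move=> p2 q2 ha hb p0 q0 pq.
(* For d = 1/200 the squares of p and q are at least 1 - 77 d = 0.615, above 9/16, whereas p q is at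
   most 77 d = 0.385, below 9/16. *)
have p3 : 3 / 4 <= p by nra.
have q3 : 3 / 4 <= q by nra.
by nra.
Qed.
End ModelGap.

Section HomDiag.
Context {R : realType} {A : unitalCstarType R}.
Implicit Types (p s t u v w : A).

Lemma hom1_diag s t u u' w : cuntz_pair s t -> hom1 u u' -> unit1 w ->
  hom1 (diag s t u w) (diag s t u' w).
Proof.
move=> st [f [fc fu f0 f1]] w1; exists (fun r => diag s t (f r) w); split; rewrite ?f0 ?f1 //.
  by apply: cpathD; [apply: cpathM; [apply: cpathM|]|]; rewrite //; exact: cpath_cst.
by move=> r; exact: diag_unit.
Qed.

Lemma unit_complement p u : p^† = p -> u ** p = u -> p ** u = u ->
  u^† ** u = p -> u ** u^† = p -> unit1 (u + (cone A - p)).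
Proof.
move=> ps up pu uau uua; have ps1 := cone_adj (A := A).
have uap : u^† ** p = u^† by rewrite -{1}ps -cadjM pu.
have pua : p ** u^† = u^† by rewrite -{1}ps -cadjM up.
have pp : p ** p = p by rewrite -{2}uau cmulA pua.
split; rewrite cadjD cadjB ps ps1 !cexpand !cmul1x !cmulx1.
  by rewrite uau uap pu pp; lmod_with (R[i]) ltac:(ring).
by rewrite uua pua up pp; lmod_with (R[i]) ltac:(ring).
Qed.
End HomDiag.

Section Embedding.
Variables (R : realType) (B : unitalCstarType R) (S : unital_subalgebra B).
Local Notation M := (subalg S).
Local Notation ι := (@emb R B S).

Definition embE := (embB, embD, embZ, embM, emb_adj, emb1).

Lemma emb_isometry (s : M) : (ι s)^† ** ι s = cone B -> s^† ** s = cone M.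
Proof. by move=> h; apply: emb_inj; rewrite !embE. Qed.

Lemma emb_cuntz (s t : M) : cuntz_pair (ι s) (ι t) -> cuntz_pair s t.
Proof. by case=> h1 h2 h3; split; apply: emb_inj; rewrite !embE. Qed.

Lemma emb_unit (u : M) : unit1 (ι u) <-> unit1 u.
Proof.
split=> -[h1 h2]; first by split; apply: emb_inj; rewrite !embE.
by split; rewrite -emb_adj -embM ?h1 ?h2 emb1.
Qed.

Lemma emb_proj (p : M) : isproj (ι p) <-> isproj p.
Proof.
split=> -[h1 h2]; first by split; apply: emb_inj; rewrite !embE.
by split; rewrite -?emb_adj -?embM ?h1 ?h2.
Qed.

Lemma emb_diag (s t x y : M) : ι (diag s t x y) = diag (ι s) (ι t) (ι x) (ι y).
Proof. by rewrite /diag !embE. Qed.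

End Embedding.

(** * The algebra M and its K-theory *)

Section ModelAlgebra.
Variable R : realType.
Local Notation B := (bops R unit point).
Local Notation E := (@E R).

Lemma model_repeat i : exists (s w : B) (Th : B -> B),
  [/\ cuntz_pair s w, forall x y, Th x ** Th y = Th (x ** y),
      forall x, (Th x)^† = Th x^†, forall x, Th x = diag s w x (Th x) &
      [/\ w ** (cone B - Th (cone B)) = cone B - Th (cone B),
          E i.+1 s, E i.+1 w & forall x, E i x -> E i.+1 (Th x)]].
Proof.
have [S [SE SP _]] := @model_pairs R i.
have [Th [w [st ThM Tha ThE [wP cw]]]] := infinite_repeat SP.
exists (S 0), w, Th; split=> //.
have SEa n : E i.+1 (S n)^† by exact: (ssub_adj (@E_star R i.+1) (SE n)).
(* The generators of level i + 1 commute with the S_n and their adjoints, hence with the strong sums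
   built from them; this is membership in E_(i+1). *)
have key s : gens i.+1 s -> s ** w = w ** s /\ forall x, s ** x = x ** s -> s ** Th x = Th x ** s.
  by move=> gs; apply: cw => n; [rewrite (SE n)|rewrite (SEa n)].
split=> // [s /key[]//|x Ex s gs].
by have [_ h] := key s gs; rewrite h // (E_mono Ex gs).
Qed.

Definition model_subalgebra : unital_subalgebra B :=
  UnitalSubalgebra (union_closure_star (@E_star R) (@E_mono R)) (union_sub (@E_one R 0)).
Definition model : unitalCstarType R := subalg model_subalgebra.
Local Notation M := model.
Local Notation ι := (@emb R B model_subalgebra).

Lemma model_lift i T : E i T -> exists m : M, ι m = T.
Proof. by move=> ET; exists (slift (union_sub ET : model_subalgebra T)); rewrite sliftE. Qed.

Lemma model_vop (m : M) x : ι m ** vop R x = vop R x ** ι m.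
Proof.
have h : star_subalgebra (commutant (fun s : B => s = vop R x)).
  by apply: commutant_star => _ ->; rewrite /vop invol_op_adj.
have : commutant (fun s : B => s = vop R x) (ι m); last exact.
move/closed_rnormP: (ssub_closed h) => cl; apply: cl => e e0.
have [i [T [ET hT]]] := emb_mem m _ e0; exists T => // _ ->; exact: E_vop ET.
Qed.

Lemma model_near (m : M) e : 0 < e -> exists i (x : M), E i (ι x) /\ rnorm (m - x) < e.
Proof.
move=> e0; have [i [T [ET hT]]] := emb_mem m _ e0; have [x xE] := model_lift ET.
by exists i, x; rewrite xE -emb_norm embB xE.
Qed.

Lemma model_is_peaking (m : M) : peaking m.
Proof.
apply: peaking_closure => e e0; have [i [x [Ex mx]]] := model_near m e0; exists x => // d d0.
have [j [s [Es ss hs]]] := model_peaking Ex d0; have [s' sE] := model_lift Es.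
exists s'; first by apply: emb_isometry; rewrite sE.
by rewrite -emb_norm !embE sE -emb_norm.
Qed.

Lemma model_cuntz : exists s t : M, cuntz_pair s t.
Proof.
have [s [w [_ [st _ _ _ [_ Es Ew _]]]]] := model_repeat 0.
have [s' sE] := model_lift Es; have [w' wE] := model_lift Ew.
by exists s', w'; apply: emb_cuntz; rewrite sE wE.
Qed.

Lemma model_uop x : exists2 m : M, ι m = uop R x & rnorm m <= 1.
Proof.
have [m mE] := model_lift (@uop_E R x); exists m => //.
by rewrite -emb_norm mE; apply: isometry_le1; rewrite /uop invol_op_adj invol_op_sqr.
Qed.

Lemma model_independent :
  exists x y : M, forall c d : R[i], c *: x + d *: y = 0 -> c = 0 /\ d = 0.
Proof.
have [m mE _] := model_uop ord0; exists (cone M), m => c d.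
move=> /(congr1 ι); rewrite !embE mE (emb0 model_subalgebra) => /(congr1 (fun T => bop T tt (delta R basepoint))).
rewrite bopDE !bopZE bop_one bop0E /uop invol_op_delta => h.
have hz z : c * delta R basepoint z + d * delta R (umap ord0 basepoint) z = 0.
  by rewrite -!vecZ -vecD h vec0.
have ne : (basepoint == umap ord0 basepoint) = false.
  by apply/eqP => /(congr1 fst) /= w1; have := lmul1_neq ord0; rewrite -w1 eqxx.
have := hz basepoint; have := hz (umap ord0 basepoint).
by rewrite !deltaE !eqxx eq_sym ne !mulr0 !mulr1 add0r addr0.
Qed.

Lemma model_purely_infinite_simple : purely_infinite_simple M.
Proof. exact: (peaking_purely_infinite model_is_peaking model_independent). Qed.

Lemma model_one_neq0 : cone M != 0.
Proof.
have [x [y h]] := model_independent; apply/eqP => e.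
have z (m : M) : m = 0 by rewrite -[m]cmul1x e cmul0x.
have [] := h 1 1; first by rewrite (z x) (z y) !scaler0 addr0.
by move/eqP; rewrite oner_eq0.
Qed.

Lemma model_sentence u : sentence_value (unital_structure u M) (@doubling_sentence R u) != 0.
Proof.
have [y1 e1 n1] := model_uop ord0; have [y2 e2 n2] := model_uop (inord 1).
have [y3 e3 n3] := model_uop ord_max.
have [d [d0 d1 dE]] : exists d : R, [/\ 0 < d, d <= 1 & d = 200^-1] by exists 200^-1; split; lra.
apply: (@unital_doubling_sentence R u M d (cone M) y1 y2 y3) => //.
- exact: model_one_neq0.
- have [s [t st]] := model_cuntz; exists s, t; have [h1 h2 _] := st.
  by have [h3 _] := cuntz_orth st.
- exact: model_is_peaking.
- exact: norm_one_le1.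
rewrite dE => {d d0 d1 dE}.
move=> v w [h0 h1 h2 h3]; apply: (@model_no_doubling R (ι v) (ι w)).
- by move=> x; exact: model_vop.
- by move=> x; exact: model_vop.
have tr y T : ι y = T -> doubling v w y 200^-1 -> doubling (ι v) (ι w) T 200^-1.
  by move=> <- [a b c]; split; rewrite -?emb_adj -?embM -?embB emb_norm.
by split; [apply: tr h0; exact: emb1|apply: tr h1|apply: tr h2|apply: tr h3].
Qed.

(** p is equivalent to a nearby projection q of some E_i, and the repeat Th q absorbs q. *)
Lemma model_K0_step (p : M) : isproj p ->
  exists a b r : M, [/\ cuntz_pair a b, isproj r & mvn1 r (diag a b p r)].
Proof.
move=> hp; have d0 : 0 < 200^-1 :> R by lra.
have [i [x [Ex px]]] := model_near p d0.
have xp : rnorm (ι x - ι p) <= 200^-1 by rewrite -embB emb_norm rdistC ltW.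
have [q0 Eq [qp qn]] := round_projection (@E_star R i) (@E_one R i) (proj2 (emb_proj p) hp) Ex xp (lexx _).
have [q qE] := model_lift Eq; rewrite -qE in Eq qp qn.
have pq : mvn1 p q.
  apply: close_projections => //; first exact/emb_proj.
  by rewrite -emb_norm embB rdistC; apply: le_trans qn _; lra.
have [s0 [w0 [Th [st ThM Tha ThE [_ Es Ew ThI]]]]] := model_repeat i.
have [s sE] := model_lift Es; have [w wE] := model_lift Ew; have [r rE] := model_lift (ThI _ Eq).
have sw : cuntz_pair s w by apply: emb_cuntz; rewrite sE wE.
have [qq qs] := qp.
have rp : isproj r by apply/emb_proj; split; rewrite rE ?ThM ?Tha ?qq ?qs.
exists s, w, r; split=> //.
have {1}-> : r = diag s w q r by apply: emb_inj; rewrite emb_diag rE sE wE.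
by apply: mvn1_diag => //; [exact: mvn1_sym|exact: mvn1_refl].
Qed.

(** u is connected to a nearby unitary g of some E_i. Its repeat Th g is unitary only under p = Th 1
    and is completed by 1 - p, which w fixes; the completed unitary still absorbs g. *)
Lemma model_K1_step (u : M) : unit1 u ->
  exists a b w : M, cuntz_pair a b /\ hom1 w (diag a b u w).
Proof.
move=> hu; have d0 : 0 < 400^-1 :> R by lra.
have [i [x [Ex ux]]] := model_near u d0.
have xu : rnorm (ι x - ι u) <= 400^-1 by rewrite -embB emb_norm rdistC ltW.
have d1 : 400^-1 <= 100^-1 :> R by lra.
have [g0 Eg [gu gn]] := round_unitary (@E_star R i) (@E_one R i) (proj2 (emb_unit u) hu) Ex xu d1.
have [g gE] := model_lift Eg; rewrite -gE in Eg gu gn.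
have ug : hom1 u g.
  apply: near_unitary_hom => //; first exact/emb_unit.
  by rewrite -emb_norm embB rdistC; apply: le_trans gn _; lra.
have [s0 [w0 [Th [st ThM Tha ThE [wP Es Ew ThI]]]]] := model_repeat i.
have [s sE] := model_lift Es; have [w wE] := model_lift Ew.
have [r rE] := model_lift (ThI _ Eg); have [p pE] := model_lift (ThI _ (@E_one R i)).
have sw : cuntz_pair s w by apply: emb_cuntz; rewrite sE wE.
have [g1 g2] := gu; have pa : p^† = p by apply: emb_inj; rewrite !embE pE Tha cone_adj.
have wp : w ** (cone M - p) = cone M - p by apply: emb_inj; rewrite !embE wE pE.
have rp : r ** p = r by apply: emb_inj; rewrite !embE rE pE ThM cmulx1.
have pr : p ** r = r by apply: emb_inj; rewrite !embE rE pE ThM cmul1x.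
have rr : r^† ** r = p by apply: emb_inj; rewrite !embE rE pE Tha ThM g1.
have rr' : r ** r^† = p by apply: emb_inj; rewrite !embE rE pE Tha ThM g2.
have v1 : unit1 (r + (cone M - p)) by exact: unit_complement.
exists s, w, (r + (cone M - p)); split=> //.
(* Conjugation by w leaves the summand 1 - p alone, while r = Th g satisfies the repeat equation. *)
have vE : r + (cone M - p) = diag s w g (r + (cone M - p)).
  have rD : r = diag s w g r by apply: emb_inj; rewrite emb_diag rE sE wE.
  have pw : (cone M - p) ** w^† = cone M - p.
    by rewrite -[LHS]cadjK cadjM cadjK cadjB pa cone_adj wp cadjB pa cone_adj.
  have e : w ** (r + (cone M - p)) ** w^† = w ** r ** w^† + (cone M - p).
    by rewrite (cmulDr w r) wp (cmulDl (w ** r)) pw.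
  by rewrite {1}rD /diag e -addrA.
rewrite {1}vE; apply: hom1_diag => //; exact: hom1_sym.
Qed.

Lemma model_K0 (x y : K0_rep M) : K0_eq x y.
Proof. by have [s [t st]] := model_cuntz; exact: (K0_trivial st model_K0_step). Qed.

Lemma model_K1 (x y : K1_rep M) : K1_eq x y.
Proof. by have [s [t st]] := model_cuntz; exact: (K1_trivial st model_K1_step). Qed.
End ModelAlgebra.

(** * The algebra O_2 *)

Section StarHom.
Context {R : realType} {A : unitalCstarType R}.
Implicit Types (x y : A) (f g : A -> A) (S : set A).

(** The factor 2 is what the triangle inequality gives for [double]; it serves as a modulus of
    continuity, uniform along paths of homomorphisms. *)
Record star_hom f : Prop := StarHom {
  shD : forall x y, f (x + y) = f x + f y;
  shZ : forall c x, f (c *: x) = c *: f x;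
  shM : forall x y, f (x ** y) = f x ** f y;
  sh_adj : forall x, f x^† = (f x)^†;
  sh_le : forall x, rnorm (f x) <= 2 * rnorm x }.

Lemma sh0 f (hf : star_hom f) : f 0 = 0.
Proof. by have := shZ hf 0 0; rewrite !scale0r. Qed.
Lemma shB f (hf : star_hom f) x y : f (x - y) = f x - f y.
Proof. by rewrite (shD hf) -[- y]scaleN1r (shZ hf) scaleN1r. Qed.

Lemma star_hom_id : star_hom id.
Proof. by split=> // x; have := rnorm_ge0 x; lra. Qed.

(** This and the next two lemmas reduce statements about homomorphisms on a generated algebra to the
    generators. *)
Lemma equalizer_star f g : star_hom f -> star_hom g -> star_subalgebra (fun x => f x = g x).
Proof.
move=> hf hg; split.
- apply/closed_rnormP => x hx; apply/eqP; rewrite -subr_eq0; apply/eqP/rnorm_small => e e0.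
  have e4 : 0 < e / 4 by rewrite divr_gt0.
  have [y yy xy] := hx _ e4.
  have -> : f x - g x = f (x - y) - g (x - y).
    by rewrite (shB hf) (shB hg) yy; lmod_with (R[i]) ltac:(ring).
  apply: le_lt_trans (le_rnormB (sh_le hf _) (sh_le hg _)) _.
  by move: xy; rewrite ltr_pdivlMr //; lra.
- by rewrite (sh0 hf) (sh0 hg).
- by move=> x y hx hy; rewrite (shD hf) (shD hg) hx hy.
- by move=> c x hx; rewrite (shZ hf) (shZ hg) hx.
- by move=> x y hx hy; rewrite (shM hf) (shM hg) hx hy.
- by move=> x hx; rewrite (sh_adj hf) (sh_adj hg) hx.
Qed.

Lemma preimage_star f S : star_hom f -> star_subalgebra S -> star_subalgebra (fun x => S (f x)).
Proof.
move=> hf hS; split.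
- apply/closed_rnormP => x hx; move/closed_rnormP: (ssub_closed hS); apply=> e e0.
  have e2 : 0 < e / 2 by rewrite divr_gt0.
  have [y Sy xy] := hx _ e2; exists (f y) => //; rewrite -(shB hf).
  by apply: le_lt_trans (sh_le hf _) _; move: xy; rewrite ltr_pdivlMr //; lra.
- by rewrite (sh0 hf); exact: ssub0.
- by move=> x y hx hy; rewrite (shD hf); exact: ssubD.
- by move=> c x hx; rewrite (shZ hf); exact: ssubZ.
- by move=> x y hx hy; rewrite (shM hf); exact: ssubM.
- by move=> x hx; rewrite (sh_adj hf); exact: ssub_adj.
Qed.

Lemma path_star (f : R -> A -> A) : (forall r, star_hom (f r)) ->
  star_subalgebra (fun x => cpath (fun r => f r x)).
Proof.
move=> hf; split.
- apply/closed_rnormP => x hx r e e0; have e8 : 0 < e / 8 by rewrite divr_gt0.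
  have [y hy xy] := hx _ e8; have e2 : 0 < e / 2 by rewrite divr_gt0.
  have [d d0 hd] := hy r _ e2; exists d => // q qd.
  have -> : f q x - f r x = f q (x - y) - f r (x - y) + (f q y - f r y).
    by rewrite (shB (hf q)) (shB (hf r)); lmod_with (R[i]) ltac:(ring).
  apply: le_lt_trans (le_rnormD (le_rnormB (sh_le (hf q) _) (sh_le (hf r) _)) (lexx _)) _.
  by have := hd q qd; move: xy; rewrite !ltr_pdivlMr //; lra.
- have -> : (fun r => f r 0) = (fun=> 0) by apply/funext => r; rewrite (sh0 (hf r)).
  exact: cpath_cst.
- move=> x y hx hy; have -> : (fun r => f r (x + y)) = (fun r => f r x + f r y).
    by apply/funext => r; rewrite (shD (hf r)).
  exact: cpathD.
- move=> c x hx; have -> : (fun r => f r (c *: x)) = (fun r => (c *: cone A) ** f r x).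
    by apply/funext => r; rewrite (shZ (hf r)) cmulZl cmul1x.
  by apply: cpathM => //; exact: cpath_cst.
- move=> x y hx hy; have -> : (fun r => f r (x ** y)) = (fun r => f r x ** f r y).
    by apply/funext => r; rewrite (shM (hf r)).
  exact: cpathM.
- move=> x hx; have -> : (fun r => f r x^†) = (fun r => (f r x)^†).
    by apply/funext => r; rewrite (sh_adj (hf r)).
  exact: cpath_adj.
Qed.

(** By [close_projections] the class of f r is locally constant, so the indicator of not being
    equivalent to f 0 is continuous and cannot jump from 0 to 1. *)
Lemma projection_path (f : R -> A) : cpath f -> (forall r, isproj (f r)) -> mvn1 (f 0) (f 1).
Proof.
move=> fc fp; apply: contrapT => n01; pose g (r : R) : R := if `[< mvn1 (f 0) (f r) >] then 0 else 1.
have gc : continuous g.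
  move=> r; apply/cvgrPdist_lt => e e0; have k0 : 0 < 8^-1 :> R by lra.
  have [d d0 hd] := fc r _ k0; apply/nbhs_ballP; exists d => //= q; rewrite /ball /= distrC => qd.
  have qr : mvn1 (f q) (f r) by apply: close_projections => //; exact/ltW/hd.
  rewrite (_ : g r = g q) ?subrr ?normr0 // /g; congr (if _ then _ else _).
  apply/asboolP/asboolP => h; first by apply: mvn1_trans h _ => //; exact: mvn1_sym.
  exact: mvn1_trans h qr.
have g0 : g 0 = 0 by rewrite /g asboolT //; exact: mvn1_refl.
have g1 : g 1 = 1 by rewrite /g asboolF.
have [c _] : exists2 c, c \in `[0, 1]%R & g c = 2^-1.
  apply: IVT; rewrite ?ler01 //; first exact: continuous_subspaceT.
  by rewrite g0 g1 min_l ?max_r ?ler01 //; apply/andP; split; lra.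
by rewrite /g; case: ifP => _ h; lra.
Qed.

End StarHom.

(** The element is a + b F with a = x + z j and b = y - z j. As F is a symmetry, unitarity means
    |a|^2 + |b|^2 = 1 and Re(conj(a) b) = 0, which are the two equations for x, y and z. *)
Lemma reflection_unit {R : realType} {A : unitalCstarType R} (F : A) (j : R[i]) (x y z : R) :
  F^† = F -> F ** F = cone A -> j * j = -1 -> conjc j = - j ->
  x ^+ 2 + y ^+ 2 + 2 * z ^+ 2 = 1 -> x * y = z ^+ 2 ->
  unit1 (x%:C *: cone A + y%:C *: F + z%:C *: (j *: (cone A - F))).
Proof.
move=> Fa FF jj jc e1 e2.
have e1C : x%:C ^+ 2 + y%:C ^+ 2 + 2 * z%:C ^+ 2 = 1 :> R[i].
  by rewrite -!rmorphXn -(rmorph_nat (real_complex R) 2) -rmorphM -!rmorphD e1 rmorph1.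
have e2C : x%:C * y%:C = z%:C ^+ 2 :> R[i] by rewrite -rmorphM e2 rmorphXn.
have -> : (x%:C *: cone A + y%:C *: F + z%:C *: (j *: (cone A - F))) =
   (x%:C + z%:C * j) *: cone A + (y%:C - z%:C * j) *: F.
  by rewrite scalerBr; lmod_with (R[i]) ltac:(ring).
set a := _ + _ * _; set b := _ - _.
have aa : conjc a = x%:C - z%:C * j by rewrite /a rmorphD rmorphM /= jc oppr0 mulrN.
have bb : conjc b = y%:C + z%:C * j by rewrite /b rmorphB rmorphM /= jc oppr0 mulrN opprK.
have E1 : conjc a * a + conjc b * b = 1.
  rewrite aa bb /a /b -e1C.
  transitivity (x%:C ^+ 2 + y%:C ^+ 2 - 2 * z%:C ^+ 2 * (j * j)); first by ring.
  by rewrite jj; ring.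
have E2 : conjc a * b + conjc b * a = 0.
  rewrite aa bb /a /b.
  transitivity (2 * (x%:C * y%:C) + 2 * z%:C ^+ 2 * (j * j)); first by ring.
  by rewrite jj e2C; ring.
clearbody a b.
have adj : (a *: cone A + b *: F)^† = conjc a *: cone A + conjc b *: F.
  by rewrite cadjD !cadjZc cone_adj Fa.
split; rewrite adj !cexpand !cmul1x !cmulx1 FF.
  transitivity ((conjc a * a + conjc b * b) *: cone A + (conjc a * b + conjc b * a) *: F).
    by lmod_with (R[i]) ltac:(ring).
  by rewrite E1 E2 scale1r scale0r addr0.
transitivity ((conjc a * a + conjc b * b) *: cone A + (conjc a * b + conjc b * a) *: F).
  by lmod_with (R[i]) ltac:(ring).
by rewrite E1 E2 scale1r scale0r addr0.
Qed.

(** * The symmetry exchanging two tensor factors *)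

Section FlipPath.
Context {R : realType} {A : unitalCstarType R}.
Variables (s t : A) (st : cuntz_pair s t).
Local Notation one := (cone A).
Implicit Types x y : A.

Definition double x := diag s t x x.

Lemma double_star_hom : star_hom double.
Proof.
have [s1 t1 _] := st; have sn := isometry_le1 s1; have tn := isometry_le1 t1.
have sn' : rnorm s^† <= 1 by rewrite rnorm_adj.
have tn' : rnorm t^† <= 1 by rewrite rnorm_adj.
split=> [x y|c x|x y|x|x].
- by rewrite /double /diag !cexpand; lmod_with (R[i]) ltac:(ring).
- by rewrite /double /diag !cexpand; lmod_with (R[i]) ltac:(ring).
- by rewrite /double diagM.
- by rewrite /double diag_adj.
- apply: le_trans (le_rnormD (le_rnormM (le_rnormM sn (lexx _)) sn')
    (le_rnormM (le_rnormM tn (lexx _)) tn')) _; lra.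
Qed.

(** The sum of the s_i s_j s_i^* s_j^* over all choices of s_i and s_j among s and t. In M_2 tensor
    M_2 tensor A, identified with A, it exchanges the factors M_2. *)
Definition flip := s ** double s^† + t ** double t^†.

Lemma double_s x : double x ** s = s ** x.
Proof.
have [s1 t1 _] := st; have [_ ts] := cuntz_orth st.
by rewrite /double /diag cmulDl -!cmulA s1 ts !cmulx0 addr0 cmulx1.
Qed.
Lemma double_t x : double x ** t = t ** x.
Proof.
have [s1 t1 _] := st; have [sT _] := cuntz_orth st.
by rewrite /double /diag cmulDl -!cmulA t1 sT !cmulx0 add0r cmulx1.
Qed.
Lemma flip_s : flip ** s = double s.
Proof. by rewrite /flip cmulDl -!cmulA !double_s !cmulA. Qed.
Lemma flip_t : flip ** t = double t.
Proof. by rewrite /flip cmulDl -!cmulA !double_t !cmulA. Qed.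

Lemma flip_adj : flip^† = flip.
Proof.
rewrite /flip cadjD !cadjM -!(sh_adj double_star_hom) !cadjK /double /diag.
by rewrite !cexpand; lmod_with (R[i]) ltac:(ring).
Qed.

Lemma flip_sqr : flip ** flip = one.
Proof.
have [_ _ e] := st; rewrite {2}/flip cmulDr !cmulA flip_s flip_t.
by rewrite -!(shM double_star_hom) -(shD double_star_hom) e /double diag1.
Qed.

(** This is 1 where the symmetry [flip] is 1, and exp (i pi r) where it is -1. *)
Definition flip_path (r : R) : A :=
  ((1 + cos (pi * r)) / 2)%:C *: cone A + ((1 - cos (pi * r)) / 2)%:C *: flip +
  (sin (pi * r) / 2)%:C *: (Complex 0 1 *: (cone A - flip)).

Lemma flip_path_unit r : unit1 (flip_path r).
Proof.
have cs := cos2Dsin2 (pi * r); apply: reflection_unit.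
- exact: flip_adj.
- exact: flip_sqr.
- by apply/eqP; rewrite eq_complex /= !mulr0 !mul0r mulr1 sub0r addr0 oppr0 !eqxx.
- by apply/eqP; rewrite eq_complex /= oppr0 !eqxx.
- by move: cs; move: (cos _) (sin _) => c q; lra.
- by move: cs; move: (cos _) (sin _) => c q; lra.
Qed.

Lemma flip_path0 : flip_path 0 = cone A.
Proof.
rewrite /flip_path mulr0 cos0 sin0 subrr !mul0r !scale0r !addr0.
by rewrite (_ : (1 + 1) / 2 = 1) ?scale1r //; lra.
Qed.

Lemma flip_path1 : flip_path 1 = flip.
Proof.
rewrite /flip_path mulr1 cospi sinpi subrr !mul0r !scale0r addr0 add0r.
by rewrite (_ : (1 - -1) / 2 = 1) ?scale1r //; lra.
Qed.

Lemma flip_path_cpath : cpath flip_path.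
Proof.
have pc : continuous (fun r : R => pi * r) by move=> r; exact: mulrl_continuous.
have cc : continuous (fun r : R => cos (pi * r)).
  by move=> r; apply: (continuous_comp (pc r)); exact: continuous_cos.
have sc : continuous (fun r : R => sin (pi * r)).
  by move=> r; apply: (continuous_comp (pc r)); exact: continuous_sin.
apply: cpathD; [apply: cpathD|]; apply: cpathZ => r; apply: cvgM; try exact: cvg_cst.
- by apply: cvgD; [exact: cvg_cst|exact: cc].
- by apply: cvgB; [exact: cvg_cst|exact: cc].
- exact: sc.
Qed.
End FlipPath.

(** * A Cuntz pair on l^2(N), from even and odd numbers *)

Section NatCuntz.
Variable R : realType.
Local Notation B := (bops R unit nat).

Definition interleave (b : bool) (n : nat) := (b + n.*2)%N.
Lemma interleave_pbP b : forall n m, Some (interleave b n) = Some m <->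
  (if odd m == b then Some m./2 else None) = Some n.
Proof.
rewrite /interleave => n m; split=> [[<-]|].
  by rewrite oddD odd_double addbF oddb eqxx half_bit_double.
by case: eqP => // <- [<-]; rewrite odd_double_half.
Qed.
Definition interleave_op b : B := pb_op R (Pbij (interleave_pbP b)).

Lemma interleave_cuntz : cuntz_pair (interleave_op false) (interleave_op true).
Proof.
have iso b : (interleave_op b)^† ** interleave_op b = cone B.
  apply: bop_delta_ext => -[] n; rewrite bop_mul /interleave_op pb_op_delta /= pb_op_inv_delta /=.
  by rewrite bop_one /interleave oddD odd_double addbF oddb eqxx half_bit_double.
split=> //; apply: bop_delta_ext => -[] n.
rewrite bopDE !bop_mul /interleave_op !pb_op_inv_delta /= bop_one.
have := odd_double_half n; case: (odd n) => /= h; rewrite ?bop0 ?addr0 ?add0r pb_op_delta /=.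
  by rewrite /interleave h.
by rewrite /interleave h.
Qed.

Lemma nat_ops_nontrivial : cone B != 0.
Proof.
apply/eqP => /(congr1 (fun T => dot (delta R 0%N) (bop T tt (delta R 0%N)))).
by rewrite bop_one bop0E dot0r dot_delta2 eqxx => /eqP; rewrite oner_eq0.
Qed.
End NatCuntz.

(* O_2 is realized as the algebra generated by the two coordinates on the set
   of all Cuntz pairs on l^2: a unitary w then acts on it by moving the pair
   (s, t) to (w s, w t). *)
Section Cuntz.
Variable R : realType.
Local Notation B := (bops R unit nat).
Definition pairs := {p : B * B | cuntz_pair p.1 p.2}.
Local Notation A := (bops R pairs nat).
Implicit Types (T S w x y : A) (q : pairs).

Lemma fiber_subproof T q : (fun _ : unit => bop T q) \in @opfam R unit nat.
Proof.
rewrite unfold_in; apply/asboolP; exists (fun _ => bop T^† q), (rnorm T) => _ f g.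
by split; [exact: bop_adj|exact: bop_le].
Qed.
Definition fiber T q : B := mkbop (fiber_subproof T q).

Lemma fiberE T q f : bop (fiber T q) tt f = bop T q f.
Proof. by rewrite /fiber mkbopE. Qed.

Lemma fiber_ext T S : (forall q, fiber T q = fiber S q) -> T = S.
Proof. by move=> h; apply: bop_eq => q f; rewrite -!fiberE h. Qed.

Lemma fiberD T S q : fiber (T + S) q = fiber T q + fiber S q.
Proof. by apply: bop_eq => -[] f; rewrite bopDE !fiberE bopDE. Qed.
Lemma fiberZ c T q : fiber (c *: T) q = c *: fiber T q.
Proof. by apply: bop_eq => -[] f; rewrite bopZE !fiberE bopZE. Qed.
Lemma fiberM T S q : fiber (T ** S) q = fiber T q ** fiber S q.
Proof. by apply: bop_eq => -[] f; rewrite bop_mul !fiberE bop_mul. Qed.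
Lemma fiber_one q : fiber (cone A) q = cone B.
Proof. by apply: bop_eq => -[] f; rewrite !fiberE !bop_one. Qed.
Lemma fiber_adj T q : fiber T^† q = (fiber T q)^†.
Proof. by apply/esym/bop_adj_uniq => -[] f g; rewrite !fiberE bop_adj. Qed.
Lemma fiber_norm T q : rnorm (fiber T q) <= rnorm T.
Proof.
apply: rnorm_bop_le => [|[] f]; first exact: rnorm_ge0.
by rewrite fiberE; exact: bop_le.
Qed.
Lemma fiber_norm_le T K : 0 <= K -> (forall q, rnorm (fiber T q) <= K) -> rnorm T <= K.
Proof.
move=> K0 h; apply: rnorm_bop_le => // q f; rewrite -fiberE.
by apply: le_trans (bop_le _ _ _) _; apply: ler_wpM2r (h q); exact: vnorm_ge0.
Qed.

Lemma family_exists (F : pairs -> B) K : (forall q, rnorm (F q) <= K) ->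
  exists T : A, forall q, fiber T q = F q.
Proof.
move=> FK; have FP : (fun q => bop (F q) tt) \in @opfam R pairs nat.
  rewrite unfold_in; apply/asboolP; exists (fun q => bop (F q)^† tt), K => q f g.
  split; first exact: bop_adj.
  by apply: le_trans (bop_le _ _ _) _; apply: ler_wpM2r (FK q); exact: vnorm_ge0.
by exists (mkbop FP) => q; apply: bop_eq => -[] f; rewrite fiberE mkbopE.
Qed.

Lemma coordinates_exist : exists st : A * A, cuntz_pair st.1 st.2 /\
  forall q, fiber st.1 q = (proj1_sig q).1 /\ fiber st.2 q = (proj1_sig q).2.
Proof.
have [s sE] : exists s : A, forall q, fiber s q = (proj1_sig q).1.
  by apply: (@family_exists _ 1) => -[[a b] /= [h _ _]]; exact: isometry_le1.
have [t tE] : exists t : A, forall q, fiber t q = (proj1_sig q).2.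
  by apply: (@family_exists _ 1) => -[[a b] /= [_ h _]]; exact: isometry_le1.
exists (s, t); split=> [|q]; last by rewrite /= sE tE.
by split; apply: fiber_ext => q; rewrite ?fiberD !fiberM !fiber_adj fiber_one /= ?sE ?tE;
  case: q => -[a b] [].
Qed.

Definition coord1 : A := (projT1 (cid coordinates_exist)).1.
Definition coord2 : A := (projT1 (cid coordinates_exist)).2.
Local Notation s := coord1.
Local Notation t := coord2.

Lemma coord_cuntz : cuntz_pair s t.
Proof. by rewrite /coord1 /coord2; case: cid => st []. Qed.
Lemma fiber_coord1 q : fiber s q = (proj1_sig q).1.
Proof. by have [_ /(_ q)[]] := projT2 (cid coordinates_exist). Qed.
Lemma fiber_coord2 q : fiber t q = (proj1_sig q).2.
Proof. by have [_ /(_ q)[]] := projT2 (cid coordinates_exist). Qed.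

Lemma twist_subproof w q : unit1 w -> cuntz_pair (fiber w q ** (proj1_sig q).1) (fiber w q ** (proj1_sig q).2).
Proof.
move=> [w1 w2]; have [h1 h2 h3] := proj2_sig q.
have u1 : (fiber w q)^† ** fiber w q = cone B by rewrite -fiber_adj -fiberM w1 fiber_one.
have u2 : fiber w q ** (fiber w q)^† = cone B by rewrite -fiber_adj -fiberM w2 fiber_one.
split.
- by rewrite cadjM -cmulA (cmulA _ _ (proj1_sig q).1) u1 cmul1x.
- by rewrite cadjM -cmulA (cmulA _ _ (proj1_sig q).2) u1 cmul1x.
rewrite !cadjM !cmulA -(cmulA _ (proj1_sig q).1) -(cmulA _ (proj1_sig q).2) -cmulDl -cmulDr h3.
by rewrite cmulx1 u2.
Qed.
Definition twist w (w1 : unit1 w) q : pairs := exist _ (_, _) (twist_subproof q w1).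

Lemma twist_exists w (w1 : unit1 w) : exists L : A -> A, forall T q,
  fiber (L T) q = fiber T (twist w1 q).
Proof.
have /choice[L LE] T : exists S, forall q, fiber S q = fiber T (twist w1 q).
  by apply: (@family_exists _ (rnorm T)) => q; exact: fiber_norm.
by exists L.
Qed.
(** Evaluating a family at the moved pair is a homomorphism for free; on the coordinates it gives w
    s and w t. *)
Definition twisted w (w1 : unit1 w) : A -> A := projT1 (cid (twist_exists w1)).
Lemma twistedE w (w1 : unit1 w) T q : fiber (twisted w1 T) q = fiber T (twist w1 q).
Proof. by rewrite /twisted; case: cid. Qed.

Lemma twisted_star_hom w (w1 : unit1 w) : star_hom (twisted w1).
Proof.
split=> [x y|c x|x y|x|x].
- by apply: fiber_ext => q; rewrite fiberD !twistedE fiberD.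
- by apply: fiber_ext => q; rewrite fiberZ !twistedE fiberZ.
- by apply: fiber_ext => q; rewrite fiberM !twistedE fiberM.
- by apply: fiber_ext => q; rewrite fiber_adj !twistedE fiber_adj.
apply: le_trans (_ : rnorm x <= _); last by have := rnorm_ge0 x; lra.
by apply: fiber_norm_le => [|q]; [exact: rnorm_ge0|rewrite twistedE; exact: fiber_norm].
Qed.

Lemma twisted1 w (w1 : unit1 w) : twisted w1 (cone A) = cone A.
Proof. by apply: fiber_ext => q; rewrite twistedE !fiber_one. Qed.
Lemma twisted_coord1 w (w1 : unit1 w) : twisted w1 s = w ** s.
Proof. by apply: fiber_ext => q; rewrite twistedE fiberM !fiber_coord1. Qed.
Lemma twisted_coord2 w (w1 : unit1 w) : twisted w1 t = w ** t.
Proof. by apply: fiber_ext => q; rewrite twistedE fiberM !fiber_coord2. Qed.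

Definition generated : A -> Prop := fun x =>
  forall S : set A, star_subalgebra S -> S (cone A) -> S s -> S t -> S x.

Lemma generated_star : star_subalgebra generated.
Proof.
split.
- apply/closed_rnormP => x hx S SP S1 Ss St; move/closed_rnormP: (ssub_closed SP); apply=> e e0.
  by have [y hy xy] := hx e e0; exists y => //; exact: hy.
- by move=> S SP *; exact: ssub0.
- by move=> x y hx hy S SP *; apply: (ssubD SP); [exact: hx|exact: hy].
- by move=> c x hx S SP *; apply: (ssubZ SP); exact: hx.
- by move=> x y hx hy S SP *; apply: (ssubM SP); [exact: hx|exact: hy].
- by move=> x hx S SP *; apply: (ssub_adj SP); exact: hx.
Qed.
Lemma generated_one : generated (cone A). Proof. by []. Qed.
Lemma generated_s : generated s. Proof. by []. Qed.
Lemma generated_t : generated t. Proof. by []. Qed.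

Definition cuntz_subalgebra : unital_subalgebra A := UnitalSubalgebra generated_star generated_one.
Definition cuntz : unitalCstarType R := subalg cuntz_subalgebra.
Local Notation O := cuntz.
Local Notation ι := (@emb R A cuntz_subalgebra).

Lemma cuntz_lift x : generated x -> exists m : O, ι m = x.
Proof. by move=> gx; exists (slift (gx : cuntz_subalgebra x)); rewrite sliftE. Qed.

Lemma cuntz_coordinates : exists a b : O, [/\ ι a = s, ι b = t & cuntz_pair a b].
Proof.
have [a aE] := cuntz_lift generated_s; have [b bE] := cuntz_lift generated_t.
by exists a, b; split=> //; apply: emb_cuntz; rewrite aE bE; exact: coord_cuntz.
Qed.

Lemma cuntz_is_O2 : is_cuntz_O2 O.
Proof.
split.
  apply/eqP => /(congr1 ι); rewrite emb1 emb0 => h.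
  have q : pairs := exist _ (_, _) (interleave_cuntz R).
  have /eqP := nat_ops_nontrivial R; apply.
  by rewrite -(fiber_one q) h -(scale0r (cone A)) fiberZ scale0r.
have [a [b [aE bE ab]]] := cuntz_coordinates; have [h1 h2 h3] := ab; exists a, b.
split=> // P Pcl Pa Pb PD PZ PM Padj x.
have P0 : P 0 by rewrite -(scale0r a); exact: PZ.
have SP : star_subalgebra (fun T : A => exists2 m : O, ι m = T & P m).
  split.
  - apply/closed_rnormP => T hT.
    have gT : generated T.
      move/closed_rnormP: (ssub_closed generated_star); apply=> e e0.
      have [_ [m <- _] hm] := hT e e0; exists (ι m) => //; exact (emb_mem m).
    have [m mE] := cuntz_lift gT; exists m => //.
    move/closed_rnormP: Pcl; apply=> e e0; have [_ [m' <- Pm'] hm'] := hT e e0.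
    by exists m' => //; rewrite -emb_norm embB mE.
  - by exists 0 => //; exact: emb0.
  - by move=> _ _ [m <- hm] [m' <- hm']; exists (m + m'); [exact: embD|exact: PD].
  - by move=> c _ [m <- hm]; exists (c *: m); [exact: embZ|exact: PZ].
  - by move=> _ _ [m <- hm] [m' <- hm']; exists (m ** m'); [exact: embM|exact: PM].
  - by move=> _ [m <- hm]; exists m^†; [exact: emb_adj|exact: Padj].
have [|||m /emb_inj <- //] := emb_mem x _ SP.
- by exists (cone O); [exact: emb1|rewrite -h1; apply: PM => //; exact: Padj].
- by exists a.
- by exists b.
Qed.

Lemma flip_generated : generated (flip s t).
Proof.
have G := generated_star; have sa := ssub_adj G generated_s; have ta := ssub_adj G generated_t.
have D x : generated x -> generated (double s t x).
  move=> gx; apply: (ssubD G); apply: (ssubM G) => //; exact: (ssubM G).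
by apply: (ssubD G); apply: (ssubM G) => //; exact: D.
Qed.

Lemma flip_path_generated r : generated (flip_path s t r).
Proof.
have G := generated_star; have F := flip_generated.
apply: (ssubD G); [apply: (ssubD G)|]; apply: (ssubZ G) => //.
by apply: (ssubZ G); exact: (ssubB G).
Qed.

Definition rotation r : A -> A := twisted (flip_path_unit coord_cuntz r).

Lemma rotation_generated r x : generated x -> generated (rotation r x).
Proof.
move=> gx; have G := generated_star; have F := flip_path_generated r.
apply: (gx (fun x => generated (rotation r x))).
- exact: (preimage_star (twisted_star_hom _) G).
- by rewrite /rotation twisted1.
- by rewrite /rotation twisted_coord1; exact: (ssubM G).
- by rewrite /rotation twisted_coord2; exact: (ssubM G).
Qed.

Lemma rotation_path x : generated x -> cpath (fun r => rotation r x).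
Proof.
move=> gx; apply: (gx (fun x => cpath (fun r => rotation r x))).
- by apply: path_star => r; exact: twisted_star_hom.
- have -> : (fun r => rotation r (cone A)) = (fun=> cone A).
    by apply/funext => r; rewrite /rotation twisted1.
  exact: cpath_cst.
- have -> : (fun r => rotation r s) = (fun r => flip_path s t r ** s).
    by apply/funext => r; rewrite /rotation twisted_coord1.
  by apply: cpathM; [exact: flip_path_cpath|exact: cpath_cst].
- have -> : (fun r => rotation r t) = (fun r => flip_path s t r ** t).
    by apply/funext => r; rewrite /rotation twisted_coord2.
  by apply: cpathM; [exact: flip_path_cpath|exact: cpath_cst].
Qed.

Lemma rotation0 x : generated x -> rotation 0 x = x.
Proof.
move=> gx; apply: (gx (fun x => rotation 0 x = x)).
- exact: (equalizer_star (twisted_star_hom _) star_hom_id).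
- by rewrite /rotation twisted1.
- by rewrite /rotation twisted_coord1 flip_path0 cmul1x.
- by rewrite /rotation twisted_coord2 flip_path0 cmul1x.
Qed.

Lemma rotation1 x : generated x -> rotation 1 x = double s t x.
Proof.
move=> gx; apply: (gx (fun x => rotation 1 x = double s t x)).
- exact: (equalizer_star (twisted_star_hom _) (double_star_hom coord_cuntz)).
- by rewrite /rotation twisted1 /double diag1 //; exact: coord_cuntz.
- by rewrite /rotation twisted_coord1 flip_path1 flip_s //; exact: coord_cuntz.
- by rewrite /rotation twisted_coord2 flip_path1 flip_t //; exact: coord_cuntz.
Qed.

(** The K-theoretic content of the homotopy: a path from x to its double whose points are images of
    x under unital homomorphisms, and so are projections or unitaries if x is. *)
Lemma cuntz_rotation (a b x : O) : ι a = s -> ι b = t -> exists f : R -> O,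
  [/\ cpath f, f 0 = x, f 1 = diag a b x x & forall r, exists h : A -> A,
      [/\ star_hom h, h (cone A) = cone A & ι (f r) = h (ι x)]].
Proof.
move=> aE bE; have gx : generated (ι x) by exact (emb_mem x).
have /choice[f fE] r : exists m : O, ι m = rotation r (ι x).
  by apply: cuntz_lift; exact: rotation_generated.
exists f; split.
- move=> r e e0; have [d d0 hd] := rotation_path gx r e0; exists d => // q qd.
  by rewrite -emb_norm embB !fE; exact: hd.
- by apply: emb_inj; rewrite fE rotation0.
- by apply: emb_inj; rewrite fE rotation1 // emb_diag aE bE.
move=> r; exists (rotation r); split; [exact: twisted_star_hom|exact: twisted1|exact: fE].
Qed.

(** Here p absorbs itself, being connected to its own double; the same holds for unitaries below. *)
Lemma cuntz_K0_step (p : O) : isproj p ->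
  exists a b r : O, [/\ cuntz_pair a b, isproj r & mvn1 r (diag a b p r)].
Proof.
move=> hp; have [a [b [aE bE ab]]] := cuntz_coordinates.
have [f [fc f0 f1 fr]] := cuntz_rotation p aE bE; exists a, b, p; split=> //.
rewrite -f1 -{1}f0; apply: projection_path => // r; apply/emb_proj.
have [h [hh h1 ->]] := fr r; have [pp ps] := proj2 (emb_proj p) hp.
by split; rewrite -?(shM hh) -?(sh_adj hh) ?pp ?ps.
Qed.

Lemma cuntz_K1_step (u : O) : unit1 u ->
  exists a b w : O, cuntz_pair a b /\ hom1 w (diag a b u w).
Proof.
move=> hu; have [a [b [aE bE ab]]] := cuntz_coordinates.
have [f [fc f0 f1 fr]] := cuntz_rotation u aE bE; exists a, b, u; split=> //.
exists f; split=> // r; apply/emb_unit.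
have [h [hh h1 ->]] := fr r; have [u1 u2] := proj2 (emb_unit u) hu.
by split; rewrite -(sh_adj hh) -(shM hh) ?u1 ?u2.
Qed.

Lemma cuntz_K0 (x y : K0_rep O) : K0_eq x y.
Proof. by have [a [b [_ _ ab]]] := cuntz_coordinates; exact: (K0_trivial ab cuntz_K0_step). Qed.

Lemma cuntz_K1 (x y : K1_rep O) : K1_eq x y.
Proof. by have [a [b [_ _ ab]]] := cuntz_coordinates; exact: (K1_trivial ab cuntz_K1_step). Qed.
End Cuntz.

Lemma quotient_isomorphic_trivial (T U : Type) (eqT : T -> T -> Prop) addT
    (eqU : U -> U -> Prop) addU (x0 : T) (y0 : U) :
  (forall x y, eqT x y) -> (forall x y, eqU x y) -> quotient_isomorphic eqT addT eqU addU.
Proof. by move=> tT tU; exists (fun=> y0); split=> // z; exists x0. Qed.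

Lemma same_K_theory_trivial (R : realType) (A B : unitalCstarType R) :
  (forall x y : K0_rep A, K0_eq x y) -> (forall x y : K0_rep B, K0_eq x y) ->
  (forall x y : K1_rep A, K1_eq x y) -> (forall x y : K1_rep B, K1_eq x y) ->
  same_K_theory A B.
Proof.
move=> A0 B0 A1 B1.
have mx0 (C : unitalCstarType R) (X Y : 'M[C]_0) : X = Y by apply/matrixP => -[].
have p0 (C : unitalCstarType R) : projection C.
  by apply: (@Projection R C 0 (\matrix_(i, j) 0)); split; exact: mx0.
have u0 (C : unitalCstarType R) : K1_rep C.
  by apply: (@K1Rep R C 0 (\matrix_(i, j) 0)); split; exact: mx0.
by split; apply: quotient_isomorphic_trivial => //; (exact: (p0 _, p0 _) || exact: u0).
Qed.

Theorem proposition7p3p1 (R : realType) :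
  exists M : unitalCstarType R,
    [/\ purely_infinite_simple M,
        exists O : unitalCstarType R, is_cuntz_O2 O /\ same_K_theory M O &
        forall u : bool,
          ~ (exists N : Lstructure R u,
               nuclear N /\
               elementarily_equivalent (unital_structure u M) N) /\
          ~ models (unital_structure u M) (nuclear_theory R u)].
Proof.
exists (model R); split; first exact: model_purely_infinite_simple.
  exists (cuntz R); split; first exact: cuntz_is_O2.
  by apply: same_K_theory_trivial; [exact: model_K0|exact: cuntz_K0|exact: model_K1|exact: cuntz_K1].
move=> u; have h := model_sentence R u; split.
  by move=> [N [nN /(_ (@doubling_sentence R u)) e]]; case/eqP: h; rewrite e nuclear_doubling_sentence.
by move=> mM; case/eqP: h; apply: mM => A nA; exact: nuclear_doubling_sentence.
Qed.
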